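(* For each $k\in\{1,2,3,4,5\}$, the Krzyż conjecture holds if and only if, for every $n\ge3$ and every function $f(z)=\sum_{j\ge0}a_jz^j$ extremal for $M_n$ (with $N$ atoms), condition $(k)$ below holds: (1) there is $\theta\in(0,\frac{4\pi}{n})$ with $f(e^{i\theta}z)=f(z)$ for all $z\in\mathbb D$; (2) for a holomorphic branch $\log f$ of the logarithm of $f$ on $\mathbb D$, $\log f(z)=\log f(0)$ if and only if $z=0$; (3) $f'$ has no zeros in $\mathbb D\setminus\{0\}$; (4) $a_j=0$ for $1\le j\le N-1$; (5) $a_j=0$ for $1\le j\le\lceil\frac{n-2}{3}\rceil$.
   Context: $\mathbb D$ is the open unit disc; $\mathcal B_0=\{f$ holomorphic on $\mathbb D: 0<|f|\le1\}$; $M_n(f)=\mathrm{Re}\,a_n$ for $f=\sum a_jz^j$; $f\in\mathcal B_0$ is extremal for $M_n$ if $M_n(f)\ge M_n(F)$ for all $F\in\mathcal B_0$. Every extremal $f$ can be written as $f(z)=\gamma\exp\big(-\sum_{j=1}^N\lambda_j\frac{1+\alpha_jz}{1-\alpha_jz}\big)$ with $\gamma\in\partial\mathbb D$, $1\le N\le n$, $\lambda_j>0$, distinct $\alpha_j\in\partial\mathbb D$ ($N$ = number of atoms). The Krzyż conjecture is the statement: for every $n\in\mathbb N$ and every $f=\sum a_jz^j\in\mathcal B_0$ with $a_0>0$, $M_n(f)\le 2/e$, with equality only if $f=f_n$, where $f_n(z)=\exp\big(\frac{z^n-1}{z^n+1}\big)$. *)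

(* Defs.v *)
From Stdlib Require Import Reals.
From Coquelicot Require Import Coquelicot.

Open Scope R_scope.

Definition inD (z : C) : Prop := Cmod z < 1.

Definition Cexp (z : C) : C := (exp (Re z) * cos (Im z), exp (Re z) * sin (Im z)).

Definition holo_D (f : C -> C) : Prop :=
  forall z : C, inD z -> exists l : C,
    is_derive (K := C_AbsRing) (V := C_NormedModule) f z l.

Definition taylor_coeffs (f : C -> C) (a : nat -> C) : Prop :=
  forall z : C, inD z ->
    is_series (K := C_AbsRing) (V := C_NormedModule) (fun j => (a j * z ^ j)%C) (f z).

Definition B0 (f : C -> C) : Prop :=
  holo_D f /\ forall z : C, inD z -> 0 < Cmod (f z) <= 1.

Definition extremal (n : nat) (f : C -> C) : Prop :=
  B0 f /\
  forall (a : nat -> C), taylor_coeffs f a ->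
  forall (F : C -> C) (b : nat -> C), B0 F -> taylor_coeffs F b ->
    Re (b n) <= Re (a n).

Definition f_extr (n : nat) (z : C) : C :=
  Cexp (((z ^ n - 1) / (z ^ n + 1))%C).

Definition Krzyz_conjecture : Prop :=
  forall (n : nat), (1 <= n)%nat ->
  forall (f : C -> C) (a : nat -> C), B0 f -> taylor_coeffs f a ->
    Im (a 0%nat) = 0 -> 0 < Re (a 0%nat) ->
    Re (a n) <= 2 / exp 1 /\
    (Re (a n) = 2 / exp 1 -> forall z, inD z -> f z = f_extr n z).

Definition atomic_repr (n : nat) (f : C -> C)
  (gamma : C) (N : nat) (lambda : nat -> R) (alpha : nat -> C) : Prop :=
  Cmod gamma = 1 /\ (1 <= N <= n)%nat /\
  (forall j, (j < N)%nat -> 0 < lambda j) /\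
  (forall j, (j < N)%nat -> Cmod (alpha j) = 1) /\
  (forall i j, (i < j < N)%nat -> alpha i <> alpha j) /\
  forall z, inD z ->
    f z = (gamma * Cexp (- sum_n (fun j => (RtoC (lambda j) *
                 ((1 + alpha j * z) / (1 - alpha j * z)))%C) (N - 1)))%C.

Definition ceil_div (a b : nat) : nat := ((a + b - 1) / b)%nat.

Definition cond (k n : nat) (f : C -> C) : Prop :=
  match k with
  | 1%nat => exists theta : R, 0 < theta < 4 * PI / INR n /\
             forall z, inD z -> f ((cos theta, sin theta) * z)%C = f z
  | 2%nat => exists g : C -> C, holo_D g /\
             (forall z, inD z -> Cexp (g z) = f z) /\
             (forall z, inD z -> (g z = g 0 <-> z = 0))
  | 3%nat => forall z, inD z -> z <> 0 -> forall l : C,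
             is_derive (K := C_AbsRing) (V := C_NormedModule) f z l -> l <> 0
  | 4%nat => forall (a : nat -> C), taylor_coeffs f a ->
             forall gamma N lambda alpha, atomic_repr n f gamma N lambda alpha ->
             forall j, (1 <= j <= N - 1)%nat -> a j = 0
  | 5%nat => forall (a : nat -> C), taylor_coeffs f a ->
             forall j, (1 <= j <= ceil_div (n - 2) 3)%nat -> a j = 0
  | _ => False
  end.

(* Main.v *)
(** Write [E_t u = exp (- t (1 + u) / (1 - u))]. A zero-free [f] bounded by one is
    [f = gamma E_t (w z)] with [|gamma| = 1] and [|w z| <= |z|], by the Schwarz lemma applied to the
    Cayley transform of [- log f]. If [a_1 = ... = a_K = 0], then [w] vanishes to order [K + 1], so for
    [n <= 3 K + 2] only the terms of degree one and two of [E_t] contribute to [a_n], and the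
    contraction inequalities for the coefficients of [w] give [|a_n| <= 2 / e], with equality
    only for [f = gamma E_1 (c z^n)]. This settles (1) and (5), whose hypotheses give such a gap,
    and the indices [n = 1, 2].

    Varying [f] multiplicatively by [exp (- eps h)] with [Re h >= 0] shows that an extremal [f] has
    a nonnegative dual trigonometric polynomial of degree [n], and that the measure of [- log |f|]
    lives on its zeros: hence the atomic structure. Each of (2), (3), (4) makes a polynomial
    built from the atoms free of middle coefficients; this forces the atoms to be equally
    spaced with equal masses, so that [f = gamma E_t (mu z^N)] with [N] dividing [n]. Testing the
    Toeplitz contraction inequality shows that [E_t] is not extremal at an index [m >= 3], hence
    [n / N <= 2] and the first part applies. Conversely, the Krzyz conjecture makes every
    extremal [f] equal to [gamma E_1 (c z^n)], which satisfies all five conditions. Extremal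
    functions exist by normality and Harnack's inequality. *)

Require Import Defs.
From Stdlib Require Import Reals Arith Lra Lia ClassicalEpsilon FunctionalExtensionality.
From Coquelicot Require Import Coquelicot.

Open Scope R_scope.

(** The number [3 K + 2] is where the cube of [w] starts to matter: [w^3] vanishes to order
    [3 K + 3]. Up to it, [a_n = gamma (e_1 w_n + e_2 (w^2)_n)] with [e_1 = - 2 t exp (- t)] and
    [e_2 = e_1 (1 - t)], while [|w_n|] plus the sum of the [|w_i|^2] with [i] and [n - i] both
    beyond the gap is at most one. So [2 / e] is the maximum of [2 t exp (- t)], and the strict
    bound [t exp (- t) |1 - t| < 1 / e] settles equality.

    Boundary values are never formed: whatever concerns the circle is stated on radius [r < 1] and
    passed to the limit, and the measure is met only through averages of [Re h] against continuous
    functions.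

    A one-atom function extremal at index [m] is stationary in its mass [t]. Stationarity and the
    recurrence for its coefficients express the four neighbours of [e_m] as multiples of [e_m], and
    three contraction inequalities then contradict [|e_m| >= 2 / e] when [m >= 3]; here a numerical
    bound on [e] enters. The cases [m <= 2] fall to the gap argument, since
    [2 N <= 3 (N - 1) + 2]. *)

Fixpoint Csum (f : nat -> C) (n : nat) : C :=
  match n with O => 0%C | S m => (Csum f m + f m)%C end.

Fixpoint Rsum (f : nat -> R) (n : nat) : R :=
  match n with O => 0 | S m => Rsum f m + f m end.

Lemma Csum_ext (f g : nat -> C) n :
  (forall k, (k < n)%nat -> f k = g k) -> Csum f n = Csum g n.
Proof.
  induction n as [|n IH]; intros H; simpl; [reflexivity|].
  rewrite IH, (H n); auto with arith.
Qed.

Lemma Csum_0 (f : nat -> C) n : (forall k, (k < n)%nat -> f k = 0%C) -> Csum f n = 0%C.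
Proof.
  induction n as [|n IH]; intros H; simpl; [reflexivity|].
  rewrite IH, (H n); auto with arith. ring.
Qed.

Lemma Csum_plus (f g : nat -> C) n : Csum (fun k => f k + g k)%C n = (Csum f n + Csum g n)%C.
Proof. induction n as [|n IH]; simpl; [ring | rewrite IH; ring]. Qed.

Lemma Csum_scal (c : C) (f : nat -> C) n : Csum (fun k => c * f k)%C n = (c * Csum f n)%C.
Proof. induction n as [|n IH]; simpl; [ring | rewrite IH; ring]. Qed.

Lemma Csum_conj (f : nat -> C) n : Cconj (Csum f n) = Csum (fun k => Cconj (f k)) n.
Proof.
  induction n as [|n IH]; simpl.
  - apply injective_projections; simpl; ring.
  - rewrite Cplus_conj, IH. reflexivity.
Qed.

Lemma Csum_S_l (f : nat -> C) n : Csum f (S n) = (f 0%nat + Csum (fun k => f (S k)) n)%C.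
Proof.
  induction n as [|n IH].
  - simpl; ring.
  - change (Csum f (S (S n))) with (Csum f (S n) + f (S n))%C. rewrite IH. simpl. ring.
Qed.

Lemma Csum_add (f : nat -> C) n m :
  Csum f (n + m) = (Csum f n + Csum (fun k => f (n + k)%nat) m)%C.
Proof.
  induction m as [|m IH].
  - rewrite Nat.add_0_r. simpl. ring.
  - rewrite Nat.add_succ_r. simpl. rewrite IH. ring.
Qed.

Lemma Csum_swap (f : nat -> nat -> C) n m :
  Csum (fun i => Csum (fun j => f i j) m) n = Csum (fun j => Csum (fun i => f i j) n) m.
Proof.
  induction n as [|n IH]; simpl.
  - symmetry; apply Csum_0; auto.
  - rewrite IH, <- Csum_plus. reflexivity.
Qed.

Lemma Csum_single (f : nat -> C) n j :
  (j < n)%nat -> (forall k, (k < n)%nat -> k <> j -> f k = 0%C) -> Csum f n = f j.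
Proof.
  induction n as [|n IH]; intros Hj H; [lia|]. simpl.
  destruct (Nat.eq_dec j n) as [->|Hne].
  - rewrite Csum_0. ring. intros k Hk; apply H; lia.
  - rewrite IH, (H n); try lia. ring. intros k Hk Hkj; apply H; lia.
Qed.

Lemma Csum_rev (f : nat -> C) n : Csum (fun k => f (n - 1 - k)%nat) n = Csum f n.
Proof.
  revert f. induction n as [|n IH]; intros f; [reflexivity|].
  rewrite Csum_S_l. simpl (Csum f (S n)).
  rewrite <- (IH f).
  replace (S n - 1 - 0)%nat with n by lia.
  rewrite Cplus_comm. f_equal. apply Csum_ext. intros k Hk. f_equal. lia.
Qed.

(** * Real and imaginary parts, moduli and powers of complex numbers *)

Lemma Re_plus (a b : C) : Re (a + b)%C = Re a + Re b.  Proof. reflexivity. Qed.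
Lemma Im_plus (a b : C) : Im (a + b)%C = Im a + Im b.  Proof. reflexivity. Qed.
Lemma Re_minus (a b : C) : Re (a - b)%C = Re a - Re b.  Proof. unfold Re; simpl; ring. Qed.
Lemma Im_minus (a b : C) : Im (a - b)%C = Im a - Im b.  Proof. unfold Im; simpl; ring. Qed.
Lemma Re_opp (a : C) : Re (- a)%C = - Re a.  Proof. reflexivity. Qed.
Lemma Im_opp (a : C) : Im (- a)%C = - Im a.  Proof. reflexivity. Qed.
Lemma Re_mult (a b : C) : Re (a * b)%C = Re a * Re b - Im a * Im b.  Proof. reflexivity. Qed.
Lemma Im_mult (a b : C) : Im (a * b)%C = Re a * Im b + Im a * Re b.  Proof. reflexivity. Qed.
Lemma Re_R (a : R) : Re (RtoC a) = a.  Proof. reflexivity. Qed.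
Lemma Im_R (a : R) : Im (RtoC a) = 0.  Proof. reflexivity. Qed.
Lemma Re_Rmult (a : R) (b : C) : Re (a * b)%C = a * Re b.  Proof. rewrite Re_mult, Re_R, Im_R; ring. Qed.
Lemma Im_Rmult (a : R) (b : C) : Im (a * b)%C = a * Im b.  Proof. rewrite Im_mult, Re_R, Im_R; ring. Qed.

Lemma C_ext (a b : C) : Re a = Re b -> Im a = Im b -> a = b.
Proof. intros H1 H2. apply injective_projections; assumption. Qed.

Lemma Re_sum (f : nat -> C) n : Re (Csum f n) = Rsum (fun k => Re (f k)) n.
Proof. induction n as [|n IH]; simpl; [reflexivity | rewrite <- IH; reflexivity]. Qed.

Lemma RtoC_sum (f : nat -> R) n : RtoC (Rsum f n) = Csum (fun k => RtoC (f k)) n.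
Proof. induction n as [|n IH]; simpl; [reflexivity | rewrite <- IH; apply RtoC_plus]. Qed.

Lemma Rsum_ext (f g : nat -> R) n :
  (forall k, (k < n)%nat -> f k = g k) -> Rsum f n = Rsum g n.
Proof.
  induction n as [|n IH]; intros H; simpl; [reflexivity|].
  rewrite IH, (H n); auto with arith.
Qed.

Lemma Rsum_le (f g : nat -> R) n :
  (forall k, (k < n)%nat -> f k <= g k) -> Rsum f n <= Rsum g n.
Proof.
  induction n as [|n IH]; intros H; simpl; [lra|].
  apply Rplus_le_compat; [apply IH; auto with arith | apply H; lia].
Qed.

Lemma Rsum_plus (f g : nat -> R) n : Rsum (fun k => f k + g k) n = Rsum f n + Rsum g n.
Proof. induction n as [|n IH]; simpl; [ring | rewrite IH; ring]. Qed.

Lemma Rsum_scal (c : R) (f : nat -> R) n : Rsum (fun k => c * f k) n = c * Rsum f n.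
Proof. induction n as [|n IH]; simpl; [ring | rewrite IH; ring]. Qed.

Lemma Rsum_ge_0 (f : nat -> R) n : (forall k, (k < n)%nat -> 0 <= f k) -> 0 <= Rsum f n.
Proof.
  induction n as [|n IH]; intros H; simpl; [lra|].
  apply Rplus_le_le_0_compat; [apply IH; auto with arith | apply H; lia].
Qed.

Lemma Rsum_term (f : nat -> R) n j :
  (forall k, (k < n)%nat -> 0 <= f k) -> (j < n)%nat -> f j <= Rsum f n.
Proof.
  induction n as [|n IH]; intros H Hj; [lia|]. simpl.
  assert (0 <= f n) by (apply H; lia).
  destruct (Nat.eq_dec j n) as [->|Hne].
  - assert (0 <= Rsum f n) by (apply Rsum_ge_0; auto with arith). lra.
  - assert (f j <= Rsum f n) by (apply IH; [auto with arith | lia]). lra.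
Qed.

Lemma Cmod_sum (f : nat -> C) n : Cmod (Csum f n) <= Rsum (fun k => Cmod (f k)) n.
Proof.
  induction n as [|n IH]; simpl; [rewrite Cmod_0; lra|].
  eapply Rle_trans; [apply Cmod_triangle | lra].
Qed.

Lemma Cmod_minus_sym (a b : C) : Cmod (a - b) = Cmod (b - a).
Proof. rewrite <- Cmod_opp. f_equal. ring. Qed.

Lemma Cmod_triangle_rev (a b : C) : Cmod a - Cmod b <= Cmod (a - b).
Proof.
  assert (H := Cmod_triangle (a - b) b).
  replace (a - b + b)%C with a in H by ring. lra.
Qed.

Lemma Re_le_mod (z : C) : Re z <= Cmod z.
Proof. eapply Rle_trans; [apply Rle_abs | apply re_le_Cmod]. Qed.

Lemma Im_abs_le_mod (z : C) : Rabs (Im z) <= Cmod z.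
Proof.
  eapply Rle_trans; [|apply Rmax_Cmod]. apply Rmax_r.
Qed.

Lemma Cmod_le_abs (z : C) : Cmod z <= Rabs (Re z) + Rabs (Im z).
Proof.
  replace z with (RtoC (Re z) + Ci * RtoC (Im z))%C at 1.
  - eapply Rle_trans; [apply Cmod_triangle|]. rewrite Cmod_mult, Cmod_Ci, !Cmod_R. lra.
  - apply C_ext; unfold Re, Im; simpl; ring.
Qed.

Lemma C_neq0_mod (z : C) : z <> 0%C -> 0 < Cmod z.
Proof. apply Cmod_gt_0. Qed.

Lemma mod_neq0 (z : C) : 0 < Cmod z -> z <> 0%C.
Proof. apply Cmod_gt_0. Qed.

Lemma mod_unit_neq0 (z : C) : Cmod z = 1 -> z <> 0%C.
Proof. intros H; apply mod_neq0; lra. Qed.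

Lemma Re_neq0 (z : C) : 0 < Re z -> z <> 0%C.
Proof. intros H E. rewrite E in H. unfold Re in H; simpl in H; lra. Qed.

Lemma Cmod_sqr (z : C) : Cmod z * Cmod z = Re z * Re z + Im z * Im z.
Proof. generalize (Cmod2_alt z). simpl. lra. Qed.

Lemma Cmult_conj_mod (z : C) : (z * Cconj z)%C = RtoC (Cmod z * Cmod z).
Proof. rewrite <- Cmod2_conj. f_equal. ring. Qed.

Lemma conj_unit (z : C) : Cmod z = 1 -> (z * Cconj z = 1)%C.
Proof. intros H. rewrite Cmult_conj_mod, H. f_equal. ring. Qed.

Lemma Cpow_add (z : C) n m : (z ^ (n + m))%C = (z ^ n * z ^ m)%C.
Proof. induction n as [|n IH]; simpl; [ring | rewrite IH; ring]. Qed.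

Lemma Cpow_mul (z : C) n m : (z ^ (n * m))%C = ((z ^ n) ^ m)%C.
Proof.
  induction m as [|m IH]; simpl.
  - rewrite Nat.mul_0_r. reflexivity.
  - rewrite Nat.mul_succ_r, Nat.add_comm, Cpow_add, IH. ring.
Qed.

Lemma Cpow_mult_l (a b : C) n : ((a * b) ^ n)%C = (a ^ n * b ^ n)%C.
Proof. induction n as [|n IH]; simpl; [ring | rewrite IH; ring]. Qed.

Lemma Cpow_neq0 (z : C) n : z <> 0%C -> (z ^ n)%C <> 0%C.
Proof. intros H. apply mod_neq0. rewrite Cmod_pow. apply pow_lt. apply C_neq0_mod, H. Qed.

Lemma Cpow_1 n : (1 ^ n)%C = 1%C.
Proof. induction n as [|n IH]; simpl; [reflexivity | rewrite IH; ring]. Qed.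

Lemma Cpow_0 n : (1 <= n)%nat -> (0 ^ n)%C = 0%C.
Proof. destruct n; intros H; [lia | simpl; ring]. Qed.

Lemma pow_unit_mod (z : C) n : Cmod z = 1 -> Cmod (z ^ n) = 1.
Proof. intros H. rewrite Cmod_pow, H. apply pow1. Qed.

Lemma pow_le_1_compat (x : R) n : 0 <= x <= 1 -> 0 <= x ^ n <= 1.
Proof.
  intros H. split; [apply pow_le; lra|]. rewrite <- (pow1 n). apply pow_incr. lra.
Qed.

Lemma pow_lt_1_compat' (x : R) n : 0 <= x < 1 -> (1 <= n)%nat -> x ^ n < 1.
Proof.
  intros H Hn. destruct n as [|n]; [lia|]. simpl.
  assert (0 <= x ^ n <= 1) by (apply pow_le_1_compat; lra). nra.
Qed.

(** * Limits of complex functions along a filter *)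

(** Stated with [Cmod] over an arbitrary filter, so that one set of rules serves sequences
    ([eventually]), complex neighbourhoods ([Cnear]), real parameters ([locally]) and radii tending
    to one ([at_left 1]). *)
Definition Clim {X : Type} (F : (X -> Prop) -> Prop) (f : X -> C) (l : C) : Prop :=
  forall eps : R, 0 < eps -> F (fun x => Cmod (f x - l) < eps).

Section Climits.
Context {X : Type} {F : (X -> Prop) -> Prop} {FF : Filter F}.

Lemma Clim_const (c : C) : Clim F (fun _ => c) c.
Proof.
  intros eps He. apply filter_forall. intros _.
  replace (c - c)%C with (RtoC 0) by ring. rewrite Cmod_0. exact He.
Qed.

Lemma Clim_ext_loc (f g : X -> C) l : F (fun x => f x = g x) -> Clim F f l -> Clim F g l.
Proof.
  intros H Hf eps He. generalize (filter_and _ _ H (Hf eps He)).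
  apply filter_imp. intros x [-> Hx]. exact Hx.
Qed.

Lemma Clim_ext (f g : X -> C) l : (forall x, f x = g x) -> Clim F f l -> Clim F g l.
Proof. intros H. apply Clim_ext_loc. apply filter_forall, H. Qed.

Lemma Clim_eq (f : X -> C) (l m : C) : l = m -> Clim F f l -> Clim F f m.
Proof. intros ->. auto. Qed.

Lemma Clim_plus (f g : X -> C) l m :
  Clim F f l -> Clim F g m -> Clim F (fun x => f x + g x)%C (l + m)%C.
Proof.
  intros Hf Hg eps He.
  assert (He2 : 0 < eps / 2) by lra.
  generalize (filter_and _ _ (Hf _ He2) (Hg _ He2)). apply filter_imp. intros x [H1 H2].
  replace (f x + g x - (l + m))%C with ((f x - l) + (g x - m))%C by ring.
  eapply Rle_lt_trans; [apply Cmod_triangle | lra].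
Qed.

Lemma Clim_opp (f : X -> C) l : Clim F f l -> Clim F (fun x => - f x)%C (- l)%C.
Proof.
  intros Hf eps He. generalize (Hf _ He). apply filter_imp. intros x H.
  replace (- f x - - l)%C with (- (f x - l))%C by ring. rewrite Cmod_opp. exact H.
Qed.

Lemma Clim_minus (f g : X -> C) l m :
  Clim F f l -> Clim F g m -> Clim F (fun x => f x - g x)%C (l - m)%C.
Proof. intros Hf Hg. apply Clim_plus; [exact Hf | apply Clim_opp, Hg]. Qed.

Lemma Clim_bound (f : X -> C) l : Clim F f l -> F (fun x => Cmod (f x) < Cmod l + 1).
Proof.
  intros Hf. generalize (Hf 1 Rlt_0_1). apply filter_imp. intros x H.
  generalize (Cmod_triangle_rev (f x) l). lra.
Qed.

Lemma Clim_mult (f g : X -> C) l m :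
  Clim F f l -> Clim F g m -> Clim F (fun x => f x * g x)%C (l * m)%C.
Proof.
  intros Hf Hg eps He.
  assert (Hl := Cmod_ge_0 l). assert (Hm := Cmod_ge_0 m).
  set (K := Cmod l + Cmod m + 2).
  assert (HK : 0 < K) by (unfold K; lra).
  assert (He2 : 0 < eps / K) by (apply Rdiv_lt_0_compat; lra).
  generalize (filter_and _ _ (filter_and _ _ (Hf _ He2) (Hg _ He2)) (Clim_bound _ _ Hf)).
  apply filter_imp. intros x [[H1 H2] H3].
  replace (f x * g x - l * m)%C with (f x * (g x - m) + (f x - l) * m)%C by ring.
  eapply Rle_lt_trans; [apply Cmod_triangle|]. rewrite !Cmod_mult.
  assert (E : eps = K * (eps / K)) by (field; lra).
  assert (H4 := Cmod_ge_0 (f x - l)). assert (H5 := Cmod_ge_0 (g x - m)).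
  assert (H6 := Cmod_ge_0 (f x)).
  apply Rle_lt_trans with ((Cmod l + 1) * (eps / K) + (eps / K) * Cmod m).
  - apply Rplus_le_compat; apply Rmult_le_compat; lra.
  - assert (H7 : (Cmod l + 1) * (eps / K) + eps / K * Cmod m < K * (eps / K)).
    { replace (K * (eps / K)) with ((Cmod l + 1) * (eps / K) + eps / K * Cmod m + eps / K)
        by (unfold K; ring). lra. }
    lra.
Qed.

Lemma Clim_scal (c : C) (f : X -> C) l : Clim F f l -> Clim F (fun x => c * f x)%C (c * l)%C.
Proof. intros H. apply Clim_mult; [apply Clim_const | exact H]. Qed.

Lemma Clim_pow (f : X -> C) l n : Clim F f l -> Clim F (fun x => f x ^ n)%C (l ^ n)%C.
Proof.
  intros H. induction n as [|n IH]; simpl; [apply Clim_const | apply Clim_mult; assumption].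
Qed.

Lemma Clim_sum (f : nat -> X -> C) (l : nat -> C) n :
  (forall k, (k < n)%nat -> Clim F (f k) (l k)) ->
  Clim F (fun x => Csum (fun k => f k x) n) (Csum l n).
Proof.
  induction n as [|n IH]; intros H; simpl; [apply Clim_const|].
  apply Clim_plus; [apply IH; auto with arith | apply H; lia].
Qed.

Lemma Clim_inv (f : X -> C) (l : C) : l <> 0%C -> Clim F f l -> Clim F (fun x => / f x)%C (/ l)%C.
Proof.
  intros Hl Hf eps He. assert (Hl' := C_neq0_mod _ Hl).
  (* The first bound keeps [Cmod (f x)] above [Cmod l / 2]; the second then makes
     [(l - f x) / (f x * l)] smaller than [eps]. *)
  set (d := Rmin (Cmod l / 2) (eps * (Cmod l * Cmod l) / 2)).
  assert (Hd : 0 < d).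
  { unfold d. apply Rmin_pos; [lra|]. apply Rdiv_lt_0_compat; [|lra].
    apply Rmult_lt_0_compat; [lra | apply Rmult_lt_0_compat; lra]. }
  generalize (Hf _ Hd). apply filter_imp. intros x H.
  assert (H1 : Cmod (f x - l) < Cmod l / 2) by (eapply Rlt_le_trans; [exact H | apply Rmin_l]).
  assert (H2 : Cmod (f x - l) < eps * (Cmod l * Cmod l) / 2)
    by (eapply Rlt_le_trans; [exact H | apply Rmin_r]).
  assert (H3 : Cmod l / 2 < Cmod (f x)).
  { generalize (Cmod_triangle_rev l (f x)). rewrite Cmod_minus_sym in H1. lra. }
  assert (Hfx : f x <> 0%C) by (apply mod_neq0; lra).
  replace (/ f x - / l)%C with ((l - f x) / (f x * l))%C by (field; auto).
  rewrite Cmod_div by (apply Cmult_neq_0; auto).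
  rewrite Cmod_mult, Cmod_minus_sym.
  assert (Hp : 0 < Cmod (f x) * Cmod l) by (apply Rmult_lt_0_compat; lra).
  apply Rmult_lt_reg_r with (Cmod (f x) * Cmod l); [exact Hp|].
  unfold Rdiv. rewrite Rmult_assoc, Rinv_l, Rmult_1_r by lra.
  eapply Rlt_le_trans; [exact H2|]. unfold Rdiv.
  rewrite Rmult_assoc. apply Rmult_le_compat_l; [lra|]. nra.
Qed.

Lemma Clim_conj (f : X -> C) l : Clim F f l -> Clim F (fun x => Cconj (f x)) (Cconj l).
Proof.
  intros Hf eps He. generalize (Hf _ He). apply filter_imp. intros x H.
  rewrite <- Cminus_conj, Cmod_conj. exact H.
Qed.

Lemma Clim_Re (f : X -> C) l : Clim F f l -> Clim F (fun x => RtoC (Re (f x))) (RtoC (Re l)).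
Proof.
  intros Hf eps He. generalize (Hf _ He). apply filter_imp. intros x H.
  rewrite <- RtoC_minus, Cmod_R, <- Re_minus. eapply Rle_lt_trans; [apply re_le_Cmod | exact H].
Qed.

Lemma Clim_Im (f : X -> C) l : Clim F f l -> Clim F (fun x => RtoC (Im (f x))) (RtoC (Im l)).
Proof.
  intros Hf eps He. generalize (Hf _ He). apply filter_imp. intros x H.
  rewrite <- RtoC_minus, Cmod_R, <- Im_minus. eapply Rle_lt_trans; [apply Im_abs_le_mod | exact H].
Qed.

Lemma Clim_mod (f : X -> C) l : Clim F f l -> Clim F (fun x => RtoC (Cmod (f x))) (RtoC (Cmod l)).
Proof.
  intros Hf eps He. generalize (Hf _ He). apply filter_imp. intros x H.
  rewrite <- RtoC_minus, Cmod_R. apply Rabs_def1.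
  - generalize (Cmod_triangle_rev (f x) l). lra.
  - generalize (Cmod_triangle_rev l (f x)). rewrite Cmod_minus_sym. lra.
Qed.

Lemma Clim_squeeze (f : X -> C) (g : X -> C) l :
  F (fun x => Cmod (f x - l) <= Cmod (g x)) -> Clim F g 0%C -> Clim F f l.
Proof.
  intros H Hg eps He. generalize (filter_and _ _ H (Hg eps He)). apply filter_imp.
  intros x [H1 H2]. replace (g x - 0)%C with (g x) in H2 by ring. lra.
Qed.

Context {PF : ProperFilter' F}.

Lemma Clim_unique (f : X -> C) l m : Clim F f l -> Clim F f m -> l = m.
Proof.
  intros Hl Hm. apply NNPP. intros Hne.
  assert (Hd : 0 < Cmod (l - m)).
  { apply C_neq0_mod. intros E. apply Hne. replace l with ((l - m) + m)%C by ring.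
    rewrite E. ring. }
  assert (Hd2 : 0 < Cmod (l - m) / 2) by lra.
  apply filter_not_empty. generalize (filter_and _ _ (Hl _ Hd2) (Hm _ Hd2)).
  apply filter_imp. intros x [H1 H2].
  assert (H := Cmod_triangle (l - f x) (f x - m)).
  replace (l - f x + (f x - m))%C with (l - m)%C in H by ring.
  rewrite Cmod_minus_sym in H1. lra.
Qed.

Lemma Clim_Re_le (f : X -> C) l (M : R) : Clim F f l -> F (fun x => Re (f x) <= M) -> Re l <= M.
Proof.
  intros Hl H. apply Rnot_lt_le. intros Hlt.
  assert (Hd : 0 < Re l - M) by lra.
  apply filter_not_empty. generalize (filter_and _ _ (Hl _ Hd) H). apply filter_imp.
  intros x [H1 H2]. assert (H3 := re_le_Cmod (f x - l)). rewrite Re_minus in H3.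
  apply Rabs_le_between in H3. lra.
Qed.

Lemma Clim_Re_ge (f : X -> C) l (M : R) : Clim F f l -> F (fun x => M <= Re (f x)) -> M <= Re l.
Proof.
  intros Hl H.
  assert (Re (- l)%C <= - M).
  { apply Clim_Re_le with (fun x => - f x)%C; [apply Clim_opp, Hl|].
    revert H. apply filter_imp. intros x Hx. rewrite Re_opp. lra. }
  rewrite Re_opp in H0. lra.
Qed.

Lemma Clim_mod_le (f : X -> C) l (M : R) : Clim F f l -> F (fun x => Cmod (f x) <= M) -> Cmod l <= M.
Proof.
  intros Hl H. rewrite <- (Re_R (Cmod l)).
  apply Clim_Re_le with (fun x => RtoC (Cmod (f x))); [apply Clim_mod, Hl | exact H].
Qed.

End Climits.

(** Round discs, so that estimates in [Cmod] apply without comparing norms on the plane. *)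
Definition Cnear (z : C) (P : C -> Prop) : Prop :=
  exists d, 0 < d /\ forall w, Cmod (w - z) < d -> P w.

Global Instance Cnear_filter z : ProperFilter (Cnear z).
Proof.
  constructor.
  - intros P [d [Hd H]]. exists z. apply H. replace (z - z)%C with (RtoC 0) by ring.
    rewrite Cmod_0. exact Hd.
  - constructor.
    + exists 1. split; [lra | auto].
    + intros P Q [d [Hd H]] [e [He H']]. exists (Rmin d e). split; [apply Rmin_pos; assumption|].
      intros w Hw. split; [apply H | apply H']; (eapply Rlt_le_trans; [exact Hw|]);
      [apply Rmin_l | apply Rmin_r].
    + intros P Q HPQ [d [Hd H]]. exists d. split; auto.
Qed.

Definition Ccont (f : C -> C) (z : C) : Prop := Clim (Cnear z) f (f z).

Lemma Ccont_id z : Ccont (fun w => w) z.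
Proof. intros eps He. exists eps. split; auto. Qed.

Lemma Clim_comp {X} {F : (X -> Prop) -> Prop} {FF : Filter F} (f : X -> C) (g : C -> C) l :
  Clim F f l -> Ccont g l -> Clim F (fun x => g (f x)) (g l).
Proof.
  intros Hf Hg eps He. destruct (Hg eps He) as [d [Hd H]].
  generalize (Hf d Hd). apply filter_imp. intros x Hx. apply H, Hx.
Qed.

Lemma Cnear_inD z : inD z -> Cnear z inD.
Proof.
  unfold inD. intros H. exists (1 - Cmod z). split; [lra|]. intros w Hw.
  generalize (Cmod_triangle_rev w z). lra.
Qed.

(** The bridge to [continuous], through which integrability of the two components is obtained from
    the real theory. *)
Lemma Clim_locally_cont (f : R -> C) t :
  Clim (locally t) f (f t) ->
  continuous (fun s => Re (f s)) t /\ continuous (fun s => Im (f s)) t.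
Proof.
  intros H; split; apply filterlim_locally; intros eps; generalize (H eps (cond_pos eps));
  apply filter_imp; intros s Hs; unfold ball; simpl; unfold AbsRing_ball, abs, minus, plus, opp; simpl.
  - rewrite <- Re_opp, <- Re_plus. eapply Rle_lt_trans; [apply re_le_Cmod | exact Hs].
  - rewrite <- Im_opp, <- Im_plus. eapply Rle_lt_trans; [apply Im_abs_le_mod | exact Hs].
Qed.

Lemma geom_lim (q : C) : Cmod q < 1 -> Clim eventually (fun n => q ^ n)%C 0%C.
Proof.
  intros Hq eps He.
  assert (Hq' : Rabs (Cmod q) < 1) by (rewrite Rabs_pos_eq; [exact Hq | apply Cmod_ge_0]).
  destruct (pow_lt_1_zero (Cmod q) Hq' eps He) as [N HN]. exists N. intros n Hn.
  replace (q ^ n - 0)%C with (q ^ n)%C by ring. rewrite Cmod_pow.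
  eapply Rle_lt_trans; [apply Rle_abs | apply HN, Hn].
Qed.

(** * Complex derivatives in Carathéodory form *)

(** With a slope function continuous at [z], the product and chain rules are algebraic identities.
    The slope also serves later as the continuous extension of a difference quotient across its
    singular point. *)
Definition cdiff (f : C -> C) (z l : C) : Prop :=
  exists phi : C -> C, Ccont phi z /\ phi z = l /\ forall w, f w = (f z + phi w * (w - z))%C.

Definition hdiff (f : C -> C) (z : C) : Prop := exists l, cdiff f z l.

Lemma cdiff_eps (f : C -> C) (z l : C) :
  cdiff f z l <->
  forall eps, 0 < eps -> exists d, 0 < d /\ forall w, Cmod (w - z) < d ->
    Cmod (f w - f z - l * (w - z)) <= eps * Cmod (w - z).
Proof.
  split.
  - intros [phi [Hc [Hz Hf]]] eps He. destruct (Hc eps He) as [d [Hd H]].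
    exists d. split; [exact Hd|]. intros w Hw.
    rewrite (Hf w).
    replace (f z + phi w * (w - z) - f z - l * (w - z))%C with ((phi w - phi z) * (w - z))%C
      by (rewrite Hz; ring).
    rewrite Cmod_mult. apply Rmult_le_compat_r; [apply Cmod_ge_0|]. left. apply H, Hw.
  - intros H.
    set (phi := fun w => match excluded_middle_informative (w = z) with
                         | left _ => l | right _ => ((f w - f z) / (w - z))%C end).
    assert (Hz : phi z = l).
    { unfold phi. destruct excluded_middle_informative as [E|E]; [reflexivity | now elim E]. }
    exists phi. split; [|split; [exact Hz|]].
    + intros eps He. assert (He2 : 0 < eps / 2) by lra.
      destruct (H _ He2) as [d [Hd H']]. exists d. split; [exact Hd|]. intros w Hw. rewrite Hz.
      unfold phi. destruct excluded_middle_informative as [E|E].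
      * replace (l - l)%C with (RtoC 0) by ring. rewrite Cmod_0; exact He.
      * assert (Hn : (w - z)%C <> 0).
        { intros E'. apply E. replace w with ((w - z) + z)%C by ring. rewrite E'. ring. }
        assert (Hp := C_neq0_mod _ Hn).
        replace ((f w - f z) / (w - z) - l)%C with ((f w - f z - l * (w - z)) / (w - z))%C
          by (field; exact Hn).
        rewrite Cmod_div by exact Hn.
        apply Rle_lt_trans with (eps / 2); [|lra].
        apply Rmult_le_reg_r with (Cmod (w - z)); [exact Hp|].
        unfold Rdiv at 1. rewrite Rmult_assoc, Rinv_l, Rmult_1_r by lra. apply H', Hw.
    + intros w. unfold phi. destruct excluded_middle_informative as [E|E].
      * rewrite E. ring.
      * field. intros E'. apply E. replace w with ((w - z) + z)%C by ring. rewrite E'. ring.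
Qed.

Lemma cdiff_is_derive (f : C -> C) (z l : C) :
  is_derive (K := C_AbsRing) (V := C_NormedModule) f z l <-> cdiff f z l.
Proof.
  rewrite cdiff_eps. split.
  - intros [_ H] eps He.
    (* [is_derive] speaks of every limit point of the neighbourhood filter; the only one is [z]
       itself. *)
    assert (Hl : is_filter_lim (locally (z : AbsRing_NormedModule C_AbsRing)) z)
      by (intros P HP; exact HP).
    destruct (H z Hl (mkposreal eps He)) as [d Hd].
    exists d. split; [apply cond_pos|]. intros w Hw.
    specialize (Hd w Hw).
    change (Cmod (f w - f z - (w - z) * l) <= eps * Cmod (w - z)) in Hd.
    rewrite (Cmult_comm l). exact Hd.
  - intros H. split.
    + apply (is_linear_scal_l (V := C_NormedModule) l).
    + intros x Hx.
      rewrite <- (is_filter_lim_locally_unique (V := AbsRing_NormedModule C_AbsRing) z x Hx).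
      clear x Hx.
      intros eps. destruct (H eps (cond_pos eps)) as [d [Hd H']].
      exists (mkposreal d Hd). intros w Hw.
      assert (Hw' : Cmod (w - z) < d) by exact Hw.
      specialize (H' w Hw').
      change (Cmod (f w - f z - (w - z) * l) <= eps * Cmod (w - z)).
      rewrite (Cmult_comm _ l). exact H'.
Qed.

Lemma holo_hdiff (f : C -> C) : holo_D f <-> forall z, inD z -> hdiff f z.
Proof.
  split; intros H z Hz; destruct (H z Hz) as [l Hl]; exists l; apply cdiff_is_derive, Hl.
Qed.

Lemma cdiff_ext_loc (f g : C -> C) z l :
  Cnear z (fun w => f w = g w) -> cdiff f z l -> cdiff g z l.
Proof.
  intros [d [Hd H]]. rewrite !cdiff_eps. intros Hf eps He.
  destruct (Hf eps He) as [e [He' H']]. exists (Rmin d e). split; [apply Rmin_pos; assumption|].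
  intros w Hw. rewrite <- (H w), <- (H z).
  - apply H'. eapply Rlt_le_trans; [exact Hw | apply Rmin_r].
  - replace (z - z)%C with (RtoC 0) by ring. rewrite Cmod_0; exact Hd.
  - eapply Rlt_le_trans; [exact Hw | apply Rmin_l].
Qed.

Lemma cdiff_ext (f g : C -> C) z l : (forall w, f w = g w) -> cdiff f z l -> cdiff g z l.
Proof. intros H. apply cdiff_ext_loc. exists 1. split; [lra | auto]. Qed.

Lemma cdiff_cont (f : C -> C) z l : cdiff f z l -> Ccont f z.
Proof.
  intros [phi [Hc [Hz Hf]]]. unfold Ccont.
  apply Clim_ext with (fun w => f z + phi w * (w - z))%C; [intros w; symmetry; apply Hf|].
  apply Clim_eq with (f z + phi z * (z - z))%C; [ring|].
  apply Clim_plus; [apply Clim_const|]. apply Clim_mult; [exact Hc|].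
  apply Clim_minus; [apply Ccont_id | apply Clim_const].
Qed.

Lemma cdiff_unique (f : C -> C) z l m : cdiff f z l -> cdiff f z m -> l = m.
Proof.
  rewrite !cdiff_eps. intros Hl Hm. apply NNPP. intros Hne.
  assert (Hd : 0 < Cmod (l - m)).
  { apply C_neq0_mod. intros E. apply Hne. replace l with ((l - m) + m)%C by ring.
    rewrite E. ring. }
  assert (He : 0 < Cmod (l - m) / 4) by lra.
  destruct (Hl _ He) as [d [Hd1 H1]]. destruct (Hm _ He) as [e [He1 H2]].
  set (r := Rmin d e / 2).
  assert (Hr : 0 < r) by (unfold r; generalize (Rmin_pos d e Hd1 He1); lra).
  assert (Hrd : r < d) by (unfold r; generalize (Rmin_l d e); unfold r in Hr; lra).
  assert (Hre : r < e) by (unfold r; generalize (Rmin_r d e); unfold r in Hr; lra).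
  set (w := (z + RtoC r)%C).
  assert (Hw : (w - z)%C = RtoC r) by (unfold w; ring).
  assert (Hm' : Cmod (w - z) = r) by (rewrite Hw, Cmod_R; apply Rabs_pos_eq; lra).
  specialize (H1 w). specialize (H2 w). rewrite Hm' in H1, H2.
  specialize (H1 Hrd). specialize (H2 Hre).
  assert (H := Cmod_triangle (f w - f z - m * (w - z)) (- (f w - f z - l * (w - z)))).
  rewrite Cmod_opp in H.
  replace (f w - f z - m * (w - z) + - (f w - f z - l * (w - z)))%C with ((l - m) * (w - z))%C in H
    by ring.
  rewrite Cmod_mult, Hm' in H. nra.
Qed.

Lemma cdiff_const (c z : C) : cdiff (fun _ => c) z 0.
Proof.
  exists (fun _ => RtoC 0). split; [apply Clim_const|]. split; [reflexivity|]. intros w. ring.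
Qed.

Lemma cdiff_id (z : C) : cdiff (fun w => w) z 1.
Proof.
  exists (fun _ => RtoC 1). split; [apply Clim_const|]. split; [reflexivity|]. intros w. ring.
Qed.

Lemma cdiff_plus (f g : C -> C) z l m :
  cdiff f z l -> cdiff g z m -> cdiff (fun w => f w + g w)%C z (l + m)%C.
Proof.
  intros [p [Hp [Hpz Hf]]] [q [Hq [Hqz Hg]]]. exists (fun w => p w + q w)%C.
  split; [apply Clim_plus; assumption|]. split; [rewrite Hpz, Hqz; reflexivity|].
  intros w. rewrite (Hf w), (Hg w). ring.
Qed.

Lemma cdiff_mult (f g : C -> C) z l m :
  cdiff f z l -> cdiff g z m -> cdiff (fun w => f w * g w)%C z (l * g z + f z * m)%C.
Proof.
  intros Hcf Hcg. assert (Hgc := cdiff_cont _ _ _ Hcg).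
  destruct Hcf as [p [Hp [Hpz Hf]]]. destruct Hcg as [q [Hq [Hqz Hg]]].
  exists (fun w => p w * g w + f z * q w)%C.
  split; [|split; [rewrite Hpz, Hqz; reflexivity|]].
  - apply Clim_plus; [apply Clim_mult; assumption | apply Clim_scal, Hq].
  - intros w. rewrite (Hf w), (Hg w). ring.
Qed.

Lemma cdiff_scal (c : C) (f : C -> C) z l : cdiff f z l -> cdiff (fun w => c * f w)%C z (c * l)%C.
Proof.
  intros H. replace (c * l)%C with (0 * f z + c * l)%C by ring.
  apply cdiff_mult; [apply cdiff_const | exact H].
Qed.

Lemma cdiff_opp (f : C -> C) z l : cdiff f z l -> cdiff (fun w => - f w)%C z (- l)%C.
Proof.
  intros H. apply cdiff_ext with (fun w => (-1) * f w)%C; [intros; ring|].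
  replace (- l)%C with ((-1) * l)%C by ring. apply cdiff_scal, H.
Qed.

Lemma cdiff_minus (f g : C -> C) z l m :
  cdiff f z l -> cdiff g z m -> cdiff (fun w => f w - g w)%C z (l - m)%C.
Proof. intros Hf Hg. apply cdiff_plus; [exact Hf | apply cdiff_opp, Hg]. Qed.

Lemma cdiff_comp (f g : C -> C) z l m :
  cdiff g z m -> cdiff f (g z) l -> cdiff (fun w => f (g w)) z (l * m)%C.
Proof.
  intros Hcg Hcf. assert (Hgc := cdiff_cont _ _ _ Hcg).
  destruct Hcf as [p [Hp [Hpz Hf]]]. destruct Hcg as [q [Hq [Hqz Hg]]].
  exists (fun w => p (g w) * q w)%C.
  split; [|split; [rewrite Hpz, Hqz; reflexivity|]].
  - apply Clim_mult; [|exact Hq]. apply Clim_comp; assumption.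
  - intros w. rewrite (Hf (g w)). rewrite (Hg w) at 2. ring.
Qed.

Lemma cdiff_inv (f : C -> C) z l :
  f z <> 0%C -> cdiff f z l -> cdiff (fun w => / f w)%C z (- l / (f z * f z))%C.
Proof.
  intros Hz Hf. replace (- l / (f z * f z))%C with ((- / (f z * f z)) * l)%C by (field; exact Hz).
  apply (cdiff_comp Cinv f); [exact Hf|]. clear Hf l. set (a := f z) in *.
  (* The slope identity is demanded at every [w], also at [0], where the inverse has only a default
     value. The function is therefore replaced at [0], a point away from [a], by its tangent
     there. *)
  apply cdiff_ext_loc with
    (fun w : C => match excluded_middle_informative (w = 0) with
              | left _ => (/ a + (- / (a * a)) * (w - a))%C | right _ => (/ w)%C end).
  { exists (Cmod a). split; [apply C_neq0_mod, Hz|]. intros w Hw.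
    destruct excluded_middle_informative as [E|E]; [|reflexivity].
    rewrite E in Hw. replace (0 - a)%C with (- a)%C in Hw by ring. rewrite Cmod_opp in Hw. lra. }
  exists (fun w : C => match excluded_middle_informative (w = 0) with
              | left _ => (- / (a * a))%C | right _ => (- / (w * a))%C end).
  split; [|split].
  - unfold Ccont. destruct excluded_middle_informative as [E|E]; [now elim Hz|].
    apply Clim_ext_loc with (fun w => - / (w * a))%C.
    + exists (Cmod a). split; [apply C_neq0_mod, Hz|]. intros w Hw.
      destruct excluded_middle_informative as [E'|E']; [|reflexivity].
      rewrite E' in Hw. replace (0 - a)%C with (- a)%C in Hw by ring. rewrite Cmod_opp in Hw. lra.
    + apply Clim_opp, Clim_inv; [apply Cmult_neq_0; exact Hz|].
      apply Clim_mult; [apply Ccont_id | apply Clim_const].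
  - destruct excluded_middle_informative as [E|E]; [now elim Hz | reflexivity].
  - intros w. destruct (excluded_middle_informative (a = 0)) as [E|E]; [now elim Hz|].
    destruct (excluded_middle_informative (w = 0)) as [E'|E'].
    + reflexivity.
    + field. split; assumption.
Qed.

Lemma cdiff_pow (f : C -> C) z l n :
  cdiff f z l -> cdiff (fun w => f w ^ S n)%C z (INR (S n) * (l * f z ^ n))%C.
Proof.
  intros H. induction n as [|n IH].
  - apply cdiff_ext with f; [intros w; simpl; ring|].
    replace (INR 1 * (l * f z ^ 0))%C with l; [exact H|]. simpl. ring.
  - replace (INR (S (S n)) * (l * f z ^ S n))%C
      with (l * f z ^ S n + f z * (INR (S n) * (l * f z ^ n)))%C.
    + apply (cdiff_mult f (fun w => f w ^ S n)%C); assumption.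
    + rewrite (S_INR (S n)), RtoC_plus. simpl (f z ^ S n)%C. ring.
Qed.

Lemma cdiff_sum (f : nat -> C -> C) (l : nat -> C) z n :
  (forall k, (k < n)%nat -> cdiff (f k) z (l k)) ->
  cdiff (fun w => Csum (fun k => f k w) n) z (Csum l n).
Proof.
  induction n as [|n IH]; intros H; simpl; [apply cdiff_const|].
  apply (cdiff_plus (fun w => Csum (fun k => f k w) n) (f n)); [apply IH; auto with arith | apply H; lia].
Qed.

Lemma hdiff_cont f z : hdiff f z -> Ccont f z.
Proof. intros [l Hl]. eapply cdiff_cont, Hl. Qed.

Lemma hdiff_const c z : hdiff (fun _ => c) z.
Proof. exists 0%C. apply cdiff_const. Qed.

Lemma hdiff_id z : hdiff (fun w => w) z.
Proof. exists 1%C. apply cdiff_id. Qed.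

Lemma hdiff_plus f g z : hdiff f z -> hdiff g z -> hdiff (fun w => f w + g w)%C z.
Proof. intros [l Hl] [m Hm]. eexists. apply cdiff_plus; eassumption. Qed.

Lemma hdiff_minus f g z : hdiff f z -> hdiff g z -> hdiff (fun w => f w - g w)%C z.
Proof. intros [l Hl] [m Hm]. eexists. apply cdiff_minus; eassumption. Qed.

Lemma hdiff_opp f z : hdiff f z -> hdiff (fun w => - f w)%C z.
Proof. intros [l Hl]. eexists. apply cdiff_opp; eassumption. Qed.

Lemma hdiff_mult f g z : hdiff f z -> hdiff g z -> hdiff (fun w => f w * g w)%C z.
Proof. intros [l Hl] [m Hm]. eexists. apply cdiff_mult; eassumption. Qed.

Lemma hdiff_comp f g z : hdiff g z -> hdiff f (g z) -> hdiff (fun w => f (g w)) z.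
Proof. intros [m Hm] [l Hl]. eexists. eapply cdiff_comp; eassumption. Qed.

Lemma hdiff_inv (f : C -> C) z : f z <> 0%C -> hdiff f z -> hdiff (fun w => / f w)%C z.
Proof. intros Hz [l Hl]. eexists. apply cdiff_inv; eassumption. Qed.

Lemma hdiff_div (f g : C -> C) z :
  g z <> 0%C -> hdiff f z -> hdiff g z -> hdiff (fun w => f w / g w)%C z.
Proof. intros Hz Hf Hg. apply hdiff_mult; [exact Hf | apply hdiff_inv; assumption]. Qed.

Lemma hdiff_pow f z n : hdiff f z -> hdiff (fun w => f w ^ n)%C z.
Proof.
  intros H. destruct n as [|n]; [apply (hdiff_const 1)|]. destruct H as [l Hl].
  eexists. apply cdiff_pow, Hl.
Qed.

Lemma hdiff_sum (f : nat -> C -> C) z n :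
  (forall k, (k < n)%nat -> hdiff (f k) z) -> hdiff (fun w => Csum (fun k => f k w) n) z.
Proof.
  induction n as [|n IH]; intros H; simpl; [apply hdiff_const|].
  apply (hdiff_plus (fun w => Csum (fun k => f k w) n) (f n)); [apply IH; auto with arith | apply H; lia].
Qed.

Lemma hdiff_ext_loc f g z : Cnear z (fun w => f w = g w) -> hdiff f z -> hdiff g z.
Proof. intros H [l Hl]. exists l. eapply cdiff_ext_loc; eassumption. Qed.

(** * The complex exponential *)

Definition Cis (t : R) : C := (cos t, sin t).

Lemma Cexp_Cis z : Cexp z = (exp (Re z) * Cis (Im z))%C.
Proof. apply C_ext; unfold Cexp, Cis, Re, Im; simpl; ring. Qed.

Lemma Cis_add a b : Cis (a + b) = (Cis a * Cis b)%C.
Proof. unfold Cis. rewrite cos_plus, sin_plus. apply C_ext; unfold Re, Im; simpl; ring. Qed.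

Lemma Cis_0 : Cis 0 = 1%C.
Proof. unfold Cis. rewrite cos_0, sin_0. reflexivity. Qed.

Lemma Cmod_Cis t : Cmod (Cis t) = 1.
Proof.
  unfold Cmod, Cis. simpl fst; simpl snd. rewrite <- sqrt_1. f_equal.
  generalize (sin2_cos2 t). unfold Rsqr. simpl. lra.
Qed.

Lemma Cis_neq0 t : Cis t <> 0%C.
Proof. apply mod_unit_neq0, Cmod_Cis. Qed.

Lemma Cis_conj t : Cconj (Cis t) = Cis (- t).
Proof. unfold Cis, Cconj. simpl. rewrite cos_neg, sin_neg. reflexivity. Qed.

Lemma Cis_pow t n : (Cis t ^ n)%C = Cis (INR n * t).
Proof.
  induction n as [|n IH].
  - simpl. rewrite Rmult_0_l, Cis_0. reflexivity.
  - rewrite S_INR, Rmult_plus_distr_r, Rmult_1_l, Cis_add. simpl. rewrite IH. ring.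
Qed.

Lemma Cis_2PI : Cis (2 * PI) = 1%C.
Proof. unfold Cis. rewrite cos_2PI, sin_2PI. reflexivity. Qed.

Lemma Cexp_add a b : Cexp (a + b) = (Cexp a * Cexp b)%C.
Proof. rewrite !Cexp_Cis, Re_plus, Im_plus, exp_plus, Cis_add, RtoC_mult. ring. Qed.

Lemma Cexp_0 : Cexp 0 = 1%C.
Proof. rewrite Cexp_Cis. simpl. rewrite exp_0, Cis_0. ring. Qed.

Lemma Cmod_Cexp z : Cmod (Cexp z) = exp (Re z).
Proof.
  rewrite Cexp_Cis, Cmod_mult, Cmod_Cis, Cmod_R, Rmult_1_r. apply Rabs_pos_eq. left; apply exp_pos.
Qed.

Lemma Cexp_neq0 z : Cexp z <> 0%C.
Proof. apply mod_neq0. rewrite Cmod_Cexp. apply exp_pos. Qed.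

Lemma Cexp_opp z : Cexp (- z) = (/ Cexp z)%C.
Proof.
  assert (H : (Cexp (- z) * Cexp z)%C = 1%C).
  { rewrite <- Cexp_add. replace (- z + z)%C with (RtoC 0) by ring. apply Cexp_0. }
  replace (Cexp (- z)) with (Cexp (- z) * Cexp z / Cexp z)%C by (field; apply Cexp_neq0).
  rewrite H. field. apply Cexp_neq0.
Qed.

Lemma unit_arg (z : C) : Cmod z = 1 -> exists t, z = Cis t.
Proof.
  intros H. assert (H2 := Cmod_sqr z). rewrite H in H2.
  assert (Hb : -1 <= Re z <= 1) by nra.
  destruct (Rle_dec 0 (Im z)) as [Hi|Hi].
  - exists (acos (Re z)). apply C_ext; unfold Cis; [unfold Re at 2 | unfold Im at 2]; cbn [fst snd].
    + rewrite cos_acos; [reflexivity | exact Hb].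
    + rewrite sin_acos by exact Hb. rewrite <- (sqrt_Rsqr (Im z)) by exact Hi. f_equal.
      unfold Rsqr. lra.
  - exists (- acos (Re z)). apply C_ext; unfold Cis; [unfold Re at 2 | unfold Im at 2]; cbn [fst snd].
    + rewrite cos_neg, cos_acos; [reflexivity | exact Hb].
    + rewrite sin_neg, sin_acos by exact Hb.
      replace (1 - (Re z)²) with (Rsqr (- Im z)) by (unfold Rsqr; lra).
      rewrite sqrt_Rsqr by lra. ring.
Qed.

Lemma polar (z : C) : exists t, z = (Cmod z * Cis t)%C.
Proof.
  destruct (excluded_middle_informative (z = 0)) as [->|Hz].
  - exists 0. rewrite Cmod_0. ring.
  - assert (Hm := C_neq0_mod _ Hz).
    destruct (unit_arg (z / Cmod z)) as [t Ht].
    + rewrite Cmod_div, Cmod_R, Rabs_pos_eq; [field; lra | lra |].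
      apply mod_neq0. rewrite Cmod_R, Rabs_pos_eq; lra.
    + exists t. rewrite <- Ht. field. apply mod_neq0. rewrite Cmod_R, Rabs_pos_eq; lra.
Qed.

Lemma Cexp_surj (z : C) : z <> 0%C -> exists w, Cexp w = z.
Proof.
  intros Hz. destruct (polar z) as [t Ht]. assert (Hm := C_neq0_mod _ Hz).
  exists (ln (Cmod z), t). rewrite Cexp_Cis. unfold Re, Im; cbn [fst snd].
  rewrite exp_ln by exact Hm. symmetry. exact Ht.
Qed.

(** The upper estimate comes from the tangent inequality at [- x], which gives
    [exp x * (1 - x) <= 1]. *)
Lemma exp_quad (x : R) : Rabs x <= 1 / 2 -> Rabs (exp x - 1 - x) <= 2 * (x * x).
Proof.
  intros H. apply Rabs_le_between in H.
  assert (H1 := exp_ineq1_le x). assert (H2 := exp_ineq1_le (- x)).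
  rewrite Rabs_pos_eq by lra.
  assert (H3 : exp x * exp (- x) = 1) by (rewrite <- exp_plus, Rplus_opp_r; apply exp_0).
  assert (H4 := exp_pos x).
  assert (H5 : exp x * (1 - x) <= 1) by nra.
  assert (exp x <= 1 + x + 2 * (x * x)); [|lra].
  apply Rmult_le_reg_r with (1 - x); [lra|].
  eapply Rle_trans; [exact H5|]. nra.
Qed.

(** From [cos y = 1 - 2 sin^2 (y / 2)] and [|sin x| <= |x|]. *)
Lemma cos_quad (y : R) : Rabs (cos y - 1) <= y * y.
Proof.
  assert (H : cos y = 1 - 2 * (sin (y / 2) * sin (y / 2))).
  { replace y with (2 * (y / 2)) at 1 by field. rewrite cos_2a_sin. ring. }
  assert (H2 : Rabs (sin (y / 2)) <= Rabs (y / 2)).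
  { assert (G : forall x, 0 <= x -> Rabs (sin x) <= x).
    { intros x Hx. destruct (Rle_lt_or_eq_dec _ _ Hx) as [Hx'|<-].
      - destruct (Rle_dec 1 x) as [H1|H1].
        + apply Rle_trans with 1; [|exact H1]. apply Rabs_le. split; apply SIN_bound.
        + rewrite Rabs_pos_eq; [left; apply sin_lt_x, Hx'|].
          apply sin_ge_0; [exact Hx|]. generalize PI2_1. lra.
      - rewrite sin_0, Rabs_R0. lra. }
    destruct (Rle_dec 0 (y / 2)) as [Hy|Hy].
    - rewrite (Rabs_pos_eq (y / 2)) by exact Hy. apply G, Hy.
    - rewrite (Rabs_left (y / 2)) by lra. rewrite <- Rabs_Ropp, <- sin_neg. apply G. lra. }
  assert (H3 : sin (y / 2) * sin (y / 2) <= (y / 2) * (y / 2)).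
  { apply Rsqr_le_abs_1 in H2. exact H2. }
  rewrite H. apply Rabs_le. split; nra.
Qed.

Lemma sin_quad (y : R) : Rabs y <= 1 -> Rabs (sin y - y) <= y * y.
Proof.
  intros Hy.
  destruct (MVT_gen sin 0 y cos) as [c [Hc E]].
  - intros x _. auto_derive; [auto | ring].
  - intros x _. apply continuity_sin.
  - rewrite sin_0 in E. rewrite Rminus_0_r, Rminus_0_r in E. rewrite E.
    replace (cos c * y - y) with ((cos c - 1) * y) by ring. rewrite Rabs_mult.
    assert (H1 := cos_quad c).
    assert (Hcy : Rabs c <= Rabs y).
    { unfold Rmin, Rmax in Hc. destruct (Rle_dec 0 y).
      - rewrite !Rabs_pos_eq; lra.
      - rewrite !Rabs_left1; lra. }
    assert (H2 : c * c <= Rabs y * Rabs y).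
    { replace (c * c) with (Rabs c * Rabs c).
      - apply Rmult_le_compat; try apply Rabs_pos; exact Hcy.
      - rewrite <- Rabs_mult. apply Rabs_pos_eq. nra. }
    assert (H3 := Rabs_pos y).
    replace (y * y) with (Rabs y * Rabs y).
    + apply Rle_trans with (Rabs y * Rabs y * Rabs y); [|nra].
      apply Rmult_le_compat_r; lra.
    + rewrite <- Rabs_mult. apply Rabs_pos_eq. nra.
Qed.

(** Only the quadratic order matters, and the constant [20] is generous. It yields the derivative of
    [Cexp] and controls the second-order term when an extremal function is varied. *)
Lemma Cexp_quad (w : C) : Cmod w <= 1 / 2 -> Cmod (Cexp w - 1 - w) <= 20 * (Cmod w * Cmod w).
Proof.
  intros H. rewrite Cmod_sqr.
  assert (Hx : Rabs (Re w) <= 1 / 2) by (eapply Rle_trans; [apply re_le_Cmod | exact H]).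
  assert (Hy : Rabs (Im w) <= 1 / 2) by (eapply Rle_trans; [apply Im_abs_le_mod | exact H]).
  eapply Rle_trans; [apply Cmod_le_abs|].
  unfold Cexp. unfold Re at 1, Im at 3. simpl fst. simpl snd.
  change (fst w) with (Re w). change (snd w) with (Im w).
  set (x := Re w) in *. set (y := Im w) in *.
  assert (E1 := exp_quad x Hx). assert (E2 := cos_quad y).
  assert (E3 : Rabs (sin y - y) <= y * y) by (apply sin_quad; lra).
  apply Rabs_le_between in Hx. apply Rabs_le_between in Hy.
  apply Rabs_le_between in E1. apply Rabs_le_between in E2. apply Rabs_le_between in E3.
  assert (Hc := COS_bound y).
  apply Rle_trans with ((2 * (x * x) + 2 * (y * y)) + (3 * (y * y) + (3 * (x * x) + 3 * (y * y)))); [|nra].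
  apply Rplus_le_compat.
  - replace (exp x * cos y + - (1) + - x) with ((exp x - 1 - x) * cos y + (1 + x) * (cos y - 1)) by ring.
    eapply Rle_trans; [apply Rabs_triang|]. rewrite !Rabs_mult.
    apply Rplus_le_compat.
    + assert (Rabs (exp x - 1 - x) <= 2 * (x * x)) by (apply Rabs_le; lra).
      assert (Rabs (cos y) <= 1) by (apply Rabs_le; lra).
      assert (0 <= Rabs (exp x - 1 - x)) by apply Rabs_pos. assert (0 <= Rabs (cos y)) by apply Rabs_pos.
      nra.
    + assert (Rabs (1 + x) <= 2) by (apply Rabs_le; lra).
      assert (Rabs (cos y - 1) <= y * y) by (apply Rabs_le; lra).
      assert (0 <= Rabs (1 + x)) by apply Rabs_pos. assert (0 <= Rabs (cos y - 1)) by apply Rabs_pos.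
      nra.
  - replace (exp x * sin y + - 0 + - y) with (exp x * (sin y - y) + (exp x - 1) * y) by ring.
    eapply Rle_trans; [apply Rabs_triang|]. rewrite !Rabs_mult.
    assert (Hx2 : x * x <= 1 / 2 * (1 / 2)) by nra.
    apply Rplus_le_compat.
    + assert (Rabs (exp x) <= 3) by (apply Rabs_le; lra).
      assert (Rabs (sin y - y) <= y * y) by (apply Rabs_le; lra).
      assert (0 <= Rabs (exp x)) by apply Rabs_pos. assert (0 <= Rabs (sin y - y)) by apply Rabs_pos.
      nra.
    + assert (A1 : Rabs (exp x - 1) <= 2 * Rabs x).
      { replace (exp x - 1) with ((exp x - 1 - x) + x) by ring.
        eapply Rle_trans; [apply Rabs_triang|].
        assert (Rabs (exp x - 1 - x) <= 2 * (x * x)) by (apply Rabs_le; lra).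
        assert (x * x = Rabs x * Rabs x) by (rewrite <- Rabs_mult; symmetry; apply Rabs_pos_eq; nra).
        assert (Rabs x <= 1 / 2) by (apply Rabs_le; lra). assert (0 <= Rabs x) by apply Rabs_pos. nra. }
      assert (x * x = Rabs x * Rabs x) by (rewrite <- Rabs_mult; symmetry; apply Rabs_pos_eq; nra).
      assert (y * y = Rabs y * Rabs y) by (rewrite <- Rabs_mult; symmetry; apply Rabs_pos_eq; nra).
      assert (0 <= Rabs x) by apply Rabs_pos. assert (0 <= Rabs y) by apply Rabs_pos.
      apply Rle_trans with (2 * Rabs x * Rabs y); [apply Rmult_le_compat_r; assumption|].
      generalize (Rle_0_sqr (Rabs x - Rabs y)) (Rle_0_sqr (Rabs x)) (Rle_0_sqr (Rabs y)).
      unfold Rsqr. intros. lra.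
Qed.

Lemma cdiff_Cexp z : cdiff Cexp z (Cexp z).
Proof.
  apply cdiff_eps. intros eps He.
  assert (Hm : 0 < Cmod (Cexp z)) by apply C_neq0_mod, Cexp_neq0.
  set (d := Rmin (1 / 2) (eps / (20 * Cmod (Cexp z)))).
  exists d. split.
  - apply Rmin_pos; [lra|]. apply Rdiv_lt_0_compat; lra.
  - intros w Hw.
    assert (H1 : Cmod (w - z) <= 1 / 2) by (left; eapply Rlt_le_trans; [exact Hw | apply Rmin_l]).
    assert (H2 : Cmod (w - z) <= eps / (20 * Cmod (Cexp z)))
      by (left; eapply Rlt_le_trans; [exact Hw | apply Rmin_r]).
    replace (Cexp w) with (Cexp z * Cexp (w - z))%C by (rewrite <- Cexp_add; f_equal; ring).
    replace (Cexp z * Cexp (w - z) - Cexp z - Cexp z * (w - z))%C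
      with (Cexp z * (Cexp (w - z) - 1 - (w - z)))%C by ring.
    rewrite Cmod_mult. assert (H3 := Cexp_quad _ H1). assert (H4 := Cmod_ge_0 (w - z)).
    apply Rle_trans with (Cmod (Cexp z) * (20 * (Cmod (w - z) * Cmod (w - z)))).
    + apply Rmult_le_compat_l; lra.
    + replace (Cmod (Cexp z) * (20 * (Cmod (w - z) * Cmod (w - z))))
        with ((20 * Cmod (Cexp z)) * Cmod (w - z) * Cmod (w - z)) by ring.
      apply Rmult_le_compat_r; [exact H4|].
      apply Rmult_le_reg_l with (/ (20 * Cmod (Cexp z))); [apply Rinv_0_lt_compat; lra|].
      rewrite <- Rmult_assoc, Rinv_l, Rmult_1_l by lra.
      unfold Rdiv in H2. lra.
Qed.

Lemma hdiff_Cexp f z : hdiff f z -> hdiff (fun w => Cexp (f w)) z.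
Proof. intros H. apply (hdiff_comp Cexp f); [exact H|]. eexists. apply cdiff_Cexp. Qed.

Lemma Ccont_Cexp z : Ccont Cexp z.
Proof. eapply cdiff_cont, cdiff_Cexp. Qed.

(** * Integrals of complex functions of a real variable *)

Definition Rcont (F : R -> C) (t : R) : Prop := Clim (locally t) F (F t).

Definition CInt (F : R -> C) (a b : R) : C :=
  (RInt (fun t => Re (F t)) a b, RInt (fun t => Im (F t)) a b).

Definition ccont_on (F : R -> C) (a b : R) : Prop := forall t, a <= t <= b -> Rcont F t.

Lemma ex_Re F a b : a <= b -> ccont_on F a b -> ex_RInt (fun t => Re (F t)) a b.
Proof.
  intros Hab H. apply (ex_RInt_continuous (V := R_CompleteNormedModule)). intros t Ht.
  rewrite Rmin_left, Rmax_right in Ht by exact Hab.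
  exact (proj1 (Clim_locally_cont F t (H t Ht))).
Qed.

Lemma ex_Im F a b : a <= b -> ccont_on F a b -> ex_RInt (fun t => Im (F t)) a b.
Proof.
  intros Hab H. apply (ex_RInt_continuous (V := R_CompleteNormedModule)). intros t Ht.
  rewrite Rmin_left, Rmax_right in Ht by exact Hab.
  exact (proj2 (Clim_locally_cont F t (H t Ht))).
Qed.

Lemma CInt_plus F G a b : a <= b -> ccont_on F a b -> ccont_on G a b ->
  CInt (fun t => F t + G t)%C a b = (CInt F a b + CInt G a b)%C.
Proof.
  intros Hab HF HG. apply C_ext.
  - exact (RInt_plus _ _ a b (ex_Re F a b Hab HF) (ex_Re G a b Hab HG)).
  - exact (RInt_plus _ _ a b (ex_Im F a b Hab HF) (ex_Im G a b Hab HG)).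
Qed.

Lemma CInt_scal (c : C) F a b : a <= b -> ccont_on F a b ->
  CInt (fun t => c * F t)%C a b = (c * CInt F a b)%C.
Proof.
  intros Hab HF. assert (H1 := ex_Re F a b Hab HF). assert (H2 := ex_Im F a b Hab HF).
  apply C_ext.
  - unfold CInt at 1, Re at 1. cbn [fst].
    transitivity (RInt (fun t => minus (scal (Re c) (Re (F t))) (scal (Im c) (Im (F t)))) a b).
    { apply RInt_ext. intros t _. reflexivity. }
    rewrite (RInt_minus (V := R_CompleteNormedModule)), !(RInt_scal (V := R_CompleteNormedModule));
      try assumption; try (apply (ex_RInt_scal (V := R_NormedModule)); assumption).
    reflexivity.
  - unfold CInt at 1, Im at 1. cbn [snd].
    transitivity (RInt (fun t => plus (scal (Re c) (Im (F t))) (scal (Im c) (Re (F t)))) a b).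
    { apply RInt_ext. intros t _. reflexivity. }
    rewrite (RInt_plus (V := R_CompleteNormedModule)), !(RInt_scal (V := R_CompleteNormedModule));
      try assumption; try (apply (ex_RInt_scal (V := R_NormedModule)); assumption).
    reflexivity.
Qed.

Lemma CInt_const (c : C) a b : CInt (fun _ => c) a b = ((b - a) * c)%C.
Proof.
  unfold CInt. rewrite !RInt_const. apply C_ext; unfold Re, Im; simpl; unfold scal; simpl; unfold mult; simpl; ring.
Qed.

Lemma CInt_Chasles F a b c : a <= b -> b <= c -> ccont_on F a c ->
  CInt F a c = (CInt F a b + CInt F b c)%C.
Proof.
  intros Hab Hbc H.
  assert (H1 : ccont_on F a b) by (intros t Ht; apply H; lra).
  assert (H2 : ccont_on F b c) by (intros t Ht; apply H; lra).
  apply C_ext; symmetry.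
  - exact (RInt_Chasles _ a b c (ex_Re F a b Hab H1) (ex_Re F b c Hbc H2)).
  - exact (RInt_Chasles _ a b c (ex_Im F a b Hab H1) (ex_Im F b c Hbc H2)).
Qed.

Lemma Rcont_const c t : Rcont (fun _ => c) t.
Proof. apply Clim_const. Qed.

Lemma Rcont_plus F G t : Rcont F t -> Rcont G t -> Rcont (fun s => F s + G s)%C t.
Proof. apply Clim_plus. Qed.

Lemma Rcont_mult F G t : Rcont F t -> Rcont G t -> Rcont (fun s => F s * G s)%C t.
Proof. apply Clim_mult. Qed.

Lemma Rcont_minus F G t : Rcont F t -> Rcont G t -> Rcont (fun s => F s - G s)%C t.
Proof. apply Clim_minus. Qed.

Lemma Rcont_scal c F t : Rcont F t -> Rcont (fun s => c * F s)%C t.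
Proof. apply Clim_scal. Qed.

Lemma Rcont_conj F t : Rcont F t -> Rcont (fun s => Cconj (F s)) t.
Proof. apply Clim_conj. Qed.

Lemma Rcont_Re F t : Rcont F t -> Rcont (fun s => RtoC (Re (F s))) t.
Proof. apply Clim_Re. Qed.

Lemma Rcont_mod F t : Rcont F t -> Rcont (fun s => RtoC (Cmod (F s))) t.
Proof. apply Clim_mod. Qed.

Lemma Rcont_comp (F : R -> C) (g : C -> C) t : Rcont F t -> Ccont g (F t) -> Rcont (fun s => g (F s)) t.
Proof. apply Clim_comp. Qed.

Lemma CInt_le (f g : R -> C) a b : a <= b -> ccont_on f a b -> ccont_on g a b ->
  (forall t, a <= t <= b -> Re (f t) <= Re (g t)) -> Re (CInt f a b) <= Re (CInt g a b).
Proof.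
  intros Hab Hf Hg H. unfold CInt, Re at 1 4. cbn [fst].
  apply RInt_le; [exact Hab | apply ex_Re; assumption | apply ex_Re; assumption |].
  intros t Ht. apply H. lra.
Qed.

(* Rotating the integral onto the positive real axis reduces this to the monotonicity of the real
   integral. *)
Lemma CInt_mod F a b : a <= b -> ccont_on F a b ->
  Cmod (CInt F a b) <= Re (CInt (fun t => RtoC (Cmod (F t))) a b).
Proof.
  intros Hab HF. destruct (polar (CInt F a b)) as [s Hs].
  assert (E : RtoC (Cmod (CInt F a b)) = CInt (fun t => Cis (- s) * F t)%C a b).
  { rewrite CInt_scal by assumption. rewrite Hs at 2.
    replace (Cis (- s) * (Cmod (CInt F a b) * Cis s))%C
      with (Cmod (CInt F a b) * (Cis (- s) * Cis s))%C by ring.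
    rewrite <- Cis_add. replace (- s + s) with 0 by ring. rewrite Cis_0. ring. }
  rewrite <- (Re_R (Cmod (CInt F a b))), E.
  apply CInt_le; [exact Hab | | |].
  - intros t Ht. apply Rcont_scal, HF, Ht.
  - intros t Ht. apply Rcont_mod, HF, Ht.
  - intros t _. rewrite Re_R. eapply Rle_trans; [apply Re_le_mod|].
    rewrite Cmod_mult, Cmod_Cis. lra.
Qed.

Lemma CInt_bound F a b M : a <= b -> ccont_on F a b -> (forall t, a <= t <= b -> Cmod (F t) <= M) ->
  Cmod (CInt F a b) <= (b - a) * M.
Proof.
  intros Hab HF H. eapply Rle_trans; [apply CInt_mod; assumption|].
  apply Rle_trans with (Re (CInt (fun _ => RtoC M) a b)).
  - apply CInt_le; [exact Hab | | intros t _; apply Rcont_const |].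
    + intros t Ht. apply Rcont_mod, HF, Ht.
    + intros t Ht. rewrite !Re_R. apply H, Ht.
  - rewrite CInt_const. rewrite <- RtoC_minus, <- RtoC_mult, Re_R. lra.
Qed.

(** * Goursat's theorem on rectangles *)

(** The counterclockwise contour integral of [G] around the rectangle whose real parts range over
    [p] and imaginary parts over [q], each pair holding two endpoints. *)
Definition Phi (G : C -> C) (p q : R * R) : C :=
  (CInt (fun x => G (x, fst q)) (fst p) (snd p) - CInt (fun x => G (x, snd q)) (fst p) (snd p)
   + Ci * (CInt (fun y => G (snd p, y)) (fst q) (snd q) - CInt (fun y => G (fst p, y)) (fst q) (snd q)))%C.

Definition in_int (p : R * R) (x : R) : Prop := fst p <= x <= snd p.

Definition rect_cont (G : C -> C) (p q : R * R) : Prop :=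
  forall x y, in_int p x -> in_int q y -> Ccont G (x, y).

Lemma Rcont_horiz (G : C -> C) x y : Ccont G (x, y) -> Rcont (fun s => G (s, y)) x.
Proof.
  intros H eps He. destruct (H eps He) as [d [Hd H']].
  exists (mkposreal d Hd). intros s Hs. apply H'.
  eapply Rle_lt_trans; [apply Cmod_le_abs|]. unfold Re, Im; simpl.
  replace (y + - y) with 0 by ring. rewrite Rabs_R0, Rplus_0_r. exact Hs.
Qed.

Lemma Rcont_vert (G : C -> C) x y : Ccont G (x, y) -> Rcont (fun s => G (x, s)) y.
Proof.
  intros H eps He. destruct (H eps He) as [d [Hd H']].
  exists (mkposreal d Hd). intros s Hs. apply H'.
  eapply Rle_lt_trans; [apply Cmod_le_abs|]. unfold Re, Im; simpl.
  replace (x + - x) with 0 by ring. rewrite Rabs_R0, Rplus_0_l. exact Hs.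
Qed.

Lemma ccont_horiz G p q y : rect_cont G p q -> in_int q y ->
  ccont_on (fun x => G (x, y)) (fst p) (snd p).
Proof. intros H Hy x Hx. apply Rcont_horiz, H; assumption. Qed.

Lemma ccont_vert G p q x : rect_cont G p q -> in_int p x ->
  ccont_on (fun y => G (x, y)) (fst q) (snd q).
Proof. intros H Hx y Hy. apply Rcont_vert, H; assumption. Qed.

Lemma in_int_l p : fst p <= snd p -> in_int p (fst p).
Proof. unfold in_int. lra. Qed.

Lemma in_int_r p : fst p <= snd p -> in_int p (snd p).
Proof. unfold in_int. lra. Qed.

Definition half (b : bool) (p : R * R) : R * R :=
  if b then (fst p, (fst p + snd p) / 2) else ((fst p + snd p) / 2, snd p).

Lemma half_in b p x : fst p <= snd p -> in_int (half b p) x -> in_int p x.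
Proof. unfold in_int. destruct b; simpl; lra. Qed.

Lemma half_le b p : fst p <= snd p -> fst (half b p) <= snd (half b p).
Proof. destruct b; simpl; lra. Qed.

Lemma half_len b p : snd (half b p) - fst (half b p) = (snd p - fst p) / 2.
Proof. destruct b; simpl; lra. Qed.

Lemma Phi_split_x G p q : fst p <= snd p -> fst q <= snd q -> rect_cont G p q ->
  Phi G p q = (Phi G (half true p) q + Phi G (half false p) q)%C.
Proof.
  intros Hp Hq H. unfold Phi. simpl.
  set (m := (fst p + snd p) / 2). assert (Hm : fst p <= m <= snd p) by (unfold m; lra).
  rewrite (CInt_Chasles (fun x => G (x, fst q)) (fst p) m (snd p)); try lra.
  rewrite (CInt_Chasles (fun x => G (x, snd q)) (fst p) m (snd p)); try lra.
  - ring.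
  - apply (ccont_horiz G p q); [exact H | apply in_int_r, Hq].
  - apply (ccont_horiz G p q); [exact H | apply in_int_l, Hq].
Qed.

Lemma Phi_split_y G p q : fst p <= snd p -> fst q <= snd q -> rect_cont G p q ->
  Phi G p q = (Phi G p (half true q) + Phi G p (half false q))%C.
Proof.
  intros Hp Hq H. unfold Phi. simpl.
  set (m := (fst q + snd q) / 2). assert (Hm : fst q <= m <= snd q) by (unfold m; lra).
  rewrite (CInt_Chasles (fun y => G (snd p, y)) (fst q) m (snd q)); try lra.
  rewrite (CInt_Chasles (fun y => G (fst p, y)) (fst q) m (snd q)); try lra.
  - ring.
  - apply (ccont_vert G p q); [exact H | apply in_int_l, Hp].
  - apply (ccont_vert G p q); [exact H | apply in_int_r, Hp].
Qed.

Lemma Phi_plus F G p q : fst p <= snd p -> fst q <= snd q -> rect_cont F p q -> rect_cont G p q ->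
  Phi (fun w => F w + G w)%C p q = (Phi F p q + Phi G p q)%C.
Proof.
  intros Hp Hq HF HG. unfold Phi.
  assert (Hpl := in_int_l p Hp). assert (Hpr := in_int_r p Hp).
  assert (Hql := in_int_l q Hq). assert (Hqr := in_int_r q Hq).
  rewrite (CInt_plus (fun x => F (x, fst q)) (fun x => G (x, fst q)));
    try assumption; try (eapply ccont_horiz; eassumption).
  rewrite (CInt_plus (fun x => F (x, snd q)) (fun x => G (x, snd q)));
    try assumption; try (eapply ccont_horiz; eassumption).
  rewrite (CInt_plus (fun y => F (fst p, y)) (fun y => G (fst p, y)));
    try assumption; try (eapply ccont_vert; eassumption).
  rewrite (CInt_plus (fun y => F (snd p, y)) (fun y => G (snd p, y)));
    try assumption; try (eapply ccont_vert; eassumption).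
  ring.
Qed.

Lemma Phi_bound G p q M : fst p <= snd p -> fst q <= snd q -> rect_cont G p q ->
  (forall x y, in_int p x -> in_int q y -> Cmod (G (x, y)) <= M) ->
  Cmod (Phi G p q) <= 2 * ((snd p - fst p) + (snd q - fst q)) * M.
Proof.
  intros Hp Hq HG HM. unfold Phi.
  assert (Hpl := in_int_l p Hp). assert (Hpr := in_int_r p Hp).
  assert (Hql := in_int_l q Hq). assert (Hqr := in_int_r q Hq).
  assert (B1 := CInt_bound (fun x => G (x, fst q)) (fst p) (snd p) M Hp (ccont_horiz G p q _ HG Hql)
                  (fun x Hx => HM x _ Hx Hql)).
  assert (B2 := CInt_bound (fun x => G (x, snd q)) (fst p) (snd p) M Hp (ccont_horiz G p q _ HG Hqr)
                  (fun x Hx => HM x _ Hx Hqr)).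
  assert (B3 := CInt_bound (fun y => G (snd p, y)) (fst q) (snd q) M Hq (ccont_vert G p q _ HG Hpr)
                  (fun y Hy => HM _ y Hpr Hy)).
  assert (B4 := CInt_bound (fun y => G (fst p, y)) (fst q) (snd q) M Hq (ccont_vert G p q _ HG Hpl)
                  (fun y Hy => HM _ y Hpl Hy)).
  eapply Rle_trans; [apply Cmod_triangle|]. rewrite Cmod_mult, Cmod_Ci.
  assert (T1 := Cmod_triangle (CInt (fun x => G (x, fst q)) (fst p) (snd p))
                  (- CInt (fun x => G (x, snd q)) (fst p) (snd p))).
  assert (T2 := Cmod_triangle (CInt (fun y => G (snd p, y)) (fst q) (snd q))
                  (- CInt (fun y => G (fst p, y)) (fst q) (snd q))).
  rewrite Cmod_opp in T1, T2. unfold Cminus. lra.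
Qed.

Lemma RInt_id a b : RInt (fun x => x) a b = (b * b - a * a) / 2.
Proof.
  apply is_RInt_unique.
  replace ((b * b - a * a) / 2) with (minus (b * b / 2) (a * a / 2))
    by (unfold minus, plus, opp; simpl; field).
  apply (is_RInt_derive (fun x => x * x / 2) (fun x => x)).
  - intros x _. auto_derive; [auto | field].
  - intros x _. apply continuous_id.
Qed.

(** Direct integration of the coordinates. This is the part of a differentiable function that
    Goursat's argument subtracts at the limit point. *)
Lemma Phi_affine (al be : C) p q : fst p <= snd p -> fst q <= snd q ->
  Phi (fun w => al + be * w)%C p q = 0%C.
Proof.
  intros Hp Hq.
  assert (Hc : forall f : C -> C, (forall z, hdiff f z) -> rect_cont f p q)
    by (intros f Hf x y _ _; apply hdiff_cont, Hf).
  assert (Hid : forall a b y, CInt (fun x => (x, y) : C) a b = ((b * b - a * a) / 2, (b - a) * y)).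
  { intros a b y. unfold CInt, Re, Im. cbn [fst snd]. rewrite RInt_id, RInt_const. reflexivity. }
  assert (Hid' : forall a b x, CInt (fun y => (x, y) : C) a b = ((b - a) * x, (b * b - a * a) / 2)).
  { intros a b y. unfold CInt, Re, Im. cbn [fst snd]. rewrite RInt_id, RInt_const. reflexivity. }
  assert (Cid : forall x y, Ccont (fun w => w) (x, y)) by (intros; apply Ccont_id).
  rewrite (Phi_plus (fun _ => al) (fun w => be * w)%C); try assumption.
  - unfold Phi. rewrite !CInt_const.
    rewrite !(CInt_scal be (fun x : R => (x, _) : C)); try assumption;
      try (intros x _; apply (Rcont_horiz (fun w => w)), Cid).
    rewrite !(CInt_scal be (fun y : R => (_, y) : C)); try assumption;
      try (intros x _; apply (Rcont_vert (fun w => w)), Cid).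
    rewrite !Hid, !Hid'. destruct al as [a1 a2], be as [b1 b2].
    apply C_ext; unfold Re, Im; simpl; field.
  - apply Hc. intros z. apply hdiff_const.
  - apply Hc. intros z. apply hdiff_mult; [apply hdiff_const | apply hdiff_id].
Qed.

Lemma dependent_choice {A : Type} (P : A -> Prop) (Q : A -> A -> Prop) (a0 : A) :
  P a0 -> (forall a, P a -> exists b, P b /\ Q a b) ->
  exists f : nat -> A, f 0%nat = a0 /\ forall n, P (f n) /\ Q (f n) (f (S n)).
Proof.
  intros H0 H.
  set (step := fun a : {a | P a} =>
     let (b, Hb) := constructive_indefinite_description _ (H (proj1_sig a) (proj2_sig a)) in
     exist P b (proj1 Hb)).
  assert (Hstep : forall a, Q (proj1_sig a) (proj1_sig (step a))).
  { intros a. unfold step. destruct constructive_indefinite_description as [b [Hb1 Hb2]]. exact Hb2. }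
  set (s := fix s n := match n with O => exist P a0 H0 | S m => step (s m) end).
  exists (fun n => proj1_sig (s n)). split; [reflexivity|].
  intros n. split; [apply (proj2_sig (s n)) | apply Hstep].
Qed.

(** The supremum of the left endpoints lies in every interval. *)
Lemma nested_point (I : nat -> R * R) :
  (forall n, fst (I n) <= snd (I n)) ->
  (forall n, fst (I n) <= fst (I (S n)) /\ snd (I (S n)) <= snd (I n)) ->
  exists x, forall n, in_int (I n) x.
Proof.
  intros Hle Hst.
  assert (Hm : forall n m, (n <= m)%nat -> fst (I n) <= fst (I m) /\ snd (I m) <= snd (I n)).
  { intros n m Hnm. induction Hnm as [|m Hnm IH]; [lra|]. generalize (Hst m). lra. }
  assert (Hc : forall n m, fst (I n) <= snd (I m)).
  { intros n m. generalize (Hm n (Nat.max n m) (Nat.le_max_l _ _)) (Hm m (Nat.max n m) (Nat.le_max_r _ _))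
      (Hle (Nat.max n m)). lra. }
  destruct (completeness (fun x => exists n, x = fst (I n))) as [x [Hx1 Hx2]].
  - exists (snd (I 0%nat)). intros x [n ->]. apply Hc.
  - exists (fst (I 0%nat)), 0%nat. reflexivity.
  - exists x. intros n. split.
    + apply Hx1. exists n. reflexivity.
    + apply Hx2. intros y [m ->]. apply Hc.
Qed.

(** Repeated quartering keeps the integral above [eps * len^2], where [len] is the half-perimeter.
    Near the limit point [G] differs from an affine map by at most [eps / 4 * len], so the integral
    is at most [eps / 2 * len^2], a contradiction. *)
Lemma Goursat_rect G p q : fst p <= snd p -> fst q <= snd q ->
  (forall x y, in_int p x -> in_int q y -> hdiff G (x, y)) -> Phi G p q = 0%C.
Proof.
  intros Hp Hq HG. apply NNPP. intros Hne.
  assert (Hpos := C_neq0_mod _ Hne).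
  set (len := fun r : (R * R) * (R * R) => (snd (fst r) - fst (fst r)) + (snd (snd r) - fst (snd r))).
  assert (Hlen : 0 <= len (p, q)) by (unfold len; simpl; lra).
  (* The [+ 1] makes the initial inequality strict and keeps the quotient meaningful for a
     degenerate rectangle. *)
  set (eps := Cmod (Phi G p q) / (len (p, q) * len (p, q) + 1)).
  assert (Hden : 0 < len (p, q) * len (p, q) + 1) by nra.
  assert (Heps : 0 < eps) by (apply Rdiv_lt_0_compat; lra).
  set (sub := fun r s : (R * R) * (R * R) =>
    (fst (fst r) <= fst (fst s) /\ snd (fst s) <= snd (fst r)) /\
    (fst (snd r) <= fst (snd s) /\ snd (snd s) <= snd (snd r)) /\ len s = len r / 2).
  set (P := fun r : (R * R) * (R * R) =>
    fst (fst r) <= snd (fst r) /\ fst (snd r) <= snd (snd r) /\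
    (forall x y, in_int (fst r) x -> in_int (snd r) y -> hdiff G (x, y)) /\
    eps * (len r * len r) < Cmod (Phi G (fst r) (snd r))).
  destruct (dependent_choice P sub (p, q)) as [r [Hr0 Hr]].
  - split; [exact Hp|]. split; [exact Hq|]. split; [exact HG|]. simpl.
    unfold eps. apply Rmult_lt_reg_r with (len (p, q) * len (p, q) + 1); [exact Hden|].
    unfold Rdiv. replace (Cmod (Phi G p q) * / (len (p, q) * len (p, q) + 1) *
      (len (p, q) * len (p, q)) * (len (p, q) * len (p, q) + 1))
      with (Cmod (Phi G p q) * (len (p, q) * len (p, q))) by (field; lra).
    apply Rmult_lt_compat_l; lra.
  - intros [p' q'] [Hp' [Hq' [HG' Hbig]]]. simpl in *.
    (* The four quarters add up to the whole and [len] is halved, so they cannot all lie below a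
       quarter of the old bound. *)
    assert (Hqr : exists b1 b2, P (half b1 p', half b2 q')).
    { apply NNPP. intros Hno.
      assert (Hsm : forall b1 b2, Cmod (Phi G (half b1 p') (half b2 q'))
        <= eps * ((len (p', q') / 2) * (len (p', q') / 2))).
      { intros b1 b2. apply Rnot_lt_le. intros Hlt. apply Hno. exists b1, b2.
        split; [apply half_le, Hp'|]. split; [apply half_le, Hq'|]. split.
        - simpl. intros x y Hx Hy. apply HG'; eapply half_in; eassumption.
        - simpl. replace (len (half b1 p', half b2 q')) with (len (p', q') / 2); [exact Hlt|].
          unfold len; simpl. rewrite !half_len. lra. }
      assert (Hc : rect_cont G p' q') by (intros x y Hx Hy; apply hdiff_cont, HG'; assumption).
      assert (Hc1 : forall b, rect_cont G (half b p') q')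
        by (intros b x y Hx Hy; apply Hc; [eapply half_in; eassumption | exact Hy]).
      rewrite (Phi_split_x G p' q') in Hbig by assumption.
      rewrite !(Phi_split_y G (half _ p') q') in Hbig by (try apply half_le; try apply Hc1; assumption).
      assert (T := Cmod_triangle
        (Phi G (half true p') (half true q') + Phi G (half true p') (half false q'))
        (Phi G (half false p') (half true q') + Phi G (half false p') (half false q'))).
      assert (T1 := Cmod_triangle (Phi G (half true p') (half true q')) (Phi G (half true p') (half false q'))).
      assert (T2 := Cmod_triangle (Phi G (half false p') (half true q')) (Phi G (half false p') (half false q'))).
      generalize (Hsm true true) (Hsm true false) (Hsm false true) (Hsm false false). lra. }
    destruct Hqr as [b1 [b2 Hb]]. exists (half b1 p', half b2 q'). split; [exact Hb|].
    unfold sub, len; simpl. rewrite !half_len. repeat split; try lra; destruct b1, b2; simpl; lra.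
  - destruct (nested_point (fun n => fst (r n))) as [x Hx].
    { intros n. apply (Hr n). } { intros n. apply (proj2 (Hr n)). }
    destruct (nested_point (fun n => snd (r n))) as [y Hy].
    { intros n. apply (proj1 (Hr n)). } { intros n. apply (proj2 (Hr n)). }
    assert (Hln : forall n, len (r n) = len (p, q) * (1 / 2) ^ n).
    { induction n as [|n IH]; [rewrite Hr0; simpl; ring|].
      destruct (proj2 (Hr n)) as [_ [_ E]]. rewrite E, IH. simpl. field. }
    assert (Hdz : hdiff G (x, y)).
    { apply HG; [specialize (Hx 0%nat) | specialize (Hy 0%nat)]; rewrite Hr0 in *; assumption. }
    destruct Hdz as [l Hl]. assert (Hl' := proj1 (cdiff_eps _ _ _) Hl).
    destruct (Hl' (eps / 4)) as [d [Hd Hdl]]; [lra|].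
    assert (Hsmall : exists n, len (r n) < d).
    { destruct (pow_lt_1_zero (1 / 2)) with (y := d / (len (p, q) + 1)) as [N HN].
      - rewrite Rabs_pos_eq; lra.
      - apply Rdiv_lt_0_compat; lra.
      - exists N. rewrite Hln. specialize (HN N (Nat.le_refl _)).
        rewrite Rabs_pos_eq in HN by (apply pow_le; lra).
        assert (0 <= (1 / 2) ^ N) by (apply pow_le; lra).
        apply Rle_lt_trans with ((len (p, q) + 1) * (1 / 2) ^ N); [nra|].
        apply (Rmult_lt_compat_r (len (p, q) + 1)) in HN; [|lra].
        replace (d / (len (p, q) + 1) * (len (p, q) + 1)) with d in HN by (field; lra). lra. }
    destruct Hsmall as [n Hn]. destruct (proj1 (Hr n)) as [Hpn [Hqn [HGn Hbig]]].
    specialize (Hx n). specialize (Hy n). simpl in Hx, Hy.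
    destruct (r n) as [p' q']. simpl in *.
    set (z := (x, y) : C) in *.
    set (A := fun w : C => (G z - l * z + l * w)%C).
    set (E := fun w : C => (G w - A w)%C).
    assert (HA : forall w, hdiff A w).
    { intros w. apply (hdiff_plus (fun _ => G z - l * z)%C); [apply hdiff_const|].
      apply hdiff_mult; [apply hdiff_const | apply hdiff_id]. }
    assert (HE : rect_cont E p' q').
    { intros u v Hu Hv. apply hdiff_cont, hdiff_minus; [apply HGn; assumption | apply HA]. }
    assert (EG : Phi G p' q' = Phi E p' q').
    { replace (Phi G p' q') with (Phi (fun w => A w + E w)%C p' q').
      - rewrite Phi_plus; try assumption.
        + unfold A. rewrite (Phi_affine (G z - l * z) l) by assumption. ring.
        + intros u v _ _. apply hdiff_cont, HA.
      - f_equal. apply functional_extensionality. intros w. unfold E. ring. }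
    assert (HM : forall u v, in_int p' u -> in_int q' v -> Cmod (E (u, v)) <= eps / 4 * len (p', q')).
    { intros u v Hu Hv.
      assert (Hdist : Cmod ((u, v) - z) <= len (p', q')).
      { eapply Rle_trans; [apply Cmod_le_abs|]. unfold z, Re, Im, len; simpl. unfold in_int in *.
        apply Rplus_le_compat; apply Rabs_le; lra. }
      replace (E (u, v)) with (G (u, v) - G z - l * ((u, v) - z))%C by (unfold E, A; ring).
      eapply Rle_trans; [apply Hdl; lra|]. apply Rmult_le_compat_l; lra. }
    assert (B := Phi_bound E p' q' _ Hpn Hqn HE HM). rewrite <- EG in B.
    change (snd p' - fst p' + (snd q' - fst q')) with (len (p', q')) in B.
    assert (0 <= len (p', q')) by (unfold len; simpl; lra). nra.
Qed.

(** * Circle averages *)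

Definition avg (F : R -> C) : C := (/ (2 * PI) * CInt F 0 (2 * PI))%C.

Definition cont2pi (F : R -> C) : Prop := forall t, Rcont F t.

Lemma two_PI_pos : 0 < 2 * PI.
Proof. generalize PI_RGT_0. lra. Qed.

Lemma avg_ext F G : (forall t, F t = G t) -> avg F = avg G.
Proof. intros H. f_equal. apply functional_extensionality, H. Qed.

Lemma avg_const c : avg (fun _ => c) = c.
Proof.
  unfold avg. rewrite CInt_const, RtoC_mult. field.
  intros E. apply (f_equal Re) in E. simpl in E. generalize PI_RGT_0. lra.
Qed.

Lemma avg_plus F G : cont2pi F -> cont2pi G -> avg (fun t => F t + G t)%C = (avg F + avg G)%C.
Proof.
  intros HF HG. unfold avg. rewrite CInt_plus; [ring | | |].
  - left; apply two_PI_pos.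
  - intros t _; apply HF.
  - intros t _; apply HG.
Qed.

Lemma avg_scal c F : cont2pi F -> avg (fun t => c * F t)%C = (c * avg F)%C.
Proof.
  intros HF. unfold avg. rewrite CInt_scal; [ring | |].
  - left; apply two_PI_pos.
  - intros t _; apply HF.
Qed.

Lemma avg_opp F : cont2pi F -> avg (fun t => - F t)%C = (- avg F)%C.
Proof.
  intros H. rewrite (avg_ext _ (fun t => (-1) * F t)%C) by (intros; ring).
  rewrite avg_scal by exact H. ring.
Qed.

Lemma avg_minus F G : cont2pi F -> cont2pi G -> avg (fun t => F t - G t)%C = (avg F - avg G)%C.
Proof.
  intros HF HG. unfold Cminus. rewrite avg_plus, avg_opp; auto.
  intros t. apply Clim_opp, HG.
Qed.

Lemma cont2pi_sum (F : nat -> R -> C) n : (forall k, (k < n)%nat -> cont2pi (F k)) ->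
  cont2pi (fun t => Csum (fun k => F k t) n).
Proof. intros H t. apply (Clim_sum F (fun k => F k t)). intros k Hk. apply H, Hk. Qed.

Lemma avg_sum (F : nat -> R -> C) n : (forall k, (k < n)%nat -> cont2pi (F k)) ->
  avg (fun t => Csum (fun k => F k t) n) = Csum (fun k => avg (F k)) n.
Proof.
  induction n as [|n IH]; intros H; simpl; [apply avg_const|].
  rewrite avg_plus, IH; auto with arith. apply cont2pi_sum; auto with arith.
Qed.

Lemma inv_2PI : (/ (2 * PI))%C = RtoC (/ (2 * PI)).
Proof. rewrite <- RtoC_mult, <- RtoC_inv; [reflexivity | generalize two_PI_pos; lra]. Qed.

Lemma avg_le F G : cont2pi F -> cont2pi G -> (forall t, Re (F t) <= Re (G t)) ->
  Re (avg F) <= Re (avg G).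
Proof.
  intros HF HG H. unfold avg. rewrite inv_2PI, !Re_Rmult.
  apply Rmult_le_compat_l; [left; apply Rinv_0_lt_compat, two_PI_pos|].
  apply CInt_le; [left; apply two_PI_pos | intros t _; apply HF | intros t _; apply HG | intros t _; apply H].
Qed.

Lemma avg_mod F : cont2pi F -> Cmod (avg F) <= Re (avg (fun t => RtoC (Cmod (F t)))).
Proof.
  intros HF. unfold avg. rewrite inv_2PI, Re_Rmult, Cmod_mult, Cmod_R.
  assert (H := Rinv_0_lt_compat _ two_PI_pos). rewrite Rabs_pos_eq by lra.
  apply Rmult_le_compat_l; [lra|]. apply CInt_mod; [left; apply two_PI_pos | intros t _; apply HF].
Qed.

Lemma avg_bound F M : cont2pi F -> (forall t, Cmod (F t) <= M) -> Cmod (avg F) <= M.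
Proof.
  intros HF H. eapply Rle_trans; [apply avg_mod, HF|].
  rewrite <- (Re_R M), <- (avg_const (RtoC M)).
  apply avg_le; [intros t; apply Rcont_mod, HF | intros t; apply Rcont_const|].
  intros t. rewrite !Re_R. apply H.
Qed.

Lemma avg_conj F : cont2pi F -> avg (fun t => Cconj (F t)) = Cconj (avg F).
Proof.
  intros HF. unfold avg. rewrite Cmult_conj, inv_2PI. f_equal.
  - apply C_ext; simpl; ring.
  - apply C_ext; unfold CInt; simpl; [reflexivity|].
    apply (RInt_opp (V := R_CompleteNormedModule) (fun t => Im (F t)) 0 (2 * PI)).
    apply ex_Im; [left; apply two_PI_pos | intros t _; apply HF].
Qed.

Lemma avg_Re F : cont2pi F -> avg (fun t => RtoC (Re (F t))) = RtoC (Re (avg F)).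
Proof.
  intros HF. rewrite re_alt.
  rewrite (avg_ext _ (fun t => (/ 2) * (F t + Cconj (F t)))%C).
  - rewrite avg_scal, avg_plus, avg_conj; auto.
    + field.
    + intros t. apply Rcont_conj, HF.
    + intros t. apply Rcont_plus; [apply HF | apply Rcont_conj, HF].
  - intros t. rewrite re_alt. field.
Qed.

Lemma Rcont_Cis t : Rcont Cis t.
Proof.
  assert (H : Rcont (fun s => (fun w => Cexp w) (0, s)) t).
  { apply Rcont_vert. apply Ccont_Cexp. }
  apply Clim_ext with (fun s => Cexp (0, s)).
  - intros s. rewrite Cexp_Cis. unfold Re, Im; cbn [fst snd]. rewrite exp_0. ring.
  - apply Clim_eq with (Cexp (0, t)); [|exact H].
    rewrite Cexp_Cis. unfold Re, Im; cbn [fst snd]. rewrite exp_0. ring.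
Qed.

Definition circ (r t : R) : C := (r * Cis t)%C.

Lemma Cmod_circ r t : 0 <= r -> Cmod (circ r t) = r.
Proof. intros H. unfold circ. rewrite Cmod_mult, Cmod_Cis, Cmod_R, Rabs_pos_eq; lra. Qed.

Lemma Rcont_circ r t : Rcont (circ r) t.
Proof. apply Rcont_scal, Rcont_Cis. Qed.

Lemma cont_circ (f : C -> C) r : 0 <= r -> (forall z, Cmod z = r -> Ccont f z) ->
  cont2pi (fun t => f (circ r t)).
Proof. intros Hr H t. apply Rcont_comp; [apply Rcont_circ | apply H, Cmod_circ, Hr]. Qed.

(* Goursat's theorem for [f o exp] on the rectangle [ln r, ln s] x [0, 2 pi]: the horizontal sides
   cancel by periodicity. *)
Lemma avg_annulus (f : C -> C) r s : 0 < r -> r <= s ->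
  (forall z, r <= Cmod z <= s -> hdiff f z) ->
  avg (fun t => f (circ r t)) = avg (fun t => f (circ s t)).
Proof.
  intros Hr Hrs Hf.
  assert (Hln : ln r <= ln s) by (destruct Hrs as [H|<-]; [left; apply ln_increasing; lra | lra]).
  assert (HG := Goursat_rect (fun w => f (Cexp w)) (ln r, ln s) (0, 2 * PI)).
  simpl in HG. specialize (HG Hln (Rlt_le _ _ two_PI_pos)).
  assert (H0 : Phi (fun w => f (Cexp w)) (ln r, ln s) (0, 2 * PI) = 0%C).
  { apply HG. intros x y [Hx1 Hx2] _. simpl in Hx1, Hx2.
    apply (hdiff_comp f Cexp); [eexists; apply cdiff_Cexp|]. apply Hf. rewrite Cmod_Cexp.
    unfold Re; simpl. split.
    - rewrite <- (exp_ln r) by lra. destruct Hx1 as [H|<-]; [left; apply exp_increasing, H | lra].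
    - rewrite <- (exp_ln s) by lra. destruct Hx2 as [H| ->]; [left; apply exp_increasing, H | lra]. }
  unfold Phi in H0. simpl in H0.
  assert (E1 : CInt (fun x => f (Cexp (x, 2 * PI))) (ln r) (ln s) = CInt (fun x => f (Cexp (x, 0))) (ln r) (ln s)).
  { f_equal. apply functional_extensionality. intros x. f_equal. rewrite !Cexp_Cis.
    unfold Re, Im; cbn [fst snd]. rewrite Cis_2PI, Cis_0. reflexivity. }
  rewrite E1 in H0.
  assert (E2 : forall u, 0 < u -> (fun y => f (Cexp (ln u, y))) = (fun t => f (circ u t))).
  { intros u Hu. apply functional_extensionality. intros y. f_equal. rewrite Cexp_Cis.
    unfold Re, Im; cbn [fst snd]. rewrite exp_ln by exact Hu. reflexivity. }
  rewrite !E2 in H0 by lra.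
  unfold avg. f_equal.
  set (a := CInt (fun t => f (circ s t)) 0 (2 * PI)) in *.
  set (b := CInt (fun t => f (circ r t)) 0 (2 * PI)) in *.
  assert (H1 : (Ci * (a - b))%C = 0%C).
  { rewrite <- H0. ring. }
  apply (f_equal (Cmult (- Ci)%C)) in H1.
  replace (- Ci * (Ci * (a - b)))%C with (a - b)%C in H1.
  - replace b with (a - (a - b))%C by ring. rewrite H1. ring.
  - destruct a, b. apply C_ext; unfold Re, Im; simpl; ring.
Qed.

(** * Taylor expansion of holomorphic functions *)

(** Uniform continuity on a closed annulus, applied to each component. Only continuity of [f] is
    assumed, so that averages can be carried across a circle containing a point where [f] is not
    known to be differentiable. *)
Lemma avg_circ_cont (f : C -> C) r0 : 0 < r0 < 1 -> (forall z, inD z -> Ccont f z) ->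
  Clim (locally r0) (fun r => avg (fun t => f (circ r t))) (avg (fun t => f (circ r0 t))).
Proof.
  intros Hr0 Hf.
  set (d := Rmin r0 (1 - r0) / 2).
  assert (Hd : 0 < d) by (unfold d; generalize (Rmin_pos r0 (1 - r0)); lra).
  assert (Hd1 : d < r0) by (unfold d; generalize (Rmin_l r0 (1 - r0)); unfold d in Hd; lra).
  assert (Hd2 : d < 1 - r0) by (unfold d; generalize (Rmin_r r0 (1 - r0)); unfold d in Hd; lra).
  assert (Hc : forall x y, r0 - d <= x <= r0 + d -> forall eps, 0 < eps ->
     locally_2d (fun u v => Cmod (f (circ u v) - f (circ x y)) < eps) x y).
  { intros x y Hx eps He.
    assert (Hin : inD (circ x y)) by (unfold inD; rewrite Cmod_circ; lra).
    destruct (Hf _ Hin eps He) as [e [Hep H]].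
    assert (He4 : 0 < e / 2) by lra.
    destruct (Rcont_Cis y (e / 2) He4) as [e2 He2].
    exists (mkposreal (Rmin (e / 2) e2) (Rmin_pos _ _ He4 (cond_pos e2))).
    simpl. intros u v Hu Hv. apply H.
    unfold circ. replace (u * Cis v - x * Cis y)%C with ((u - x) * Cis v + x * (Cis v - Cis y))%C by ring.
    eapply Rle_lt_trans; [apply Cmod_triangle|].
    rewrite !Cmod_mult, Cmod_Cis, <- RtoC_minus, !Cmod_R.
    assert (B1 : Rabs (u - x) < e / 2) by (eapply Rlt_le_trans; [exact Hu | apply Rmin_l]).
    assert (B2 : Cmod (Cis v - Cis y) < e / 2)
      by (apply He2; eapply Rlt_le_trans; [exact Hv | apply Rmin_r]).
    rewrite (Rabs_pos_eq x) by lra. assert (H0 := Cmod_ge_0 (Cis v - Cis y)). nra. }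
  intros eps He. assert (He4 : 0 < eps / 4) by lra.
  destruct (uniform_continuity_2d (fun u v => Re (f (circ u v))) (r0 - d) (r0 + d) 0 (2 * PI))
    with (eps := mkposreal _ He4) as [d1 Hd1'].
  { intros x y Hx _ e'. destruct (Hc x y Hx e' (cond_pos e')) as [dd Hdd]. exists dd.
    intros u v Hu Hv. rewrite <- Re_minus. eapply Rle_lt_trans; [apply re_le_Cmod | apply Hdd; assumption]. }
  destruct (uniform_continuity_2d (fun u v => Im (f (circ u v))) (r0 - d) (r0 + d) 0 (2 * PI))
    with (eps := mkposreal _ He4) as [d2 Hd2'].
  { intros x y Hx _ e'. destruct (Hc x y Hx e' (cond_pos e')) as [dd Hdd]. exists dd.
    intros u v Hu Hv. rewrite <- Im_minus. eapply Rle_lt_trans; [apply Im_abs_le_mod | apply Hdd; assumption]. }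
  simpl in Hd1', Hd2'.
  set (e := Rmin d (Rmin d1 d2)).
  assert (Hepos : 0 < e) by (apply Rmin_pos; [exact Hd | apply Rmin_pos; apply cond_pos]).
  exists (mkposreal e Hepos). intros r Hr.
  assert (Hr' : Rabs (r - r0) < e) by exact Hr. clear Hr.
  assert (Hra : Rabs (r - r0) < d) by (eapply Rlt_le_trans; [exact Hr' | apply Rmin_l]).
  assert (Hrb : Rabs (r - r0) < d1)
    by (eapply Rlt_le_trans; [exact Hr' | eapply Rle_trans; [apply Rmin_r | apply Rmin_l]]).
  assert (Hrc : Rabs (r - r0) < d2)
    by (eapply Rlt_le_trans; [exact Hr' | eapply Rle_trans; [apply Rmin_r | apply Rmin_r]]).
  apply Rabs_lt_between in Hra.
  assert (C1 : cont2pi (fun t => f (circ r t))).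
  { apply cont_circ; [lra|]. intros z Hz. apply Hf. unfold inD. lra. }
  assert (C2 : cont2pi (fun t => f (circ r0 t))).
  { apply cont_circ; [lra|]. intros z Hz. apply Hf. unfold inD. lra. }
  assert (two := two_PI_pos).
  rewrite <- avg_minus by assumption.
  apply Rle_lt_trans with (eps / 2); [|lra].
  unfold avg. rewrite inv_2PI, Cmod_mult, Cmod_R.
  assert (Hinv := Rinv_0_lt_compat _ two). rewrite Rabs_pos_eq by lra.
  apply Rmult_le_reg_l with (2 * PI); [exact two|].
  rewrite <- Rmult_assoc, Rinv_r, Rmult_1_l by lra.
  eapply Rle_trans; [apply CInt_bound with (M := eps / 2)|].
  - lra.
  - intros t _. apply Rcont_minus; [apply C1 | apply C2].
  - intros t Ht. eapply Rle_trans; [apply Cmod_le_abs|]. rewrite Re_minus, Im_minus.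
    replace (eps / 2) with (eps / 4 + eps / 4) by field.
    assert (Z : Rabs (t - t) = 0) by (replace (t - t) with 0 by ring; apply Rabs_R0).
    apply Rplus_le_compat; left.
    + apply Hd1'; try lra. rewrite Z. apply cond_pos.
    + apply Hd2'; try lra. rewrite Z. apply cond_pos.
  - lra.
Qed.

Lemma avg_circ_0 (f : C -> C) (l : C) :
  (forall z, inD z -> Ccont f z) -> (forall r, 0 < r < 1 -> avg (fun t => f (circ r t)) = l) -> l = f 0%C.
Proof.
  intros Hf H. apply NNPP. intros Hne.
  assert (Hp : 0 < Cmod (l - f 0%C)).
  { apply C_neq0_mod. intros E. apply Hne. replace l with (l - f 0%C + f 0%C)%C by ring. rewrite E. ring. }
  assert (H0 : inD 0) by (unfold inD; rewrite Cmod_0; lra).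
  assert (Hp2 : 0 < Cmod (l - f 0%C) / 2) by lra.
  destruct (Hf _ H0 _ Hp2) as [d [Hd Hd']].
  set (r := Rmin (1 / 2) (d / 2)).
  assert (Hr : 0 < r) by (apply Rmin_pos; lra).
  assert (Hr1 : r <= 1 / 2) by apply Rmin_l. assert (Hr2 : r <= d / 2) by apply Rmin_r.
  assert (C1 : cont2pi (fun t => f (circ r t))).
  { apply cont_circ; [lra|]. intros z Hz. apply Hf. unfold inD. lra. }
  assert (B : Cmod (avg (fun t => f (circ r t) - f 0%C)%C) <= Cmod (l - f 0%C) / 2).
  { apply avg_bound.
    - intros t. apply Rcont_minus; [apply C1 | apply Rcont_const].
    - intros t. left. apply Hd'. replace (circ r t - 0)%C with (circ r t) by ring.
      rewrite Cmod_circ; lra. }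
  rewrite avg_minus, avg_const, H in B; [lra | lra | exact C1 | intros t; apply Rcont_const].
Qed.

(** Inside and outside the circle through [z0] the averages are constant by [avg_annulus];
    continuity in the radius joins the two constants, and radius zero identifies the value. The
    exceptional point is what lets difference quotients in. *)
Lemma avg_removable (f : C -> C) (z0 : C) r :
  (forall z, inD z -> Ccont f z) -> (forall z, inD z -> z <> 0%C -> z <> z0 -> hdiff f z) ->
  0 < r < 1 -> avg (fun t => f (circ r t)) = f 0%C.
Proof.
  intros Hc Hh.
  set (A := fun r => avg (fun t => f (circ r t))).
  set (R0 := Cmod z0).
  assert (nz : forall z, 0 < Cmod z -> z <> 0%C) by (intros z Hz; apply mod_neq0, Hz).
  assert (H1 : forall r s, 0 < r -> r <= s -> s < 1 -> s < R0 -> A r = A s).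
  { intros r1 s Hr Hrs Hs Hs'. apply avg_annulus; [exact Hr | exact Hrs|].
    intros z Hz. apply Hh; [unfold inD; lra | apply nz; lra |]. intros E. rewrite E in Hz. fold R0 in Hz. lra. }
  assert (H2 : forall r s, 0 < r -> r <= s -> s < 1 -> R0 < r -> A r = A s).
  { intros r1 s Hr Hrs Hs Hs'. apply avg_annulus; [exact Hr | exact Hrs|].
    intros z Hz. apply Hh; [unfold inD; lra | apply nz; lra |]. intros E. rewrite E in Hz. fold R0 in Hz. lra. }
  assert (Hat : 0 < R0 < 1 -> forall r, 0 < r < 1 -> A r = A R0).
  { intros HR r1 Hr1. assert (HL := avg_circ_cont f R0 HR Hc). fold A in HL.
    destruct (Rtotal_order r1 R0) as [Hlt|[->|Hgt]]; [|reflexivity|].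
    - assert (HL2 : Clim (at_left R0) A (A R0)).
      { intros e He. generalize (HL e He). unfold at_left, within. apply filter_imp. auto. }
      apply (Clim_unique (F := at_left R0) A); [|exact HL2].
      apply Clim_ext_loc with (fun _ => A r1); [|apply Clim_const].
      assert (Hp : 0 < R0 - r1) by lra. exists (mkposreal _ Hp). intros y Hy Hy'.
      assert (Hy2 : Rabs (y - R0) < R0 - r1) by exact Hy. apply Rabs_lt_between in Hy2.
      apply H1; lra.
    - assert (HL2 : Clim (at_right R0) A (A R0)).
      { intros e He. generalize (HL e He). unfold at_right, within. apply filter_imp. auto. }
      apply (Clim_unique (F := at_right R0) A); [|exact HL2].
      apply Clim_ext_loc with (fun _ => A r1); [|apply Clim_const].
      assert (Hp : 0 < r1 - R0) by lra. exists (mkposreal _ Hp). intros y Hy Hy'.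
      assert (Hy2 : Rabs (y - R0) < r1 - R0) by exact Hy. apply Rabs_lt_between in Hy2.
      symmetry. apply H2; lra. }
  intros Hr. change (A r = f 0%C). apply avg_circ_0; [exact Hc|]. intros s Hs. change (A s = A r).
  assert (HR0 : 0 <= R0) by apply Cmod_ge_0.
  destruct (Rlt_dec 0 R0) as [HR|HR].
  - destruct (Rlt_dec R0 1) as [HR1|HR1].
    + rewrite (Hat (conj HR HR1) r Hr), (Hat (conj HR HR1) s Hs). reflexivity.
    + destruct (Rle_dec r s); [symmetry; apply H1; lra | apply H1; lra].
  - destruct (Rle_dec r s); [symmetry; apply H2; lra | apply H2; lra].
Qed.

Lemma avg_mean (f : C -> C) r : holo_D f -> 0 < r < 1 -> avg (fun t => f (circ r t)) = f 0%C.
Proof.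
  intros H. rewrite holo_hdiff in H. apply avg_removable with (RtoC 0).
  - intros z Hz. apply hdiff_cont, H, Hz.
  - intros z Hz _ _. apply H, Hz.
Qed.

Lemma holo_cont f z : holo_D f -> inD z -> Ccont f z.
Proof. intros H Hz. apply hdiff_cont, holo_hdiff; assumption. Qed.

Lemma holo_circ f r : holo_D f -> 0 < r < 1 -> cont2pi (fun t => f (circ r t)).
Proof. intros H Hr. apply cont_circ; [lra|]. intros z Hz. apply holo_cont; [exact H | unfold inD; lra]. Qed.

Lemma cont_Cis_lin a : cont2pi (fun t => Cis (a * t)).
Proof.
  intros t. assert (H := Rcont_Cis (a * t)). intros eps He. specialize (H eps He).
  assert (Hc : continuous (fun s => a * s) t).
  { apply (continuous_scal_r (V := R_NormedModule) a (fun s => s)). apply continuous_id. }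
  exact (Hc _ H).
Qed.

Lemma cont_mult F G : cont2pi F -> cont2pi G -> cont2pi (fun t => F t * G t)%C.
Proof. intros HF HG t. apply Rcont_mult; auto. Qed.

(** Cauchy's formula on the fixed circle of radius [1 / 2]; being total, it can be written for any
    function before anything is known about it. [avg_coef] frees it from the radius. *)
Definition coef (f : C -> C) (k : nat) : C :=
  (2 ^ k * avg (fun t => f (circ (1 / 2) t) * Cis (- INR k * t)))%C.

Lemma circ_pow r t k : (circ r t ^ k)%C = ((r ^ k)%R * Cis (INR k * t))%C.
Proof. unfold circ. rewrite Cpow_mult_l, Cis_pow, RtoC_pow. reflexivity. Qed.

Lemma inv_Cis s : (/ Cis s)%C = Cis (- s).
Proof.
  assert (H := Cis_neq0 s).
  replace (Cis (- s)) with (Cis (- s) * Cis s / Cis s)%C by (field; exact H).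
  rewrite <- Cis_add. replace (- s + s) with 0 by ring. rewrite Cis_0. field. exact H.
Qed.

Lemma circ_neq0 r t : 0 < r -> circ r t <> 0%C.
Proof. intros H. apply mod_neq0. rewrite Cmod_circ; lra. Qed.

Lemma RtoC_neq0 (r : R) : r <> 0 -> RtoC r <> 0%C.
Proof. intros H E. apply H. apply (f_equal Re) in E. exact E. Qed.

Lemma inv_circ_pow r t k : 0 < r -> (/ circ r t ^ k)%C = ((/ r ^ k)%R * Cis (- INR k * t))%C.
Proof.
  intros Hr. rewrite circ_pow. assert (H := pow_lt r k Hr).
  rewrite RtoC_inv by lra. replace (- INR k * t) with (- (INR k * t)) by ring. rewrite <- inv_Cis.
  field. split; [apply Cis_neq0 | apply RtoC_neq0; lra].
Qed.

(** The function [f z / z^k] is holomorphic off the origin, so its circle averages agree. *)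
Lemma avg_coef f r k : holo_D f -> 0 < r < 1 ->
  avg (fun t => f (circ r t) * Cis (- INR k * t))%C = (coef f k * (r ^ k)%R)%C.
Proof.
  intros Hf.
  assert (Hh := proj1 (holo_hdiff f) Hf).
  assert (G : forall r, 0 < r < 1 -> avg (fun t => f (circ r t) * Cis (- INR k * t))%C =
    ((r ^ k)%R * avg (fun t => f (circ r t) * / circ r t ^ k))%C).
  { intros s Hs. assert (Hp := pow_lt s k (proj1 Hs)).
    rewrite (avg_ext (fun t => f (circ s t) * / circ s t ^ k)%C
      (fun t => (/ s ^ k)%R * (f (circ s t) * Cis (- INR k * t)))%C).
    - rewrite avg_scal.
      + rewrite RtoC_inv by lra. field. apply RtoC_neq0. lra.
      + apply cont_mult; [apply holo_circ; assumption | apply cont_Cis_lin].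
    - intros t. rewrite inv_circ_pow by lra. ring. }
  assert (E : forall r s, 0 < r -> r <= s -> s < 1 ->
    avg (fun t => f (circ r t) * / circ r t ^ k)%C = avg (fun t => f (circ s t) * / circ s t ^ k)%C).
  { intros s u Hs Hsu Hu. apply (avg_annulus (fun z => f z * / z ^ k)%C); [exact Hs | exact Hsu|].
    intros z Hz. apply hdiff_mult; [apply Hh; unfold inD; lra|].
    apply hdiff_inv; [apply Cpow_neq0, mod_neq0; lra | apply hdiff_pow, hdiff_id]. }
  intros Hr. unfold coef. rewrite (G r Hr), (G (1 / 2)) by lra.
  assert (E' : avg (fun t => f (circ r t) * / circ r t ^ k)%C =
               avg (fun t => f (circ (1 / 2) t) * / circ (1 / 2) t ^ k)%C)
    by (destruct (Rle_dec r (1 / 2)); [apply E; lra | symmetry; apply E; lra]).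
  rewrite E'. set (a := avg _).
  replace (2 ^ k * (((1 / 2) ^ k)%R * a) * (r ^ k)%R)%C with ((2 ^ k * (1 / 2) ^ k * r ^ k)%R * a)%C
    by (rewrite !RtoC_mult, <- (RtoC_pow 2); ring).
  rewrite <- Rpow_mult_distr. replace (2 * (1 / 2)) with 1 by field. rewrite pow1.
  rewrite Rmult_1_l. reflexivity.
Qed.

(** The mean value property of [f z * z^k], which vanishes at the origin. *)
Lemma avg_coef_neg f r k : holo_D f -> 0 < r < 1 -> (1 <= k)%nat ->
  avg (fun t => f (circ r t) * Cis (INR k * t))%C = 0%C.
Proof.
  intros Hf Hr Hk.
  assert (Hh := proj1 (holo_hdiff f) Hf). assert (Hp := pow_lt r k (proj1 Hr)).
  assert (Hg : holo_D (fun z => f z * z ^ k)%C).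
  { apply holo_hdiff. intros z Hz. apply hdiff_mult; [apply Hh, Hz | apply hdiff_pow, hdiff_id]. }
  assert (E := avg_mean _ r Hg Hr). cbv beta in E. rewrite (Cpow_0 k Hk) in E.
  rewrite (avg_ext _ (fun t => (/ r ^ k)%R * (f (circ r t) * circ r t ^ k))%C).
  - rewrite avg_scal, E; [ring|]. apply (holo_circ _ r Hg Hr).
  - intros t. rewrite circ_pow, RtoC_inv by lra. field. apply RtoC_neq0. lra.
Qed.

Lemma coef_ext_D f g k : (forall z, inD z -> f z = g z) -> coef f k = coef g k.
Proof.
  intros H. unfold coef. f_equal. apply avg_ext. intros t. rewrite H; [reflexivity|].
  unfold inD. rewrite Cmod_circ; lra.
Qed.

Lemma coef_plus f g k : holo_D f -> holo_D g -> coef (fun z => f z + g z)%C k = (coef f k + coef g k)%C.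
Proof.
  intros Hf Hg. assert (Hh : 0 < 1 / 2 < 1) by lra. unfold coef.
  rewrite (avg_ext _ (fun t => f (circ (1 / 2) t) * Cis (- INR k * t) + g (circ (1 / 2) t) * Cis (- INR k * t))%C)
    by (intros; ring).
  rewrite avg_plus; [ring | |];
    (apply cont_mult; [apply holo_circ; assumption | apply cont_Cis_lin]).
Qed.

Lemma coef_scal c f k : holo_D f -> coef (fun z => c * f z)%C k = (c * coef f k)%C.
Proof.
  intros Hf. assert (Hh : 0 < 1 / 2 < 1) by lra. unfold coef.
  rewrite (avg_ext _ (fun t => c * (f (circ (1 / 2) t) * Cis (- INR k * t)))%C)
    by (intros; ring).
  rewrite avg_scal; [ring|]. apply cont_mult; [apply holo_circ; assumption | apply cont_Cis_lin].
Qed.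

Lemma holo_const c : holo_D (fun _ => c).
Proof. apply holo_hdiff. intros z _. apply hdiff_const. Qed.

Lemma holo_id : holo_D (fun z => z).
Proof. apply holo_hdiff. intros z _. apply hdiff_id. Qed.

Lemma holo_plus f g : holo_D f -> holo_D g -> holo_D (fun z => f z + g z)%C.
Proof. rewrite !holo_hdiff. intros Hf Hg z Hz. apply hdiff_plus; auto. Qed.

Lemma holo_minus f g : holo_D f -> holo_D g -> holo_D (fun z => f z - g z)%C.
Proof. rewrite !holo_hdiff. intros Hf Hg z Hz. apply hdiff_minus; auto. Qed.

Lemma holo_opp f : holo_D f -> holo_D (fun z => - f z)%C.
Proof. rewrite !holo_hdiff. intros Hf z Hz. apply hdiff_opp; auto. Qed.

Lemma holo_mult f g : holo_D f -> holo_D g -> holo_D (fun z => f z * g z)%C.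
Proof. rewrite !holo_hdiff. intros Hf Hg z Hz. apply hdiff_mult; auto. Qed.

Lemma holo_scal c f : holo_D f -> holo_D (fun z => c * f z)%C.
Proof. intros H. apply holo_mult; [apply holo_const | exact H]. Qed.

Lemma holo_pow f n : holo_D f -> holo_D (fun z => f z ^ n)%C.
Proof. rewrite !holo_hdiff. intros Hf z Hz. apply hdiff_pow; auto. Qed.

Lemma holo_div (f g : C -> C) : (forall z, inD z -> g z <> 0%C) -> holo_D f -> holo_D g ->
  holo_D (fun z => f z / g z)%C.
Proof. rewrite !holo_hdiff. intros Hn Hf Hg z Hz. apply hdiff_div; auto. Qed.

Lemma holo_Cexp f : holo_D f -> holo_D (fun z => Cexp (f z)).
Proof. rewrite !holo_hdiff. intros Hf z Hz. apply hdiff_Cexp; auto. Qed.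

Lemma holo_comp f g : (forall z, inD z -> inD (g z)) -> holo_D f -> holo_D g -> holo_D (fun z => f (g z)).
Proof. rewrite !holo_hdiff. intros Hn Hf Hg z Hz. apply hdiff_comp; auto. Qed.

Lemma holo_sum (f : nat -> C -> C) n : (forall k, (k < n)%nat -> holo_D (f k)) ->
  holo_D (fun z => Csum (fun k => f k z) n).
Proof.
  intros H. apply holo_hdiff. intros z Hz. apply hdiff_sum. intros k Hk.
  apply holo_hdiff; auto.
Qed.

Lemma holo_ext f g : (forall z, inD z -> f z = g z) -> holo_D f -> holo_D g.
Proof.
  rewrite !holo_hdiff. intros H Hf z Hz. apply hdiff_ext_loc with f; [|apply Hf, Hz].
  destruct (Cnear_inD z Hz) as [d [Hd Hd']]. exists d. split; auto.
Qed.

Lemma coef_opp f k : holo_D f -> coef (fun z => - f z)%C k = (- coef f k)%C.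
Proof.
  intros H. rewrite (coef_ext_D _ (fun z => (-1) * f z)%C) by (intros; ring).
  rewrite coef_scal by exact H. ring.
Qed.

Lemma coef_minus f g k : holo_D f -> holo_D g -> coef (fun z => f z - g z)%C k = (coef f k - coef g k)%C.
Proof.
  intros Hf Hg. unfold Cminus. rewrite coef_plus, coef_opp; auto. apply holo_opp, Hg.
Qed.

Lemma coef_sum (f : nat -> C -> C) n k : (forall j, (j < n)%nat -> holo_D (f j)) ->
  coef (fun z => Csum (fun j => f j z) n) k = Csum (fun j => coef (f j) k) n.
Proof.
  induction n as [|n IH]; intros H; simpl.
  - unfold coef. rewrite (avg_ext _ (fun _ => 0%C)) by (intros; ring). rewrite avg_const. ring.
  - rewrite (coef_plus (fun z => Csum (fun j => f j z) n) (f n)).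
    + rewrite IH; auto with arith.
    + apply holo_sum. auto with arith.
    + apply H. lia.
Qed.

Lemma coef_shift f n k : holo_D f ->
  coef (fun z => z ^ n * f z)%C k = if le_lt_dec n k then coef f (k - n) else 0%C.
Proof.
  intros Hf. unfold coef at 1. assert (Hh : 0 < 1 / 2 < 1) by lra.
  destruct (le_lt_dec n k) as [Hnk|Hnk].
  - rewrite (avg_ext _ (fun t => ((1 / 2) ^ n)%R * (f (circ (1 / 2) t) * Cis (- INR (k - n) * t)))%C).
    + rewrite avg_scal, avg_coef by (try apply cont_mult; try apply holo_circ; try apply cont_Cis_lin; assumption).
      replace k with (n + (k - n))%nat at 1 by lia.
      set (m := (k - n)%nat). set (a := coef f m).
      replace (2 ^ (n + m) * (((1 / 2) ^ n)%R * (a * ((1 / 2) ^ m)%R)))%C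
        with (a * ((2 * (1 / 2)) ^ (n + m))%R)%C.
      * replace (2 * (1 / 2)) with 1 by field. rewrite pow1. ring.
      * rewrite Rpow_mult_distr, !RtoC_mult, (pow_add (1 / 2)), RtoC_mult, <- (RtoC_pow 2). ring.
    + intros t. rewrite circ_pow. rewrite minus_INR by exact Hnk.
      replace (- INR k * t) with (- (INR n * t) + - (INR k - INR n) * t) by ring. rewrite Cis_add, <- inv_Cis.
      field. apply Cis_neq0.
  - rewrite (avg_ext _ (fun t => ((1 / 2) ^ n)%R * (f (circ (1 / 2) t) * Cis (INR (n - k) * t)))%C).
    + rewrite avg_scal, avg_coef_neg by (try apply cont_mult; try apply holo_circ; try apply cont_Cis_lin; try lia; assumption).
      ring.
    + intros t. rewrite circ_pow. rewrite minus_INR by lia.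
      replace (- INR k * t) with (- (INR n * t) + (INR n - INR k) * t) by ring. rewrite Cis_add, <- inv_Cis.
      field. apply Cis_neq0.
Qed.

Lemma coef_0 f : holo_D f -> coef f 0 = f 0%C.
Proof.
  intros Hf. unfold coef. rewrite (avg_ext _ (fun t => f (circ (1 / 2) t))).
  - rewrite avg_mean; [simpl; ring | exact Hf | lra].
  - intros t. simpl. rewrite Ropp_0, Rmult_0_l, Cis_0. ring.
Qed.

(** The exponential of negative frequency is the conjugate of one of positive frequency, whose
    average is zero by [avg_coef_neg] for the constant function. *)
Lemma coef_const (c : C) k : (1 <= k)%nat -> coef (fun _ => c) k = 0%C.
Proof.
  intros Hk.
  assert (H := avg_coef_neg (fun _ => 1%C) (1 / 2) k (holo_const 1)). cbv beta in H.
  unfold coef. rewrite avg_scal by apply cont_Cis_lin.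
  rewrite (avg_ext _ (fun t => Cconj (1 * Cis (INR k * t))%C)).
  - rewrite avg_conj.
    + rewrite H by (lra || lia). apply C_ext; simpl; ring.
    + intros t. apply Rcont_scal, cont_Cis_lin.
  - intros t. rewrite Cmult_1_l, Cis_conj. f_equal. ring.
Qed.

Definition Cseries (a : nat -> C) (l : C) : Prop := Clim eventually (Csum a) l.

Lemma geom_finite (q : C) n : ((1 - q) * Csum (fun k => q ^ k) n)%C = (1 - q ^ n)%C.
Proof. induction n as [|n IH]; simpl; [ring|]. rewrite Cmult_plus_distr_l, IH. ring. Qed.

(** When [f z = 0], the quotient [f u / (u - z)] is removable at [z], so the average of
    [u f u / (u - z)] vanishes. Expanding [u / (u - z)] as a finite geometric sum shows that the
    partial sum of the series is minus the remainder. *)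
Lemma coef_series_zero f z : holo_D f -> inD z -> f z = 0%C ->
  Cseries (fun k => coef f k * z ^ k)%C 0%C.
Proof.
  intros Hf Hz Hfz. assert (Hh := proj1 (holo_hdiff f) Hf).
  assert (Hz0 := Cmod_ge_0 z). unfold inD in Hz.
  set (r := (1 + Cmod z) / 2). assert (Hr : Cmod z < r < 1) by (unfold r; lra).
  assert (Hr1 : 0 < r < 1) by lra.
  assert (Hden : forall t, (circ r t - z)%C <> 0%C).
  { intros t. apply mod_neq0. generalize (Cmod_triangle_rev (circ r t) z). rewrite Cmod_circ; lra. }
  assert (Havg : avg (fun t => circ r t * (f (circ r t) / (circ r t - z)))%C = 0%C).
  (* The Carathéodory slope is continuous at [z] and equals the quotient elsewhere; no further
     extension theorem is called for. *)
  { destruct (Hh z Hz) as [l [phi [Hphi [_ Hf2]]]].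
    assert (Hphi2 : forall w, w <> z -> phi w = (f w / (w - z))%C).
    { intros w Hw. assert ((w - z)%C <> 0%C).
      { intros E. apply Hw. replace w with (w - z + z)%C by ring. rewrite E. ring. }
      rewrite (Hf2 w), Hfz. field. assumption. }
    assert (Hd : forall w, inD w -> w <> z -> hdiff phi w).
    { intros w Hw Hwz. assert (Hwz' : 0 < Cmod (w - z)).
      { apply C_neq0_mod. intros E. apply Hwz. replace w with (w - z + z)%C by ring. rewrite E. ring. }
      apply hdiff_ext_loc with (fun w => f w / (w - z))%C.
      - exists (Cmod (w - z)). split; [exact Hwz'|]. intros u Hu. symmetry. apply Hphi2.
        intros E. rewrite E, Cmod_minus_sym in Hu. lra.
      - apply hdiff_div; [apply mod_neq0, Hwz' | apply Hh, Hw | apply hdiff_minus; [apply hdiff_id | apply hdiff_const]]. }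
    rewrite (avg_ext _ (fun t => (fun w => w * phi w)%C (circ r t))).
    - rewrite (avg_removable (fun w => w * phi w)%C z r); [ring | | | exact Hr1].
      + intros w Hw. destruct (excluded_middle_informative (w = z)) as [->|E].
        * apply Clim_mult; [apply Ccont_id | exact Hphi].
        * apply hdiff_cont, hdiff_mult; [apply hdiff_id | apply Hd; assumption].
      + intros w Hw _ E. apply hdiff_mult; [apply hdiff_id | apply Hd; assumption].
    - intros t. cbv beta. f_equal. symmetry. apply Hphi2. intros E. apply (Hden t). rewrite E. ring. }
  assert (Hcf := holo_circ f r Hf Hr1).
  assert (Hcz : cont2pi (fun t => / (circ r t - z))%C).
  { intros t. apply (Clim_inv (fun t => circ r t - z)%C); [apply Hden|].
    apply Clim_minus; [apply Rcont_circ | apply Clim_const]. }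
  assert (Hci : forall k, cont2pi (fun t => / circ r t ^ k)%C).
  { intros k t. apply (Clim_inv (fun t => circ r t ^ k)%C); [apply Cpow_neq0, circ_neq0; lra|].
    apply Clim_pow, Rcont_circ. }
  (* The integrand left over after [n] terms of the geometric sum, up to the factor [z^n]. *)
  set (rem := fun n t => (circ r t * (f (circ r t) / (circ r t - z)) * / circ r t ^ n)%C).
  assert (Hcrem : forall n, cont2pi (rem n)).
  { intros n. apply cont_mult; [|apply Hci]. apply cont_mult; [intros t; apply Rcont_circ|].
    apply cont_mult; assumption. }
  assert (Hsum : forall n, Csum (fun k => coef f k * z ^ k)%C n = (- (z ^ n * avg (rem n)))%C).
  { intros n.
    assert (E : avg (fun t => circ r t * (f (circ r t) / (circ r t - z)))%C =
      (Csum (fun k => coef f k * z ^ k) n + z ^ n * avg (rem n))%C).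
    - rewrite (avg_ext _ (fun t => Csum (fun k => z ^ k * (f (circ r t) * / circ r t ^ k)) n + z ^ n * rem n t)%C).
      + rewrite avg_plus, avg_sum, avg_scal.
        * f_equal. apply Csum_ext. intros k _. rewrite avg_scal.
          -- rewrite (avg_ext _ (fun t => (/ r ^ k)%R * (f (circ r t) * Cis (- INR k * t)))%C).
             ++ rewrite avg_scal, avg_coef by (try apply cont_mult; try apply cont_Cis_lin; assumption).
                rewrite RtoC_inv by (apply pow_nonzero; lra). field. apply RtoC_neq0, pow_nonzero. lra.
             ++ intros t. rewrite inv_circ_pow by lra. ring.
          -- apply cont_mult; [exact Hcf | apply Hci].
        * apply Hcrem.
        * intros k _ t. apply Rcont_scal. apply cont_mult; [exact Hcf | apply Hci].
        * apply cont2pi_sum. intros k _ t. apply Rcont_scal. apply cont_mult; [exact Hcf | apply Hci].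
        * intros t. apply Rcont_scal, Hcrem.
      + intros t. unfold rem. set (u := circ r t).
        assert (Hu : u <> 0%C) by (apply circ_neq0; lra).
        assert (Hun := Cpow_neq0 u n Hu). assert (Hd := Hden t). fold u in Hd.
        rewrite (Csum_ext _ (fun k => f u * (z / u) ^ k)%C).
        * rewrite (Csum_scal (f u) (fun k => (z / u) ^ k)%C n).
          assert (G := geom_finite (z / u) n).
          assert (Hq : ((z / u) ^ n)%C = (z ^ n / u ^ n)%C).
          { clear G. induction n as [|m IH]; [simpl; field|].
            assert (Hm := Cpow_neq0 u m Hu). simpl. rewrite IH by exact Hm. field. split; assumption. }
          rewrite Hq in G.
          assert (G2 : Csum (fun k => (z / u) ^ k)%C n = ((1 - z ^ n / u ^ n) * (u / (u - z)))%C).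
          { rewrite <- G. field. split; assumption. }
          rewrite G2. field. split; assumption.
        * intros k _. assert (Hm := Cpow_neq0 u k Hu).
          assert (Hq : ((z / u) ^ k)%C = (z ^ k / u ^ k)%C).
          { clear Hm. induction k as [|m IH]; [simpl; field|].
            simpl. rewrite IH. field. split; [apply Cpow_neq0|]; assumption. }
          rewrite Hq. field. assumption.
    - rewrite Havg in E.
      replace (Csum (fun k => coef f k * z ^ k)%C n) with
        (Csum (fun k => coef f k * z ^ k)%C n + z ^ n * avg (rem n) - z ^ n * avg (rem n))%C by ring.
      rewrite <- E. ring. }
  (* The average of [rem n] grows at most like [r^(-n)], so the remainder is of order
     [(Cmod z / r)^n]. *)
  assert (HB : exists B, forall n, Cmod (avg (rem n)) <= B * / r ^ n).
  { exists (Re (avg (fun t => RtoC (Cmod (circ r t * (f (circ r t) / (circ r t - z))))))).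
    intros n. eapply Rle_trans; [apply avg_mod, Hcrem|].
    assert (Hp := pow_lt r n (proj1 Hr1)).
    rewrite (avg_ext _ (fun t => (/ r ^ n)%R * RtoC (Cmod (circ r t * (f (circ r t) / (circ r t - z)))))%C).
    - rewrite avg_scal.
      + rewrite Re_Rmult. lra.
      + intros t. apply Rcont_mod. apply cont_mult; [intros s; apply Rcont_circ|].
        apply cont_mult; assumption.
    - intros t. unfold rem. rewrite Cmod_mult, Cmod_inv, Cmod_pow, Cmod_circ by (try lra; apply Cpow_neq0, circ_neq0; lra).
      rewrite RtoC_mult. ring. }
  destruct HB as [B HB].
  apply Clim_squeeze with (fun n => (Cmod z / r)%R ^ n * B)%C.
  - exists 0%nat. intros n _. rewrite Hsum.
    replace (- (z ^ n * avg (rem n)) - 0)%C with (- (z ^ n * avg (rem n)))%C by ring.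
    rewrite Cmod_opp, !Cmod_mult, !Cmod_pow, !Cmod_R.
    assert (Hp := pow_lt r n (proj1 Hr1)).
    rewrite (Rabs_pos_eq (Cmod z / r)) by (apply Rdiv_le_0_compat; lra).
    unfold Rdiv. rewrite Rpow_mult_distr, pow_inv, Rmult_assoc.
    apply Rmult_le_compat_l; [apply pow_le; lra|].
    eapply Rle_trans; [apply HB|]. rewrite Rmult_comm.
    apply Rmult_le_compat_l; [left; apply Rinv_0_lt_compat; lra | apply Rle_abs].
  - apply Clim_eq with (0 * B)%C; [ring|]. apply Clim_mult; [|apply Clim_const].
    apply geom_lim. rewrite Cmod_R, Rabs_pos_eq by (apply Rdiv_le_0_compat; lra).
    apply Rmult_lt_reg_r with r; [lra|]. unfold Rdiv. rewrite Rmult_assoc, Rinv_l; lra.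
Qed.

(** Subtracting the constant [f z] produces a zero at [z] and changes only the coefficient of index
    zero. *)
Lemma coef_series f z : holo_D f -> inD z -> Cseries (fun k => coef f k * z ^ k)%C (f z).
Proof.
  intros Hf Hz. set (g := fun w : C => (f w - f z)%C).
  assert (Hg : holo_D g) by (apply holo_minus; [exact Hf | apply holo_const]).
  assert (H := coef_series_zero g z Hg Hz).
  assert (H0 : g z = 0%C) by (unfold g; ring). specialize (H H0).
  apply Clim_ext_loc with (fun n => f z + Csum (fun k => coef g k * z ^ k) n)%C.
  - exists 1%nat. intros n Hn. destruct n as [|n]; [lia|].
    rewrite !Csum_S_l. rewrite (Csum_ext (fun k => coef g (S k) * z ^ S k)%C (fun k => coef f (S k) * z ^ S k)%C).
    + unfold g. rewrite coef_minus, (coef_0 (fun _ => f z)) by first [exact Hf | apply holo_const]. simpl. ring.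
    + intros k _. unfold g. rewrite coef_minus, coef_const by first [exact Hf | apply holo_const | lia]. ring.
  - apply Clim_eq with (f z + 0)%C; [ring|]. apply Clim_plus; [apply Clim_const | exact H].
Qed.

Lemma is_series_Cseries (a : nat -> C) (l : C) :
  is_series (K := C_AbsRing) (V := C_NormedModule) a l <-> Cseries a l.
Proof.
  assert (Hs : forall n, sum_n (G := C_NormedModule) a n = Csum a (S n)).
  { induction n as [|n IH].
    - rewrite sum_O. simpl. ring.
    - rewrite sum_Sn, IH. reflexivity. }
  split.
  - intros H eps He.
    (* Balls of the normed module are products of intervals; passing to [Cmod] costs a factor
       [sqrt 2]. The shift from [n] to [S n] reflects that [sum_n] includes its last index while
       [Csum] does not. *)
    assert (He2 : 0 < eps / sqrt 2) by (apply Rdiv_lt_0_compat; [lra | apply Rlt_sqrt2_0]).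
    destruct (proj1 (filterlim_locally (U := C_NormedModule) _ l) H (mkposreal _ He2)) as [N HN].
    exists (S N). intros n Hn. destruct n as [|n]; [lia|].
    assert (B := HN n ltac:(lia)). rewrite Hs in B.
    apply C_NormedModule_mixin_compat2 in B. simpl pos in B.
    replace (sqrt 2 * (eps / sqrt 2)) with eps in B by (field; generalize Rlt_sqrt2_0; lra). exact B.
  - intros H. apply (filterlim_locally (U := C_NormedModule)). intros eps.
    destruct (H eps (cond_pos eps)) as [N HN]. exists N. intros n Hn.
    rewrite Hs. apply C_NormedModule_mixin_compat1. apply HN. lia.
Qed.

Lemma taylor_coef f : holo_D f -> taylor_coeffs f (coef f).
Proof. intros Hf z Hz. apply is_series_Cseries, coef_series; assumption. Qed.

(** * Power series *)

Definition radius1 (a : nat -> C) : Prop :=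
  forall rho, 0 < rho < 1 -> exists M, forall k, Cmod (a k) * rho ^ k <= M.

(** A chosen limit: it is the sum of the series wherever that converges, in particular in the disc
    when [radius1 a] holds, and an arbitrary value elsewhere. *)
Definition pser (a : nat -> C) (z : C) : C :=
  epsilon (inhabits (RtoC 0)) (Cseries (fun k => a k * z ^ k)%C).

Lemma Rsum_geom q n : q <> 1 -> Rsum (fun k => q ^ k) n = (1 - q ^ n) / (1 - q).
Proof.
  intros Hq. induction n as [|n IH]; simpl; [field; lra|]. rewrite IH. field. lra.
Qed.

Lemma Csum_geom_bound (b : nat -> C) M q n : 0 <= q < 1 ->
  (forall k, Cmod (b k) <= M * q ^ k) -> Cmod (Csum b n) <= M / (1 - q).
Proof.
  intros Hq Hb. assert (HM : 0 <= M).
  { generalize (Hb 0%nat) (Cmod_ge_0 (b 0%nat)). simpl. lra. }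
  eapply Rle_trans; [apply Cmod_sum|].
  eapply Rle_trans; [apply Rsum_le; intros k _; apply Hb|].
  rewrite Rsum_scal, Rsum_geom by lra. unfold Rdiv. rewrite <- Rmult_assoc.
  apply Rmult_le_compat_r; [left; apply Rinv_0_lt_compat; lra|].
  assert (0 <= q ^ n) by (apply pow_le; lra). nra.
Qed.

Lemma Cseries_ex (b : nat -> C) M q : 0 <= q < 1 ->
  (forall k, Cmod (b k) <= M * q ^ k) -> exists l, Cseries b l.
Proof.
  intros Hq Hb.
  destruct (ex_series_le (K := C_AbsRing) (V := C_CompleteNormedModule) b (fun k => M * q ^ k)) as [l Hl].
  - intros k. exact (Hb k).
  - apply (ex_series_scal_l M (fun k => q ^ k)). apply ex_series_geom. rewrite Rabs_pos_eq; lra.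
  - exists l. apply is_series_Cseries. exact Hl.
Qed.

Lemma Cseries_unique b l m : Cseries b l -> Cseries b m -> l = m.
Proof. apply Clim_unique. Qed.

Lemma Clim_shift (u : nat -> C) l n : Clim eventually u l -> Clim eventually (fun k => u (n + k)%nat) l.
Proof. intros H eps He. destruct (H eps He) as [N HN]. exists N. intros k Hk. apply HN. lia. Qed.

Lemma Clim_unshift (u : nat -> C) l n : Clim eventually (fun k => u (n + k)%nat) l -> Clim eventually u l.
Proof.
  intros H eps He. destruct (H eps He) as [N HN]. exists (n + N)%nat. intros k Hk.
  replace k with (n + (k - n))%nat by lia. apply HN. lia.
Qed.

Lemma Cseries_shift b l n : Cseries b l <-> Cseries (fun k => b (n + k)%nat) (l - Csum b n)%C.
Proof.
  split; intros H.
  - apply Clim_ext with (fun k => Csum b (n + k) - Csum b n)%C; [intros k; rewrite Csum_add; ring|].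
    apply Clim_minus; [apply (Clim_shift _ _ _ H) | apply Clim_const].
  - apply (Clim_unshift _ _ n). apply Clim_ext with (fun k => Csum b n + Csum (fun k => b (n + k)%nat) k)%C.
    + intros k. rewrite Csum_add. reflexivity.
    + apply Clim_eq with (Csum b n + (l - Csum b n))%C; [ring|].
      apply Clim_plus; [apply Clim_const | exact H].
Qed.

Lemma Cseries_tail b l M q n : 0 <= q < 1 -> (forall k, Cmod (b k) <= M * q ^ k) -> Cseries b l ->
  Cmod (l - Csum b n) <= M * q ^ n / (1 - q).
Proof.
  intros Hq Hb Hl. apply (proj1 (Cseries_shift b l n)) in Hl.
  apply (Clim_mod_le _ _ _ Hl). apply filter_forall. intros m.
  apply Csum_geom_bound; [exact Hq|]. intros k. rewrite Rmult_assoc, <- pow_add. apply Hb.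
Qed.

Lemma Cseries_ext a b l : (forall k, a k = b k) -> Cseries a l -> Cseries b l.
Proof.
  intros H. apply Clim_ext. intros n. apply Csum_ext. intros k _. apply H.
Qed.

Lemma term_bound a z rho M : 0 < rho -> (forall k, Cmod (a k) * rho ^ k <= M) ->
  forall k, Cmod (a k * z ^ k)%C <= M * (Cmod z / rho) ^ k.
Proof.
  intros Hr HM k. rewrite Cmod_mult, Cmod_pow. unfold Rdiv. rewrite Rpow_mult_distr, pow_inv.
  assert (Hp := pow_lt rho k Hr). assert (Hz := pow_le (Cmod z) k (Cmod_ge_0 z)).
  apply Rle_trans with ((Cmod (a k) * rho ^ k) * (Cmod z ^ k * / rho ^ k)).
  - right. field. lra.
  - apply Rmult_le_compat_r; [|apply HM].
    apply Rmult_le_pos; [exact Hz | left; apply Rinv_0_lt_compat, Hp].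
Qed.

Lemma ratio_lt z rho : Cmod z < rho -> 0 <= Cmod z / rho < 1.
Proof.
  intros H. assert (H0 := Cmod_ge_0 z). split; [apply Rdiv_le_0_compat; lra|].
  apply Rmult_lt_reg_r with rho; [lra|]. unfold Rdiv. rewrite Rmult_assoc, Rinv_l; lra.
Qed.

Lemma pser_spec a z : radius1 a -> inD z -> Cseries (fun k => a k * z ^ k)%C (pser a z).
Proof.
  intros Ha Hz. unfold pser. apply epsilon_spec. unfold inD in Hz. assert (H0 := Cmod_ge_0 z).
  set (rho := (1 + Cmod z) / 2). assert (Hr : Cmod z < rho < 1) by (unfold rho; lra).
  destruct (Ha rho) as [M HM]; [lra|].
  apply Cseries_ex with M (Cmod z / rho); [apply ratio_lt; lra|].
  apply term_bound; [lra | exact HM].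
Qed.

(** Bernoulli's inequality for [1 + h = / q]. *)
Lemma mult_pow_bound q k : 0 < q < 1 -> INR k * q ^ k <= / (/ q - 1).
Proof.
  intros Hq. assert (Hi : 1 < / q) by (rewrite <- Rinv_1; apply Rinv_lt_contravar; lra).
  set (h := / q - 1). assert (Hh : 0 < h) by (unfold h; lra).
  assert (B := poly k h Hh). replace (1 + h) with (/ q) in B by (unfold h; ring).
  rewrite pow_inv in B. assert (Hp := pow_lt q k (proj1 Hq)).
  apply Rmult_le_reg_r with h; [exact Hh|]. rewrite Rinv_l by lra.
  apply (Rmult_le_compat_r (q ^ k)) in B; [|lra]. rewrite Rinv_l in B by lra. nra.
Qed.

Lemma radius1_mult_k a : radius1 a -> radius1 (fun k => INR k * a k)%C.
Proof.
  intros Ha rho Hr. set (s := (1 + rho) / 2). assert (Hs : rho < s < 1) by (unfold s; lra).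
  destruct (Ha s) as [M HM]; [lra|].
  assert (Hq : 0 < rho / s < 1).
  { split; [apply Rdiv_lt_0_compat; lra|]. apply Rmult_lt_reg_r with s; [lra|].
    unfold Rdiv. rewrite Rmult_assoc, Rinv_l; lra. }
  exists (M * / (/ (rho / s) - 1)). intros k.
  rewrite Cmod_mult, Cmod_R, Rabs_pos_eq by apply pos_INR.
  assert (B := mult_pow_bound (rho / s) k Hq).
  replace (INR k * Cmod (a k) * rho ^ k) with ((Cmod (a k) * s ^ k) * (INR k * (rho / s) ^ k)).
  - apply Rmult_le_compat; [| |apply HM|exact B].
    + apply Rmult_le_pos; [apply Cmod_ge_0 | apply pow_le; lra].
    + apply Rmult_le_pos; [apply pos_INR | apply pow_le; lra].
  - unfold Rdiv. rewrite Rpow_mult_distr, pow_inv. field. apply pow_nonzero. lra.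
Qed.

Lemma radius1_shift a n : radius1 a -> radius1 (fun k => a (n + k)%nat).
Proof.
  intros Ha rho Hr. destruct (Ha rho Hr) as [M HM]. exists (M * / rho ^ n). intros k.
  specialize (HM (n + k)%nat). rewrite pow_add in HM. assert (Hp := pow_lt rho n (proj1 Hr)).
  apply Rmult_le_reg_r with (rho ^ n); [exact Hp|].
  rewrite (Rmult_assoc M), Rinv_l, Rmult_1_r by lra.
  eapply Rle_trans; [right|exact HM]. ring.
Qed.

Definition dser (a : nat -> C) (k : nat) : C := (INR (S k) * a (S k))%C.

Lemma radius1_dser a : radius1 a -> radius1 (dser a).
Proof. intros H. apply (radius1_shift (fun k => INR k * a k)%C 1), radius1_mult_k, H. Qed.

(** The second-order Taylor remainder of a power, by induction on the exponent. The factor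
    [rho * rho] stands on the left because dividing by it would ask for a negative exponent in the
    first case. *)
Lemma pow_taylor2 (z w : C) rho k : 0 < rho -> Cmod z <= rho -> Cmod w <= rho ->
  rho * rho * Cmod (w ^ S k - z ^ S k - INR (S k) * z ^ k * (w - z))
    <= INR (S k) * INR (S k) * rho ^ S k * (Cmod (w - z) * Cmod (w - z)).
Proof.
  intros Hr Hz Hw. induction k as [|k IH].
  - replace (w ^ 1 - z ^ 1 - INR 1 * z ^ 0 * (w - z))%C with (RtoC 0) by (simpl; ring).
    rewrite Cmod_0. assert (0 <= Cmod (w - z)) by apply Cmod_ge_0. simpl.
    rewrite Rmult_0_r. repeat apply Rmult_le_pos; lra.
  - replace (w ^ S (S k) - z ^ S (S k) - INR (S (S k)) * z ^ S k * (w - z))%C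
      with (w * (w ^ S k - z ^ S k - INR (S k) * z ^ k * (w - z))
            + INR (S k) * z ^ k * ((w - z) * (w - z)))%C.
    + set (D := (w ^ S k - z ^ S k - INR (S k) * z ^ k * (w - z))%C) in *.
      set (d := Cmod (w - z)) in *. assert (Hd : 0 <= d) by apply Cmod_ge_0.
      apply Rle_trans with (rho * rho * (rho * Cmod D + INR (S k) * rho ^ k * (d * d))).
      * apply Rmult_le_compat_l; [nra|]. eapply Rle_trans; [apply Cmod_triangle|].
        apply Rplus_le_compat.
        -- rewrite Cmod_mult. apply Rmult_le_compat_r; [apply Cmod_ge_0 | exact Hw].
        -- rewrite !Cmod_mult, Cmod_pow, Cmod_R, Rabs_pos_eq by apply pos_INR.
           fold d. apply Rmult_le_compat_r; [nra|]. apply Rmult_le_compat_l; [apply pos_INR|].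
           apply pow_incr. split; [apply Cmod_ge_0 | exact Hz].
      * assert (HD := Cmod_ge_0 D). rewrite (S_INR (S k)). set (m := INR (S k)) in *.
        assert (Hm : 0 <= m) by apply pos_INR.
        assert (Hp : 0 <= rho ^ k) by (apply pow_le; lra).
        simpl (rho ^ S k) in IH. simpl (rho ^ S (S k)).
        apply Rle_trans with (rho * (m * m * (rho * rho ^ k) * (d * d)) + m * (rho * (rho * rho ^ k)) * (d * d)).
        -- replace (rho * rho * (rho * Cmod D + m * rho ^ k * (d * d)))
             with (rho * (rho * rho * Cmod D) + m * (rho * (rho * rho ^ k)) * (d * d)) by ring.
           apply Rplus_le_compat_r, Rmult_le_compat_l; [lra | exact IH].
        -- replace (rho * (m * m * (rho * rho ^ k) * (d * d)) + m * (rho * (rho * rho ^ k)) * (d * d))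
             with ((m * m + m) * ((rho * (rho * rho ^ k)) * (d * d))) by ring.
           replace ((m + 1) * (m + 1) * (rho * (rho * rho ^ k)) * (d * d))
             with ((m + 1) * (m + 1) * ((rho * (rho * rho ^ k)) * (d * d))) by ring.
           apply Rmult_le_compat_r; [repeat apply Rmult_le_pos; lra | nra].
    + rewrite (S_INR (S k)), RtoC_plus. simpl. ring.
Qed.

(** Summing the Taylor remainders of the single powers bounds the error by [K * Cmod (w - z)^2] near
    [z]. *)
Lemma cdiff_pser a z : radius1 a -> inD z -> cdiff (pser a) z (pser (dser a) z).
Proof.
  intros Ha Hz. assert (Hz' := Hz). unfold inD in Hz'. assert (H0 := Cmod_ge_0 z).
  set (rho := (1 + Cmod z) / 2). assert (Hr : Cmod z < rho < 1) by (unfold rho; lra).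
  set (s := (1 + rho) / 2). assert (Hs : rho < s < 1) by (unfold s; lra).
  (* Two multiplications by the index supply the factor [k^2] of [pow_taylor2]; the larger radius
     [s] turns the bound into a geometric one with ratio [rho / s]. *)
  destruct (radius1_mult_k _ (radius1_mult_k _ Ha) s) as [M HM]; [lra|].
  assert (Hq : 0 <= rho / s < 1).
  { split; [apply Rdiv_le_0_compat; lra|]. apply Rmult_lt_reg_r with s; [lra|].
    unfold Rdiv. rewrite Rmult_assoc, Rinv_l; lra. }
  set (q := rho / s) in *.
  assert (HMk : forall k, INR k * INR k * Cmod (a k) * rho ^ k <= M * q ^ k).
  { intros k. specialize (HM k). rewrite !Cmod_mult, !Cmod_R, !Rabs_pos_eq in HM by apply pos_INR.
    unfold q, Rdiv. rewrite Rpow_mult_distr, pow_inv. assert (Hp : 0 < s ^ k) by (apply pow_lt; lra).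
    assert (Hpr : 0 < rho ^ k) by (apply pow_lt; lra).
    apply Rmult_le_reg_r with (s ^ k); [exact Hp|].
    replace (M * (rho ^ k * / s ^ k) * s ^ k) with (M * rho ^ k) by (field; lra).
    replace (INR k * INR k * Cmod (a k) * rho ^ k * s ^ k) with ((INR k * (INR k * Cmod (a k)) * s ^ k) * rho ^ k) by ring.
    apply Rmult_le_compat_r; lra. }
  set (K := M / (rho * rho) / (1 - q)).
  assert (HM0 : 0 <= M) by (specialize (HMk 0%nat); simpl in HMk; lra).
  assert (HK : 0 <= K).
  { unfold K. apply Rdiv_le_0_compat; [|lra]. apply Rdiv_le_0_compat; nra. }
  assert (Hmain : forall w, Cmod w < rho ->
    Cmod (pser a w - pser a z - pser (dser a) z * (w - z)) <= K * (Cmod (w - z) * Cmod (w - z))).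
  { intros w Hw.
    assert (Hwz : inD w) by (unfold inD; lra).
    set (b := fun k => match k with O => RtoC 0 | S j => (a (S j) * (w ^ S j - z ^ S j - INR (S j) * z ^ j * (w - z)))%C end).
    assert (Hb : Cseries b (pser a w - pser a z - pser (dser a) z * (w - z))%C).
    { assert (S1 := pser_spec a w Ha Hwz). assert (S2 := pser_spec a z Ha Hz).
      assert (S3 := pser_spec (dser a) z (radius1_dser a Ha) Hz).
      apply (Clim_unshift _ _ 1).
      apply Clim_ext with (fun k => Csum (fun k => a k * w ^ k) (1 + k) - Csum (fun k => a k * z ^ k) (1 + k)
        - Csum (fun k => dser a k * z ^ k) k * (w - z))%C.
      - intros k. simpl (1 + k)%nat. induction k as [|k IH]; [simpl; ring|].
        change (Csum b (S (S k))) with (Csum b (S k) + b (S k))%C. rewrite <- IH.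
        change (Csum (fun k0 => a k0 * w ^ k0) (S (S k)))%C with (Csum (fun k0 => a k0 * w ^ k0) (S k) + a (S k) * w ^ S k)%C.
        change (Csum (fun k0 => a k0 * z ^ k0) (S (S k)))%C with (Csum (fun k0 => a k0 * z ^ k0) (S k) + a (S k) * z ^ S k)%C.
        change (Csum (fun k0 => dser a k0 * z ^ k0) (S k))%C with (Csum (fun k0 => dser a k0 * z ^ k0) k + dser a k * z ^ k)%C.
        unfold b, dser. ring.
      - apply Clim_minus; [apply Clim_minus|].
        + apply (Clim_shift _ _ 1 S1).
        + apply (Clim_shift _ _ 1 S2).
        + apply Clim_mult; [exact S3 | apply Clim_const]. }
    assert (Hd := Cmod_ge_0 (w - z)).
    assert (Hbk : forall k, Cmod (b k) <= (M / (rho * rho) * (Cmod (w - z) * Cmod (w - z))) * q ^ k).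
    { intros [|j].
      - simpl. rewrite Cmod_0. apply Rmult_le_pos; [|lra]. apply Rmult_le_pos; [|nra].
        apply Rdiv_le_0_compat; nra.
      - unfold b. rewrite Cmod_mult.
        assert (P := pow_taylor2 z w rho j ltac:(lra) ltac:(lra) ltac:(lra)).
        assert (Ham := Cmod_ge_0 (a (S j))).
        set (D := Cmod (w ^ S j - z ^ S j - INR (S j) * z ^ j * (w - z))) in *.
        apply Rmult_le_reg_l with (rho * rho); [nra|].
        replace (rho * rho * (M / (rho * rho) * (Cmod (w - z) * Cmod (w - z)) * q ^ S j))
          with (M * q ^ S j * (Cmod (w - z) * Cmod (w - z))) by (field; lra).
        apply Rle_trans with (Cmod (a (S j)) * (INR (S j) * INR (S j) * rho ^ S j * (Cmod (w - z) * Cmod (w - z)))).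
        + replace (rho * rho * (Cmod (a (S j)) * D)) with (Cmod (a (S j)) * (rho * rho * D)) by ring.
          apply Rmult_le_compat_l; assumption.
        + replace (Cmod (a (S j)) * (INR (S j) * INR (S j) * rho ^ S j * (Cmod (w - z) * Cmod (w - z))))
            with ((INR (S j) * INR (S j) * Cmod (a (S j)) * rho ^ S j) * (Cmod (w - z) * Cmod (w - z))) by ring.
          apply Rmult_le_compat_r; [nra | apply HMk]. }
    assert (T := Cseries_tail _ _ _ q 0 Hq Hbk Hb). simpl in T.
    replace (pser a w - pser a z - pser (dser a) z * (w - z) - 0)%C
      with (pser a w - pser a z - pser (dser a) z * (w - z))%C in T by ring.
    eapply Rle_trans; [exact T|]. right. unfold K. field. split; lra. }
  apply cdiff_eps. intros eps He.
  exists (Rmin (rho - Cmod z) (eps / (K + 1))). split.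
  - apply Rmin_pos; [lra | apply Rdiv_lt_0_compat; lra].
  - intros w Hw.
    assert (W1 : Cmod (w - z) < rho - Cmod z) by (eapply Rlt_le_trans; [exact Hw | apply Rmin_l]).
    assert (W2 : Cmod (w - z) < eps / (K + 1)) by (eapply Rlt_le_trans; [exact Hw | apply Rmin_r]).
    eapply Rle_trans; [apply Hmain; generalize (Cmod_triangle_rev w z); lra|].
    assert (Hd := Cmod_ge_0 (w - z)).
    rewrite <- Rmult_assoc. apply Rmult_le_compat_r; [exact Hd|].
    apply (Rmult_lt_compat_r (K + 1)) in W2; [|lra].
    replace (eps / (K + 1) * (K + 1)) with eps in W2 by (field; lra). nra.
Qed.

Lemma holo_pser a : radius1 a -> holo_D (pser a).
Proof. intros Ha. apply holo_hdiff. intros z Hz. eexists. apply cdiff_pser; assumption. Qed.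

Lemma coef_bound f r M k : holo_D f -> 0 < r < 1 -> (forall z, Cmod z = r -> Cmod (f z) <= M) ->
  Cmod (coef f k) * r ^ k <= M.
Proof.
  intros Hf Hr HM. rewrite <- (Rabs_pos_eq (r ^ k)) by (apply pow_le; lra).
  rewrite <- Cmod_R, <- Cmod_mult, <- avg_coef by assumption.
  apply avg_bound.
  - apply cont_mult; [apply holo_circ; assumption | apply cont_Cis_lin].
  - intros t. rewrite Cmod_mult, Cmod_Cis, Rmult_1_r. apply HM, Cmod_circ. lra.
Qed.

Lemma radius1_coef f : holo_D f -> radius1 (coef f).
Proof.
  intros Hf rho Hr. exists (Re (avg (fun t => RtoC (Cmod (f (circ rho t)))))). intros k.
  rewrite <- (Rabs_pos_eq (rho ^ k)) by (apply pow_le; lra).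
  rewrite <- Cmod_R, <- Cmod_mult, <- avg_coef by assumption.
  eapply Rle_trans; [apply avg_mod; apply cont_mult; [apply holo_circ; assumption | apply cont_Cis_lin]|].
  right. f_equal. apply avg_ext. intros t. rewrite Cmod_mult, Cmod_Cis, Rmult_1_r. reflexivity.
Qed.

Lemma holo_pser_eq f z : holo_D f -> inD z -> f z = pser (coef f) z.
Proof.
  intros Hf Hz. apply (Cseries_unique (fun k => coef f k * z ^ k)%C).
  - apply coef_series; assumption.
  - apply pser_spec; [apply radius1_coef, Hf | exact Hz].
Qed.

Lemma coef_monomial c j k : coef (fun z => c * z ^ j)%C k = if Nat.eq_dec j k then c else 0%C.
Proof.
  rewrite (coef_ext_D _ (fun z => z ^ j * c)%C) by (intros; ring).
  rewrite (coef_shift (fun _ => c)) by apply holo_const.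
  destruct (le_lt_dec j k), (Nat.eq_dec j k); try lia; try reflexivity.
  - replace (k - j)%nat with 0%nat by lia. apply coef_0, holo_const.
  - apply coef_const. lia.
Qed.

Lemma holo_poly c n : holo_D (fun z => Csum (fun k => c k * z ^ k)%C n).
Proof. apply (holo_sum (fun k z => c k * z ^ k)%C). intros k _. apply holo_scal, holo_pow, holo_id. Qed.

Lemma coef_poly c n k : coef (fun z => Csum (fun k => c k * z ^ k)%C n) k = if lt_dec k n then c k else 0%C.
Proof.
  rewrite (coef_sum (fun k z => c k * z ^ k)%C) by (intros; apply holo_scal, holo_pow, holo_id).
  destruct (lt_dec k n) as [H|H].
  - rewrite (Csum_single _ n k H).
    + rewrite coef_monomial. destruct Nat.eq_dec; [reflexivity | lia].
    + intros j _ Hj. rewrite coef_monomial. destruct Nat.eq_dec; [lia | reflexivity].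
  - apply Csum_0. intros j Hj. rewrite coef_monomial. destruct Nat.eq_dec; [lia | reflexivity].
Qed.

(** A term is the difference of two consecutive partial sums, hence bounded once these are within
    one of the limit; the finitely many earlier terms are added to the bound. *)
Lemma radius1_of_series (a : nat -> C) :
  (forall z, inD z -> exists l, Cseries (fun k => a k * z ^ k)%C l) -> radius1 a.
Proof.
  intros H rho Hr.
  destruct (H (RtoC rho)) as [l Hl]; [unfold inD; rewrite Cmod_R, Rabs_pos_eq; lra|].
  destruct (Hl 1 Rlt_0_1) as [N HN].
  exists (Rsum (fun k => Cmod (a k) * rho ^ k) N + 2). intros k.
  assert (Hnn : forall k, 0 <= Cmod (a k) * rho ^ k)
    by (intros j; apply Rmult_le_pos; [apply Cmod_ge_0 | apply pow_le; lra]).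
  destruct (lt_dec k N) as [Hk|Hk].
  - assert (T := Rsum_term (fun k => Cmod (a k) * rho ^ k) N k (fun j _ => Hnn j) Hk). simpl in T. lra.
  - assert (H1 := HN k ltac:(lia)). assert (H2 := HN (S k) ltac:(lia)). simpl in H2.
    assert (Hp := Rsum_ge_0 (fun k => Cmod (a k) * rho ^ k) N (fun j _ => Hnn j)).
    replace (Cmod (a k) * rho ^ k) with (Cmod (a k * RtoC rho ^ k)%C)
      by (rewrite Cmod_mult, Cmod_pow, Cmod_R, Rabs_pos_eq; lra).
    set (u := Csum _ k) in *. set (v := (a k * RtoC rho ^ k)%C) in *.
    assert (T := Cmod_triangle (u + v - l) (- (u - l))). rewrite Cmod_opp in T.
    replace (u + v - l + - (u - l))%C with v in T by ring. lra.
Qed.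

(** The Cauchy estimate on radius [1 / 2], applied to [f] minus a long partial sum, bounds the
    discrepancy of the [k]-th coefficients by a quantity tending to zero. *)
Lemma coef_unique f a k : holo_D f -> (forall z, inD z -> Cseries (fun k => a k * z ^ k)%C (f z)) ->
  a k = coef f k.
Proof.
  intros Hf Ha.
  assert (Hra : radius1 a) by (apply radius1_of_series; intros z Hz; exists (f z); auto).
  (* Boundedness at [3 / 4] gives, on the circle of radius [1 / 2], a geometric tail of ratio
     [2 / 3], whence the factor [3] below. *)
  destruct (Hra (3 / 4)) as [M HM]; [lra|].
  assert (Hq : 0 <= 2 / 3 < 1) by lra.
  assert (HM0 : 0 <= M) by (generalize (HM 0%nat) (Cmod_ge_0 (a 0%nat)); simpl; lra).
  assert (B : forall n, (k < n)%nat -> Cmod (coef f k - a k) * (1 / 2) ^ k <= (2 / 3) ^ n * (3 * M)).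
  { intros n Hn.
    set (S := fun z => Csum (fun k => a k * z ^ k)%C n).
    assert (HS : holo_D S) by apply holo_poly.
    assert (E : (coef f k - a k)%C = coef (fun z => f z - S z)%C k).
    { rewrite coef_minus by assumption. unfold S. rewrite coef_poly.
      destruct (lt_dec k n); [reflexivity | lia]. }
    rewrite E. apply coef_bound; [apply holo_minus; assumption | lra|].
    intros z Hz.
    assert (T := Cseries_tail (fun k => a k * z ^ k)%C (f z) M (2 / 3) n Hq).
    eapply Rle_trans; [apply T|].
    - intros j. assert (TB := term_bound a z (3 / 4) M ltac:(lra) HM j).
      rewrite Hz in TB. replace (1 / 2 / (3 / 4)) with (2 / 3) in TB by field. exact TB.
    - apply Ha. unfold inD. lra.
    - right. field. }
  assert (L : Clim eventually (fun n => (2 / 3)%R ^ n * (3 * M)%R)%C 0%C).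
  { apply Clim_eq with (0 * (3 * M)%R)%C; [ring|]. apply Clim_mult; [|apply Clim_const].
    apply geom_lim. rewrite Cmod_R, Rabs_pos_eq; lra. }
  assert (L2 : Cmod (coef f k - a k) * (1 / 2) ^ k <= 0).
  { rewrite <- (Re_R 0). apply (Clim_Re_ge _ _ _ L). exists (S k). intros n Hn.
    rewrite <- RtoC_pow, <- RtoC_mult, Re_R. apply B. lia. }
  assert (Hp : 0 < (1 / 2) ^ k) by (apply pow_lt; lra).
  assert (Hc : Cmod (coef f k - a k) = 0).
  { assert (H0 := Cmod_ge_0 (coef f k - a k)). nra. }
  apply Cmod_eq_0 in Hc. replace (a k) with (coef f k - (coef f k - a k))%C by ring. rewrite Hc. ring.
Qed.

Lemma taylor_unique f a k : holo_D f -> taylor_coeffs f a -> a k = coef f k.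
Proof. intros Hf Ha. apply coef_unique; [exact Hf|]. intros z Hz. apply is_series_Cseries, Ha, Hz. Qed.

Lemma coef_inj f g z : holo_D f -> holo_D g -> (forall k, coef f k = coef g k) -> inD z -> f z = g z.
Proof.
  intros Hf Hg H Hz. rewrite (holo_pser_eq f z), (holo_pser_eq g z) by assumption.
  f_equal. apply functional_extensionality, H.
Qed.

Lemma coef_pser a k : radius1 a -> coef (pser a) k = a k.
Proof. intros Ha. symmetry. apply coef_unique; [apply holo_pser, Ha | intros z Hz; apply pser_spec; assumption]. Qed.

Lemma taylor_remainder f n : holo_D f -> exists g, holo_D g /\
  (forall z, inD z -> f z = (Csum (fun k => coef f k * z ^ k) n + z ^ n * g z)%C) /\
  (forall k, coef g k = coef f (n + k)).
Proof.
  intros Hf. assert (Hr := radius1_shift _ n (radius1_coef f Hf)).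
  exists (pser (fun k => coef f (n + k))). split; [apply holo_pser, Hr|]. split.
  - intros z Hz. apply (Cseries_unique (fun k => coef f k * z ^ k)%C); [apply coef_series; assumption|].
    apply (Cseries_shift _ _ n).
    apply Clim_ext with (fun m => z ^ n * Csum (fun k => coef f (n + k) * z ^ k) m)%C.
    + intros m. rewrite <- Csum_scal. apply Csum_ext. intros k _. rewrite Cpow_add. ring.
    + apply Clim_eq with (z ^ n * pser (fun k => coef f (n + k)) z)%C; [ring|].
      apply Clim_scal. apply pser_spec; assumption.
  - intros k. apply (coef_pser (fun k => coef f (n + k))), Hr.
Qed.

(** Replacing [f] by its Taylor polynomial of degree [n] alters the product only by a multiple of
    [z^(n+1)]. *)
Lemma coef_mult f g n : holo_D f -> holo_D g ->
  coef (fun z => f z * g z)%C n = Csum (fun k => coef f k * coef g (n - k))%C (S n).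
Proof.
  intros Hf Hg. destruct (taylor_remainder f (S n) Hf) as [h [Hh [Ef _]]].
  assert (Hj : forall j, holo_D (fun z => coef f j * (z ^ j * g z))%C)
    by (intros; apply holo_scal, holo_mult; [apply holo_pow, holo_id | exact Hg]).
  rewrite (coef_ext_D _ (fun z => Csum (fun k => coef f k * (z ^ k * g z)) (S n) + z ^ S n * (h z * g z))%C).
  - rewrite coef_plus, (coef_sum (fun k z => coef f k * (z ^ k * g z))%C), (coef_shift (fun z => h z * g z)%C).
    + destruct (le_lt_dec (S n) n); [lia|].
      match goal with |- (?a + _)%C = _ => transitivity a; [ring|] end.
      apply Csum_ext. intros k Hk. rewrite coef_scal, coef_shift; auto.
      * destruct (le_lt_dec k n); [reflexivity | lia].
      * apply holo_mult; [apply holo_pow, holo_id | exact Hg].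
    + apply holo_mult; assumption.
    + intros j _. apply Hj.
    + apply (holo_sum (fun k z => coef f k * (z ^ k * g z))%C). intros; apply Hj.
    + apply holo_mult; [apply holo_pow, holo_id | apply holo_mult; assumption].
  - intros z Hz. rewrite (Ef z Hz) at 1.
    rewrite (Csum_ext (fun k => coef f k * (z ^ k * g z))%C (fun k => g z * (coef f k * z ^ k))%C) by (intros; ring).
    rewrite Csum_scal. ring.
Qed.

Definition deriv_D (f : C -> C) : C -> C := pser (dser (coef f)).

Lemma cdiff_deriv_D f z : holo_D f -> inD z -> cdiff f z (deriv_D f z).
Proof.
  intros Hf Hz. apply cdiff_ext_loc with (pser (coef f)).
  - destruct (Cnear_inD z Hz) as [d [Hd H]]. exists d. split; [exact Hd|].
    intros w Hw. symmetry. apply holo_pser_eq; auto.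
  - apply cdiff_pser; [apply radius1_coef, Hf | exact Hz].
Qed.

Lemma holo_deriv_D f : holo_D f -> holo_D (deriv_D f).
Proof. intros Hf. apply holo_pser, radius1_dser, radius1_coef, Hf. Qed.

Lemma coef_deriv_D f k : holo_D f -> coef (deriv_D f) k = (INR (S k) * coef f (S k))%C.
Proof. intros Hf. apply (coef_pser (dser (coef f))), radius1_dser, radius1_coef, Hf. Qed.

Lemma deriv_D_eq f z l : holo_D f -> inD z -> cdiff f z l -> deriv_D f z = l.
Proof. intros Hf Hz H. eapply cdiff_unique; [apply cdiff_deriv_D; assumption | exact H]. Qed.

Lemma coef_const_fun f : holo_D f -> (forall k, coef f (S k) = 0%C) -> forall z, inD z -> f z = f 0%C.
Proof.
  intros Hf H z Hz. apply (coef_inj f (fun _ => f 0%C)); [exact Hf | apply holo_const | | exact Hz].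
  intros [|k].
  - rewrite !coef_0; [reflexivity | apply holo_const | exact Hf].
  - rewrite H, coef_const; [reflexivity | lia].
Qed.

Lemma deriv_0_const f : holo_D f -> (forall z, inD z -> cdiff f z 0%C) -> forall z, inD z -> f z = f 0%C.
Proof.
  intros Hf H. apply coef_const_fun; [exact Hf|]. intros k.
  assert (E : coef (deriv_D f) k = 0%C).
  { rewrite (coef_ext_D _ (fun _ => RtoC 0)).
    - destruct k; [apply coef_0, holo_const | apply coef_const; lia].
    - intros z Hz. apply deriv_D_eq; auto. }
  rewrite coef_deriv_D in E by exact Hf.
  assert (Hn : RtoC (INR (S k)) <> 0%C) by (apply RtoC_neq0, not_0_INR; lia).
  replace (coef f (S k)) with (INR (S k) * coef f (S k) / INR (S k))%C by (field; exact Hn).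
  rewrite E. field. exact Hn.
Qed.

(** Take for [h] a primitive of [- f' / f], built by integrating its Taylor series; then
    [f * Cexp h] has zero derivative. *)
Lemma holo_log f : holo_D f -> (forall z, inD z -> f z <> 0%C) ->
  exists h, holo_D h /\ forall z, inD z -> f z = Cexp (- h z).
Proof.
  intros Hf Hn.
  assert (H0 : inD 0) by (unfold inD; rewrite Cmod_0; lra).
  destruct (Cexp_surj (f 0%C) (Hn _ H0)) as [w Hw].
  set (q := fun z => (- deriv_D f z / f z)%C).
  assert (Hq : holo_D q) by (apply holo_div; [exact Hn | apply holo_opp, holo_deriv_D, Hf | exact Hf]).
  (* The constant term [- w] is chosen so that [Cexp (- h 0)] equals [f 0]. *)
  set (c := fun k => match k with O => (- w)%C | S j => (coef q j / INR (S j))%C end).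
  assert (Hdc : forall k, dser c k = coef q k).
  { intros k. unfold dser, c. field. apply RtoC_neq0, not_0_INR. lia. }
  assert (Hc : radius1 c).
  { intros rho Hr. destruct (radius1_coef q Hq rho Hr) as [M HM]. exists (M + Cmod w).
    assert (HM0 : 0 <= M) by (generalize (HM 0%nat) (Cmod_ge_0 (coef q 0)); simpl; lra).
    intros [|k]; unfold c.
    - rewrite Cmod_opp. simpl. lra.
    - assert (Hi : 1 <= INR (S k)) by (rewrite S_INR; generalize (pos_INR k); lra).
      rewrite Cmod_div by (apply RtoC_neq0; lra). rewrite Cmod_R, Rabs_pos_eq by lra.
      assert (Hw0 := Cmod_ge_0 w). specialize (HM k).
      assert (Hp : 0 <= rho ^ k) by (apply pow_le; lra). assert (Hcq := Cmod_ge_0 (coef q k)).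
      assert (Hdiv : 0 <= Cmod (coef q k) / INR (S k) <= Cmod (coef q k)).
      { split; [apply Rdiv_le_0_compat; lra|]. apply Rmult_le_reg_r with (INR (S k)); [lra|].
        unfold Rdiv. rewrite Rmult_assoc, Rinv_l by lra. apply Rmult_le_compat_l; lra. }
      apply Rle_trans with (Cmod (coef q k) * rho ^ k); [|lra].
      simpl (rho ^ S k). set (m := INR (S k)) in *.
      apply Rmult_le_compat; [lra | apply Rmult_le_pos; lra | lra |].
      rewrite <- (Rmult_1_l (rho ^ k)) at 2. apply Rmult_le_compat_r; lra. }
  set (h := pser c). assert (Hh : holo_D h) by (apply holo_pser, Hc).
  assert (Hh0 : h 0%C = (- w)%C) by (rewrite <- coef_0 by exact Hh; unfold h; rewrite coef_pser by exact Hc; reflexivity).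
  assert (Hdh : forall z, inD z -> cdiff h z (q z)).
  { intros z Hz. replace (q z) with (pser (dser c) z); [apply cdiff_pser; assumption|].
    rewrite (holo_pser_eq q z) by assumption. f_equal. apply functional_extensionality, Hdc. }
  exists h. split; [exact Hh|]. intros z Hz.
  assert (E : (f z * Cexp (h z))%C = (f 0 * Cexp (h 0))%C).
  { apply (deriv_0_const (fun z => f z * Cexp (h z))%C).
    - apply holo_mult; [exact Hf | apply holo_Cexp, Hh].
    - intros u Hu.
      replace (RtoC 0) with (deriv_D f u * Cexp (h u) + f u * (Cexp (h u) * q u))%C.
      + apply (cdiff_mult f (fun z => Cexp (h z))); [apply cdiff_deriv_D; assumption|].
        apply (cdiff_comp Cexp h); [apply Hdh, Hu | apply cdiff_Cexp].
      + unfold q. field. apply Hn, Hu.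
    - exact Hz. }
  rewrite Hh0, <- Hw, <- Cexp_add in E. replace (w + - w)%C with (RtoC 0) in E by ring. rewrite Cexp_0 in E.
  rewrite Cexp_opp. assert (Hx := Cexp_neq0 (h z)).
  replace (f z) with (f z * Cexp (h z) / Cexp (h z))%C by (field; exact Hx).
  rewrite E. field. exact Hx.
Qed.

(** * Maximum modulus and the Schwarz lemma *)

(* Cauchy's estimates applied to the powers of [f]. *)
Lemma max_modulus f r M z : holo_D f -> 0 < r < 1 -> (forall w, Cmod w = r -> Cmod (f w) <= M) ->
  Cmod z < r -> Cmod (f z) <= M.
Proof.
  intros Hf Hr HM Hz.
  assert (Hz' : inD z) by (unfold inD; lra).
  assert (Hq := ratio_lt z r Hz). set (q := Cmod z / r) in *.
  assert (HM0 : 0 <= M).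
  { eapply Rle_trans; [apply Cmod_ge_0 | apply (HM (RtoC r))]. rewrite Cmod_R, Rabs_pos_eq; lra. }
  assert (B : forall n, Cmod (f z) ^ n <= M ^ n / (1 - q)).
  { intros n. set (g := fun w => (f w ^ n)%C). assert (Hg : holo_D g) by (apply holo_pow, Hf).
    rewrite <- Cmod_pow. change (f z ^ n)%C with (g z).
    assert (Hc : forall k, Cmod (coef g k * z ^ k) <= M ^ n * q ^ k).
    { apply term_bound; [lra|]. intros k. apply coef_bound; [exact Hg | exact Hr|].
      intros w Hw. unfold g. rewrite Cmod_pow. apply pow_incr. split; [apply Cmod_ge_0 | apply HM, Hw]. }
    assert (T := Cseries_tail _ _ _ q 0 Hq Hc (coef_series g z Hg Hz')). simpl in T.
    replace (g z - 0)%C with (g z) in T by ring. lra. }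
  apply Rnot_lt_le. intros Hlt.
  assert (Hinv : 0 < / (1 - q)) by (apply Rinv_0_lt_compat; lra).
  destruct (Req_dec M 0) as [->|HMn].
  - specialize (B 1%nat). simpl in B. unfold Rdiv in B. lra.
  - set (x := Cmod (f z) / M).
    assert (Hx : 1 < x).
    { unfold x. apply Rmult_lt_reg_r with M; [lra|]. unfold Rdiv. rewrite Rmult_assoc, Rinv_l; lra. }
    assert (B' : forall n, 1 + INR n * (x - 1) <= / (1 - q)).
    { intros n. eapply Rle_trans; [apply (poly n (x - 1)); lra|].
      replace (1 + (x - 1)) with x by ring. unfold x, Rdiv. rewrite Rpow_mult_distr, pow_inv.
      assert (Hp : 0 < M ^ n) by (apply pow_lt; lra).
      apply Rmult_le_reg_r with (M ^ n); [exact Hp|]. rewrite Rmult_assoc, Rinv_l by lra.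
      specialize (B n). unfold Rdiv in B. lra. }
    destruct (INR_unbounded (/ (1 - q) / (x - 1))) as [n Hn].
    specialize (B' n). apply (Rmult_lt_compat_r (x - 1)) in Hn; [|lra].
    unfold Rdiv in Hn. rewrite Rmult_assoc, Rinv_l in Hn; lra.
Qed.

(** The maximum principle for [w z / z] on circles of radius [r] bounds it by [/ r], and [r] tends
    to one. *)
Lemma schwarz w z : holo_D w -> (forall z, inD z -> Cmod (w z) <= 1) -> w 0%C = 0%C -> inD z ->
  Cmod (w z) <= Cmod z.
Proof.
  intros Hw Hb H0 Hz. assert (Hz' := Hz). unfold inD in Hz'.
  destruct (taylor_remainder w 1 Hw) as [g [Hg [E _]]].
  assert (E' : forall u, inD u -> w u = (u * g u)%C).
  { intros u Hu. rewrite (E u Hu). simpl. rewrite coef_0, H0 by exact Hw. ring. }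
  assert (Hm := Cmod_ge_0 z).
  assert (Hgz : Cmod (g z) <= 1).
  { apply le_epsilon. intros eps He.
    (* The first entry puts [z] inside the circle; the second makes [/ r] at most [1 + eps]. *)
    set (r := Rmax ((1 + Cmod z) / 2) (/ (1 + eps))).
    assert (Hi : 0 < / (1 + eps) < 1).
    { split; [apply Rinv_0_lt_compat; lra|]. rewrite <- Rinv_1 at 2. apply Rinv_lt_contravar; lra. }
    assert (Hr1 : (1 + Cmod z) / 2 <= r) by apply Rmax_l. assert (Hr2 : / (1 + eps) <= r) by apply Rmax_r.
    assert (Hr3 : r < 1) by (apply Rmax_lub_lt; lra).
    apply (max_modulus g r); [exact Hg | lra | | lra].
    intros u Hu. assert (Hub : inD u) by (unfold inD; lra).
    assert (B := Hb u Hub). rewrite (E' u Hub), Cmod_mult, Hu in B.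
    apply Rmult_le_reg_l with r; [lra|]. eapply Rle_trans; [exact B|].
    apply (Rmult_le_compat_r (1 + eps)) in Hr2; [|lra]. rewrite Rinv_l in Hr2; lra. }
  rewrite (E' z Hz), Cmod_mult. nra.
Qed.

(** * Coefficient inequalities for bounded functions *)

Lemma Clim_left1 : Clim (at_left 1) (fun r => RtoC r) 1.
Proof.
  intros eps He. exists (mkposreal eps He). intros y Hy _.
  rewrite <- RtoC_minus, Cmod_R. exact Hy.
Qed.

Lemma at_left1_pos : at_left 1 (fun r => 0 < r < 1).
Proof.
  exists (mkposreal 1 Rlt_0_1). intros y Hy Hy1.
  assert (H : Rabs (y - 1) < 1) by exact Hy. apply Rabs_lt_between in H. lra.
Qed.

Lemma cont_circ_poly (g : nat -> C) d r : cont2pi (fun t => Csum (fun l => g l * circ r t ^ l)%C d).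
Proof.
  apply (cont2pi_sum (fun l t => g l * circ r t ^ l)%C). intros k _ t.
  apply Rcont_scal, Clim_pow, Rcont_circ.
Qed.

Lemma Csum_trunc (f : nat -> C) d i : (i < d)%nat ->
  Csum (fun l => if le_lt_dec l i then f l else 0%C) d = Csum f (S i).
Proof.
  intros H. replace d with (S i + (d - S i))%nat by lia. rewrite Csum_add.
  rewrite (Csum_0 (fun k => if le_lt_dec (S i + k) i then f (S i + k)%nat else 0%C)).
  - match goal with |- (?a + _)%C = _ => transitivity a; [ring|] end.
    apply Csum_ext. intros k Hk. destruct (le_lt_dec k i); [reflexivity | lia].
  - intros k _. destruct (le_lt_dec (S i + k) i); [lia | reflexivity].
Qed.

(** Orthogonality of exponentials: the pair [(l, i)] picks the coefficient of [F] of index [i - l],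
    which is absent when [l > i]. The powers of [r] combine as [r^(l + i) r^(i - l) = r^(2 i)]. *)
Lemma avg_bilinear (F : C -> C) (g y : nat -> C) d r : holo_D F -> 0 < r < 1 ->
  avg (fun t => F (circ r t) * Csum (fun l => g l * circ r t ^ l) d * Cconj (Csum (fun i => y i * circ r t ^ i) d))%C =
  Csum (fun i => Csum (fun l => g l * coef F (i - l)) (S i) * Cconj (y i) * (r ^ (2 * i))%R)%C d.
Proof.
  intros HF Hr.
  set (T := fun i l t => (F (circ r t) * (circ r t ^ l * Cconj (circ r t ^ i)))%C).
  assert (HT : forall i l, cont2pi (T i l)).
  { intros i l. apply cont_mult; [apply holo_circ; assumption|]. apply cont_mult.
    - intros t. apply Clim_pow, Rcont_circ.
    - intros t. apply Rcont_conj, Clim_pow, Rcont_circ. }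
  assert (HTi : forall i l, (i < d)%nat -> avg (T i l) =
    if le_lt_dec l i then (coef F (i - l) * (r ^ (2 * i))%R)%C else 0%C).
  { intros i l _.
    assert (E : forall t, (circ r t ^ l * Cconj (circ r t ^ i))%C = ((r ^ (l + i))%R * Cis ((INR l - INR i) * t))%C).
    { intros t. rewrite !circ_pow, Cmult_conj, Cis_conj.
      replace ((INR l - INR i) * t) with (INR l * t + - (INR i * t)) by ring.
      rewrite Cis_add, pow_add, RtoC_mult.
      replace (Cconj (r ^ i)%R) with (RtoC (r ^ i)) by (apply C_ext; simpl; ring). ring. }
    destruct (le_lt_dec l i) as [H|H].
    - rewrite (avg_ext _ (fun t => (r ^ (l + i))%R * (F (circ r t) * Cis (- INR (i - l) * t)))%C).
      + rewrite avg_scal, avg_coef by (try apply cont_mult; try apply holo_circ; try apply cont_Cis_lin; assumption).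
        replace (2 * i)%nat with (l + i + (i - l))%nat by lia. rewrite (pow_add r (l + i)), RtoC_mult. ring.
      + intros t. unfold T. rewrite E, minus_INR by exact H.
        replace (- (INR i - INR l)) with (INR l - INR i) by ring. ring.
    - rewrite (avg_ext _ (fun t => (r ^ (l + i))%R * (F (circ r t) * Cis (INR (l - i) * t)))%C).
      + rewrite avg_scal, avg_coef_neg by (try apply cont_mult; try apply holo_circ; try apply cont_Cis_lin; try lia; assumption).
        ring.
      + intros t. unfold T. rewrite E, minus_INR by lia. ring. }
  rewrite (avg_ext _ (fun t => Csum (fun i => Csum (fun l => (g l * Cconj (y i)) * T i l t) d) d)%C).
  - rewrite (avg_sum (fun i t => Csum (fun l => (g l * Cconj (y i)) * T i l t) d)%C).
    + apply Csum_ext. intros i Hi.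
      rewrite (avg_sum (fun l t => (g l * Cconj (y i)) * T i l t)%C) by (intros; intros t; apply Rcont_scal, HT).
      rewrite (Csum_ext _ (fun l => if le_lt_dec l i then (Cconj (y i) * (r ^ (2 * i))%R) * (g l * coef F (i - l)) else 0)%C).
      * rewrite (Csum_trunc (fun l => (Cconj (y i) * (r ^ (2 * i))%R) * (g l * coef F (i - l)))%C d i Hi).
        rewrite Csum_scal. ring.
      * intros l _. rewrite avg_scal by apply HT. rewrite HTi by exact Hi.
        destruct (le_lt_dec l i); ring.
    + intros i _. apply (cont2pi_sum (fun l t => (g l * Cconj (y i)) * T i l t)%C). intros l _ t. apply Rcont_scal, HT.
  - intros t. rewrite Csum_conj, <- Csum_scal. apply Csum_ext. intros i _.
    set (G := Csum (fun l => g l * circ r t ^ l)%C d).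
    transitivity ((F (circ r t) * Cconj (y i * circ r t ^ i)) * G)%C; [ring|].
    unfold G. rewrite <- Csum_scal. apply Csum_ext. intros l _. unfold T. rewrite Cmult_conj. ring.
Qed.

Lemma avg_norm2 (g : nat -> C) d r : 0 < r < 1 ->
  Re (avg (fun t => RtoC (Cmod (Csum (fun l => g l * circ r t ^ l)%C d) * Cmod (Csum (fun l => g l * circ r t ^ l)%C d))))
  <= Rsum (fun i => Cmod (g i) * Cmod (g i)) d.
Proof.
  intros Hr.
  rewrite (avg_ext _ (fun t => (fun _ => RtoC 1) (circ r t) * Csum (fun l => g l * circ r t ^ l) d * Cconj (Csum (fun i => g i * circ r t ^ i) d))%C).
  - rewrite (avg_bilinear (fun _ => RtoC 1)) by (try apply holo_const; exact Hr).
    rewrite Re_sum. apply Rsum_le. intros i Hi.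
    rewrite (Csum_single _ (S i) i).
    + replace (i - i)%nat with 0%nat by lia. rewrite coef_0 by apply holo_const.
      replace (g i * 1 * Cconj (g i) * (r ^ (2 * i))%R)%C with ((g i * Cconj (g i)) * (r ^ (2 * i))%R)%C by ring.
      rewrite Cmult_conj_mod, <- RtoC_mult, Re_R.
      assert (P := pow_le_1_compat r (2 * i) ltac:(lra)).
      assert (0 <= Cmod (g i) * Cmod (g i)) by (apply Rmult_le_pos; apply Cmod_ge_0).
      rewrite <- (Rmult_1_r (Cmod (g i) * Cmod (g i))) at 2. apply Rmult_le_compat_l; lra.
    + lia.
    + intros k Hk Hki. rewrite coef_const by lia. ring.
  - intros t. cbv beta. rewrite <- Cmult_conj_mod, Cmult_1_l. reflexivity.
Qed.

(* [Re <w g, y> <= (|g|^2 + |y|^2) / 2]: multiplication by [w] is a contraction of the Hardy space. *)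
Lemma toeplitz_contraction (w : C -> C) (g y : nat -> C) d : holo_D w -> (forall z, inD z -> Cmod (w z) <= 1) ->
  Re (Csum (fun i => Csum (fun l => g l * coef w (i - l)) (S i) * Cconj (y i))%C d)
  <= / 2 * (Rsum (fun i => Cmod (g i) * Cmod (g i)) d + Rsum (fun i => Cmod (y i) * Cmod (y i)) d).
Proof.
  intros Hw Hb.
  set (s := fun i => (Csum (fun l => g l * coef w (i - l)) (S i) * Cconj (y i))%C).
  (* The inequality is proved on each circle of radius [r < 1], where [w] is continuous, and then
     [r] tends to one in the finite sums. *)
  apply (Clim_Re_le (F := at_left 1) (fun r => Csum (fun i => s i * (RtoC r) ^ (2 * i)) d)%C).
  - apply Clim_eq with (Csum (fun i => s i * 1 ^ (2 * i))%C d).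
    + apply Csum_ext. intros i _. rewrite Cpow_1. ring.
    + apply (Clim_sum (fun i (r : R) => s i * (RtoC r) ^ (2 * i))%C). intros k _.
      apply Clim_scal, Clim_pow, Clim_left1.
  - generalize at_left1_pos. apply filter_imp. intros r Hr.
    set (G := fun t => Csum (fun l => g l * circ r t ^ l)%C d).
    set (Y := fun t => Csum (fun l => y l * circ r t ^ l)%C d).
    assert (HG : cont2pi G) by apply cont_circ_poly.
    assert (HY : cont2pi Y) by apply cont_circ_poly.
    assert (Hwc := holo_circ w r Hw Hr).
    assert (HGn : cont2pi (fun t => RtoC (Cmod (G t) * Cmod (G t)))).
    { intros t. eapply Clim_ext; [intros x; symmetry; apply RtoC_mult|]. rewrite RtoC_mult.
      apply Clim_mult; apply Clim_mod, HG. }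
    assert (HYn : cont2pi (fun t => RtoC (Cmod (Y t) * Cmod (Y t)))).
    { intros t. eapply Clim_ext; [intros x; symmetry; apply RtoC_mult|]. rewrite RtoC_mult.
      apply Clim_mult; apply Clim_mod, HY. }
    replace (Csum (fun i => s i * (RtoC r) ^ (2 * i)) d)%C with (avg (fun t => w (circ r t) * G t * Cconj (Y t))%C).
    + apply Rle_trans with (Re (avg (fun t => / 2 * (RtoC (Cmod (G t) * Cmod (G t)) + RtoC (Cmod (Y t) * Cmod (Y t))))%C)).
      * apply avg_le.
        -- apply cont_mult; [apply cont_mult; assumption|]. intros t. apply Rcont_conj, HY.
        -- intros t. apply Rcont_scal, Rcont_plus; [apply HGn | apply HYn].
        -- intros t. eapply Rle_trans; [apply Re_le_mod|].
           rewrite <- RtoC_plus, <- RtoC_inv, <- RtoC_mult, Re_R by lra.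
           rewrite !Cmod_mult, Cmod_conj.
           assert (B : Cmod (w (circ r t)) <= 1) by (apply Hb; unfold inD; rewrite Cmod_circ; lra).
           assert (H1 := Cmod_ge_0 (G t)). assert (H2 := Cmod_ge_0 (Y t)).
           assert (H3 := Cmod_ge_0 (w (circ r t))).
           apply Rle_trans with (Cmod (G t) * Cmod (Y t)).
           ++ apply Rmult_le_compat_r; [exact H2|]. rewrite <- (Rmult_1_l (Cmod (G t))) at 2.
              apply Rmult_le_compat_r; lra.
           ++ generalize (Rle_0_sqr (Cmod (G t) - Cmod (Y t))). unfold Rsqr. lra.
      * rewrite avg_scal, avg_plus.
        -- rewrite <- RtoC_inv, Re_Rmult, Re_plus by lra. apply Rmult_le_compat_l; [lra|].
           apply Rplus_le_compat; apply avg_norm2, Hr.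
        -- exact HGn.
        -- exact HYn.
        -- intros t. apply Rcont_plus; [apply HGn | apply HYn].
    + unfold G, Y. rewrite avg_bilinear by assumption. apply Csum_ext. intros i _. unfold s.
      rewrite RtoC_pow. reflexivity.
Qed.

Lemma Rsum_single (f : nat -> R) n j :
  (j < n)%nat -> (forall k, (k < n)%nat -> k <> j -> f k = 0) -> Rsum f n = f j.
Proof.
  intros Hj H. assert (E := Csum_single (fun k => RtoC (f k)) n j Hj).
  rewrite <- RtoC_sum in E. apply RtoC_inj, E. intros k Hk Hkj. rewrite H; auto.
Qed.

Lemma Rsum_rev (f : nat -> R) n : Rsum (fun k => f (n - 1 - k)%nat) n = Rsum f n.
Proof.
  apply RtoC_inj. rewrite !RtoC_sum. apply (Csum_rev (fun k => RtoC (f k))).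
Qed.

(** With [g = 1] and [y] a Taylor polynomial of [w], contraction reads [S <= (1 + S) / 2]. *)
Lemma bessel (w : C -> C) d : holo_D w -> (forall z, inD z -> Cmod (w z) <= 1) ->
  Rsum (fun i => Cmod (coef w i) * Cmod (coef w i)) d <= 1.
Proof.
  intros Hw Hb. destruct d as [|d]; [simpl; lra|].
  assert (M := toeplitz_contraction w (fun l => if Nat.eq_dec l 0 then RtoC 1 else RtoC 0) (coef w) (S d) Hw Hb).
  rewrite (Csum_ext _ (fun i => RtoC (Cmod (coef w i) * Cmod (coef w i)))) in M.
  - rewrite <- RtoC_sum, Re_R in M.
    rewrite (Rsum_single (fun i => Cmod (if Nat.eq_dec i 0 then RtoC 1 else RtoC 0) * _) (S d) 0) in M.
    + simpl (Nat.eq_dec 0 0) in M. cbv iota in M. rewrite Cmod_1 in M. lra.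
    + lia.
    + intros k _ Hk. destruct (Nat.eq_dec k 0); [lia|]. rewrite Cmod_0. ring.
  - intros i _. rewrite <- Cmult_conj_mod. f_equal.
    rewrite (Csum_single _ (S i) 0).
    + simpl. rewrite Nat.sub_0_r. ring.
    + lia.
    + intros k _ Hk. destruct (Nat.eq_dec k 0); [lia|]. ring.
Qed.

Lemma coef_mod_le1 (w : C -> C) k : holo_D w -> (forall z, inD z -> Cmod (w z) <= 1) -> Cmod (coef w k) <= 1.
Proof.
  intros Hw Hb. assert (B := bessel w (S k) Hw Hb). simpl in B.
  assert (H := Rsum_ge_0 (fun i => Cmod (coef w i) * Cmod (coef w i)) k
    (fun j _ => Rmult_le_pos _ _ (Cmod_ge_0 _) (Cmod_ge_0 _))).
  assert (H0 := Cmod_ge_0 (coef w k)). nra.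
Qed.

(** The indices [i] for which [i] and [n - i] are both at least [s]: those that contribute to degree
    [n] of [w * w] when [w] vanishes to order [s]. *)
Definition mid (s n i : nat) : bool := (s <=? i)%nat && (i + s <=? n)%nat.

Lemma mid_true s n i : mid s n i = true <-> (s <= i /\ i + s <= n)%nat.
Proof. unfold mid. rewrite Bool.andb_true_iff, !Nat.leb_le. tauto. Qed.

Definition midsum (w : C -> C) (s n : nat) : R :=
  Rsum (fun i => if mid s n i then Cmod (coef w i) * Cmod (coef w i) else 0) (S n).

(** In [toeplitz_contraction] both test vectors have squared norm [1 + sg], while the pairing equals
    [Cmod (coef w n) + 2 sg]; the difference is the claim. *)
Lemma carlson (w : C -> C) s n : holo_D w -> (forall z, inD z -> Cmod (w z) <= 1) ->
  (1 <= s)%nat -> (n < 3 * s)%nat -> (forall j, (j < s)%nat -> coef w j = 0%C) ->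
  Cmod (coef w n) + midsum w s n <= 1.
Proof.
  intros Hw Hb Hs Hn H0.
  destruct (polar (coef w n)) as [th Hth]. set (eta := Cis th) in *.
  assert (Heta : (eta * Cconj eta)%C = 1%C) by (apply conj_unit, Cmod_Cis).
  set (v := fun i => if mid s n i then coef w i else RtoC 0).
  assert (Hvn : v n = 0%C).
  { unfold v. destruct (mid s n n) eqn:E; [apply mid_true in E; lia | reflexivity]. }
  (* The middle part [v] of [w] is put into [y] as it stands and into [g] conjugated and reversed,
     with the phase [eta] of [coef w n], so that [|v|^2] is collected twice: once from the term [1]
     of [g], once from the term [eta] of [y]. *)
  set (g := fun l => ((if Nat.eq_dec l 0 then RtoC 1 else RtoC 0) + eta * Cconj (v (n - l)%nat))%C).
  set (y := fun i => (v i + (if Nat.eq_dec i n then eta else RtoC 0))%C).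
  set (sg := midsum w s n).
  assert (Hsg : Rsum (fun i => Cmod (v i) * Cmod (v i)) (S n) = sg).
  { apply Rsum_ext. intros i _. unfold v. destruct (mid s n i); [reflexivity | rewrite Cmod_0; ring]. }
  assert (Hvw : forall i, (coef w i * Cconj (v i))%C = RtoC (Cmod (v i) * Cmod (v i))).
  { intros i. unfold v. destruct (mid s n i); [apply Cmult_conj_mod|].
    rewrite Cmod_0, Rmult_0_l. apply C_ext; simpl; ring. }
  assert (M := toeplitz_contraction w g y (S n) Hw Hb).
  assert (Hg : Rsum (fun i => Cmod (g i) * Cmod (g i)) (S n) = 1 + sg).
  { rewrite (Rsum_ext _ (fun i => (if Nat.eq_dec i 0 then 1 else 0) + (fun i => Cmod (v i) * Cmod (v i)) (S n - 1 - i)%nat)).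
    - rewrite Rsum_plus, (Rsum_rev (fun i => Cmod (v i) * Cmod (v i))), Hsg.
      rewrite (Rsum_single _ (S n) 0); [destruct (Nat.eq_dec 0 0); [reflexivity | lia] | lia |].
      intros k _ Hk. destruct (Nat.eq_dec k 0); [lia | reflexivity].
    - intros i _. unfold g. replace (S n - 1 - i)%nat with (n - i)%nat by lia.
      destruct (Nat.eq_dec i 0) as [->|Hi].
      + rewrite Nat.sub_0_r, Hvn. replace (RtoC 1 + eta * Cconj 0)%C with (RtoC 1).
        * rewrite Cmod_1, Cmod_0. ring.
        * apply C_ext; unfold Re, Im; simpl; ring.
      + rewrite Cplus_0_l, Cmod_mult, Cmod_conj. unfold eta. rewrite Cmod_Cis. ring. }
  assert (Hy : Rsum (fun i => Cmod (y i) * Cmod (y i)) (S n) = sg + 1).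
  { rewrite (Rsum_ext _ (fun i => Cmod (v i) * Cmod (v i) + (if Nat.eq_dec i n then 1 else 0))).
    - rewrite Rsum_plus, Hsg. f_equal.
      rewrite (Rsum_single _ (S n) n); [destruct (Nat.eq_dec n n); [reflexivity | lia] | lia |].
      intros k _ Hk. destruct (Nat.eq_dec k n); [lia | reflexivity].
    - intros i _. unfold y. destruct (Nat.eq_dec i n) as [->|Hi].
      + rewrite Hvn, Cplus_0_l. unfold eta. rewrite Cmod_Cis, Cmod_0. ring.
      + rewrite Cplus_0_r. ring. }
  rewrite Hg, Hy in M.
  set (q := fun i => Csum (fun l => Cconj (v (n - l)%nat) * coef w (i - l))%C (S i)).
  assert (Hgi : forall i, Csum (fun l => g l * coef w (i - l))%C (S i) = (coef w i + eta * q i)%C).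
  { intros i. unfold g.
    rewrite (Csum_ext _ (fun l => (if Nat.eq_dec l 0 then RtoC 1 else RtoC 0) * coef w (i - l)
      + eta * (Cconj (v (n - l)%nat) * coef w (i - l)))%C) by (intros; ring).
    rewrite Csum_plus, Csum_scal. f_equal.
    rewrite (Csum_single _ (S i) 0).
    - simpl. rewrite Nat.sub_0_r. ring.
    - lia.
    - intros k _ Hk. destruct (Nat.eq_dec k 0); [lia | ring]. }
  assert (Hqn : q n = RtoC sg).
  { unfold q. rewrite (Csum_ext _ (fun l => (fun l => RtoC (Cmod (v l) * Cmod (v l))) (S n - 1 - l)%nat)).
    - rewrite (Csum_rev (fun l => RtoC (Cmod (v l) * Cmod (v l)))), <- RtoC_sum, Hsg. reflexivity.
    - intros l _. replace (S n - 1 - l)%nat with (n - l)%nat by lia. rewrite <- Hvw. ring. }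
  (* A nonzero product would give [l >= s], [i - l >= s] and [n - i >= s], hence [n >= 3 s]. This is
     where the bound on [n] enters. *)
  assert (Hqm : forall i, mid s n i = true -> q i = 0%C).
  { intros i Hi. apply mid_true in Hi. unfold q. apply Csum_0. intros l Hl.
    destruct (le_lt_dec s (i - l)) as [H1|H1].
    - unfold v. destruct (mid s n (n - l)) eqn:E.
      + apply mid_true in E. lia.
      + apply C_ext; unfold Re, Im; simpl; ring.
    - rewrite (H0 (i - l)%nat H1). ring. }
  rewrite (Csum_ext _ (fun i => RtoC (Cmod (v i) * Cmod (v i)) + (if Nat.eq_dec i n then (coef w n + eta * q n) * Cconj eta else 0))%C) in M.
  - rewrite Csum_plus, <- RtoC_sum, Hsg in M.
    rewrite (Csum_single (fun i => if Nat.eq_dec i n then _ else _) (S n) n) in M.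
    + destruct (Nat.eq_dec n n) as [_|]; [|lia].
      rewrite Hqn in M.
      replace ((coef w n + eta * sg) * Cconj eta)%C with (RtoC (Cmod (coef w n) + sg)) in M.
      * rewrite Re_plus, !Re_R in M. lra.
      * rewrite Hth at 2. rewrite RtoC_plus.
        replace ((Cmod (coef w n) * eta + eta * sg) * Cconj eta)%C with ((Cmod (coef w n) + sg) * (eta * Cconj eta))%C by ring.
        rewrite Heta. ring.
    + lia.
    + intros k _ Hk. destruct (Nat.eq_dec k n); [lia | reflexivity].
  - intros i _. rewrite Hgi. unfold y. rewrite Cplus_conj.
    replace ((coef w i + eta * q i) * (Cconj (v i) + Cconj (if Nat.eq_dec i n then eta else RtoC 0)))%C
      with (coef w i * Cconj (v i) + eta * (q i * Cconj (v i)) + (coef w i + eta * q i) * Cconj (if Nat.eq_dec i n then eta else RtoC 0))%C by ring.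
    rewrite Hvw.
    assert (Hz : (q i * Cconj (v i))%C = 0%C).
    { destruct (mid s n i) eqn:E.
      - rewrite (Hqm i E). ring.
      - unfold v. rewrite E. apply C_ext; unfold Re, Im; simpl; ring. }
    rewrite Hz. destruct (Nat.eq_dec i n) as [->|Hi]; [ring|].
    replace (Cconj 0) with (RtoC 0) by (apply C_ext; simpl; ring). ring.
Qed.

(** In the convolution the indices [k] and [n - k] are paired by the arithmetic-geometric
    inequality. *)
Lemma coef_sqr_bound (w : C -> C) s n : holo_D w -> (forall j, (j < s)%nat -> coef w j = 0%C) ->
  Cmod (coef (fun z => w z * w z)%C n) <= midsum w s n.
Proof.
  intros Hw H0. rewrite coef_mult by exact Hw.
  eapply Rle_trans; [apply Cmod_sum|]. unfold midsum.
  set (u := fun i => if mid s n i then Cmod (coef w i) * Cmod (coef w i) else 0).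
  apply Rle_trans with (Rsum (fun k => / 2 * (u k + u (S n - 1 - k)%nat)) (S n)).
  - apply Rsum_le. intros k Hk. rewrite Cmod_mult. replace (S n - 1 - k)%nat with (n - k)%nat by lia.
    unfold u. destruct (mid s n k) eqn:E.
    + assert (E2 : mid s n (n - k) = true) by (apply mid_true; apply mid_true in E; lia).
      rewrite E2. generalize (Rle_0_sqr (Cmod (coef w k) - Cmod (coef w (n - k)))). unfold Rsqr. lra.
    + assert (E2 : mid s n (n - k) = false).
      { apply Bool.not_true_iff_false. intros E2. apply mid_true in E2.
        assert (mid s n k = true) by (apply mid_true; lia). congruence. }
      rewrite E2. destruct (le_lt_dec s k) as [H1|H1].
      * rewrite (H0 (n - k)%nat), Cmod_0; [lra|].
        destruct (le_lt_dec s (n - k)); [|assumption].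
        assert (mid s n k = true) by (apply mid_true; lia). congruence.
      * rewrite (H0 k H1), Cmod_0. lra.
  - rewrite Rsum_scal, Rsum_plus, (Rsum_rev u). lra.
Qed.

(** * Singular inner functions with one atom *)

Definition Atom (t : R) (u : C) : C := Cexp (- (t * ((1 + u) / (1 - u))))%C.

Lemma one_minus_neq0 (u : C) : inD u -> (1 - u)%C <> 0%C.
Proof.
  unfold inD. intros Hu. apply mod_neq0. generalize (Cmod_triangle_rev 1 u). rewrite Cmod_1. lra.
Qed.

Lemma inD_0 : inD 0.
Proof. unfold inD. rewrite Cmod_0. lra. Qed.

Lemma hdiff_cayley u : inD u -> cdiff (fun u => (1 + u) / (1 - u))%C u (2 / ((1 - u) * (1 - u)))%C.
Proof.
  intros Hu. assert (Hn := one_minus_neq0 u Hu).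
  replace (2 / ((1 - u) * (1 - u)))%C
    with ((0 + 1) * / (1 - u) + (1 + u) * (- (0 - 1) / ((1 - u) * (1 - u))))%C by (field; exact Hn).
  apply (cdiff_mult (fun u => 1 + u)%C (fun u => / (1 - u))%C).
  - apply (cdiff_plus (fun _ => RtoC 1) (fun u => u)); [apply cdiff_const | apply cdiff_id].
  - apply (cdiff_inv (fun u => 1 - u)%C); [exact Hn|].
    apply (cdiff_minus (fun _ => RtoC 1) (fun u => u)); [apply cdiff_const | apply cdiff_id].
Qed.

Lemma cdiff_Atom t u : inD u -> cdiff (Atom t) u (Atom t u * (- (t * (2 / ((1 - u) * (1 - u))))))%C.
Proof.
  intros Hu. apply (cdiff_comp Cexp (fun u => - (t * ((1 + u) / (1 - u))))%C).
  - apply cdiff_opp, (cdiff_scal t (fun u => (1 + u) / (1 - u))%C), hdiff_cayley, Hu.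
  - apply cdiff_Cexp.
Qed.

Lemma holo_Atom t : holo_D (Atom t).
Proof. apply holo_hdiff. intros u Hu. eexists. apply cdiff_Atom, Hu. Qed.

Lemma Re_div (a b : C) : b <> 0%C -> Re (a / b)%C = Re (a * Cconj b)%C / (Cmod b * Cmod b).
Proof.
  intros Hb. assert (Hm := C_neq0_mod b Hb).
  assert (Hcb : Cconj b <> 0%C) by (apply mod_neq0; rewrite Cmod_conj; exact Hm).
  replace (a / b)%C with (RtoC (/ (Cmod b * Cmod b)) * (a * Cconj b))%C.
  - rewrite Re_Rmult. unfold Rdiv. ring.
  - rewrite RtoC_inv by nra. rewrite <- Cmult_conj_mod. field. split; assumption.
Qed.

Lemma Re_cayley u : (1 - u)%C <> 0%C ->
  Re ((1 + u) / (1 - u))%C = (1 - Cmod u * Cmod u) / (Cmod (1 - u) * Cmod (1 - u)).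
Proof.
  intros H. rewrite Re_div by exact H. f_equal. rewrite Cmod_sqr.
  destruct u as [x y]. unfold Re, Im; simpl. ring.
Qed.

Lemma Re_cayley_pos u : inD u -> 0 < Re ((1 + u) / (1 - u))%C.
Proof.
  intros H. assert (Hn := one_minus_neq0 u H). rewrite Re_cayley by exact Hn.
  assert (Hp := C_neq0_mod _ Hn). unfold inD in H. assert (H0 := Cmod_ge_0 u).
  apply Rdiv_lt_0_compat; [nra | apply Rmult_lt_0_compat; exact Hp].
Qed.

Lemma Cmod_Atom t u : 0 <= t -> inD u -> 0 < Cmod (Atom t u) <= 1.
Proof.
  intros Ht Hu. unfold Atom. rewrite Cmod_Cexp, Re_opp, Re_Rmult. split; [apply exp_pos|].
  apply Rle_trans with (exp 0); [|rewrite exp_0; lra]. assert (H := Re_cayley_pos u Hu).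
  assert (H2 : 0 <= t * Re ((1 + u) / (1 - u))%C) by (apply Rmult_le_pos; lra).
  destruct H2 as [H2|H2]; [left; apply exp_increasing; lra | right; rewrite <- H2, Ropp_0; reflexivity].
Qed.

Lemma Atom_0 t : coef (Atom t) 0 = RtoC (exp (- t)).
Proof.
  rewrite coef_0 by apply holo_Atom. unfold Atom.
  replace (- (t * ((1 + 0) / (1 - 0))))%C with (RtoC (- t)) by (rewrite RtoC_opp; field; apply (one_minus_neq0 0 inD_0)).
  rewrite Cexp_Cis, Re_R, Im_R, Cis_0. ring.
Qed.

Lemma Atom_rec0 t : coef (Atom t) 1 = (- (2 * t) * coef (Atom t) 0)%C.
Proof.
  assert (HE := holo_Atom t). assert (HD := holo_deriv_D _ HE).
  assert (H : coef (deriv_D (Atom t)) 0 = (INR 1 * coef (Atom t) 1)%C) by apply coef_deriv_D, HE.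
  rewrite coef_0 in H by exact HD.
  rewrite (deriv_D_eq (Atom t) 0 _ HE inD_0 (cdiff_Atom t 0 inD_0)) in H.
  rewrite <- coef_0 in H by exact HE. simpl in H.
  replace (coef (Atom t) 1) with (1 * coef (Atom t) 1)%C by ring. rewrite <- H. field.
Qed.

(* Coefficient form of the differential equation [(1 - u)^2 E' = - 2 t E]. *)
Lemma Atom_rec t j :
  (INR (S (S j)) * coef (Atom t) (S (S j)) - 2 * INR (S j) * coef (Atom t) (S j)
   + INR j * coef (Atom t) j + 2 * t * coef (Atom t) (S j) = 0)%C.
Proof.
  assert (HE := holo_Atom t). assert (HD := holo_deriv_D _ HE).
  set (D := deriv_D (Atom t)) in *.
  assert (Hz : coef (fun u => D u + ((-2) * (u ^ 1 * D u) + (u ^ 2 * D u + (2 * t) * Atom t u)))%C (S j) = 0%C).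
  { rewrite (coef_ext_D _ (fun _ => RtoC 0)); [apply coef_const; lia|].
    intros u Hu. unfold D. rewrite (deriv_D_eq (Atom t) u _ HE Hu (cdiff_Atom t u Hu)).
    field. apply one_minus_neq0, Hu. }
  assert (H1 : holo_D (fun u => u ^ 1 * D u)%C) by (apply holo_mult; [apply holo_pow, holo_id | exact HD]).
  assert (H2 : holo_D (fun u => u ^ 2 * D u)%C) by (apply holo_mult; [apply holo_pow, holo_id | exact HD]).
  assert (H3 : holo_D (fun u => (2 * t) * Atom t u)%C) by (apply holo_scal, HE).
  assert (H4 : holo_D (fun u => u ^ 2 * D u + (2 * t) * Atom t u)%C) by (apply holo_plus; assumption).
  assert (H5 : holo_D (fun u => (-2) * (u ^ 1 * D u))%C) by (apply holo_scal, H1).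
  assert (H6 : holo_D (fun u => (-2) * (u ^ 1 * D u) + (u ^ 2 * D u + (2 * t) * Atom t u))%C)
    by (apply holo_plus; assumption).
  rewrite coef_plus, coef_plus, coef_plus, !coef_scal, !coef_shift in Hz by assumption.
  destruct (le_lt_dec 1 (S j)) as [_|]; [|lia].
  replace (S j - 1)%nat with j in Hz by lia.
  unfold D in Hz. rewrite !coef_deriv_D in Hz by exact HE.
  destruct (le_lt_dec 2 (S j)) as [Hj|Hj].
  - replace (S (S j - 2)) with j in Hz by lia. rewrite <- Hz. ring.
  - assert (j = 0)%nat as -> by lia. rewrite <- Hz. simpl. ring.
Qed.

Lemma Atom_real t k : Im (coef (Atom t) k) = 0.
Proof.
  assert (H : Im (coef (Atom t) k) = 0 /\ Im (coef (Atom t) (S k)) = 0); [|apply H].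
  induction k as [|k [IH1 IH2]].
  - split; [rewrite Atom_0; reflexivity|].
    rewrite Atom_rec0, Atom_0, <- RtoC_mult, <- RtoC_opp, <- RtoC_mult. reflexivity.
  - split; [exact IH2|]. assert (H := Atom_rec t k). apply (f_equal Im) in H.
    set (a := coef (Atom t) (S (S k))) in *. set (b := coef (Atom t) (S k)) in *. set (c := coef (Atom t) k) in *.
    replace (INR (S (S k)) * a - 2 * INR (S k) * b + INR k * c + 2 * t * b)%C
      with (INR (S (S k)) * a + RtoC (- (2 * INR (S k))) * b + INR k * c + RtoC (2 * t) * b)%C in H
      by (rewrite RtoC_opp, !RtoC_mult; ring).
    rewrite !Im_plus, !Im_Rmult, IH1, IH2 in H. rewrite Im_R in H.
    assert (Hn : INR (S (S k)) <> 0) by (apply not_0_INR; lia).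

    assert (H' : INR (S (S k)) * Im a = 0) by lra.
    apply Rmult_integral in H'. destruct H'; [contradiction | assumption].
Qed.

(** These are [exp (- t)] times the Laguerre polynomials of parameter [- 1] at [2 t]; [er_rec] is
    their three-term recurrence. *)
Definition er (t : R) (k : nat) : R := Re (coef (Atom t) k).

Lemma Atom_er t k : coef (Atom t) k = RtoC (er t k).
Proof. apply C_ext; [reflexivity | rewrite Atom_real; reflexivity]. Qed.

Lemma er_0 t : er t 0 = exp (- t).
Proof. unfold er. rewrite Atom_0. reflexivity. Qed.

Lemma er_1 t : er t 1 = - 2 * t * exp (- t).
Proof.
  unfold er. rewrite Atom_rec0, Atom_0, <- RtoC_mult, <- RtoC_opp, <- RtoC_mult, Re_R. ring.
Qed.

Lemma er_rec t j : INR (S (S j)) * er t (S (S j)) = (2 * INR (S j) - 2 * t) * er t (S j) - INR j * er t j.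
Proof.
  assert (H := Atom_rec t j). rewrite !Atom_er in H.
  apply (f_equal Re) in H.
  rewrite <- !RtoC_mult, <- RtoC_minus, <- !RtoC_plus, !Re_R in H. lra.
Qed.

Lemma er_2 t : er t 2 = - 2 * t * (1 - t) * exp (- t).
Proof.
  assert (H := er_rec t 0). rewrite er_1, er_0 in H. simpl in H. lra.
Qed.

(** * The Krzyż bound for functions with a gap *)

(** The map [(p - t) / (p + t)] sends the right half-plane to the disc and [t] to [0], so the
    Schwarz lemma applies to [w]; solving for [p] puts [f] into the stated form. The bound at the
    origin is what makes [t] positive. *)
Lemma subordination (f : C -> C) : B0 f -> Cmod (f 0%C) < 1 ->
  exists (gam : C) (t : R) (w : C -> C), Cmod gam = 1 /\ 0 < t /\ holo_D w /\
    (forall z, inD z -> Cmod (w z) <= Cmod z) /\ forall z, inD z -> f z = (gam * Atom t (w z))%C.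
Proof.
  intros [Hf Hb] H0.
  destruct (holo_log f Hf) as [h [Hh Hfh]].
  { intros z Hz. apply mod_neq0. apply (Hb z Hz). }
  assert (HRe : forall z, inD z -> 0 <= Re (h z)).
  { intros z Hz. destruct (Hb z Hz) as [_ H1]. rewrite (Hfh z Hz), Cmod_Cexp, Re_opp in H1.
    apply Rnot_lt_le. intros Hneg. rewrite <- exp_0 in H1.
    assert (exp 0 < exp (- Re (h z))) by (apply exp_increasing; lra). lra. }
  set (t := Re (h 0%C)). set (b := Im (h 0%C)).
  assert (Ht : 0 < t).
  { destruct (HRe _ inD_0) as [H|H]; [exact H|].
    rewrite (Hfh _ inD_0), Cmod_Cexp, Re_opp, <- H, Ropp_0, exp_0 in H0. lra. }
  (* Removing the imaginary part of [h 0], which becomes the phase of [gam], makes [p 0] the real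
     number [t]. *)
  set (p := fun z => (h z - Ci * b)%C).
  assert (Hp : holo_D p) by (apply holo_minus; [exact Hh | apply holo_const]).
  assert (Hp0 : p 0%C = RtoC t).
  { unfold p, b. apply C_ext; unfold Re, Im; simpl; [|ring]. unfold t, Re. ring. }
  assert (HpRe : forall z, Re (p z) = Re (h z)) by (intros z; unfold p, Re; simpl; ring).
  assert (Hpt : forall z, inD z -> (p z + t)%C <> 0%C).
  { intros z Hz. apply Re_neq0. rewrite Re_plus, HpRe, Re_R. generalize (HRe z Hz). lra. }
  set (w := fun z => ((p z - t) / (p z + t))%C).
  assert (Hw : holo_D w).
  { apply holo_div; [exact Hpt | apply holo_minus | apply holo_plus]; try exact Hp; apply holo_const. }
  assert (Hwb : forall z, inD z -> Cmod (w z) <= 1).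
  { intros z Hz. unfold w. rewrite Cmod_div by (apply Hpt, Hz).
    assert (Hpos := C_neq0_mod _ (Hpt z Hz)).
    apply Rmult_le_reg_r with (Cmod (p z + t)); [exact Hpos|].
    unfold Rdiv. rewrite Rmult_assoc, Rinv_l, Rmult_1_l, Rmult_1_r by lra.
    apply Rsqr_incr_0; [|apply Cmod_ge_0|apply Cmod_ge_0]. unfold Rsqr. rewrite !Cmod_sqr.
    rewrite Re_minus, Im_minus, Re_plus, Im_plus, Re_R, Im_R, HpRe.
    generalize (HRe z Hz). nra. }
  assert (Hw0 : w 0%C = 0%C).
  { unfold w. rewrite Hp0. field. rewrite <- RtoC_plus. apply RtoC_neq0. lra. }
  exists (Cexp (- (Ci * b)))%C, t, w.
  split; [rewrite Cmod_Cexp; replace (Re (- (Ci * b))%C) with 0 by (unfold Re; simpl; ring); apply exp_0|].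
  split; [exact Ht|]. split; [exact Hw|].
  split; [intros z Hz; apply schwarz; assumption|].
  intros z Hz. rewrite (Hfh z Hz). unfold Atom. rewrite <- Cexp_add. f_equal.
  assert (Hd := Hpt z Hz).
  replace (t * ((1 + w z) / (1 - w z)))%C with (p z).
  - unfold p. ring.
  - unfold w. field. split; [exact Hd|].
    replace (p z + t - (p z - t))%C with (RtoC (2 * t)) by (rewrite RtoC_mult; ring).
    apply RtoC_neq0. lra.
Qed.

Lemma exp_m1 : exp (- (1)) = / exp 1.
Proof. rewrite exp_Ropp. reflexivity. Qed.

(** Equivalent to [t <= exp (t - 1)], strict unless [t = 1]. *)
Lemma t_exp_bound t : t * exp (- t) <= / exp 1 /\ (t * exp (- t) = / exp 1 -> t = 1).
Proof.
  assert (H : forall x, x <> 0 -> 1 + x < exp x) by (intros; apply exp_ineq1; assumption).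
  assert (E : exp (- t) = / exp 1 * / exp (t - 1)).
  { rewrite <- !exp_Ropp, <- exp_plus. f_equal. ring. }
  assert (Hp := exp_pos (t - 1)). assert (Hp1 := Rinv_0_lt_compat _ (exp_pos 1)).
  destruct (Req_dec t 1) as [->|Ht].
  - split; [|reflexivity]. rewrite exp_m1. lra.
  - assert (B : t < exp (t - 1)) by (generalize (H (t - 1)); lra).
    assert (B2 : t * / exp (t - 1) < 1).
    { apply Rmult_lt_reg_r with (exp (t - 1)); [exact Hp|]. rewrite Rmult_assoc, Rinv_l; lra. }
    rewrite E. assert (t * (/ exp 1 * / exp (t - 1)) < / exp 1).
    { replace (t * (/ exp 1 * / exp (t - 1))) with (/ exp 1 * (t * / exp (t - 1))) by ring.
      rewrite <- (Rmult_1_r (/ exp 1)) at 2. apply Rmult_lt_compat_l; assumption. }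
    split; [lra | intros; lra].
Qed.

Lemma exp_quad_lower x : 0 <= x -> 1 + x + x * x / 2 <= exp x.
Proof.
  intros Hx. destruct (Req_dec x 0) as [->|Hn]; [rewrite exp_0; lra|].
  destruct (MVT_gen (fun y => exp y - 1 - y - y * y / 2) 0 x (fun y => exp y - 1 - y)) as [c [Hc E]].
  - intros y _. auto_derive; [auto | field].
  - intros y _. apply continuity_pt_filterlim.
    apply (ex_derive_continuous (fun y => exp y - 1 - y - y * y / 2)). auto_derive. auto.
  - rewrite Rmin_left, Rmax_right in Hc by lra. rewrite exp_0 in E.
    assert (B := exp_ineq1_le c). nra.
Qed.

(** The derivative of the difference is the nonnegative quantity of [exp_quad_lower]. The cubic term
    is what makes [(1 + x) * x < exp x] provable for all [x >= 0]. *)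
Lemma exp_cubic_lower x : 0 <= x -> 1 + x + x * x / 2 + x * x * x / 6 <= exp x.
Proof.
  intros Hx. destruct (Req_dec x 0) as [->|Hn]; [rewrite exp_0; lra|].
  destruct (MVT_gen (fun y => exp y - 1 - y - y * y / 2 - y * y * y / 6) 0 x
              (fun y => exp y - 1 - y - y * y / 2)) as [c [Hc E]].
  - intros y _. auto_derive; [auto | field].
  - intros y _. apply continuity_pt_filterlim.
    apply (ex_derive_continuous (fun y => exp y - 1 - y - y * y / 2 - y * y * y / 6)). auto_derive. auto.
  - rewrite Rmin_left, Rmax_right in Hc by lra. rewrite exp_0 in E.
    assert (B := exp_quad_lower c ltac:(lra)). nra.
Qed.

(** The coefficient of the quadratic term stays strictly below that of the linear one at its best,
    which makes equality in the gap bound rigid. For [t <= 1], [1 / 4 < 1 / 3 <= 1 / e]; for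
    [t > 1], the cubic bound with [x = t - 1]. *)
Lemma t_exp_bound2 t : 0 < t -> t * exp (- t) * Rabs (1 - t) < / exp 1.
Proof.
  intros Ht.
  assert (E : exp (- t) = / exp 1 * / exp (t - 1)).
  { rewrite <- !exp_Ropp, <- exp_plus. f_equal. ring. }
  assert (Hp := exp_pos (t - 1)). assert (Hp1 := Rinv_0_lt_compat _ (exp_pos 1)).
  destruct (Rle_dec t 1) as [H|H].
  - rewrite Rabs_pos_eq by lra.
    assert (He : exp (- t) <= 1) by (rewrite <- exp_0; left; apply exp_increasing; lra).
    assert (He0 := exp_pos (- t)).
    assert (E3 := exp_le_3). assert (Hi : / 3 <= / exp 1) by (apply Rinv_le_contravar; [apply exp_pos | lra]).
    assert (t * (1 - t) <= / 4). { generalize (Rle_0_sqr (t - / 2)). unfold Rsqr. lra. }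
    apply Rle_lt_trans with (/ 4); [|lra].
    replace (t * exp (- t) * (1 - t)) with (t * (1 - t) * exp (- t)) by ring.
    assert (0 <= t * (1 - t)) by nra. nra.
  - rewrite Rabs_left by lra. set (x := t - 1) in *.
    assert (Hx : 0 < x) by (unfold x; lra). assert (B := exp_cubic_lower x ltac:(lra)).
    assert (B2 : (1 + x) * x < exp x).
    { eapply Rlt_le_trans; [|exact B].
      (* Since [6 (1 + x + x^2/2 + x^3/6 - (1 + x) x) = (x + 1) (x - 2)^2 + 2]. *)
      assert (0 <= (x + 1) * ((x - 2) * (x - 2))) by (apply Rmult_le_pos; [lra | apply Rle_0_sqr]). lra. }
    rewrite E. replace t with (1 + x) by (unfold x; ring).
    apply Rmult_lt_reg_r with (exp x); [exact Hp|].
    replace ((1 + x) * (/ exp 1 * / exp x) * - (1 - (1 + x)) * exp x) with (/ exp 1 * ((1 + x) * x)) by (field; split; [lra | generalize (exp_pos 1); lra]).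
    apply Rmult_lt_compat_l; assumption.
Qed.

Section Gap.
Variables (f : C -> C) (gam : C) (t : R) (w : C -> C).
Hypothesis Hgam : Cmod gam = 1.
Hypothesis Ht : 0 < t.
Hypothesis Hw : holo_D w.
Hypothesis Hwz : forall z, inD z -> Cmod (w z) <= Cmod z.
Hypothesis Hfw : forall z, inD z -> f z = (gam * Atom t (w z))%C.

Lemma w_inD z : inD z -> inD (w z).
Proof. intros Hz. unfold inD. eapply Rle_lt_trans; [apply Hwz, Hz | exact Hz]. Qed.

Lemma w_le1 z : inD z -> Cmod (w z) <= 1.
Proof. intros Hz. left. apply w_inD, Hz. Qed.

Lemma coef_w0 : coef w 0 = 0%C.
Proof.
  rewrite coef_0 by exact Hw. apply Cmod_eq_0. assert (H := Hwz 0 inD_0). rewrite Cmod_0 in H.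
  generalize (Cmod_ge_0 (w 0%C)). lra.
Qed.

(* Below degree [3 s] only the quadratic Taylor polynomial of [Atom t] matters. *)
Lemma coef_gap s n : (1 <= n)%nat -> (n < 3 * s)%nat -> (forall j, (j < s)%nat -> coef w j = 0%C) ->
  coef f n = (gam * (er t 1 * coef w n + er t 2 * coef (fun z => w z * w z) n))%C /\
  ((n < 2 * s)%nat -> coef (fun z => w z * w z)%C n = 0%C).
Proof.
  intros Hn Hns H0.
  destruct (taylor_remainder w s Hw) as [phi [Hphi [Ephi _]]].
  assert (Ew : forall z, inD z -> w z = (z ^ s * phi z)%C).
  { intros z Hz. rewrite (Ephi z Hz), Csum_0; [ring|]. intros k Hk. rewrite (H0 k Hk). ring. }
  destruct (taylor_remainder (Atom t) 3 (holo_Atom t)) as [G [HG [EG _]]].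
  assert (HGw : holo_D (fun z => G (w z))) by (apply holo_comp; [exact w_inD | exact HG | exact Hw]).
  assert (Hww : holo_D (fun z => w z * w z)%C) by (apply holo_mult; exact Hw).
  assert (Hrem : holo_D (fun z => (phi z * phi z * phi z) * G (w z))%C)
    by (apply holo_mult; [apply holo_mult; [apply holo_mult|] |]; assumption).
  split.
  - rewrite (coef_ext_D f (fun z => gam * (coef (Atom t) 0 + (coef (Atom t) 1 * w z + (coef (Atom t) 2 * (w z * w z)
        + z ^ (3 * s) * ((phi z * phi z * phi z) * G (w z))))))%C).
    + assert (A1 : holo_D (fun z => z ^ (3 * s) * ((phi z * phi z * phi z) * G (w z)))%C)
        by (apply holo_mult; [apply holo_pow, holo_id | exact Hrem]).
      assert (A2 : holo_D (fun z => coef (Atom t) 2 * (w z * w z))%C) by (apply holo_scal, Hww).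
      assert (A3 : holo_D (fun z => coef (Atom t) 1 * w z)%C) by (apply holo_scal, Hw).
      assert (A4 := holo_plus _ _ A2 A1). assert (A5 := holo_plus _ _ A3 A4).
      rewrite coef_scal by (apply holo_plus; [apply holo_const | exact A5]).
      rewrite (coef_plus (fun _ => coef (Atom t) 0)), coef_const by (try exact A5; try apply holo_const; lia).
      rewrite (coef_plus (fun z => coef (Atom t) 1 * w z)%C), coef_scal by assumption.
      rewrite (coef_plus (fun z => coef (Atom t) 2 * (w z * w z))%C), coef_scal by assumption.
      rewrite (coef_shift (fun z => (phi z * phi z * phi z) * G (w z))%C) by exact Hrem.
      destruct (le_lt_dec (3 * s) n); [lia|]. rewrite !Atom_er. ring.
    + intros z Hz. rewrite (Hfw z Hz), (EG (w z) (w_inD z Hz)). f_equal.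
      assert (Hcube : (w z ^ 3)%C = (z ^ (3 * s) * (phi z * phi z * phi z))%C).
      { rewrite (Ew z Hz). replace (3 * s)%nat with (s + (s + s))%nat by lia. rewrite !Cpow_add. simpl. ring. }
      rewrite Hcube. simpl. ring.
  - intros Hn2.
    rewrite (coef_ext_D _ (fun z => z ^ (2 * s) * (phi z * phi z))%C).
    + rewrite (coef_shift (fun z => phi z * phi z)%C) by (apply holo_mult; exact Hphi).
      destruct (le_lt_dec (2 * s) n); [lia | reflexivity].
    + intros z Hz. rewrite (Ew z Hz). replace (2 * s)%nat with (s + s)%nat by lia. rewrite Cpow_add. ring.
Qed.

(** Once the lower coefficients of [w] vanish, [coef_gap] at index [j] reduces to
    [coef f j = gam * er t 1 * coef w j], and [er t 1] is nonzero. *)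
Lemma gap_w K : (forall j, (1 <= j <= K)%nat -> coef f j = 0%C) -> forall j, (j <= K)%nat -> coef w j = 0%C.
Proof.
  intros HK j. induction j as [j IH] using lt_wf_ind. intros Hj.
  destruct j as [|j]; [apply coef_w0|].
  destruct (coef_gap (S j) (S j)) as [E Q]; [lia | lia | |].
  - intros i Hi. apply IH; lia.
  - rewrite HK, Q in E by lia.
    assert (Her : er t 1 <> 0).
    { rewrite er_1. generalize (exp_pos (- t)). intros. apply Rmult_integral_contrapositive_currified; [|lra].
      lra. }
    assert (Hn := RtoC_neq0 _ Her). assert (Hg := mod_unit_neq0 _ Hgam).
    replace (coef w (S j)) with (gam * (er t 1 * coef w (S j) + er t 2 * 0) / (gam * er t 1))%C by (field; split; assumption).
    rewrite <- E. field. split; assumption.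
Qed.

(** With [T = t exp (- t)], the coefficient is at most [2 T x + 2 T |1 - t| sg]. Both [T] and
    [T |1 - t|] are at most [1 / e], and [x + sg <= 1] by [carlson]. *)
Lemma gap_bound K n : (1 <= n <= 3 * K + 2)%nat -> (forall j, (1 <= j <= K)%nat -> coef f j = 0%C) ->
  Cmod (coef f n) <= 2 / exp 1 /\
  (Cmod (coef f n) = 2 / exp 1 -> t = 1 /\ exists c, Cmod c = 1 /\ forall z, inD z -> w z = (c * z ^ n)%C).
Proof.
  intros Hn HK. assert (H0 := gap_w K HK).
  destruct (coef_gap (S K) n) as [E _]; [lia | lia | intros j Hj; apply H0; lia |].
  assert (HC := carlson w (S K) n Hw w_le1 ltac:(lia) ltac:(lia) ltac:(intros; apply H0; lia)).
  assert (HQ := coef_sqr_bound w (S K) n Hw ltac:(intros; apply H0; lia)).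
  set (sg := midsum w (S K) n) in *. set (x := Cmod (coef w n)) in *.
  assert (Hx : 0 <= x) by apply Cmod_ge_0.
  assert (Hsg : 0 <= sg) by (eapply Rle_trans; [apply Cmod_ge_0 | exact HQ]).
  assert (Hexp := exp_pos (- t)). assert (Hie := Rinv_0_lt_compat _ (exp_pos 1)).
  destruct (t_exp_bound t) as [B1 B1e]. assert (B2 := t_exp_bound2 t Ht).
  set (T := t * exp (- t)) in *.
  assert (HT : 0 < T) by (apply Rmult_lt_0_compat; assumption).
  assert (Hub : Cmod (coef f n) <= 2 * T * x + 2 * (T * Rabs (1 - t)) * sg).
  { rewrite E, Cmod_mult, Hgam, Rmult_1_l. eapply Rle_trans; [apply Cmod_triangle|].
    rewrite !Cmod_mult, !Cmod_R, er_1, er_2. fold x.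
    replace (-2 * t * exp (- t)) with (- (2 * T)) by (unfold T; ring).
    replace (-2 * t * (1 - t) * exp (- t)) with (- (2 * T) * (1 - t)) by (unfold T; ring).
    rewrite Rabs_mult, !Rabs_Ropp, !(Rabs_pos_eq (2 * T)) by lra.
    apply Rplus_le_compat; [lra|].
    replace (2 * (T * Rabs (1 - t)) * sg) with (2 * T * Rabs (1 - t) * sg) by ring.
    apply Rmult_le_compat_l; [|exact HQ]. apply Rmult_le_pos; [lra | apply Rabs_pos]. }
  set (T2 := T * Rabs (1 - t)) in *.
  assert (P1 : T * x <= / exp 1 * x) by (apply Rmult_le_compat_r; assumption).
  assert (P2 : T2 * sg <= / exp 1 * sg) by (apply Rmult_le_compat_r; lra).
  assert (P3 : / exp 1 * (x + sg) <= / exp 1) by (rewrite <- (Rmult_1_r (/ exp 1)) at 2; apply Rmult_le_compat_l; lra).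
  unfold Rdiv. split; [lra|]. intros Heq.
  (* A positive [sg] would carry the strict bound of [t_exp_bound2] and spoil equality. *)
  assert (Hsg0 : sg = 0).
  { destruct Hsg as [Hs|Hs]; [|symmetry; exact Hs].
    assert (T2 * sg < / exp 1 * sg) by (apply Rmult_lt_compat_r; lra). lra. }
  rewrite Hsg0 in *.
  assert (Hx1 : x = 1).
  { destruct (Req_dec x 1) as [|Hne]; [assumption|].
    assert (/ exp 1 * x < / exp 1 * 1) by (apply Rmult_lt_compat_l; lra). lra. }
  rewrite Hx1 in *. split; [apply B1e; lra|].
  exists (coef w n). split; [exact Hx1|]. intros z Hz.
  apply (coef_inj w (fun z => coef w n * z ^ n)%C); [exact Hw | apply holo_scal, holo_pow, holo_id | | exact Hz].
  intros k. rewrite coef_monomial. destruct (Nat.eq_dec n k) as [->|Hnk]; [reflexivity|].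
  (* As [Cmod (coef w n) = 1] already exhausts the sum of squares, every other coefficient of [w] is
     zero. *)
  assert (Bs := bessel w (S (Nat.max n k)) Hw w_le1).
  apply Cmod_eq_0.
  assert (S2 : Cmod (coef w n) * Cmod (coef w n) + Cmod (coef w k) * Cmod (coef w k)
     <= Rsum (fun i => Cmod (coef w i) * Cmod (coef w i)) (S (Nat.max n k))).
  { eapply Rle_trans; [|apply (Rsum_le (fun i => (if Nat.eq_dec i n then Cmod (coef w i) * Cmod (coef w i) else 0)
       + (if Nat.eq_dec i k then Cmod (coef w i) * Cmod (coef w i) else 0)))].
    - rewrite Rsum_plus, (Rsum_single _ _ n), (Rsum_single _ _ k); try lia.
      + destruct (Nat.eq_dec n n), (Nat.eq_dec k k); try lia. lra.
      + intros i _ Hi. destruct (Nat.eq_dec i k); [lia | reflexivity].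
      + intros i _ Hi. destruct (Nat.eq_dec i n); [lia | reflexivity].
    - intros i _. assert (0 <= Cmod (coef w i) * Cmod (coef w i)) by (apply Rmult_le_pos; apply Cmod_ge_0).
      destruct (Nat.eq_dec i n), (Nat.eq_dec i k); try lia; lra. }
  fold x in S2. rewrite Hx1 in S2. assert (Hk0 := Cmod_ge_0 (coef w k)). nra.
Qed.
End Gap.

(** [gap_bound] freed from the representation by [subordination]. In the remaining case
    [Cmod (f 0) = 1], [bessel] makes the coefficient zero. *)
Lemma krzyz_gap (f : C -> C) K n : B0 f -> (1 <= n <= 3 * K + 2)%nat ->
  (forall j, (1 <= j <= K)%nat -> coef f j = 0%C) ->
  Cmod (coef f n) <= 2 / exp 1 /\
  (Cmod (coef f n) = 2 / exp 1 -> exists gam c, Cmod gam = 1 /\ Cmod c = 1 /\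
     forall z, inD z -> f z = (gam * Atom 1 (c * z ^ n))%C).
Proof.
  intros HB Hn HK. assert (HB' := HB). destruct HB' as [Hf Hb].
  assert (Hpos : 0 < 2 / exp 1) by (apply Rdiv_lt_0_compat; [lra | apply exp_pos]).
  destruct (Rlt_le_dec (Cmod (f 0%C)) 1) as [H1|H1].
  - destruct (subordination f HB H1) as [gam [t [w [Hg [Ht [Hw [Hwz Hfw]]]]]]].
    destruct (gap_bound f gam t w Hg Ht Hw Hwz Hfw K n Hn HK) as [A1 A2]. split; [exact A1|].
    intros He. destruct (A2 He) as [E1' [c [Hc Hcz]]]. exists gam, c. split; [exact Hg|]. split; [exact Hc|].
    intros z Hz. rewrite (Hfw z Hz), E1', (Hcz z Hz). reflexivity.
  - assert (Hz : Cmod (coef f n) = 0).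
    { assert (Bs := bessel f (S n) Hf (fun z Hz => proj2 (Hb z Hz))).
      destruct n as [|n]; [lia|].
      assert (T := Rsum_term (fun i => Cmod (coef f i) * Cmod (coef f i)) (S n) 0
        (fun _ _ => Rmult_le_pos _ _ (Cmod_ge_0 _) (Cmod_ge_0 _)) ltac:(lia)).
      simpl in T. rewrite coef_0 in T by exact Hf.
      change (Rsum (fun i => Cmod (coef f i) * Cmod (coef f i)) (S n) + Cmod (coef f (S n)) * Cmod (coef f (S n)) <= 1) in Bs.
      simpl Rsum in Bs. assert (H0 := Cmod_ge_0 (coef f (S n))). nra. }
    rewrite Hz. split; [lra | intros; lra].
Qed.

(** * Extremal functions *)

Lemma extremal_coef n f : extremal n f <->
  B0 f /\ forall F, B0 F -> Re (coef F n) <= Re (coef f n).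
Proof.
  split; intros [HB H]; split; try exact HB.
  - intros F HF. apply (H (coef f) (taylor_coef f (proj1 HB)) F (coef F) HF (taylor_coef F (proj1 HF))).
  - intros a Ha F b HF Hb. rewrite (taylor_unique f a n (proj1 HB) Ha), (taylor_unique F b n (proj1 HF) Hb).
    apply H, HF.
Qed.

Lemma inD_pow_unit (c z : C) n : (1 <= n)%nat -> Cmod c = 1 -> inD z -> inD (c * z ^ n)%C.
Proof.
  unfold inD. intros Hn Hc Hz. rewrite Cmod_mult, Cmod_pow, Hc, Rmult_1_l.
  apply pow_lt_1_compat'; [split; [apply Cmod_ge_0 | exact Hz] | exact Hn].
Qed.

Lemma B0_model gam t c n : 0 <= t -> Cmod gam = 1 -> Cmod c = 1 -> (1 <= n)%nat ->
  B0 (fun z => gam * Atom t (c * z ^ n))%C.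
Proof.
  intros Ht Hg Hc Hn. split.
  - apply holo_scal. apply (holo_comp (Atom t) (fun z => c * z ^ n)%C).
    + intros z Hz. apply inD_pow_unit; assumption.
    + apply holo_Atom.
    + apply holo_scal, holo_pow, holo_id.
  - intros z Hz. rewrite Cmod_mult, Hg, Rmult_1_l. apply Cmod_Atom; [exact Ht|].
    apply inD_pow_unit; assumption.
Qed.

(** The inner function [c z^n] vanishes to order [n], so up to degree [n] only the linear term of
    [Atom 1] contributes. *)
Lemma coef_model f gam c n : Cmod gam = 1 -> Cmod c = 1 -> (1 <= n)%nat ->
  (forall z, inD z -> f z = (gam * Atom 1 (c * z ^ n))%C) ->
  coef f n = (gam * c * (- (2 / exp 1))%R)%C /\ (forall j, (1 <= j < n)%nat -> coef f j = 0%C).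
Proof.
  intros Hg Hc Hn Hf.
  assert (Hw : holo_D (fun z => c * z ^ n)%C) by apply holo_scal, holo_pow, holo_id.
  assert (Hwz : forall z, inD z -> Cmod (c * z ^ n) <= Cmod z).
  { intros z Hz. rewrite Cmod_mult, Hc, Rmult_1_l, Cmod_pow. destruct n as [|n]; [lia|].
    simpl. unfold inD in Hz. assert (H0 := Cmod_ge_0 z).
    assert (P := pow_le_1_compat (Cmod z) n ltac:(lra)). nra. }
  assert (Hcw : forall j, coef (fun z => c * z ^ n)%C j = if Nat.eq_dec n j then c else 0%C)
    by (intros; apply coef_monomial).
  assert (H0 : forall j, (j < n)%nat -> coef (fun z => c * z ^ n)%C j = 0%C).
  { intros j Hj. rewrite Hcw. destruct (Nat.eq_dec n j); [lia | reflexivity]. }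
  assert (Main : forall j, (1 <= j <= n)%nat -> coef f j = (gam * (er 1 1 * coef (fun z => c * z ^ n) j))%C).
  { intros j Hj. destruct (coef_gap f gam 1 _ Hw Hwz Hf n j ltac:(lia) ltac:(lia) H0) as [E Q].
    rewrite E, Q by lia. ring. }
  split.
  - rewrite Main by lia. rewrite Hcw. destruct (Nat.eq_dec n n); [|lia].
    rewrite er_1. replace (-2 * 1 * exp (- (1))) with (- (2 / exp 1)).
    + ring.
    + rewrite exp_m1. field. apply Rgt_not_eq, exp_pos.
  - intros j Hj. rewrite Main, H0 by lia. ring.
Qed.

Lemma f_extr_eq n z : (1 <= n)%nat -> inD z -> f_extr n z = Atom 1 ((- (1)) * z ^ n)%C.
Proof.
  intros Hn Hz. unfold f_extr, Atom. f_equal.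
  assert (H := one_minus_neq0 (- (1) * z ^ n)%C (inD_pow_unit (- (1))%C z n Hn Cmod_m1 Hz)).
  replace (1 - - (1) * z ^ n)%C with (z ^ n + 1)%C in * by ring.
  field. exact H.
Qed.

Lemma B0_ext f g : (forall z, inD z -> f z = g z) -> B0 f -> B0 g.
Proof.
  intros H [Hf Hb]. split; [eapply holo_ext; eassumption|]. intros z Hz. rewrite <- H; auto.
Qed.

Lemma f_extr_B0 n : (1 <= n)%nat -> B0 (f_extr n) /\ coef (f_extr n) n = RtoC (2 / exp 1).
Proof.
  intros Hn. assert (H1 : Cmod 1 = 1) by apply Cmod_1.
  assert (E : forall z, inD z -> f_extr n z = (1 * Atom 1 ((- (1)) * z ^ n))%C)
    by (intros z Hz; rewrite (f_extr_eq n z Hn Hz); ring).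
  split.
  - eapply B0_ext; [intros z Hz; symmetry; apply E, Hz|].
    apply B0_model; try exact Hn; try apply Cmod_m1; try exact H1. lra.
  - destruct (coef_model (f_extr n) 1 (- (1)) n H1 Cmod_m1 Hn E) as [Ec _]. rewrite Ec.
    rewrite RtoC_opp. ring.
Qed.

Lemma B0_scal gam f : Cmod gam = 1 -> B0 f -> B0 (fun z => gam * f z)%C.
Proof.
  intros Hg [Hf Hb]. split; [apply holo_scal, Hf|]. intros z Hz.
  rewrite Cmod_mult, Hg, Rmult_1_l. apply Hb, Hz.
Qed.

(** Multiplying [f] by a unimodular constant competes with the value [Cmod (coef f n)], hence the
    real part attains the modulus. *)
Lemma extremal_real n f : (1 <= n)%nat -> extremal n f ->
  exists A, 2 / exp 1 <= A /\ coef f n = RtoC A.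
Proof.
  intros Hn He. apply extremal_coef in He. destruct He as [HB H].
  destruct (f_extr_B0 n Hn) as [HF HFc]. assert (H1 := H _ HF). rewrite HFc, Re_R in H1.
  exists (Re (coef f n)). split; [exact H1|].
  destruct (polar (coef f n)) as [th Hth].
  assert (H2 := H _ (B0_scal (Cis (- th)) f (Cmod_Cis _) HB)).
  rewrite coef_scal in H2 by apply HB.
  assert (E : (Cis (- th) * coef f n)%C = RtoC (Cmod (coef f n))).
  { rewrite Hth at 1. replace (Cis (- th) * (Cmod (coef f n) * Cis th))%C with (Cmod (coef f n) * (Cis (- th) * Cis th))%C by ring.
    rewrite <- Cis_add. replace (- th + th) with 0 by ring. rewrite Cis_0. ring. }
  rewrite E, Re_R in H2. assert (S := Cmod_sqr (coef f n)). assert (H0 := Cmod_ge_0 (coef f n)).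
  assert (H3 := Re_le_mod (coef f n)).
  apply C_ext; [reflexivity|]. rewrite Im_R. nra.
Qed.

(** * First variations and the dual polynomial *)

Lemma holo_bounded p r : holo_D p -> 0 < r < 1 -> exists M, 0 < M /\ forall z, Cmod z <= r -> Cmod (p z) <= M.
Proof.
  intros Hp Hr. set (s := (1 + r) / 2). assert (Hs : r < s < 1) by (unfold s; lra).
  destruct (radius1_coef p Hp s) as [M HM]; [lra|].
  assert (HM0 : 0 <= M) by (generalize (HM 0%nat) (Cmod_ge_0 (coef p 0)); simpl; lra).
  assert (Hq : 0 <= r / s < 1).
  { split; [apply Rdiv_le_0_compat; lra|]. apply Rmult_lt_reg_r with s; [lra|].
    unfold Rdiv. rewrite Rmult_assoc, Rinv_l; lra. }
  exists (M / (1 - r / s) + 1). split.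
  { assert (0 <= M / (1 - r / s)) by (apply Rdiv_le_0_compat; lra). lra. }
  intros z Hz. assert (Hzd : inD z) by (unfold inD; lra).
  assert (T := Cseries_tail (fun k => coef p k * z ^ k)%C (p z) M (r / s) 0 Hq).
  simpl in T. rewrite Rmult_1_r in T. replace (p z - 0)%C with (p z) in T by ring.
  eapply Rle_trans; [apply T|lra].
  - intros k. eapply Rle_trans; [apply (term_bound _ z s M); [lra | exact HM]|].
    apply Rmult_le_compat_l; [exact HM0|]. apply pow_incr.
    assert (H0 := Cmod_ge_0 z). assert (0 < / s) by (apply Rinv_0_lt_compat; lra).
    split; [apply Rdiv_le_0_compat; lra|]. apply Rmult_le_compat_r; lra.
  - apply coef_series; assumption.
Qed.

(** To first order the competitor changes the [n]-th coefficient by [- eps * c]. Were [Re c]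
    negative, this gain would beat the quadratic remainder for small [eps]. *)
Lemma variation n f p : extremal n f -> holo_D p ->
  (forall eps, 0 < eps < 1 -> B0 (fun z => f z * Cexp (- (eps * p z)))%C) ->
  0 <= Re (coef (fun z => f z * p z)%C n).
Proof.
  intros He Hp Hvar. apply extremal_coef in He. destruct He as [[Hf Hb] He].
  destruct (holo_bounded p (1 / 2) Hp ltac:(lra)) as [M [HM0 HM]].
  set (c := coef (fun z => f z * p z)%C n).
  apply Rnot_lt_le. intros Hneg.
  assert (Hfp : holo_D (fun z => f z * p z)%C) by (apply holo_mult; assumption).
  (* The factor [2 ^ n] is Cauchy's estimate on radius [1 / 2], and [20] comes from [Cexp_quad]. *)
  set (K := 2 ^ n * (20 * (M * M))).
  assert (HK : 0 < K) by (unfold K; apply Rmult_lt_0_compat; [apply pow_lt; lra | nra]).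
  (* The first entry brings the exponent into the range of [Cexp_quad]; the second makes [K * eps^2]
     at most half of the gain. *)
  set (eps := Rmin (/ (2 * (M + 1))) (- Re c / (2 * K))).
  assert (HM1 : 0 < / (2 * (M + 1))) by (apply Rinv_0_lt_compat; lra).
  assert (Hep : 0 < eps) by (apply Rmin_pos; [exact HM1 | apply Rdiv_lt_0_compat; lra]).
  assert (He1 : eps <= / (2 * (M + 1))) by apply Rmin_l.
  assert (He2 : eps <= - Re c / (2 * K)) by apply Rmin_r.
  assert (HeM : eps * (2 * (M + 1)) <= 1).
  { apply (Rmult_le_compat_r (2 * (M + 1))) in He1; [|lra]. rewrite Rinv_l in He1; lra. }
  assert (HeK : eps * K <= - Re c / 2).
  { apply (Rmult_le_compat_r K) in He2; [|lra]. replace (- Re c / (2 * K) * K) with (- Re c / 2) in He2 by (field; lra). exact He2. }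
  assert (Hlt1 : 0 < eps < 1) by nra.
  set (Rm := fun z => (f z * (Cexp (- (eps * p z)) - 1 - - (eps * p z)))%C).
  assert (HRm : holo_D Rm).
  { apply holo_mult; [exact Hf|]. apply holo_minus; [apply holo_minus|].
    - apply holo_Cexp, holo_opp, holo_scal, Hp.
    - apply holo_const.
    - apply holo_opp, holo_scal, Hp. }
  assert (HE : coef (fun z => f z * Cexp (- (eps * p z)))%C n = (coef f n + (- eps * c + coef Rm n))%C).
  { rewrite (coef_ext_D _ (fun z => f z + ((RtoC (- eps)) * (f z * p z) + Rm z))%C).
    - assert (Hs : holo_D (fun z => RtoC (- eps) * (f z * p z))%C) by exact (holo_scal _ _ Hfp).
      rewrite (coef_plus f (fun z => RtoC (- eps) * (f z * p z) + Rm z)%C n Hf (holo_plus _ _ Hs HRm)).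
      rewrite (coef_plus _ Rm n Hs HRm), (coef_scal _ _ n Hfp), RtoC_opp. reflexivity.
    - intros z _. unfold Rm. rewrite RtoC_opp. ring. }
  assert (HB := He _ (Hvar eps Hlt1)). rewrite HE, !Re_plus, <- RtoC_opp, Re_Rmult in HB.
  assert (HR : Cmod (coef Rm n) * (1 / 2) ^ n <= 20 * (M * M) * (eps * eps)).
  { apply coef_bound; [exact HRm | lra|]. intros z Hz.
    assert (Hzd : inD z) by (unfold inD; lra).
    unfold Rm. rewrite Cmod_mult.
    assert (Hpz := HM z ltac:(lra)).
    assert (Hx : Cmod (- (eps * p z)) = eps * Cmod (p z)).
    { rewrite Cmod_opp, Cmod_mult, Cmod_R, Rabs_pos_eq; lra. }
    assert (Hxb : eps * Cmod (p z) <= eps * M) by (apply Rmult_le_compat_l; lra).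
    assert (Q : Cmod (Cexp (- (eps * p z)) - 1 - - (eps * p z)) <= 20 * (Cmod (- (eps * p z)) * Cmod (- (eps * p z)))).
    { apply Cexp_quad. rewrite Hx. lra. }
    rewrite Hx in Q. destruct (Hb z Hzd) as [Hf0 Hf1]. assert (Hpz0 := Cmod_ge_0 (p z)).
    assert (Hsq : eps * Cmod (p z) * (eps * Cmod (p z)) <= eps * M * (eps * M)) by (apply Rmult_le_compat; nra).
    assert (Q0 := Cmod_ge_0 (Cexp (- (eps * p z)) - 1 - - (eps * p z))). nra. }
  assert (HR2 : Cmod (coef Rm n) <= K * (eps * eps)).
  { assert (P2 : 0 < 2 ^ n) by (apply pow_lt; lra).
    apply (Rmult_le_compat_l (2 ^ n)) in HR; [|lra].
    replace (2 ^ n * (Cmod (coef Rm n) * (1 / 2) ^ n)) with (Cmod (coef Rm n) * ((2 * (1 / 2)) ^ n)) in HR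
      by (rewrite Rpow_mult_distr; ring).
    replace (2 * (1 / 2)) with 1 in HR by field. rewrite pow1 in HR. unfold K. lra. }
  assert (HRe := re_le_Cmod (coef Rm n)). apply Rabs_le_between in HRe. nra.
Qed.

Definition cay (al z : C) : C := ((1 + al * z) / (1 - al * z))%C.

Lemma inD_unit_mult (al z : C) : Cmod al = 1 -> inD z -> inD (al * z)%C.
Proof. unfold inD. intros Ha Hz. rewrite Cmod_mult, Ha, Rmult_1_l. exact Hz. Qed.

Lemma cay_den al z : Cmod al = 1 -> inD z -> (1 - al * z)%C <> 0%C.
Proof. intros Ha Hz. apply one_minus_neq0, inD_unit_mult; assumption. Qed.

Lemma holo_cay al : Cmod al = 1 -> holo_D (cay al).
Proof.
  intros Ha. apply holo_div.
  - intros z Hz. apply cay_den; assumption.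
  - apply holo_plus; [apply holo_const | apply holo_scal, holo_id].
  - apply holo_minus; [apply holo_const | apply holo_scal, holo_id].
Qed.

Lemma coef_cay al k : Cmod al = 1 -> coef (cay al) k = if Nat.eq_dec k 0 then 1%C else (2 * al ^ k)%C.
Proof.
  intros Ha. symmetry.
  apply (coef_unique (cay al) (fun k => if Nat.eq_dec k 0 then RtoC 1 else (2 * al ^ k)%C) k (holo_cay al Ha)).
  intros z Hz. set (q := (al * z)%C).
  assert (Hq : inD q) by (apply inD_unit_mult; assumption). assert (Hn := one_minus_neq0 q Hq).
  apply Clim_ext_loc with (fun n => 2 * ((1 - q ^ n) / (1 - q)) - 1)%C.
  - exists 1%nat. intros n Hn1. destruct n as [|n]; [lia|].
    rewrite Csum_S_l. simpl (Nat.eq_dec 0 0). cbv iota.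
    rewrite (Csum_ext _ (fun k => 2 * q * q ^ k)%C).
    + rewrite (Csum_scal (2 * q) (fun k => q ^ k)%C n). assert (G := geom_finite q n).
      replace (Csum (fun k => q ^ k)%C n) with ((1 - q) * Csum (fun k => q ^ k) n / (1 - q))%C by (field; exact Hn).
      rewrite G. simpl. field. exact Hn.
    + intros j _. simpl. unfold q. rewrite Cpow_mult_l. ring.
  - apply Clim_eq with (2 * ((1 - 0) / (1 - q)) - 1)%C.
    + unfold cay. fold q. field. exact Hn.
    + apply Clim_minus; [|apply Clim_const]. apply Clim_scal.
      apply Clim_mult; [|apply Clim_const]. apply Clim_minus; [apply Clim_const|].
      apply geom_lim, Hq.
Qed.

Lemma B0_exp_var f p eps : B0 f -> holo_D p -> 0 <= eps -> (forall z, inD z -> 0 <= Re (p z)) ->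
  B0 (fun z => f z * Cexp (- (eps * p z)))%C.
Proof.
  intros [Hf Hb] Hp He HRe. split.
  - apply holo_mult; [exact Hf | apply holo_Cexp, holo_opp, holo_scal, Hp].
  - intros z Hz. destruct (Hb z Hz) as [H1 H2].
    rewrite Cmod_mult, Cmod_Cexp, Re_opp, Re_Rmult. assert (Hx := exp_pos (- (eps * Re (p z)))).
    assert (Hx1 : exp (- (eps * Re (p z))) <= 1).
    { rewrite <- exp_0. assert (H := Rmult_le_pos _ _ He (HRe z Hz)).
      destruct H as [H|H]; [left; apply exp_increasing; lra | right; f_equal; lra]. }
    split; [apply Rmult_lt_0_compat; lra | nra].
Qed.

(* The dual trigonometric polynomial of the extremal problem. *)
Definition Sdual (f : C -> C) (n : nat) (u : C) : C :=
  (coef f n + 2 * Csum (fun k => coef f k * u ^ (n - k)) n)%C.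

(** Variation by the Herglotz kernel [cay u], whose real part is positive in the disc; its
    coefficients [1, 2 u, 2 u^2, ...] turn the first-order term into [Sdual]. *)
Lemma Sdual_nonneg n f u : extremal n f -> Cmod u = 1 -> 0 <= Re (Sdual f n u).
Proof.
  intros He Hu.
  assert (HB : B0 f) by (apply extremal_coef in He; apply He).
  replace (Sdual f n u) with (coef (fun z => f z * cay u z)%C n).
  - apply (variation n f (cay u) He (holo_cay u Hu)). intros eps Hep.
    apply B0_exp_var; [exact HB | apply holo_cay, Hu | lra |].
    intros z Hz. left. apply (Re_cayley_pos (u * z)%C), inD_unit_mult; assumption.
  - rewrite (coef_mult f (cay u) n (proj1 HB) (holo_cay u Hu)).
    change (Csum (fun k => coef f k * coef (cay u) (n - k)) (S n))%C
      with (Csum (fun k => coef f k * coef (cay u) (n - k)) n + coef f n * coef (cay u) (n - n))%C.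
    rewrite (Csum_ext _ (fun k => 2 * (coef f k * u ^ (n - k)))%C).
    + rewrite Csum_scal, coef_cay, Nat.sub_diag by exact Hu. unfold Sdual. simpl. ring.
    + intros k Hk. rewrite coef_cay by exact Hu. destruct (Nat.eq_dec (n - k) 0); [lia | ring].
Qed.

(** * The boundary measure of an extremal function lives on the zeros of the dual weight *)

Section Structure.
Variables (n : nat) (f h : C -> C) (A : R).
Hypothesis Hn : (1 <= n)%nat.
Hypothesis Hext : extremal n f.
Hypothesis HA : coef f n = RtoC A.
Hypothesis HApos : 0 < A.
Hypothesis Hh : holo_D h.
Hypothesis Hfh : forall z, inD z -> f z = Cexp (- h z).
Hypothesis HRe : forall z, inD z -> 0 <= Re (h z).

Lemma ext_B0 : B0 f.
Proof. apply extremal_coef in Hext. apply Hext. Qed.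

(** The powers [f^(1 + eps)] and [f^(1 - eps)] both stay in the class, so the first variation along
    [h] has both signs. *)
Lemma Re_coef_fh : Re (coef (fun z => f z * h z)%C n) = 0.
Proof.
  assert (HB := ext_B0). assert (Hf := proj1 HB).
  assert (H1 : 0 <= Re (coef (fun z => f z * h z)%C n)).
  { apply (variation n f h Hext Hh). intros eps He. apply B0_exp_var; try assumption. lra. }
  assert (H2 : 0 <= Re (coef (fun z => f z * (- h z))%C n)).
  { apply (variation n f (fun z => - h z)%C Hext (holo_opp _ Hh)). intros eps He.
    apply B0_ext with (fun z => 1 * Cexp (- (RtoC (1 - eps) * h z)))%C.
    - intros z Hz. rewrite (Hfh z Hz), <- Cexp_add, Cmult_1_l. f_equal. rewrite RtoC_minus. ring.
    - apply (B0_exp_var (fun _ => RtoC 1)); try assumption; [|lra].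
      split; [apply holo_const|]. intros z _. rewrite Cmod_1. lra. }
  rewrite (coef_ext_D _ (fun z => - (f z * h z))%C) in H2 by (intros; ring).
  rewrite coef_opp, Re_opp in H2 by (apply holo_mult; assumption). lra.
Qed.

(** The Fourier coefficients of [Re h] with the power of the radius removed: the moments of the
    measure of which [h] is, up to an imaginary constant, the Herglotz transform. *)
Definition mom (k : nat) : C := if Nat.eq_dec k 0 then RtoC (Re (h 0%C)) else (coef h k / 2)%C.

Lemma avg_Re_h r k : 0 < r < 1 ->
  avg (fun t => RtoC (Re (h (circ r t))) * Cis (- INR k * t))%C = (mom k * RtoC r ^ k)%C.
Proof using Hh.
  clear n Hn Hext HA.
  intros Hr. assert (Hc := holo_circ h r Hh Hr).
  assert (C1 : cont2pi (fun t => h (circ r t) * Cis (- INR k * t))%C) by (apply cont_mult; [exact Hc | apply cont_Cis_lin]).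
  assert (C3 : cont2pi (fun t => h (circ r t) * Cis (INR k * t))%C) by (apply cont_mult; [exact Hc | apply cont_Cis_lin]).
  assert (C2 : cont2pi (fun t => Cconj (h (circ r t) * Cis (INR k * t)))%C) by (intros t; apply Rcont_conj, C3).
  rewrite (avg_ext _ (fun t => / 2 * (h (circ r t) * Cis (- INR k * t) + Cconj (h (circ r t) * Cis (INR k * t))))%C).
  - rewrite avg_scal by (intros t; apply Rcont_plus; [apply C1 | apply C2]).
    rewrite (avg_plus _ _ C1 C2), (avg_coef h r k Hh Hr), (avg_conj _ C3).
    unfold mom. destruct (Nat.eq_dec k 0) as [->|Hk].
    + rewrite (avg_ext _ (fun t => h (circ r t))).
      * rewrite avg_mean, coef_0 by assumption. rewrite re_alt. simpl. field.
      * intros t. simpl. rewrite Rmult_0_l, Cis_0. ring.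
    + rewrite avg_coef_neg by (try assumption; lia). rewrite RtoC_pow.
      replace (Cconj 0) with (RtoC 0) by (apply C_ext; simpl; ring). field.
  - intros t. rewrite re_alt, Cmult_conj, Cis_conj.
    replace (- (INR k * t)) with (- INR k * t) by ring. field.
Qed.

Lemma cont_Reh r : 0 < r < 1 -> cont2pi (fun t => RtoC (Re (h (circ r t)))).
Proof. intros Hr t. apply Rcont_Re. apply holo_circ; assumption. Qed.

Definition ccirc (q : C -> C) : Prop := forall u, Cmod u = 1 -> Ccont q u.

Lemma cont_ccirc q : ccirc q -> cont2pi (fun t => q (Cis (- t))).
Proof.
  intros Hq t. apply (Rcont_comp (fun t => Cis (- t)) q).
  - assert (H := cont_Cis_lin (-1) t). revert H. unfold Rcont. intros H.
    apply Clim_ext with (fun s => Cis (-1 * s)); [intros s; f_equal; ring|].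
    apply Clim_eq with (Cis (-1 * t)); [f_equal; ring | exact H].
  - apply Hq, Cmod_Cis.
Qed.

(** The approximating measure on radius [r]. The point [Cis (- t)] is the reflected one because
    [cay al] has its pole at the conjugate of the unimodular [al]; in this way [u^k] integrates to
    [mom k * r^k]. *)
Definition mu (r : R) (q : C -> C) : C := avg (fun t => RtoC (Re (h (circ r t))) * q (Cis (- t)))%C.

Lemma mu_poly r c d : 0 < r < 1 ->
  mu r (fun u => Csum (fun k => c k * u ^ k)%C d) = Csum (fun k => c k * (mom k * RtoC r ^ k))%C d.
Proof.
  intros Hr. unfold mu.
  set (T := fun k t => (RtoC (Re (h (circ r t))) * Cis (- INR k * t))%C).
  assert (HT : forall k, cont2pi (T k)) by (intros k; apply cont_mult; [apply cont_Reh, Hr | apply cont_Cis_lin]).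
  rewrite (avg_ext _ (fun t => Csum (fun k => c k * T k t)%C d)).
  - rewrite (avg_sum (fun k t => c k * T k t)%C) by (intros k _ t; apply Rcont_scal, HT).
    apply Csum_ext. intros k _. rewrite avg_scal by apply HT. unfold T. rewrite avg_Re_h by exact Hr. reflexivity.
  - intros t. rewrite <- Csum_scal. apply Csum_ext. intros k _. unfold T.
    rewrite Cis_pow. replace (INR k * - t) with (- INR k * t) by ring. ring.
Qed.

Lemma mu_plus r q1 q2 : 0 < r < 1 -> ccirc q1 -> ccirc q2 -> mu r (fun u => q1 u + q2 u)%C = (mu r q1 + mu r q2)%C.
Proof.
  intros Hr H1 H2. unfold mu.
  rewrite (avg_ext _ (fun t => RtoC (Re (h (circ r t))) * q1 (Cis (- t)) + RtoC (Re (h (circ r t))) * q2 (Cis (- t)))%C) by (intros; ring).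
  apply avg_plus; (apply cont_mult; [apply cont_Reh, Hr | apply cont_ccirc; assumption]).
Qed.

Lemma mu_scal r c q : 0 < r < 1 -> ccirc q -> mu r (fun u => c * q u)%C = (c * mu r q)%C.
Proof.
  intros Hr H. unfold mu.
  rewrite (avg_ext _ (fun t => c * (RtoC (Re (h (circ r t))) * q (Cis (- t))))%C) by (intros; ring).
  apply avg_scal, cont_mult; [apply cont_Reh, Hr | apply cont_ccirc, H].
Qed.

Lemma circ_inD r t : 0 < r < 1 -> inD (circ r t).
Proof. intros Hr. unfold inD. rewrite Cmod_circ; lra. Qed.

Lemma mu_le r q1 q2 : 0 < r < 1 -> ccirc q1 -> ccirc q2 ->
  (forall u, Cmod u = 1 -> Re (q1 u) <= Re (q2 u)) -> Re (mu r q1) <= Re (mu r q2).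
Proof.
  intros Hr H1 H2 H. apply avg_le; try (apply cont_mult; [apply cont_Reh, Hr | apply cont_ccirc; assumption]).
  intros t. rewrite !Re_Rmult. apply Rmult_le_compat_l; [apply HRe, circ_inD, Hr | apply H, Cmod_Cis].
Qed.

Lemma ccirc_mod q : ccirc q -> ccirc (fun u => RtoC (Cmod (q u))).
Proof. intros H u Hu. apply Clim_mod, H, Hu. Qed.

Lemma mu_mod r q : 0 < r < 1 -> ccirc q -> Cmod (mu r q) <= Re (mu r (fun u => RtoC (Cmod (q u)))).
Proof.
  intros Hr H. unfold mu. eapply Rle_trans.
  - apply avg_mod. apply cont_mult; [apply cont_Reh, Hr | apply cont_ccirc, H].
  - right. f_equal. apply avg_ext. intros t. rewrite Cmod_mult, Cmod_R, RtoC_mult.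
    rewrite Rabs_pos_eq; [reflexivity | apply HRe, circ_inD, Hr].
Qed.

Definition wt (u : C) : C := RtoC (Re (Sdual f n u)).

Lemma Ccont_Sdual u : Ccont (Sdual f n) u.
Proof.
  unfold Ccont, Sdual. apply Clim_plus; [apply Clim_const|]. apply Clim_scal.
  apply (Clim_sum (fun k u => coef f k * u ^ (n - k))%C). intros k _. apply Clim_scal, Clim_pow, Ccont_id.
Qed.

Lemma ccirc_wt : ccirc wt.
Proof. intros u _. apply Clim_Re, Ccont_Sdual. Qed.

Lemma mu_Re r q : 0 < r < 1 -> ccirc q -> mu r (fun u => RtoC (Re (q u))) = RtoC (Re (mu r q)).
Proof.
  intros Hr Hq. unfold mu. rewrite <- avg_Re.
  - apply avg_ext. intros t. rewrite Re_Rmult, RtoC_mult. reflexivity.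
  - apply cont_mult; [apply cont_Reh, Hr | apply cont_ccirc, Hq].
Qed.

Lemma Sdual_poly u : Sdual f n u = Csum (fun k => (if Nat.eq_dec k 0 then coef f n else 2 * coef f (n - k)) * u ^ k)%C (S n).
Proof.
  rewrite Csum_S_l. unfold Sdual. simpl (Nat.eq_dec 0 0). cbv iota. rewrite <- Csum_scal.
  f_equal; [simpl; ring|]. rewrite <- Csum_rev. apply Csum_ext. intros k Hk.
  replace (n - (n - 1 - k))%nat with (S k) by lia. replace (n - 1 - k)%nat with (n - S k)%nat by lia.
  destruct (Nat.eq_dec (S k) 0); [lia|]. ring.
Qed.

(** Complementary slackness: the moments pair with the coefficients of the dual polynomial exactly
    to [Re (coef (f h) n)], which is zero. *)
Lemma mu_wt_lim : Clim (at_left 1) (fun r => mu r wt) 0%C.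
Proof.
  set (c := fun k => (if Nat.eq_dec k 0 then coef f n else 2 * coef f (n - k))%C).
  apply Clim_ext_loc with (fun r => RtoC (Re (Csum (fun k => c k * (mom k * RtoC r ^ k)) (S n))%C)).
  - generalize at_left1_pos. apply filter_imp. intros r Hr. rewrite <- mu_poly by exact Hr.
    unfold wt. rewrite (mu_Re r (Sdual f n)) by (try exact Hr; intros u _; apply Ccont_Sdual).
    do 2 f_equal. unfold mu. apply avg_ext. intros t. rewrite Sdual_poly. reflexivity.
  - apply Clim_eq with (RtoC (Re (Csum (fun k => c k * (mom k * 1 ^ k)) (S n))%C)).
    + f_equal.
      (* The product at index zero involves all of [h 0], the measure only its real part; the
         difference is imaginary and drops out since [coef f n] is real. *)
      assert (E : (coef f n * RtoC (Re (h 0%C)) + coef f n * (coef h 0 - RtoC (Re (h 0%C))))%C = (coef f n * coef h 0)%C) by ring.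
      rewrite <- Re_coef_fh.
      rewrite (coef_mult f h n (proj1 ext_B0) Hh).
      rewrite Csum_S_l. change (Csum (fun k => coef f k * coef h (n - k)) (S n))%C
        with (Csum (fun k => coef f k * coef h (n - k)) n + coef f n * coef h (n - n))%C.
      rewrite Nat.sub_diag, <- E, HA, coef_0 by exact Hh.
      rewrite !Re_plus, !Re_Rmult, Re_minus, Re_R.
      replace (c 0%nat * (mom 0 * 1 ^ 0))%C with (A * Re (h 0%C))%C.
      * rewrite Re_Rmult, Re_R.
        replace (Re (Csum (fun k => c (S k) * (mom (S k) * 1 ^ S k)) n)%C) with (Re (Csum (fun k => coef f k * coef h (n - k)) n)%C).
        -- lra.
        -- f_equal. rewrite <- Csum_rev. apply Csum_ext. intros k Hk. unfold c, mom.
           destruct (Nat.eq_dec (S k) 0); [lia|]. rewrite Cpow_1.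
           replace (n - 1 - k)%nat with (n - S k)%nat by lia. replace (n - (n - S k))%nat with (S k) by lia. field.
      * unfold c, mom. simpl. rewrite HA. ring.
    + apply Clim_Re. apply (Clim_sum (fun k (r : R) => c k * (mom k * RtoC r ^ k))%C). intros k _.
      apply Clim_scal, Clim_scal, Clim_pow, Clim_left1.
Qed.

Lemma mu_one r : 0 < r < 1 -> mu r (fun _ => RtoC 1) = RtoC (Re (h 0%C)).
Proof.
  intros Hr. unfold mu. rewrite (avg_ext _ (fun t => RtoC (Re (h (circ r t))) * Cis (- INR 0 * t))%C).
  - rewrite avg_Re_h by exact Hr. unfold mom. simpl. ring.
  - intros t. simpl. rewrite Ropp_0, Rmult_0_l, Cis_0. reflexivity.
Qed.

(** An argument in a fixed compact interval, on which extrema over the circle are attained. *)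
Lemma circle_arg (u : C) : Cmod u = 1 -> exists t, - PI <= t <= PI /\ u = Cis t.
Proof.
  intros H. destruct (unit_arg u H) as [t _].
  assert (H2 := Cmod_sqr u). rewrite H in H2.
  assert (Hb : -1 <= Re u <= 1) by nra. assert (Hac := acos_bound (Re u)).
  destruct (Rle_dec 0 (Im u)) as [Hi|Hi].
  - exists (acos (Re u)). split; [lra|]. apply C_ext; unfold Cis; [unfold Re at 2 | unfold Im at 2]; cbn [fst snd].
    + rewrite cos_acos; [reflexivity | exact Hb].
    + rewrite sin_acos by exact Hb. rewrite <- (sqrt_Rsqr (Im u)) by exact Hi. f_equal.
      unfold Rsqr. lra.
  - exists (- acos (Re u)). split; [lra|]. apply C_ext; unfold Cis; [unfold Re at 2 | unfold Im at 2]; cbn [fst snd].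
    + rewrite cos_neg, cos_acos; [reflexivity | exact Hb].
    + rewrite sin_neg, sin_acos by exact Hb.
      replace (1 - (Re u)²) with (Rsqr (- Im u)) by (unfold Rsqr; lra).
      rewrite sqrt_Rsqr by lra. ring.
Qed.

Lemma ccirc_const c : ccirc (fun _ => c).
Proof. intros u _. apply Clim_const. Qed.

Lemma ccirc_plus q1 q2 : ccirc q1 -> ccirc q2 -> ccirc (fun u => q1 u + q2 u)%C.
Proof. intros H1 H2 u Hu. apply Clim_plus; [apply H1 | apply H2]; exact Hu. Qed.

Lemma ccirc_scal c q : ccirc q -> ccirc (fun u => c * q u)%C.
Proof. intros H u Hu. apply Clim_scal, H, Hu. Qed.

(** Compactness: [q] is small near the zeros of [wt], and elsewhere [wt] has a positive lower
    bound. *)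
Lemma circle_domination q eps : ccirc q -> 0 < eps ->
  (forall u, Cmod u = 1 -> wt u = 0%C -> q u = 0%C) ->
  exists K, 0 <= K /\ forall u, Cmod u = 1 -> Cmod (q u) <= eps + K * Re (wt u).
Proof.
  intros Hq He Hz.
  set (g := fun u => (eps + (- (1)) * RtoC (Cmod (q u)))%C).
  (* This is [wt + max (eps - |q|, 0)], positive everywhere on the circle. With [m] its minimum and
     [M] the maximum of [|q|], the constant [M / m] works: where [|q| > eps], [F] is [wt] alone. *)
  set (F := fun u => (wt u + / 2 * (g u + RtoC (Cmod (g u))))%C).
  assert (Hg : ccirc g) by (apply ccirc_plus; [apply ccirc_const | apply ccirc_scal, ccirc_mod, Hq]).
  assert (HF : ccirc F).
  { apply ccirc_plus; [apply ccirc_wt|]. apply ccirc_scal, ccirc_plus; [exact Hg | apply ccirc_mod, Hg]. }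
  assert (HgR : forall u, g u = RtoC (eps - Cmod (q u))) by (intros u; unfold g; rewrite RtoC_minus; ring).
  assert (HFR : forall u, Re (F u) = Re (wt u) + / 2 * ((eps - Cmod (q u)) + Rabs (eps - Cmod (q u)))).
  { intros u. unfold F. rewrite HgR, Cmod_R, <- RtoC_plus, <- RtoC_inv, <- RtoC_mult, Re_plus, Re_R by lra. reflexivity. }
  assert (Hw0 : forall u, Cmod u = 1 -> 0 <= Re (wt u)).
  { intros u Hu. unfold wt. rewrite Re_R. apply Sdual_nonneg; assumption. }
  assert (HFc : forall t, continuity_pt (fun t => Re (F (Cis t))) t).
  { intros t. apply continuity_pt_filterlim. apply (Clim_locally_cont (fun t => F (Cis t)) t).
    apply (Rcont_comp Cis F); [apply Rcont_Cis | apply HF, Cmod_Cis]. }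
  assert (HqC : forall t, continuity_pt (fun t => Re (RtoC (Cmod (q (Cis t))))) t).
  { intros t. apply continuity_pt_filterlim. apply (Clim_locally_cont (fun t => RtoC (Cmod (q (Cis t)))) t).
    apply Rcont_mod. apply (Rcont_comp Cis q); [apply Rcont_Cis | apply Hq, Cmod_Cis]. }
  assert (Hpi : - PI <= PI) by (generalize PI_RGT_0; lra).
  destruct (continuity_ab_min (fun t => Re (F (Cis t))) (- PI) PI Hpi (fun t _ => HFc t)) as [t0 [Hm _]].
  destruct (continuity_ab_maj (fun t => Re (RtoC (Cmod (q (Cis t))))) (- PI) PI Hpi (fun t _ => HqC t)) as [t1 [HM _]].
  set (m := Re (F (Cis t0))) in *. set (M := Re (RtoC (Cmod (q (Cis t1))))) in *.
  assert (HM0 : 0 <= M) by (unfold M; rewrite Re_R; apply Cmod_ge_0).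
  assert (Hmpos : 0 < m).
  { unfold m. rewrite HFR. set (u := Cis t0). assert (Hu : Cmod u = 1) by apply Cmod_Cis.
    assert (H0 := Hw0 u Hu). destruct (Rle_lt_or_eq_dec _ _ H0) as [H1|H1].
    - assert (Ha := Rle_abs (- (eps - Cmod (q u)))). rewrite Rabs_Ropp in Ha. lra.
    - rewrite (Hz u Hu), Cmod_0 by (unfold wt in *; rewrite Re_R in H1; rewrite <- H1; reflexivity).
      rewrite Rabs_pos_eq; lra. }
  exists (M / m). split; [apply Rdiv_le_0_compat; assumption|].
  intros u Hu. destruct (circle_arg u Hu) as [t [Ht ->]].
  specialize (Hm t Ht). specialize (HM t Ht). cbv beta in Hm, HM. rewrite Re_R in HM.
  assert (H0 := Hw0 (Cis t) Hu).
  assert (HMm : 0 <= M / m) by (apply Rdiv_le_0_compat; assumption).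
  assert (HMw : 0 <= M / m * Re (wt (Cis t))) by (apply Rmult_le_pos; assumption).
  destruct (Rle_dec (Cmod (q (Cis t))) eps) as [Hle|Hgt]; [lra|].
  rewrite HFR, Rabs_left in Hm by lra.
  assert (M <= M / m * Re (wt (Cis t))); [|lra].
  apply Rle_trans with (M / m * m); [right; field; lra|]. apply Rmult_le_compat_l; lra.
Qed.

(** By domination, the integral of [|q|] is at most [e1] times the total mass plus [K] times the
    integral of [wt], and the latter tends to zero. *)
Lemma mu_vanish q : ccirc q -> (forall u, Cmod u = 1 -> wt u = 0%C -> q u = 0%C) ->
  Clim (at_left 1) (fun r => mu r q) 0%C.
Proof.
  intros Hq Hz eps He. set (T := Re (h 0%C)).
  assert (HT : 0 <= T) by (apply HRe, inD_0).
  set (e1 := eps / (2 * (T + 1))). assert (He1 : 0 < e1) by (apply Rdiv_lt_0_compat; lra).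
  destruct (circle_domination q e1 Hq He1 Hz) as [K [HK HKu]].
  set (e2 := eps / (2 * (K + 1))). assert (He2 : 0 < e2) by (apply Rdiv_lt_0_compat; lra).
  generalize (filter_and _ _ at_left1_pos (mu_wt_lim e2 He2)). apply filter_imp. intros r [Hr Hm].
  replace (mu r q - 0)%C with (mu r q) by ring. replace (mu r wt - 0)%C with (mu r wt) in Hm by ring.
  eapply Rle_lt_trans; [apply mu_mod; assumption|].
  apply Rle_lt_trans with (Re (mu r (fun u => e1 * 1 + K * wt u)%C)).
  - apply mu_le; [exact Hr | apply ccirc_mod, Hq | |].
    + apply ccirc_plus; [apply ccirc_const | apply ccirc_scal, ccirc_wt].
    + intros u Hu. rewrite Re_plus, !Re_Rmult, !Re_R, Rmult_1_r. apply HKu, Hu.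
  - rewrite (mu_plus r (fun _ => e1 * 1)%C (fun u => K * wt u)%C) by
      (try exact Hr; try apply ccirc_const; apply ccirc_scal, ccirc_wt).
    rewrite (mu_scal r e1 (fun _ => RtoC 1)), (mu_scal r K wt), mu_one by
      (try exact Hr; try apply ccirc_const; apply ccirc_wt).
    rewrite Re_plus, !Re_Rmult, Re_R. fold T.
    assert (Hmm := Re_le_mod (mu r wt)).
    assert (Hd1 : e1 * T < eps / 2).
    { unfold e1. apply Rlt_le_trans with (eps / (2 * (T + 1)) * (T + 1)).
      - apply Rmult_lt_compat_l; [exact He1 | lra].
      - right. field. lra. }
    assert (Hd2 : K * Re (mu r wt) <= eps / 2).
    { apply Rle_trans with (K * e2); [apply Rmult_le_compat_l; lra|].
      unfold e2. apply Rle_trans with (eps / (2 * (K + 1)) * (K + 1)).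
      - rewrite Rmult_comm. apply Rmult_le_compat_l; [left; exact He2 | lra].
      - right. field. lra. }
    lra.
Qed.
End Structure.

(** * Polynomial functions *)

Definition is_poly (d : nat) (p : C -> C) : Prop :=
  exists c : nat -> C, forall u, p u = Csum (fun k => c k * u ^ k)%C (S d).

Lemma is_poly_const c : is_poly 0 (fun _ => c).
Proof. exists (fun _ => c). intros u. simpl. ring. Qed.

Lemma is_poly_le d e p : (d <= e)%nat -> is_poly d p -> is_poly e p.
Proof.
  intros Hde [c Hc]. exists (fun k => if le_lt_dec k d then c k else RtoC 0). intros u.
  replace (S e) with (S d + (e - d))%nat by lia. rewrite Csum_add, Hc.
  rewrite (Csum_0 (fun k => (if le_lt_dec (S d + k) d then c (S d + k)%nat else RtoC 0) * u ^ (S d + k))%C).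
  - match goal with |- _ = (?a + _)%C => transitivity a; [|ring] end.
    apply Csum_ext. intros k Hk. destruct (le_lt_dec k d); [reflexivity | lia].
  - intros k _. destruct (le_lt_dec (S d + k) d); [lia | ring].
Qed.

Lemma is_poly_plus d p q : is_poly d p -> is_poly d q -> is_poly d (fun u => p u + q u)%C.
Proof.
  intros [a Ha] [b Hb]. exists (fun k => a k + b k)%C. intros u. rewrite Ha, Hb, <- Csum_plus.
  apply Csum_ext. intros; ring.
Qed.

Lemma is_poly_scal d c p : is_poly d p -> is_poly d (fun u => c * p u)%C.
Proof.
  intros [a Ha]. exists (fun k => c * a k)%C. intros u. rewrite Ha, <- Csum_scal.
  apply Csum_ext. intros; ring.
Qed.

Lemma is_poly_ext d p q : (forall u, p u = q u) -> is_poly d p -> is_poly d q.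
Proof. intros H [c Hc]. exists c. intros u. rewrite <- H. apply Hc. Qed.

Lemma is_poly_mulX d p : is_poly d p -> is_poly (S d) (fun u => u * p u)%C.
Proof.
  intros [a Ha]. exists (fun k => match k with O => RtoC 0 | S j => a j end). intros u.
  rewrite Csum_S_l, Ha, <- Csum_scal.
  match goal with |- _ = (_ + ?a)%C => transitivity a; [|ring] end.
  apply Csum_ext. intros k _. simpl. ring.
Qed.

Lemma is_poly_lin d p (a b : C) : is_poly d p -> is_poly (S d) (fun u => (a + b * u) * p u)%C.
Proof.
  intros H. apply is_poly_ext with (fun u => a * p u + b * (u * p u))%C; [intros; ring|].
  apply is_poly_plus.
  - apply is_poly_scal. apply is_poly_le with d; [lia | exact H].
  - apply is_poly_scal, is_poly_mulX, H.
Qed.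

Lemma is_poly_mul d e p q : is_poly d p -> is_poly e q -> is_poly (d + e) (fun u => p u * q u)%C.
Proof.
  intros Hp [c Hc].
  assert (H : forall m, (m <= e)%nat -> is_poly (d + e) (fun u => p u * Csum (fun k => c k * u ^ k) (S m))%C).
  { assert (Hm : forall m, (m <= e)%nat -> is_poly (d + e) (fun u => c m * (u ^ m * p u))%C).
    { intros m Hm. apply is_poly_scal. apply is_poly_le with (d + m)%nat; [lia|]. clear Hm.
      induction m as [|m IH].
      - rewrite Nat.add_0_r. apply is_poly_ext with p; [intros; simpl; ring | exact Hp].
      - rewrite Nat.add_succ_r. apply is_poly_ext with (fun u => u * (u ^ m * p u))%C; [intros; simpl; ring|].
        apply is_poly_mulX, IH. }
    induction m as [|m IH]; intros Hme.
    - apply is_poly_ext with (fun u => c 0%nat * (u ^ 0 * p u))%C; [intros; simpl; ring | apply Hm; lia].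
    - apply is_poly_ext with (fun u => p u * Csum (fun k => c k * u ^ k) (S m) + c (S m) * (u ^ S m * p u))%C.
      + intros u. change (Csum (fun k => c k * u ^ k) (S (S m)))%C with (Csum (fun k => c k * u ^ k) (S m) + c (S m) * u ^ S m)%C. ring.
      + apply is_poly_plus; [apply IH; lia | apply Hm, Hme]. }
  apply is_poly_ext with (fun u => p u * Csum (fun k => c k * u ^ k) (S e))%C; [intros u; rewrite Hc; reflexivity|].
  apply H. lia.
Qed.

Lemma is_poly_sum (p : nat -> C -> C) d n : (forall k, (k < n)%nat -> is_poly d (p k)) ->
  is_poly d (fun u => Csum (fun k => p k u) n).
Proof.
  induction n as [|n IH]; intros H; simpl.
  - apply is_poly_le with 0%nat; [lia | apply is_poly_const].
  - apply (is_poly_plus d (fun u => Csum (fun k => p k u) n)); [apply IH; auto with arith | apply H; lia].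
Qed.

Lemma is_poly_monomial k : is_poly k (fun u => u ^ k)%C.
Proof.
  induction k as [|k IH]; [apply (is_poly_const 1)|]. apply (is_poly_mulX k (fun u => u ^ k)%C), IH.
Qed.

Lemma hdiff_is_poly d p u : is_poly d p -> hdiff p u.
Proof.
  intros [c Hc]. apply hdiff_ext_loc with (fun u => Csum (fun k => c k * u ^ k)%C (S d)).
  - exists 1. split; [lra | intros; symmetry; apply Hc].
  - apply (hdiff_sum (fun k u => c k * u ^ k)%C). intros k _.
    apply hdiff_mult; [apply hdiff_const | apply hdiff_pow, hdiff_id].
Qed.

Lemma poly_diff_factor d p a : is_poly (S d) p ->
  exists q, is_poly d q /\ forall u, (p u - p a)%C = ((u - a) * q u)%C.
Proof.
  revert p. induction d as [|d IH]; intros p [c Hc].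
  - exists (fun _ => c 1%nat). split; [apply is_poly_const|]. intros u. rewrite !Hc. simpl. ring.
  - set (p1 := fun u => Csum (fun k => c (S k) * u ^ k)%C (S (S d))).
    assert (E : forall u, p u = (c 0%nat + u * p1 u)%C).
    { intros u. rewrite Hc, Csum_S_l. unfold p1. rewrite <- Csum_scal. f_equal; [simpl; ring|].
      apply Csum_ext. intros k _. simpl. ring. }
    destruct (IH p1) as [q1 [Hq1 Eq1]]; [exists (fun k => c (S k)); reflexivity|].
    exists (fun u => u * q1 u + p1 a)%C. split.
    + apply (is_poly_plus (S d) (fun u => u * q1 u)%C (fun _ => p1 a)); [apply is_poly_mulX, Hq1|].
      apply is_poly_le with 0%nat; [lia | apply is_poly_const].
    + intros u. rewrite !E.
      replace (c 0%nat + u * p1 u - (c 0%nat + a * p1 a))%C with (u * (p1 u - p1 a) + (u - a) * p1 a)%C by ring.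
      rewrite Eq1. ring.
Qed.

Lemma poly_root_factor d p a : is_poly d p -> p a = 0%C ->
  (exists u, p u <> 0%C) -> exists e q, d = S e /\ is_poly e q /\ forall u, p u = ((u - a) * q u)%C.
Proof.
  intros Hp Ha [u0 Hu0]. destruct d as [|d].
  - destruct Hp as [c Hc]. elim Hu0. rewrite Hc. rewrite Hc in Ha. simpl in *. exact Ha.
  - destruct (poly_diff_factor d p a Hp) as [q [Hq E]]. exists d, q. split; [reflexivity|].
    split; [exact Hq|]. intros u. rewrite <- E, Ha. ring.
Qed.

Lemma C_integral (a b : C) : (a * b)%C = 0%C -> a = 0%C \/ b = 0%C.
Proof.
  intros H. destruct (excluded_middle_informative (a = 0)) as [E|E]; [left; exact E|]. right.
  replace b with (a * b / a)%C by (field; exact E). rewrite H. field. exact E.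
Qed.

Lemma Cminus_eq0 (a b : C) : (a - b)%C = 0%C -> a = b.
Proof. intros H. replace a with (a - b + b)%C by ring. rewrite H. ring. Qed.

Lemma Cminus_neq0 (a b : C) : a <> b -> (a - b)%C <> 0%C.
Proof. intros H E. apply H, Cminus_eq0, E. Qed.

Lemma cdiff_shift_id (a z : C) : cdiff (fun u => u - a)%C z 1%C.
Proof.
  replace (RtoC 1) with (1 - 0)%C by ring.
  apply (cdiff_minus (fun u => u) (fun _ => a)); [apply cdiff_id | apply cdiff_const].
Qed.

(** Dividing by the square of [u - al N] lowers the degree by two and leaves the other roots double,
    since this factor does not vanish there. *)
Lemma poly_double_roots N : forall d p (al : nat -> C), is_poly d p -> (exists u, p u <> 0%C) ->
  (forall i j, (i < j < N)%nat -> al i <> al j) ->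
  (forall j, (j < N)%nat -> p (al j) = 0%C /\ cdiff p (al j) 0%C) -> (2 * N <= d)%nat.
Proof.
  induction N as [|N IH]; intros d p al Hp Hnz Hdist Hroot; [lia|].
  destruct (Hroot N ltac:(lia)) as [Ha Hda]. set (a := al N) in *.
  destruct (poly_root_factor d p a Hp Ha Hnz) as [e [q [-> [Hq Eq]]]].
  destruct (hdiff_is_poly e q a Hq) as [l Hl].
  assert (Hqa : q a = 0%C).
  { assert (D : cdiff p a (1 * q a + (a - a) * l)%C).
    { apply cdiff_ext with (fun u => (u - a) * q u)%C; [intros; symmetry; apply Eq|].
      apply (cdiff_mult (fun u => u - a)%C q); [apply cdiff_shift_id | exact Hl]. }
    assert (U := cdiff_unique _ _ _ _ D Hda).
    replace (q a) with (1 * q a + (a - a) * l)%C by ring. exact U. }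
  destruct Hnz as [u0 Hu0].
  destruct (poly_root_factor e q a Hq Hqa) as [e' [q2 [-> [Hq2 Eq2]]]].
  { exists u0. intros E. apply Hu0. rewrite Eq, E. ring. }
  assert (Ep : forall u, p u = ((u - a) * (u - a) * q2 u)%C) by (intros u; rewrite Eq, Eq2; ring).
  assert (H2 : (2 * N <= e')%nat); [|lia].
  apply (IH e' q2 al Hq2).
  - exists u0. intros E. apply Hu0. rewrite Ep, E. ring.
  - intros i j Hij. apply Hdist. lia.
  - intros j Hj. destruct (Hroot j ltac:(lia)) as [Hb Hdb]. set (b := al j) in *.
    assert (Hba : (b - a)%C <> 0%C) by (apply Cminus_neq0, Hdist; lia).
    assert (Hq2b : q2 b = 0%C).
    { rewrite Ep in Hb. apply C_integral in Hb. destruct Hb as [Hb|Hb]; [|exact Hb].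
      apply C_integral in Hb. destruct Hb; contradiction. }
    split; [exact Hq2b|].
    destruct (hdiff_is_poly e' q2 b Hq2) as [m Hm].
    assert (D : cdiff p b ((1 * (b - a) + (b - a) * 1) * q2 b + ((b - a) * (b - a)) * m)%C).
    { apply cdiff_ext with (fun u => ((u - a) * (u - a)) * q2 u)%C; [intros; symmetry; apply Ep|].
      apply (cdiff_mult (fun u => (u - a) * (u - a))%C q2); [|exact Hm].
      apply (cdiff_mult (fun u => u - a)%C (fun u => u - a)%C); apply cdiff_shift_id. }
    assert (U := cdiff_unique _ _ _ _ D Hdb).
    rewrite Hq2b in U. replace ((1 * (b - a) + (b - a) * 1) * 0 + (b - a) * (b - a) * m)%C with ((b - a) * (b - a) * m)%C in U by ring.
    assert (Hm0 : m = 0%C).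
    { apply C_integral in U. destruct U as [U|U]; [|exact U]. apply C_integral in U. destruct U; contradiction. }
    rewrite <- Hm0. exact Hm.
Qed.

(** Interpolation by a product of linear factors, normalised at [al j]. The degree bound [N] is
    coarse; the polynomials serve only as continuous test functions with known moments. *)
Lemma lagrange (al : nat -> C) N j : (forall i, (i < N)%nat -> i <> j -> al i <> al j) ->
  exists l, is_poly N l /\ l (al j) = 1%C /\ forall i, (i < N)%nat -> i <> j -> l (al i) = 0%C.
Proof.
  induction N as [|N IH]; intros H.
  - exists (fun _ => RtoC 1). split; [apply is_poly_const|]. split; [reflexivity | intros; lia].
  - destruct IH as [l [Hl [Hlj Hli]]]; [intros; apply H; lia|].
    destruct (Nat.eq_dec N j) as [->|HNj].
    + exists l. split; [apply is_poly_le with j; [lia | exact Hl]|]. split; [exact Hlj|].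
      intros i Hi Hij. apply Hli; lia.
    + assert (Hne : (al j - al N)%C <> 0%C) by (apply Cminus_neq0; intros E; apply (H N); [lia | exact HNj | auto]).
      exists (fun u => (- al N / (al j - al N) + / (al j - al N) * u) * l u)%C.
      split; [apply is_poly_lin, Hl|]. split.
      * rewrite Hlj. field. exact Hne.
      * intros i Hi Hij. destruct (Nat.eq_dec i N) as [->|HiN].
        -- field. exact Hne.
        -- rewrite Hli by lia. ring.
Qed.

(** * The atomic structure of extremal functions *)

Section Atoms.
Variables (n : nat) (f h : C -> C) (A : R).
Hypothesis Hn : (1 <= n)%nat.
Hypothesis Hext : extremal n f.
Hypothesis HA : coef f n = RtoC A.
Hypothesis HApos : 0 < A.
Hypothesis Hh : holo_D h.
Hypothesis Hfh : forall z, inD z -> f z = Cexp (- h z).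
Hypothesis HRe : forall z, inD z -> 0 <= Re (h z).

Let Zw (u : C) : Prop := Cmod u = 1 /\ Re (Sdual f n u) = 0.

(* [W] is [2 u^n Re (Sdual u)] on the unit circle. *)
Let W (u : C) : C :=
  (u ^ n * Sdual f n u + (Cconj (coef f n) * u ^ n + 2 * Csum (fun k => Cconj (coef f k) * u ^ k) n))%C.

Lemma W_poly : is_poly (2 * n) W.
Proof.
  unfold W.
  apply (is_poly_plus (2 * n) (fun u => u ^ n * Sdual f n u)%C
    (fun u => Cconj (coef f n) * u ^ n + 2 * Csum (fun k => Cconj (coef f k) * u ^ k) n)%C).
  - replace (2 * n)%nat with (n + n)%nat by lia. apply (is_poly_mul n n (fun u => u ^ n)%C); [apply is_poly_monomial|].
    unfold Sdual. apply (is_poly_plus n (fun _ => coef f n)).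
    + apply is_poly_le with 0%nat; [lia | apply is_poly_const].
    + apply is_poly_scal. apply (is_poly_sum (fun k u => coef f k * u ^ (n - k))%C).
      intros k _. apply is_poly_scal, is_poly_le with (n - k)%nat; [lia | apply is_poly_monomial].
  - apply (is_poly_plus (2 * n) (fun u => Cconj (coef f n) * u ^ n)%C).
    + apply is_poly_scal, is_poly_le with n; [lia | apply is_poly_monomial].
    + apply is_poly_scal. apply (is_poly_sum (fun k u => Cconj (coef f k) * u ^ k)%C).
      intros k Hk. apply is_poly_scal, is_poly_le with k; [lia | apply is_poly_monomial].
Qed.

(** At the origin only [2 * Cconj (coef f 0)] survives, and [f] has no zero. *)
Lemma W_nonzero : exists u, W u <> 0%C.
Proof.
  exists (RtoC 0). unfold W. rewrite Cpow_0 by exact Hn.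
  rewrite (Csum_single _ n 0).
  - intros E. assert (Hc : (2 * Cconj (coef f 0))%C = 0%C) by (rewrite <- E; simpl; ring).
    apply C_integral in Hc. destruct Hc as [Hc|Hc].
    + apply (f_equal Re) in Hc. simpl in Hc. lra.
    + assert (HB := ext_B0 n f Hext). destruct HB as [Hf Hb].
      assert (Hm : Cmod (coef f 0) = 0) by (rewrite <- Cmod_conj, Hc; apply Cmod_0).
      rewrite coef_0 in Hm by exact Hf. generalize (Hb _ inD_0). lra.
  - lia.
  - intros k Hk Hk0. rewrite Cpow_0 by lia. ring.
Qed.

Lemma W_circle u : Cmod u = 1 -> W u = (u ^ n * RtoC (2 * Re (Sdual f n u)))%C.
Proof.
  intros Hu. assert (Hc := conj_unit u Hu).
  assert (E : RtoC (2 * Re (Sdual f n u)) = (Sdual f n u + Cconj (Sdual f n u))%C).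
  { rewrite RtoC_mult, re_alt. field. }
  rewrite E, Cmult_plus_distr_l. unfold W. f_equal. unfold Sdual.
  rewrite Cplus_conj, Cmult_conj, Csum_conj.
  replace (Cconj 2) with (RtoC 2) by (apply C_ext; simpl; ring).
  replace (u ^ n * (Cconj (coef f n) + 2 * Csum (fun k => Cconj (coef f k * u ^ (n - k))) n))%C
    with (Cconj (coef f n) * u ^ n + 2 * (u ^ n * Csum (fun k => Cconj (coef f k * u ^ (n - k))) n))%C by ring.
  f_equal. f_equal. rewrite <- Csum_scal. apply Csum_ext. intros k Hk.
  rewrite Cmult_conj, Cpow_conj. replace n with (k + (n - k))%nat at 1 by lia. rewrite Cpow_add.
  assert (Ep : (u ^ (n - k) * Cconj u ^ (n - k))%C = 1%C) by (rewrite <- Cpow_mult_l, Hc; apply Cpow_1).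
  replace (u ^ k * u ^ (n - k) * (Cconj (coef f k) * Cconj u ^ (n - k)))%C
    with (Cconj (coef f k) * u ^ k * (u ^ (n - k) * Cconj u ^ (n - k)))%C by ring.
  rewrite Ep. ring.
Qed.

(* On the circle [u^-n W(u)] is real and nonnegative, so its zeros are double. *)
Lemma W_double a : Zw a -> W a = 0%C /\ cdiff W a 0%C.
Proof.
  intros [Ha HaR].
  assert (HWa : W a = 0%C) by (rewrite W_circle, HaR, Rmult_0_r by exact Ha; ring).
  split; [exact HWa|].
  destruct (hdiff_is_poly _ W a W_poly) as [l Hl].
  (* A holomorphic parametrisation of the circle by real [z], so that the complex derivative can be
     read off along the real axis. *)
  set (e := fun z => (a * Cexp (Ci * z))%C).
  assert (He0 : e 0%C = a) by (unfold e; replace (Ci * 0)%C with (RtoC 0) by ring; rewrite Cexp_0; ring).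
  assert (Hde : cdiff e 0 (a * (Cexp (Ci * 0) * (Ci * 1)))%C).
  { apply cdiff_scal. apply (cdiff_comp Cexp (fun z => Ci * z)%C); [apply cdiff_scal, cdiff_id | apply cdiff_Cexp]. }
  assert (Hen : e 0%C <> 0%C) by (rewrite He0; apply mod_unit_neq0, Ha).
  assert (Hinv : hdiff (fun z => / (e z ^ n))%C 0).
  { apply hdiff_inv; [apply Cpow_neq0, Hen | apply hdiff_pow; eexists; exact Hde]. }
  destruct Hinv as [v Hv].
  assert (HdW : cdiff (fun z => W (e z)) 0 (l * (a * (Cexp (Ci * 0) * (Ci * 1))))%C).
  { apply (cdiff_comp W e); [exact Hde | rewrite He0; exact Hl]. }
  assert (HdH := cdiff_mult _ _ _ _ _ HdW Hv). simpl in HdH.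
  set (H := fun z => (W (e z) * / e z ^ n)%C) in HdH.
  set (kap := (l * (a * (Cexp (Ci * 0) * (Ci * 1))) * / e 0 ^ n + W (e 0%C) * v)%C) in HdH.
  assert (Hreal : forall s : R, H (RtoC s) = RtoC (2 * Re (Sdual f n (e (RtoC s)))) /\ 0 <= 2 * Re (Sdual f n (e (RtoC s)))).
  { intros s. assert (Hes : Cmod (e (RtoC s)) = 1).
    { unfold e. rewrite Cmod_mult, Ha, Cmod_Cexp. replace (Re (Ci * s)%C) with 0 by (unfold Re; simpl; ring).
      rewrite exp_0. ring. }
    split.
    - unfold H. rewrite W_circle by exact Hes. field. apply Cpow_neq0, mod_unit_neq0, Hes.
    - assert (P := Sdual_nonneg n f (e (RtoC s)) Hext Hes). lra. }
  assert (H0 : H 0%C = 0%C) by (unfold H; rewrite He0, HWa; ring).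
  (* Along the real axis [H] is real, nonnegative and zero at [0]. Comparing [s] with [- s] bounds
     both parts of [kap] by [Cmod kap / 4], too little for a nonzero number. *)
  assert (Hk0 : kap = 0%C).
  { apply NNPP. intros Hne. assert (Hp := C_neq0_mod _ Hne).
    destruct (proj1 (cdiff_eps _ _ _) HdH (Cmod kap / 4) ltac:(lra)) as [d [Hd Hdd]].
    assert (Hs : forall s : R, Rabs s < d -> Cmod (H (RtoC s) - kap * s) <= Cmod kap / 4 * Rabs s).
    { intros s Hs. assert (Q := Hdd (RtoC s)). change (W (e 0%C) * / e 0 ^ n)%C with (H 0%C) in Q.
      change (W (e (RtoC s)) * / e (RtoC s) ^ n)%C with (H (RtoC s)) in Q.
      replace (RtoC s - 0)%C with (RtoC s) in Q by ring. rewrite Cmod_R, H0 in Q. specialize (Q Hs).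
      replace (H (RtoC s) - 0 - kap * s)%C with (H (RtoC s) - kap * s)%C in Q by ring. exact Q. }
    set (s := d / 2). assert (Hs0 : 0 < s) by (unfold s; lra).
    assert (Q1 := Hs s ltac:(rewrite Rabs_pos_eq; unfold s; lra)).
    assert (Q2 := Hs (- s) ltac:(rewrite Rabs_Ropp, Rabs_pos_eq; unfold s; lra)).
    rewrite Rabs_Ropp in Q2. rewrite (Rabs_pos_eq s) in Q1, Q2 by lra.
    destruct (Hreal s) as [R1 P1]. destruct (Hreal (- s)) as [R2 P2]. rewrite R1 in Q1. rewrite R2 in Q2.
    set (x1 := 2 * Re (Sdual f n (e (RtoC s)))) in *. set (x2 := 2 * Re (Sdual f n (e (RtoC (- s))))) in *.
    assert (A1 := re_le_Cmod (RtoC x1 - kap * s)). assert (A2 := re_le_Cmod (RtoC x2 - kap * (- s)%R)).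
    assert (A3 := Im_abs_le_mod (RtoC x1 - kap * s)).
    rewrite Re_minus, Re_R, (Cmult_comm kap), Re_Rmult in A1, A2. rewrite Im_minus, Im_R, (Cmult_comm kap), Im_Rmult in A3.
    rewrite (Cmult_comm kap) in Q1, Q2.
    apply Rabs_le_between in A1. apply Rabs_le_between in A2. apply Rabs_le_between in A3.
    assert (B1 : Rabs (Re kap) <= Cmod kap / 4).
    { apply Rabs_le. split; apply Rmult_le_reg_l with s; try exact Hs0; lra. }
    assert (B2 : Rabs (Im kap) <= Cmod kap / 4).
    { apply Rabs_le. split; apply Rmult_le_reg_l with s; try exact Hs0; lra. }
    assert (B3 := Cmod_le_abs kap). lra. }
  unfold kap in Hk0. rewrite He0, HWa in Hk0. replace (Ci * 0)%C with (RtoC 0) in Hk0 by ring. rewrite Cexp_0 in Hk0.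
  assert (Han := mod_unit_neq0 a Ha). assert (Hann := Cpow_neq0 a n Han).
  assert (Hi : Ci <> 0%C) by (apply mod_neq0; rewrite Cmod_Ci; lra).
  assert (Hl0 : l = 0%C).
  { replace l with ((l * (a * (1 * (Ci * 1))) * / a ^ n + 0 * v) * (a ^ n / (a * Ci)))%C
      by (field; repeat split; assumption).
    rewrite Hk0. field. split; assumption. }
  rewrite <- Hl0. exact Hl.
Qed.

Lemma zeros_bound N (al : nat -> C) : (forall i j, (i < j < N)%nat -> al i <> al j) ->
  (forall j, (j < N)%nat -> Zw (al j)) -> (N <= n)%nat.
Proof.
  intros Hd HZ. assert (H := poly_double_roots N (2 * n) W al W_poly W_nonzero Hd (fun j Hj => W_double _ (HZ j Hj))).
  lia.
Qed.

(** Zeros are collected one at a time; the process stops because [zeros_bound] allows at most [n] of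
    them. *)
Lemma zeros_list : exists N (al : nat -> C), (N <= n)%nat /\ (forall i j, (i < j < N)%nat -> al i <> al j) /\
  (forall j, (j < N)%nat -> Zw (al j)) /\ (forall u, Zw u -> exists j, (j < N)%nat /\ u = al j).
Proof.
  assert (Hmain : forall m N (al : nat -> C), (n - N <= m)%nat -> (forall i j, (i < j < N)%nat -> al i <> al j) ->
    (forall j, (j < N)%nat -> Zw (al j)) -> exists N (al : nat -> C), (N <= n)%nat /\ (forall i j, (i < j < N)%nat -> al i <> al j) /\
  (forall j, (j < N)%nat -> Zw (al j)) /\ (forall u, Zw u -> exists j, (j < N)%nat /\ u = al j)).
  { induction m as [|m IH]; intros N al Hm Hd HZ.
    - exists N, al. assert (HN := zeros_bound N al Hd HZ). repeat split; try assumption; try apply (HZ j H).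
      intros u Hu. apply NNPP. intros Hno.
      assert (S N <= n)%nat; [|lia].
      apply (zeros_bound (S N) (fun j => if Nat.eq_dec j N then u else al j)).
      + intros i j Hij. destruct (Nat.eq_dec i N); [lia|]. destruct (Nat.eq_dec j N) as [->|].
        * intros E. apply Hno. exists i. split; [lia | auto].
        * apply Hd; lia.
      + intros j Hj. destruct (Nat.eq_dec j N); [exact Hu | apply HZ; lia].
    - destruct (excluded_middle_informative (forall u, Zw u -> exists j, (j < N)%nat /\ u = al j)) as [Hc|Hc].
      + exists N, al. assert (HN := zeros_bound N al Hd HZ). repeat split; try assumption; apply (HZ j H).
      + apply not_all_ex_not in Hc. destruct Hc as [u Hu]. apply imply_to_and in Hu. destruct Hu as [Hu Hno].
        apply (IH (S N) (fun j => if Nat.eq_dec j N then u else al j)); [lia | |].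
        * intros i j Hij. destruct (Nat.eq_dec i N); [lia|]. destruct (Nat.eq_dec j N) as [->|].
          -- intros E. apply Hno. exists i. split; [lia | auto].
          -- apply Hd; lia.
        * intros j Hj. destruct (Nat.eq_dec j N); [exact Hu | apply HZ; lia]. }
  apply (Hmain n 0%nat (fun _ => RtoC 0)); intros; lia.
Qed.

Lemma ccirc_poly d p : is_poly d p -> ccirc p.
Proof. intros Hp u _. apply hdiff_cont. eapply hdiff_is_poly, Hp. Qed.

Lemma wt_zero u : Cmod u = 1 -> wt n f u = 0%C -> Zw u.
Proof. intros Hu Hw. split; [exact Hu|]. unfold wt in Hw. apply (f_equal Re) in Hw. exact Hw. Qed.

Lemma mu_poly_lim d p : is_poly d p -> exists L, Clim (at_left 1) (fun r => mu h r p) L.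
Proof.
  intros [c Hc]. exists (Csum (fun k => c k * (mom h k * 1 ^ k))%C (S d)).
  apply Clim_ext_loc with (fun r => Csum (fun k => c k * (mom h k * RtoC r ^ k))%C (S d)).
  - generalize at_left1_pos. apply filter_imp. intros r Hr. rewrite <- (mu_poly h Hh r c (S d) Hr).
    unfold mu. apply avg_ext. intros t. rewrite Hc. reflexivity.
  - apply (Clim_sum (fun k (r : R) => c k * (mom h k * RtoC r ^ k))%C). intros k _.
    apply Clim_scal, Clim_scal, Clim_pow, Clim_left1.
Qed.

(** By [mu_vanish], two test functions that agree on the zeros have the same limiting integral.
    Interpolating at the zeros thus turns every moment into a finite sum, with masses the limits for
    the Lagrange polynomials. *)
Lemma atoms_moments : exists N (al : nat -> C) (lam : nat -> R), (N <= n)%nat /\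
  (forall i j, (i < j < N)%nat -> al i <> al j) /\ (forall j, (j < N)%nat -> Cmod (al j) = 1) /\
  (forall j, (j < N)%nat -> 0 <= lam j) /\
  forall k, mom h k = Csum (fun j => lam j * al j ^ k)%C N.
Proof.
  destruct zeros_list as [N [al [HN [Hd [HZ Hall]]]]].
  assert (Hd2 : forall i j, (i < N)%nat -> (j < N)%nat -> i <> j -> al i <> al j).
  { intros i j Hi Hj Hij. destruct (Nat.lt_ge_cases i j) as [H|H].
    - apply Hd. lia.
    - intros E. apply (Hd j i); [lia | auto]. }
  assert (Hl : forall j, exists lL : (C -> C) * C, (j < N)%nat -> is_poly N (fst lL) /\ fst lL (al j) = 1%C /\
     (forall i, (i < N)%nat -> i <> j -> fst lL (al i) = 0%C) /\ Clim (at_left 1) (fun r => mu h r (fst lL)) (snd lL)).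
  { intros j. destruct (lt_dec j N) as [Hj|Hj]; [|exists (fun _ => RtoC 0, RtoC 0); intros; lia].
    destruct (lagrange al N j) as [l [H1 [H2 H3]]]; [intros i Hi Hij; apply Hd2; assumption|].
    destruct (mu_poly_lim N l H1) as [L HL]. exists (l, L). intros _. repeat split; assumption. }
  set (lL := fun j => proj1_sig (constructive_indefinite_description _ (Hl j))).
  assert (HlL : forall j, (j < N)%nat -> is_poly N (fst (lL j)) /\ fst (lL j) (al j) = 1%C /\
     (forall i, (i < N)%nat -> i <> j -> fst (lL j) (al i) = 0%C) /\ Clim (at_left 1) (fun r => mu h r (fst (lL j))) (snd (lL j))).
  { intros j Hj. unfold lL. destruct constructive_indefinite_description as [x Hx]. simpl. apply Hx, Hj. }
  clearbody lL. clear Hl.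
  assert (Hlam : forall j, (j < N)%nat -> 0 <= Re (snd (lL j)) /\ Im (snd (lL j)) = 0).
  { intros j Hj. destruct (HlL j Hj) as [H1 [H2 [H3 HL]]]. set (l := fst (lL j)) in *. set (L := snd (lL j)) in *.
    assert (Hcl := ccirc_poly N l H1).
    (* At the zeros the Lagrange polynomial is [0] or [1], so it agrees there with its squared
       modulus; this makes the mass real and nonnegative. *)
    set (m2 := fun u => RtoC (Cmod (l u) * Cmod (l u))).
    assert (Hm2 : ccirc m2).
    { intros u Hu. unfold Ccont, m2. apply Clim_ext with (fun u => RtoC (Cmod (l u)) * RtoC (Cmod (l u)))%C; [intros; symmetry; apply RtoC_mult|].
      rewrite RtoC_mult. apply Clim_mult; apply Clim_mod, Hcl, Hu. }
    assert (HLm : Clim (at_left 1) (fun r => mu h r m2) L).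
    { assert (V : Clim (at_left 1) (fun r => mu h r (fun u => m2 u + (- (1)) * l u)%C) 0%C).
      { apply (mu_vanish n f h A); try assumption.
        - apply ccirc_plus; [exact Hm2 | apply ccirc_scal, Hcl].
        - intros u Hu Hw. destruct (Hall u (wt_zero u Hu Hw)) as [i [Hi ->]]. unfold m2.
          destruct (Nat.eq_dec i j) as [->|Hij].
          + rewrite H2, Cmod_1, Rmult_1_l. ring.
          + rewrite (H3 i Hi Hij), Cmod_0, Rmult_0_l. ring. }
      apply Clim_ext_loc with (fun r => mu h r (fun u => m2 u + (- (1)) * l u)%C + mu h r l)%C.
      - generalize at_left1_pos. apply filter_imp. intros r Hr.
        rewrite mu_plus, mu_scal; try assumption; [ring | apply ccirc_scal, Hcl].
      - apply Clim_eq with (0 + L)%C; [ring|]. apply Clim_plus; assumption. }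
    assert (Hreal : forall r, 0 < r < 1 -> 0 <= Re (mu h r m2) /\ Im (mu h r m2) = 0).
    { intros r Hr. split.
      - assert (Q := mu_le h Hh HRe r (fun _ => RtoC 0) m2 Hr (ccirc_const _) Hm2).
        assert (E0 : mu h r (fun _ => RtoC 0) = 0%C).
        { unfold mu. rewrite (avg_ext _ (fun _ => RtoC 0)) by (intros; ring). apply avg_const. }
        rewrite E0, Re_R in Q. apply Q. intros u _. unfold m2. rewrite !Re_R. apply Rmult_le_pos; apply Cmod_ge_0.
      - assert (Q := mu_Re h Hh r m2 Hr Hm2). change (mu h r m2 = RtoC (Re (mu h r m2))) in Q.
        rewrite Q. reflexivity. }
    split.
    - apply (Clim_Re_ge _ _ _ HLm). generalize at_left1_pos. apply filter_imp. intros r Hr. apply Hreal, Hr.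
    - assert (HI := Clim_Im _ _ HLm).
      assert (HI2 : Clim (at_left 1) (fun r => RtoC (Im (mu h r m2))) 0%C).
      { apply Clim_ext_loc with (fun _ => RtoC 0); [|apply Clim_const].
        generalize at_left1_pos. apply filter_imp. intros r Hr. rewrite (proj2 (Hreal r Hr)). reflexivity. }
      apply RtoC_inj. apply (Clim_unique _ _ _ HI HI2). }
  exists N, al, (fun j => Re (snd (lL j))). split; [exact HN|]. split; [exact Hd|].
  split; [intros j Hj; apply (HZ j Hj)|]. split; [intros j Hj; apply Hlam, Hj|].
  intros k.
  (* The difference of [u^k] and its interpolant vanishes at every zero. *)
  set (q := fun u => (u ^ k + Csum (fun j => (- al j ^ k) * fst (lL j) u) N)%C).
  assert (Hsc : ccirc (fun u => Csum (fun j => (- al j ^ k) * fst (lL j) u) N)%C).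
  { intros u Hu. unfold Ccont. apply (Clim_sum (fun j u => (- al j ^ k) * fst (lL j) u)%C). intros j Hj.
    apply Clim_scal. apply (ccirc_poly N _ (proj1 (HlL j Hj)) u Hu). }
  assert (Hkc : ccirc (fun u => u ^ k)%C) by (eapply ccirc_poly, is_poly_monomial).
  assert (V : Clim (at_left 1) (fun r => mu h r q) 0%C).
  { apply (mu_vanish n f h A); try assumption.
    - apply ccirc_plus; assumption.
    - intros u Hu Hw. destruct (Hall u (wt_zero u Hu Hw)) as [i [Hi ->]]. unfold q.
      rewrite (Csum_single _ N i Hi).
      + rewrite (proj1 (proj2 (HlL i Hi))). ring.
      + intros j Hj Hji. destruct (HlL j Hj) as [_ [_ [H3 _]]]. rewrite H3 by auto. ring. }
  assert (V2 : Clim (at_left 1) (fun r => mu h r q) (mom h k * 1 ^ k + Csum (fun j => (- al j ^ k) * snd (lL j)) N)%C).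
  { apply Clim_ext_loc with (fun r => mom h k * RtoC r ^ k + Csum (fun j => (- al j ^ k) * mu h r (fst (lL j))) N)%C.
    - generalize at_left1_pos. apply filter_imp. intros r Hr. unfold q. rewrite mu_plus by assumption. f_equal.
      + rewrite <- (avg_Re_h h Hh r k Hr). unfold mu. apply avg_ext. intros t. rewrite Cis_pow.
        replace (INR k * - t) with (- INR k * t) by ring. reflexivity.
      + clear Hsc q V. assert (G : forall M, (M <= N)%nat ->
          mu h r (fun u => Csum (fun j => (- al j ^ k) * fst (lL j) u) M)%C = Csum (fun j => (- al j ^ k) * mu h r (fst (lL j)))%C M
          /\ ccirc (fun u => Csum (fun j => (- al j ^ k) * fst (lL j) u)%C M)).
        { induction M as [|M IH]; intros HM; simpl.
          - split; [|apply ccirc_const]. unfold mu. rewrite (avg_ext _ (fun _ => RtoC 0)) by (intros; ring). apply avg_const.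
          - destruct (IH ltac:(lia)) as [IH1 IH2].
            assert (Hc := ccirc_poly N _ (proj1 (HlL M HM))).
            split.
            + rewrite (mu_plus h Hh r (fun u => Csum (fun j => (- al j ^ k) * fst (lL j) u) M)%C (fun u => (- al M ^ k) * fst (lL M) u)%C Hr IH2 (ccirc_scal _ _ Hc)).
              rewrite IH1, mu_scal by assumption. reflexivity.
            + apply (ccirc_plus (fun u => Csum (fun j => (- al j ^ k) * fst (lL j) u) M)%C); [exact IH2 | apply ccirc_scal, Hc]. }
        symmetry. apply (G N (Nat.le_refl _)).
    - apply Clim_plus.
      + apply Clim_scal, Clim_pow, Clim_left1.
      + apply (Clim_sum (fun j r => (- al j ^ k) * mu h r (fst (lL j)))%C). intros j Hj.
        apply Clim_scal. apply (HlL j Hj). }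
  assert (E := Clim_unique _ _ _ V2 V). rewrite Cpow_1 in E.
  rewrite (Csum_ext _ (fun j => (- (1)) * (RtoC (Re (snd (lL j))) * al j ^ k))%C) in E.
  - rewrite Csum_scal in E. apply Cminus_eq0. rewrite <- E. ring.
  - intros j Hj. assert (Ej : snd (lL j) = RtoC (Re (snd (lL j)))) by (apply C_ext; [reflexivity | rewrite Im_R; apply Hlam, Hj]).
    rewrite Ej at 1. ring.
Qed.
End Atoms.

(** Zeros of the weight may carry no mass, whereas [atomic_repr] asks for positive masses. Stating
    the conclusion for every [g] covers all moments at once. *)
Lemma trim_atoms N (al : nat -> C) (lam : nat -> R) : (forall i j, (i < j < N)%nat -> al i <> al j) ->
  (forall j, (j < N)%nat -> 0 <= lam j) ->
  exists N' (al' : nat -> C) (lam' : nat -> R), (N' <= N)%nat /\ (forall i j, (i < j < N')%nat -> al' i <> al' j) /\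
  (forall j, (j < N')%nat -> exists i, (i < N)%nat /\ al' j = al i) /\ (forall j, (j < N')%nat -> 0 < lam' j) /\
  forall g : C -> C, Csum (fun j => lam' j * g (al' j))%C N' = Csum (fun j => lam j * g (al j))%C N.
Proof.
  induction N as [|N IH]; intros Hd Hl.
  - exists 0%nat, al, lam. repeat split; intros; try lia.
  - destruct IH as [N' [al' [lam' [H1 [H2 [H3 [H4 H5]]]]]]]; [intros; apply Hd; lia | intros; apply Hl; lia|].
    destruct (Rle_lt_or_eq_dec _ _ (Hl N ltac:(lia))) as [Hpos|Hz].
    + exists (S N'), (fun j => if Nat.eq_dec j N' then al N else al' j), (fun j => if Nat.eq_dec j N' then lam N else lam' j).
      split; [lia|]. split; [|split; [|split]].
      * intros i j Hij. destruct (Nat.eq_dec i N'); [lia|]. destruct (Nat.eq_dec j N') as [->|].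
        -- destruct (H3 i ltac:(lia)) as [k [Hk ->]]. apply Hd. lia.
        -- apply H2; lia.
      * intros j Hj. destruct (Nat.eq_dec j N') as [->|]; [exists N; split; [lia | reflexivity]|].
        destruct (H3 j ltac:(lia)) as [k [Hk E]]. exists k. split; [lia | exact E].
      * intros j Hj. destruct (Nat.eq_dec j N'); [exact Hpos | apply H4; lia].
      * intros g. simpl. rewrite <- H5. destruct (Nat.eq_dec N' N'); [|lia]. f_equal.
        apply Csum_ext. intros j Hj. destruct (Nat.eq_dec j N'); [lia | reflexivity].
    + exists N', al', lam'. split; [lia|]. split; [exact H2|]. split; [|split; [exact H4|]].
      * intros j Hj. destruct (H3 j Hj) as [k [Hk E]]. exists k. split; [lia | exact E].
      * intros g. simpl. rewrite H5, <- Hz. ring.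
Qed.

Lemma sum_n_Csum (g : nat -> C) N : (1 <= N)%nat -> sum_n g (N - 1) = Csum g N.
Proof.
  intros HN. destruct N as [|N]; [lia|]. replace (S N - 1)%nat with N by lia. clear HN.
  induction N as [|N IH].
  - rewrite sum_O. simpl. ring.
  - rewrite sum_Sn, IH. reflexivity.
Qed.

(** The moments are, up to the factor two, the coefficients of [h], so [h] and the sum of kernels
    [cay] have the same Taylor series apart from an imaginary constant, which becomes [gamma]. *)
Theorem atomic_structure n f : (1 <= n)%nat -> extremal n f ->
  exists gamma N lambda alpha, atomic_repr n f gamma N lambda alpha.
Proof.
  intros Hn Hext. destruct (extremal_real n f Hn Hext) as [A [HA2 HA]].
  assert (Hpos : 0 < 2 / exp 1) by (apply Rdiv_lt_0_compat; [lra | apply exp_pos]).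
  assert (HB := ext_B0 n f Hext). assert (HB' := HB). destruct HB' as [Hf Hb].
  destruct (holo_log f Hf) as [h [Hh Hfh]].
  { intros z Hz. apply mod_neq0. apply (Hb z Hz). }
  assert (HRe : forall z, inD z -> 0 <= Re (h z)).
  { intros z Hz. destruct (Hb z Hz) as [_ H1]. rewrite (Hfh z Hz), Cmod_Cexp, Re_opp in H1.
    apply Rnot_lt_le. intros Hneg. rewrite <- exp_0 in H1.
    assert (exp 0 < exp (- Re (h z))) by (apply exp_increasing; lra). lra. }
  destruct (atoms_moments n f h A Hn Hext HA Hh Hfh HRe) as [N0 [al0 [lam0 [HN0 [Hd0 [Hu0 [Hl0 Hm0]]]]]]].
  destruct (trim_atoms N0 al0 lam0 Hd0 Hl0) as [N [al [lam [HN [Hd [Hin [Hl Hsum]]]]]]].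
  assert (Hu : forall j, (j < N)%nat -> Cmod (al j) = 1).
  { intros j Hj. destruct (Hin j Hj) as [i [Hi ->]]. apply Hu0, Hi. }
  assert (Hm : forall k, mom h k = Csum (fun j => lam j * al j ^ k)%C N).
  { intros k. rewrite Hm0. symmetry. apply (Hsum (fun u => u ^ k)%C). }
  set (b := Im (h 0%C)).
  assert (Hcays : holo_D (fun z => Csum (fun j => lam j * cay (al j) z)%C N)).
  { apply (holo_sum (fun j z => lam j * cay (al j) z)%C). intros j Hj. apply holo_scal, holo_cay, Hu, Hj. }
  assert (Hrep : forall z, inD z -> h z = (Ci * b + Csum (fun j => lam j * cay (al j) z) N)%C).
  { intros z Hz. apply (coef_inj h (fun z => Ci * b + Csum (fun j => lam j * cay (al j) z) N)%C); [exact Hh | | | exact Hz].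
    - apply (holo_plus (fun _ => Ci * b)%C); [apply holo_const | exact Hcays].
    - intros k. rewrite (coef_plus (fun _ => Ci * b)%C) by first [exact Hcays | apply holo_const].
      rewrite (coef_sum (fun j z => lam j * cay (al j) z)%C) by (intros; apply holo_scal, holo_cay, Hu; assumption).
      rewrite (Csum_ext _ (fun j => if Nat.eq_dec k 0 then (lam j * al j ^ k)%C else (2 * (lam j * al j ^ k))%C)).
      + specialize (Hm k). unfold mom in Hm. destruct (Nat.eq_dec k 0) as [->|Hk].
        * rewrite <- Hm, (coef_0 (fun _ => Ci * b)%C), coef_0 by first [exact Hh | apply holo_const].
          unfold b. apply C_ext; unfold Re, Im; simpl; ring.
        * rewrite Csum_scal, <- Hm, coef_const by lia. field.
      + intros j Hj. rewrite coef_scal, coef_cay by (try apply holo_cay; apply Hu, Hj).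
        destruct (Nat.eq_dec k 0) as [->|Hk]; [simpl; ring | ring]. }
  (* Without atoms [f] would be constant and its [n]-th coefficient zero instead of at least
     [2 / e]. *)
  assert (HN1 : (1 <= N)%nat).
  { destruct N as [|N]; [|lia]. exfalso.
    assert (Hc : forall z, inD z -> f z = (fun _ => Cexp (- (Ci * b + 0))) z).
    { intros z Hz. rewrite (Hfh z Hz), (Hrep z Hz). reflexivity. }
    rewrite (coef_ext_D f _ n Hc), coef_const in HA by lia. apply (f_equal Re) in HA. rewrite !Re_R in HA. lra. }
  exists (Cexp (- (Ci * b)))%C, N, lam, al. split; [|split; [lia|split; [exact Hl|split; [exact Hu|split; [exact Hd|]]]]].
  - rewrite Cmod_Cexp. replace (Re (- (Ci * b))%C) with 0 by (unfold Re; simpl; ring). apply exp_0.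
  - intros z Hz. rewrite (Hfh z Hz), (Hrep z Hz), sum_n_Csum by exact HN1. rewrite <- Cexp_add. f_equal.
    unfold cay. ring.
Qed.

(** * Polynomials without zeros in the punctured plane *)

Lemma poly_growth (c : nat -> C) d u : 1 <= Cmod u ->
  Cmod (c (S d)) * Cmod u - Rsum (fun k => Cmod (c k)) (S d) <= Cmod (Csum (fun k => c k * u ^ k)%C (S (S d))).
Proof.
  intros Hu. set (x := Cmod u) in *.
  assert (Hxd : 1 <= x ^ d) by (apply pow_R1_Rle; exact Hu).
  change (Csum (fun k => c k * u ^ k)%C (S (S d))) with (Csum (fun k => c k * u ^ k)%C (S d) + c (S d) * u ^ S d)%C.
  set (L := Csum (fun k => c k * u ^ k)%C (S d)).
  assert (HL : Cmod L <= Rsum (fun k => Cmod (c k)) (S d) * x ^ d).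
  { unfold L. eapply Rle_trans; [apply Cmod_sum|]. rewrite (Rmult_comm _ (x ^ d)), <- Rsum_scal.
    apply Rsum_le. intros k Hk. rewrite Cmod_mult, Cmod_pow, Rmult_comm. fold x.
    apply Rmult_le_compat_r; [apply Cmod_ge_0|]. apply Rle_pow; [exact Hu | lia]. }
  assert (T := Cmod_triangle_rev (c (S d) * u ^ S d) (- L)).
  rewrite Cmod_opp, Cmod_mult, Cmod_pow in T. fold x in T.
  replace (c (S d) * u ^ S d - - L)%C with (L + c (S d) * u ^ S d)%C in T by ring.
  set (S0 := Rsum (fun k => Cmod (c k)) (S d)) in *.
  assert (HS0 : 0 <= S0) by (apply Rsum_ge_0; intros; apply Cmod_ge_0).
  assert (Hc := Cmod_ge_0 (c (S d))). simpl pow in T.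
  destruct (Rle_dec (Cmod (c (S d)) * x - S0) 0) as [Hneg|Hpos].
  - apply Rle_trans with 0; [exact Hneg | apply Cmod_ge_0].
  - apply Rle_trans with ((Cmod (c (S d)) * x - S0) * x ^ d); [|lra].
    rewrite <- (Rmult_1_r (Cmod (c (S d)) * x - S0)) at 1. apply Rmult_le_compat_l; lra.
Qed.

(* The fundamental theorem of algebra, from the mean value property of [1 / p (R z)]. *)
Lemma nonvanishing_poly_const d : forall p, is_poly d p -> (forall u, p u <> 0%C) -> forall u, p u = p 0%C.
Proof.
  induction d as [|d IH]; intros p [c Hc] Hp u.
  - rewrite !Hc. simpl. ring.
  - destruct (excluded_middle_informative (c (S d) = 0)) as [E|E].
    + apply IH; [|exact Hp]. exists c. intros v. rewrite Hc. simpl. rewrite E. ring.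
    + exfalso. assert (Ht := C_neq0_mod _ E). assert (H0 := C_neq0_mod _ (Hp 0%C)).
      set (S0 := Rsum (fun k => Cmod (c k)) (S d)).
      (* By [poly_growth], [p] has modulus at least [Cmod (p 0) + 1] on radius [R0 / 2], which
         contradicts the mean value property of the reciprocal at the origin. *)
      set (R0 := 2 * ((S0 + Cmod (p 0%C) + 1) / Cmod (c (S d))) + 2).
      assert (HS0 : 0 <= S0) by (apply Rsum_ge_0; intros; apply Cmod_ge_0).
      assert (Hd0 : 0 <= (S0 + Cmod (p 0%C) + 1) / Cmod (c (S d))) by (apply Rdiv_le_0_compat; lra).
      set (g := fun z => (/ p (R0 * z))%C).
      assert (Hg : holo_D g).
      { apply holo_hdiff. intros z _. apply (hdiff_inv (fun z => p (R0 * z))%C); [apply Hp|].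
        apply (hdiff_comp p (fun z => R0 * z)%C); [apply hdiff_mult; [apply hdiff_const | apply hdiff_id]|].
        eapply hdiff_is_poly. exists c. exact Hc. }
      assert (M := avg_mean g (1 / 2) Hg ltac:(lra)).
      assert (Hg0 : g 0%C = (/ p 0)%C) by (unfold g; do 2 f_equal; ring).
      assert (B : Cmod (g 0%C) <= / (Cmod (p 0%C) + 1)).
      { rewrite <- M. apply avg_bound; [apply holo_circ; [exact Hg | lra]|]. intros t.
        unfold g. rewrite Cmod_inv by apply Hp. apply Rinv_le_contravar; [lra|].
        set (v := (R0 * circ (1 / 2) t)%C).
        assert (Hv : Cmod v = R0 / 2) by (unfold v; rewrite Cmod_mult, Cmod_circ, Cmod_R, Rabs_pos_eq; unfold R0; lra).
        rewrite (Hc v). assert (Hv1 : 1 <= Cmod v) by (rewrite Hv; unfold R0; lra).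
        eapply Rle_trans; [|apply poly_growth, Hv1]. fold S0. rewrite Hv. unfold R0.
        replace (Cmod (c (S d)) * ((2 * ((S0 + Cmod (p 0%C) + 1) / Cmod (c (S d))) + 2) / 2))
          with (S0 + Cmod (p 0%C) + 1 + Cmod (c (S d))) by (field; lra). lra. }
      rewrite Hg0, Cmod_inv in B by apply Hp.
      assert (/ (Cmod (p 0%C) + 1) < / Cmod (p 0%C)) by (apply Rinv_lt_contravar; [apply Rmult_lt_0_compat|]; lra). lra.
Qed.

(** Factors [u] are divided out until the value at the origin is nonzero; what is left has no zero
    at all and is constant. *)
Lemma poly_monomial d : forall p, is_poly d p -> (forall u : C, u <> 0%C -> p u <> 0%C) ->
  exists l (c : C), (l <= d)%nat /\ c <> 0%C /\ forall u, p u = (c * u ^ l)%C.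
Proof.
  assert (H1 : RtoC 1 <> 0%C) by (apply RtoC_neq0; lra).
  induction d as [|d IH]; intros p Hp Hn.
  - exists 0%nat, (p 0%C). destruct Hp as [c Hc].
    assert (E : forall u, p u = p 0%C) by (intros u; rewrite !Hc; simpl; ring).
    split; [lia|]. split; [rewrite <- (E 1%C); apply Hn, H1|]. intros u. rewrite (E u). simpl. ring.
  - destruct (excluded_middle_informative (p 0%C = 0%C)) as [E|E].
    + destruct (poly_root_factor (S d) p 0%C Hp E) as [e [q [Ed [Hq Eq]]]]; [exists 1%C; apply Hn, H1|].
      injection Ed as <-.
      destruct (IH q Hq) as [l [c [Hl [Hc Hqc]]]].
      { intros u Hu Hqu. apply (Hn u Hu). rewrite Eq, Hqu. ring. }
      exists (S l), c. split; [lia|]. split; [exact Hc|]. intros u. rewrite Eq, Hqc. simpl. ring.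
    + exists 0%nat, (p 0%C). split; [lia|]. split; [exact E|]. intros u.
      rewrite (nonvanishing_poly_const (S d) p Hp); [simpl; ring|].
      intros v. destruct (excluded_middle_informative (v = 0%C)) as [->|Hv]; [exact E | apply Hn, Hv].
Qed.

(** * Finite products and products with one factor left out *)

Fixpoint Cprod (f : nat -> C) (n : nat) : C :=
  match n with O => RtoC 1 | S m => (Cprod f m * f m)%C end.

Definition exc (j : nat) (f : nat -> C) (i : nat) : C := if Nat.eq_dec i j then RtoC 1 else f i.

Lemma Cprod_ext f g n : (forall k, (k < n)%nat -> f k = g k) -> Cprod f n = Cprod g n.
Proof.
  induction n as [|n IH]; intros H; simpl; [reflexivity|].
  rewrite IH, (H n); auto with arith.
Qed.

Lemma Cprod_mult f g n : Cprod (fun k => f k * g k)%C n = (Cprod f n * Cprod g n)%C.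
Proof. induction n as [|n IH]; simpl; [ring | rewrite IH; ring]. Qed.

Lemma Cprod_exc f n j : (j < n)%nat -> (f j * Cprod (exc j f) n)%C = Cprod f n.
Proof.
  induction n as [|n IH]; intros H; [lia|]. simpl.
  destruct (Nat.eq_dec j n) as [->|Hj].
  - replace (Cprod (exc n f) n) with (Cprod f n).
    + unfold exc. destruct (Nat.eq_dec n n); [ring | lia].
    + apply Cprod_ext. intros k Hk. unfold exc. destruct (Nat.eq_dec k n); [lia | reflexivity].
  - rewrite <- IH by lia. unfold exc at 2. destruct (Nat.eq_dec n j); [lia | ring].
Qed.

Lemma Cprod_0 (f : nat -> C) n i : (i < n)%nat -> f i = 0%C -> Cprod f n = 0%C.
Proof.
  induction n as [|n IH]; intros Hi H; [lia|]. simpl.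
  destruct (Nat.eq_dec i n) as [->|Hin]; [rewrite H; ring | rewrite IH by (lia || exact H); ring].
Qed.

Lemma Cprod_neq0 (f : nat -> C) n : (forall i, (i < n)%nat -> f i <> 0%C) -> Cprod f n <> 0%C.
Proof.
  induction n as [|n IH]; intros H; simpl; [apply RtoC_neq0; lra|].
  apply Cmult_neq_0; [apply IH; auto with arith | apply H; lia].
Qed.

Lemma Cprod_zero_inv (f : nat -> C) n : Cprod f n = 0%C -> exists i, (i < n)%nat /\ f i = 0%C.
Proof.
  intros H. apply NNPP. intros Hno. apply (Cprod_neq0 f n); [|exact H].
  intros i Hi E. apply Hno. exists i. auto.
Qed.

Lemma Cprod_pow (c : C) n : Cprod (fun _ => c) n = (c ^ n)%C.
Proof. induction n as [|n IH]; simpl; [reflexivity | rewrite IH; ring]. Qed.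

Lemma Cprod_conj f n : Cconj (Cprod f n) = Cprod (fun k => Cconj (f k)) n.
Proof.
  induction n as [|n IH]; simpl; [apply C_ext; simpl; ring | rewrite Cmult_conj, IH; reflexivity].
Qed.

Lemma Cmod_Cprod_unit f n : (forall i, (i < n)%nat -> Cmod (f i) = 1) -> Cmod (Cprod f n) = 1.
Proof.
  induction n as [|n IH]; intros H; simpl; [apply Cmod_1|].
  rewrite Cmod_mult, IH, H by auto with arith. ring.
Qed.

Lemma is_poly_Cprod_lin (f : nat -> C -> C) n : (forall i, (i < n)%nat -> exists a b : C, forall u, f i u = (a + b * u)%C) ->
  is_poly n (fun u => Cprod (fun i => f i u) n).
Proof.
  induction n as [|n IH]; intros H; simpl; [apply is_poly_const|].
  destruct (H n ltac:(lia)) as [a [b E]].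
  apply is_poly_ext with (fun u => (a + b * u) * Cprod (fun i => f i u) n)%C; [intros u; rewrite E; ring|].
  apply is_poly_lin, IH. auto with arith.
Qed.

Lemma is_poly_exc (f : nat -> C -> C) n j : (j < n)%nat -> (forall i, (i < n)%nat -> exists a b : C, forall u, f i u = (a + b * u)%C) ->
  is_poly (n - 1) (fun u => Cprod (exc j (fun i => f i u)) n).
Proof.
  induction n as [|n IH]; intros Hj H; [lia|]. replace (S n - 1)%nat with n by lia.
  destruct (Nat.eq_dec j n) as [->|Hjn].
  - apply is_poly_ext with (fun u => Cprod (fun i => f i u) n).
    + intros u. simpl. unfold exc at 2. destruct (Nat.eq_dec n n); [|lia]. rewrite Cmult_1_r.
      apply Cprod_ext. intros k Hk. unfold exc. destruct (Nat.eq_dec k n); [lia | reflexivity].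
    + apply is_poly_Cprod_lin. auto with arith.
  - destruct (H n ltac:(lia)) as [a [b E]].
    apply is_poly_ext with (fun u => (a + b * u) * Cprod (exc j (fun i => f i u)) n)%C.
    + intros u. simpl. unfold exc at 3. destruct (Nat.eq_dec n j); [lia|]. rewrite E. ring.
    + replace n with (S (n - 1)) at 1 by lia. apply is_poly_lin, IH; [lia | auto with arith].
Qed.

(** * Equally spaced atoms *)

Section Spaced.
Variables (f : C -> C) (gam : C) (N : nat) (lam : nat -> R) (al : nat -> C).
Hypothesis HN1 : (1 <= N)%nat.
Hypothesis Hgam : Cmod gam = 1.
Hypothesis Hlam : forall j, (j < N)%nat -> 0 < lam j.
Hypothesis Hal : forall j, (j < N)%nat -> Cmod (al j) = 1.
Hypothesis Hdist : forall i j, (i < j < N)%nat -> al i <> al j.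

(** The Herglotz transform of the atomic measure; [pm] below gives its moments. *)
Definition hat (z : C) : C := Csum (fun j => lam j * cay (al j) z)%C N.

Hypothesis Hf : forall z, inD z -> f z = (gam * Cexp (- hat z))%C.

Definition mass : R := Rsum lam N.

Definition pm (k : nat) : C := Csum (fun j => lam j * al j ^ k)%C N.

Lemma mass_pos : 0 < mass.
Proof.
  assert (H := Rsum_term lam N 0 (fun k Hk => Rlt_le _ _ (Hlam k Hk)) ltac:(lia)).
  assert (H0 := Hlam 0%nat ltac:(lia)). unfold mass. lra.
Qed.

Lemma pm_0 : pm 0 = RtoC mass.
Proof. unfold pm, mass. rewrite RtoC_sum. apply Csum_ext. intros k _. simpl. ring. Qed.

Lemma holo_hat : holo_D hat.
Proof. apply (holo_sum (fun j z => lam j * cay (al j) z)%C). intros j Hj. apply holo_scal, holo_cay, Hal, Hj. Qed.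

Lemma coef_hat k : (1 <= k)%nat -> coef hat k = (2 * pm k)%C.
Proof.
  intros Hk. unfold hat. rewrite (coef_sum (fun j z => lam j * cay (al j) z)%C)
    by (intros; apply holo_scal, holo_cay, Hal; assumption).
  unfold pm. rewrite <- Csum_scal. apply Csum_ext. intros j Hj.
  rewrite coef_scal, coef_cay by (try apply holo_cay; apply Hal, Hj).
  destruct (Nat.eq_dec k 0); [lia | ring].
Qed.

Lemma hat_0 : hat 0%C = RtoC mass.
Proof.
  unfold hat, mass. rewrite RtoC_sum. apply Csum_ext. intros k _. unfold cay.
  replace ((1 + al k * 0) / (1 - al k * 0))%C with (RtoC 1); [ring|].
  replace (1 - al k * 0)%C with (RtoC 1) by ring. field.
Qed.

Lemma monic_roots M (b : nat -> C) : exists d : nat -> C, d M = 1%C /\ (forall i, (M < i)%nat -> d i = 0%C) /\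
  forall j, (j < M)%nat -> Csum (fun i => d i * b j ^ i)%C (S M) = 0%C.
Proof.
  induction M as [|M IH].
  - exists (fun i => if Nat.eq_dec i 0 then RtoC 1 else RtoC 0). split; [reflexivity|].
    split; [intros i Hi; destruct (Nat.eq_dec i 0); [lia | reflexivity] | intros; lia].
  - destruct IH as [d [H1 [H2 H3]]].
    (* Coefficients of the previous polynomial multiplied by [X - b M]. *)
    exists (fun i => ((match i with O => RtoC 0 | S k => d k end) - b M * d i)%C).
    split; [rewrite H1, (H2 (S M)) by lia; ring|].
    split; [intros i Hi; destruct i as [|i]; [lia|]; rewrite (H2 i), (H2 (S i)) by lia; ring|].
    intros j Hj.
    assert (E : Csum (fun i => ((match i with O => RtoC 0 | S k => d k end) - b M * d i) * b j ^ i)%C (S (S M))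
      = ((b j - b M) * Csum (fun i => d i * b j ^ i) (S M))%C).
    { rewrite (Csum_ext _ (fun i => (match i with O => RtoC 0 | S k => d k end) * b j ^ i + (- b M) * (d i * b j ^ i))%C) by (intros; ring).
      rewrite Csum_plus, Csum_scal. rewrite Csum_S_l.
      rewrite (Csum_ext _ (fun i => b j * (d i * b j ^ i))%C) by (intros; simpl; ring).
      rewrite Csum_scal. change (Csum (fun i => d i * b j ^ i)%C (S (S M))) with (Csum (fun i => d i * b j ^ i) (S M) + d (S M) * b j ^ S M)%C.
      rewrite (H2 (S M)) by lia. ring. }
    rewrite E. destruct (Nat.eq_dec j M) as [->|Hjm]; [ring|]. rewrite H3 by lia. ring.
Qed.

Hypothesis Hpm : forall k, (1 <= k < N)%nat -> pm k = 0%C.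

(* The moments of the monic polynomial with roots [al j] against the measure force all its middle
   coefficients to vanish. *)
Lemma atoms_roots : exists mu : C, Cmod mu = 1 /\ forall j, (j < N)%nat -> (al j ^ N)%C = mu.
Proof.
  destruct (monic_roots N al) as [d [Hd1 [Hd2 Hd3]]].
  assert (Hm := mass_pos).
  assert (Hd0 : forall k, (1 <= k < N)%nat -> d k = 0%C).
  { intros k Hk.
    (* Pairing the vanishing values with the conjugate of [al j ^ k] isolates [d k * mass]: every
       other index differs from [k] by a number from [1] to [N - 1], whose moment is zero. *)
    assert (Z : Csum (fun j => lam j * Cconj (al j) ^ k * Csum (fun i => d i * al j ^ i) (S N))%C N = 0%C).
    { apply Csum_0. intros j Hj. rewrite Hd3 by exact Hj. ring. }
    rewrite (Csum_ext _ (fun j => Csum (fun i => d i * (lam j * (al j ^ i * Cconj (al j) ^ k))) (S N))%C) in Z.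
    - rewrite Csum_swap in Z.
      rewrite (Csum_single _ (S N) k) in Z.
      + rewrite Csum_scal in Z. rewrite (Csum_ext _ (fun j => lam j * al j ^ 0)%C) in Z.
        * change (Csum (fun j => lam j * al j ^ 0)%C N) with (pm 0) in Z. rewrite pm_0 in Z.
          apply C_integral in Z. destruct Z as [Z|Z]; [exact Z|]. apply (f_equal Re) in Z. rewrite !Re_R in Z. lra.
        * intros j Hj. rewrite <- Cpow_mult_l, conj_unit, Cpow_1 by (apply Hal, Hj). reflexivity.
      + lia.
      + intros i Hi Hik. rewrite Csum_scal.
        destruct (Nat.lt_ge_cases i k) as [H|H].
        * rewrite (Csum_ext _ (fun j => Cconj (lam j * al j ^ (k - i)))%C).
          -- rewrite <- Csum_conj. change (Csum (fun j => lam j * al j ^ (k - i))%C N) with (pm (k - i)).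
             rewrite Hpm by lia. apply C_ext; unfold Re, Im; simpl; ring.
          -- intros j Hj. rewrite Cmult_conj, Cpow_conj.
             replace (Cconj (lam j)) with (RtoC (lam j)) by (apply C_ext; simpl; ring). f_equal.
             replace k with (i + (k - i))%nat at 1 by lia. rewrite Cpow_add, Cmult_assoc, <- Cpow_mult_l, conj_unit, Cpow_1 by (apply Hal, Hj).
             ring.
        * rewrite (Csum_ext _ (fun j => lam j * al j ^ (i - k))%C).
          -- change (Csum (fun j => lam j * al j ^ (i - k))%C N) with (pm (i - k)).
             rewrite Hpm by lia. ring.
          -- intros j Hj. f_equal. replace i with ((i - k) + k)%nat at 1 by lia.
             rewrite Cpow_add, <- Cmult_assoc, <- Cpow_mult_l, conj_unit, Cpow_1 by (apply Hal, Hj). ring.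
    - intros j Hj. rewrite <- Csum_scal. apply Csum_ext. intros; ring. }
  assert (Hr : forall j, (j < N)%nat -> (al j ^ N)%C = (- d 0%nat)%C).
  { intros j Hj. assert (E := Hd3 j Hj). change (Csum (fun i => d i * al j ^ i)%C (S N)) with (Csum (fun i => d i * al j ^ i) N + d N * al j ^ N)%C in E.
    rewrite (Csum_single _ N 0), Hd1 in E.
    - apply Cminus_eq0. rewrite <- E. simpl. ring.
    - lia.
    - intros k Hk Hk0. rewrite Hd0 by lia. ring. }
  exists (- d 0%nat)%C. split; [|exact Hr].
  rewrite <- (Hr 0%nat) by lia. apply pow_unit_mod, Hal. lia.
Qed.

(** As [al j ^ N = mu], each kernel is a combination of [(al j * z)^s], [s < N], over the common
    denominator [1 - mu z^N]. In the sum over the atoms only [s = 0] survives, which yields the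
    total mass without solving for the single ones. *)
Lemma spaced_form : exists mu : C, Cmod mu = 1 /\ forall z, inD z -> f z = (gam * Atom mass (mu * z ^ N))%C.
Proof.
  destruct atoms_roots as [mu [Hmu Hr]]. exists mu. split; [exact Hmu|]. intros z Hz.
  rewrite (Hf z Hz). unfold Atom. do 3 f_equal.
  set (v := (mu * z ^ N)%C).
  assert (Hv : (1 - v)%C <> 0%C) by (apply one_minus_neq0, inD_pow_unit; [lia | exact Hmu | exact Hz]).
  assert (E : forall j, (j < N)%nat -> cay (al j) z = (2 / (1 - v) * Csum (fun s => (al j * z) ^ s) N - 1)%C).
  { intros j Hj. assert (Hd := cay_den (al j) z (Hal j Hj) Hz).
    assert (G := geom_finite (al j * z) N). rewrite Cpow_mult_l, (Hr j Hj) in G. fold v in G.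
    set (X := Csum (fun s => ((al j * z) ^ s)%C) N) in *.
    replace (2 / (1 - v) * X - 1)%C with (2 / (1 - v) * ((1 - al j * z) * X / (1 - al j * z)) - 1)%C by (field; split; assumption).
    rewrite G. unfold cay. field. split; assumption. }
  unfold hat. rewrite (Csum_ext _ (fun j => 2 / (1 - v) * Csum (fun s => z ^ s * (lam j * al j ^ s)) N + (- (1)) * (lam j * al j ^ 0))%C).
  - rewrite Csum_plus, !Csum_scal, Csum_swap.
    change (Csum (fun j => lam j * al j ^ 0)%C N) with (pm 0).
    rewrite (Csum_single _ N 0).
    + rewrite Csum_scal. change (Csum (fun j => lam j * al j ^ 0)%C N) with (pm 0). rewrite pm_0. simpl. field. exact Hv.
    + lia.
    + intros k Hk Hk0. rewrite Csum_scal. change (Csum (fun j => lam j * al j ^ k)%C N) with (pm k).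
      rewrite Hpm by lia. ring.
  - intros j Hj. rewrite (E j Hj).
    rewrite (Csum_ext (fun s => z ^ s * (lam j * al j ^ s))%C (fun s => lam j * (al j * z) ^ s)%C) by (intros; rewrite Cpow_mult_l; ring).
    rewrite (Csum_scal (lam j) (fun s => (al j * z) ^ s)%C N). change (al j ^ 0)%C with (RtoC 1). ring.
Qed.
End Spaced.

(** * From conditions (2), (3) and (4) to vanishing moments *)

Section Conditions.
Variables (f : C -> C) (gam : C) (N : nat) (lam : nat -> R) (al : nat -> C).
Hypothesis HN1 : (1 <= N)%nat.
Hypothesis Hgam : Cmod gam = 1.
Hypothesis Hlam : forall j, (j < N)%nat -> 0 < lam j.
Hypothesis Hal : forall j, (j < N)%nat -> Cmod (al j) = 1.
Hypothesis Hdist : forall i j, (i < j < N)%nat -> al i <> al j.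
Hypothesis HfB : holo_D f.
Hypothesis Hf : forall z, inD z -> f z = (gam * Cexp (- hat N lam al z))%C.

Let hh := hat N lam al.
Let ms := mass N lam.

Lemma hh_holo : holo_D hh.
Proof. apply holo_hat, Hal. Qed.

Lemma pm_of_coef k : (1 <= k)%nat -> coef hh k = 0%C -> pm N lam al k = 0%C.
Proof.
  intros Hk H. unfold hh in H. rewrite coef_hat in H by assumption.
  apply C_integral in H. destruct H as [H|H]; [|exact H]. apply (f_equal Re) in H. rewrite !Re_R in H. lra.
Qed.

(* Compare coefficients in [f' = - f hat']. *)
Lemma gap_moments : (forall j, (1 <= j <= N - 1)%nat -> coef f j = 0%C) ->
  forall k, (1 <= k < N)%nat -> pm N lam al k = 0%C.
Proof.
  intros H0 k Hk. apply pm_of_coef; [lia|]. revert k Hk.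
  assert (Hh := hh_holo). assert (Hdh := holo_deriv_D _ Hh).
  assert (Hf0 : coef f 0 <> 0%C).
  { rewrite coef_0, (Hf _ inD_0) by exact HfB. apply Cmult_neq_0; [apply mod_unit_neq0, Hgam | apply Cexp_neq0]. }
  assert (E : forall k, (INR (S k) * coef f (S k))%C = (- Csum (fun i => (INR (S i) * coef hh (S i)) * coef f (k - i)) (S k))%C).
  { intros k. rewrite <- coef_deriv_D by exact HfB.
    rewrite (coef_ext_D (deriv_D f) (fun z => - (deriv_D hh z * f z))%C).
    - rewrite (coef_opp (fun z => deriv_D hh z * f z)%C k (holo_mult _ _ Hdh HfB)), (coef_mult (deriv_D hh) f k Hdh HfB). f_equal. apply Csum_ext. intros i _.
      rewrite coef_deriv_D by exact Hh. reflexivity.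
    - intros z Hz. apply deriv_D_eq; [exact HfB | exact Hz|].
      apply cdiff_ext_loc with (fun z => gam * Cexp (- hh z))%C.
      + destruct (Cnear_inD z Hz) as [d [Hd Hd']]. exists d. split; [exact Hd|]. intros w Hw. symmetry. apply Hf, Hd', Hw.
      + replace (- (deriv_D hh z * f z))%C with (gam * (Cexp (- hh z) * (- deriv_D hh z)))%C by (rewrite (Hf z Hz); fold hh; ring).
        apply cdiff_scal. apply (cdiff_comp Cexp (fun z => - hh z)%C); [|apply cdiff_Cexp].
        apply cdiff_opp, cdiff_deriv_D; assumption. }
  intros k. induction k as [k IH] using lt_wf_ind. intros Hk. destruct k as [|k]; [lia|].
  assert (Ek := E k). rewrite H0 in Ek by lia.
  rewrite (Csum_single _ (S k) k) in Ek.
  - rewrite Nat.sub_diag in Ek.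
    assert (Hi : RtoC (INR (S k)) <> 0%C) by (apply RtoC_neq0, not_0_INR; lia).
    replace (coef hh (S k)) with ((- - (INR (S k) * coef hh (S k) * coef f 0)) / (INR (S k) * coef f 0))%C by (field; split; assumption).
    rewrite <- Ek. field. split; assumption.
  - lia.
  - intros i Hi Hik. rewrite (IH (S i)) by lia. ring.
Qed.

Let den (i : nat) (u : C) : C := (1 - al i * u)%C.
Let Dn (u : C) : C := Cprod (fun i => den i u) N.
Let Pj (j : nat) (u : C) : C := Cprod (exc j (fun i => den i u)) N.

Lemma den_lin i : exists a b : C, forall u, den i u = (a + b * u)%C.
Proof. exists 1%C, (- al i)%C. intros u. unfold den. ring. Qed.

Lemma Dn_Pj j u : (j < N)%nat -> Dn u = (den j u * Pj j u)%C.
Proof. intros Hj. symmetry. apply (Cprod_exc (fun i => den i u)), Hj. Qed.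

Lemma Dn_disc u : inD u -> Dn u <> 0%C.
Proof. intros Hu. apply Cprod_neq0. intros i Hi. apply cay_den; [apply Hal, Hi | exact Hu]. Qed.

(** Distinct atoms have distinct poles, so at a pole exactly one of the partial products
    survives. *)
Lemma Pj_pole j u : (j < N)%nat -> den j u = 0%C -> Pj j u <> 0%C /\ forall i, (i < N)%nat -> i <> j -> Pj i u = 0%C.
Proof.
  intros Hj Hd. split.
  - apply Cprod_neq0. intros i Hi. unfold exc. destruct (Nat.eq_dec i j) as [->|Hij]; [apply RtoC_neq0; lra|].
    intros E. unfold den in *.
    assert (Hu : u <> 0%C).
    { intros Eu. rewrite Eu in Hd. replace (1 - al j * 0)%C with (RtoC 1) in Hd by ring. revert Hd. apply RtoC_neq0. lra. }
    assert (Ea : al i = al j).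
    { apply Cminus_eq0. replace (al i - al j)%C with (((1 - al j * u) - (1 - al i * u)) / u)%C by (field; exact Hu).
      rewrite Hd, E. field. exact Hu. }
    destruct (Nat.lt_ge_cases i j) as [H|H]; [apply (Hdist i j); [lia | exact Ea] | apply (Hdist j i); [lia | auto]].
  - intros i Hi Hij. apply (Cprod_0 _ N j Hj). unfold exc. destruct (Nat.eq_dec j i); [lia | exact Hd].
Qed.

Lemma holo_invD m : holo_D (fun u => / Dn u ^ m)%C.
Proof.
  apply holo_hdiff. intros u Hu. apply (hdiff_inv (fun u => Dn u ^ m)%C); [apply Cpow_neq0, Dn_disc, Hu|].
  apply hdiff_pow. eapply hdiff_is_poly. apply (is_poly_Cprod_lin den). intros i _. apply den_lin.
Qed.

Let En (u : C) : C := Csum (fun j => 2 * lam j * al j * Pj j u)%C N.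

(** From [(1 + v) / (1 - v) - 1 = 2 v / (1 - v)] over the common denominator [Dn]. Zeros of [En] are
    thus the points where [hat] takes its central value again. *)
Lemma hat_En u : Dn u <> 0%C -> (hh u - ms)%C = (u * En u / Dn u)%C.
Proof.
  intros Hu. unfold En, hh, hat, ms, mass. rewrite RtoC_sum.
  replace (u * Csum (fun j => 2 * lam j * al j * Pj j u) N / Dn u)%C
    with ((u / Dn u) * Csum (fun j => 2 * lam j * al j * Pj j u) N)%C by (field; exact Hu).
  replace (Csum (fun j => lam j * cay (al j) u) N - Csum (fun k => RtoC (lam k)) N)%C
    with (Csum (fun j => lam j * cay (al j) u) N + (- (1)) * Csum (fun k => RtoC (lam k)) N)%C by ring.
  rewrite <- !Csum_scal, <- Csum_plus. apply Csum_ext. intros j Hj.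
  assert (E := Dn_Pj j u Hj).
  assert (Hd : den j u <> 0%C) by (intros Z; apply Hu; rewrite E, Z; ring).
  assert (HP : Pj j u <> 0%C) by (intros Z; apply Hu; rewrite E, Z; ring).
  rewrite E. unfold cay, den in *. field. split; assumption.
Qed.

(** The kernel [(1 + v) / (1 - v)] has nonpositive real part for [|v| >= 1], so outside the disc
    [hat] cannot take the positive value [ms]. *)
Lemma Re_hat_out u : 1 <= Cmod u -> Dn u <> 0%C -> Re (hh u) <= 0.
Proof.
  intros Hu HD. unfold hh, hat. rewrite Re_sum. rewrite <- Ropp_0.
  assert (H : 0 <= Rsum (fun k => - Re (lam k * cay (al k) u)%C) N).
  { apply Rsum_ge_0. intros k Hk. rewrite Re_Rmult.
    assert (Hd : den k u <> 0%C) by (intros Z; apply HD; rewrite (Dn_Pj k u Hk), Z; ring).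
    unfold cay. rewrite (Re_cayley (al k * u)%C Hd).
    assert (Hp := C_neq0_mod _ Hd). unfold den in Hp.
    rewrite Cmod_mult, (Hal k Hk), Rmult_1_l.
    assert (Hl := Hlam k Hk). set (x := Cmod (1 - al k * u)) in *.
    assert (0 < / (x * x)) by (apply Rinv_0_lt_compat, Rmult_lt_0_compat; assumption).
    replace (- (lam k * ((1 - Cmod u * Cmod u) / (x * x)))) with (lam k * ((Cmod u * Cmod u - 1) * / (x * x))) by (unfold Rdiv; ring).
    apply Rmult_le_pos; [lra|]. apply Rmult_le_pos; [nra | lra]. }
  rewrite (Rsum_ext _ (fun k => (- (1)) * Re (lam k * cay (al k) u)%C)) in H by (intros; ring).
  rewrite Rsum_scal in H. lra.
Qed.

Lemma En_poly : is_poly (N - 1) En.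
Proof.
  apply (is_poly_sum (fun j u => 2 * lam j * al j * Pj j u)%C). intros j Hj. apply is_poly_scal.
  apply (is_poly_exc den N j Hj). intros i _. apply den_lin.
Qed.

Lemma at_pole (F : nat -> C -> C) u : (forall j, (j < N)%nat -> Pj j u = 0%C -> F j u = 0%C) ->
  (forall j, (j < N)%nat -> Pj j u <> 0%C -> F j u <> 0%C) -> Dn u = 0%C -> Csum (fun j => F j u) N <> 0%C.
Proof.
  intros H0 H1 HD. destruct (Cprod_zero_inv _ _ HD) as [j [Hj Hd]].
  destruct (Pj_pole j u Hj Hd) as [P1 P2].
  rewrite (Csum_single _ N j Hj); [apply H1; assumption|].
  intros k Hk Hkj. apply H0; [exact Hk | apply P2; assumption].
Qed.

Lemma lam_al_neq0 j : (j < N)%nat -> (2 * lam j * al j)%C <> 0%C.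
Proof.
  intros Hj. apply Cmult_neq_0; [|apply mod_unit_neq0, Hal, Hj].
  rewrite <- RtoC_mult. apply RtoC_neq0. generalize (Hlam j Hj). lra.
Qed.

(** Injectivity at the centre excludes zeros of [En] in the punctured disc, [Re_hat_out] those
    beyond and [at_pole] those at poles; hence [En] is a monomial. Its degree must be [N - 1], so
    [hat - ms] vanishes to order [N]. *)
Lemma branch_moments : (forall z, inD z -> hh z = hh 0%C -> z = 0%C) ->
  forall k, (1 <= k < N)%nat -> pm N lam al k = 0%C.
Proof.
  intros Hinj.
  assert (Hms : 0 < ms) by (apply mass_pos; assumption).
  assert (Hhm : hh 0%C = RtoC ms) by apply hat_0.
  assert (Hnz : forall u : C, u <> 0%C -> En u <> 0%C).
  { intros u Hu HE. destruct (excluded_middle_informative (Dn u = 0%C)) as [HD|HD].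
    - revert HE. apply (at_pole (fun j u => 2 * lam j * al j * Pj j u)%C); [| |exact HD].
      + intros j _ ->. ring.
      + intros j Hj HP. apply Cmult_neq_0; [apply lam_al_neq0, Hj | exact HP].
    - assert (E := hat_En u HD). rewrite HE in E.
      assert (E2 : hh u = hh 0%C).
      { rewrite Hhm. apply Cminus_eq0. rewrite E. field. exact HD. }
      destruct (Rlt_le_dec (Cmod u) 1) as [H1|H1].
      + apply Hu, Hinj; [exact H1 | exact E2].
      + assert (R1 := Re_hat_out u H1 HD). rewrite E2, Hhm, Re_R in R1. lra. }
  destruct (poly_monomial (N - 1) En En_poly Hnz) as [l [c [Hl [Hc HE]]]].
  assert (HlN : S l = N).
  { destruct (Nat.eq_dec (S l) N) as [|Hne]; [assumption|]. exfalso.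
    (* If [l < N - 1], then [u En / Dn] tends to zero at infinity, whereas [hat - ms] keeps modulus
       at least [ms]. At [u = K + 1] every factor of [Dn] is at least [K] and [K + 1 <= 2 K], so
       this [K] is large enough for the contradiction. *)
    set (K := Cmod c * 2 ^ (N - 1) / ms + 2).
    assert (Hcp := C_neq0_mod _ Hc). assert (H2N : 0 < 2 ^ (N - 1)) by (apply pow_lt; lra).
    assert (HK : 2 < K) by (unfold K; assert (0 < Cmod c * 2 ^ (N - 1) / ms) by (apply Rdiv_lt_0_compat; [apply Rmult_lt_0_compat|]; assumption); lra).
    set (u := RtoC (K + 1)).
    assert (Hu : Cmod u = K + 1) by (unfold u; rewrite Cmod_R, Rabs_pos_eq; lra).
    assert (HDlow : forall M, (M <= N)%nat -> K ^ M <= Cmod (Cprod (fun i => den i u) M)).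
    { induction M as [|M IH]; intros HM; simpl; [rewrite Cmod_1; lra|].
      rewrite Cmod_mult, Rmult_comm. apply Rmult_le_compat; [apply pow_le; lra | lra | apply IH; lia |].
      unfold den. generalize (Cmod_triangle_rev (al M * u) 1). rewrite Cmod_minus_sym, Cmod_mult, Hal, Hu, Cmod_1 by lia. lra. }
    assert (HDN := HDlow N (Nat.le_refl _)). fold (Dn u) in HDN.
    assert (HKN : 0 < K ^ N) by (apply pow_lt; lra).
    assert (HD : Dn u <> 0%C) by (apply mod_neq0; lra).
    assert (E := hat_En u HD). rewrite HE in E.
    assert (R1 := Re_hat_out u ltac:(lra) HD).
    assert (M1 : ms <= Cmod (hh u - ms)).
    { assert (Q := re_le_Cmod (hh u - ms)). rewrite Re_minus, Re_R in Q. apply Rabs_le_between in Q. lra. }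
    assert (M2 : Cmod (hh u - ms) * Cmod (Dn u) = Cmod c * (K + 1) ^ S l).
    { rewrite <- Cmod_mult, E. replace (u * (c * u ^ l) / Dn u * Dn u)%C with (c * u ^ S l)%C by (simpl; field; exact HD).
      rewrite Cmod_mult, Cmod_pow, Hu. reflexivity. }
    assert (M3 : (K + 1) ^ S l <= (2 * K) ^ (N - 1)).
    { apply Rle_trans with ((K + 1) ^ (N - 1)); [apply Rle_pow; [lra | lia] | apply pow_incr; lra]. }
    rewrite Rpow_mult_distr in M3.
    assert (M4 : ms * K ^ N <= Cmod c * (2 ^ (N - 1) * K ^ (N - 1))).
    { apply Rle_trans with (Cmod (hh u - ms) * Cmod (Dn u)); [apply Rmult_le_compat; lra|].
      rewrite M2. apply Rmult_le_compat_l; lra. }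
    replace (K ^ N) with (K * K ^ (N - 1)) in M4 by (replace N with (S (N - 1)) at 2 by lia; reflexivity).
    assert (HKp : 0 < K ^ (N - 1)) by (apply pow_lt; lra).
    assert (M5 : ms * K <= Cmod c * 2 ^ (N - 1)) by (apply Rmult_le_reg_r with (K ^ (N - 1)); lra).
    unfold K in M5. rewrite Rmult_plus_distr_l in M5.
    replace (ms * (Cmod c * 2 ^ (N - 1) / ms)) with (Cmod c * 2 ^ (N - 1)) in M5 by (field; lra). lra. }
  intros k Hk. apply pm_of_coef; [lia|].
  rewrite (coef_ext_D hh (fun u => ms + u ^ N * (c * / Dn u ^ 1))%C).
  - assert (Hi : holo_D (fun u => c * / Dn u ^ 1)%C) by (apply holo_scal, holo_invD).
    rewrite (coef_plus (fun _ => RtoC ms) (fun u => u ^ N * (c * / Dn u ^ 1))%C k (holo_const _)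
      (holo_mult _ _ (holo_pow _ N holo_id) Hi)).
    rewrite coef_const by lia. rewrite (coef_shift (fun u => c * / Dn u ^ 1)%C N k Hi).
    destruct (le_lt_dec N k); [lia | ring].
  - intros u Hu. assert (HD := Dn_disc u Hu). assert (E := hat_En u HD).
    replace (hh u) with (hh u - ms + ms)%C by ring. rewrite E, HE, <- HlN. simpl. field. exact HD.
Qed.

(** The numerator of the derivative of [hat] over the denominator [Dn^2]. *)
Let Pn (u : C) : C := Csum (fun j => 2 * lam j * al j * (Pj j u * Pj j u))%C N.

Lemma cdiff_hat u : inD u -> cdiff hh u (Pn u / (Dn u * Dn u))%C.
Proof.
  intros Hu. assert (HD := Dn_disc u Hu).
  replace (Pn u / (Dn u * Dn u))%C with (Csum (fun j => lam j * ((2 / ((1 - al j * u) * (1 - al j * u))) * (al j * 1))) N)%C.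
  - apply (cdiff_sum (fun j z => lam j * cay (al j) z)%C). intros j Hj. apply cdiff_scal.
    apply (cdiff_comp (fun u => (1 + u) / (1 - u))%C (fun z => al j * z)%C).
    + apply cdiff_scal, cdiff_id.
    + apply hdiff_cayley, inD_unit_mult; [apply Hal, Hj | exact Hu].
  - unfold Pn. replace (Csum (fun j => 2 * lam j * al j * (Pj j u * Pj j u)) N / (Dn u * Dn u))%C
      with (/ (Dn u * Dn u) * Csum (fun j => 2 * lam j * al j * (Pj j u * Pj j u)) N)%C by (field; exact HD).
    rewrite <- Csum_scal. apply Csum_ext. intros j Hj.
    assert (E := Dn_Pj j u Hj).
    assert (Hd : den j u <> 0%C) by (intros Z; apply HD; rewrite E, Z; ring).
    assert (HP : Pj j u <> 0%C) by (intros Z; apply HD; rewrite E, Z; ring).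
    rewrite E. unfold den in *. field. split; assumption.
Qed.

Lemma Pn_poly : is_poly (2 * (N - 1)) Pn.
Proof.
  apply (is_poly_sum (fun j u => 2 * lam j * al j * (Pj j u * Pj j u))%C). intros j Hj. apply is_poly_scal.
  replace (2 * (N - 1))%nat with ((N - 1) + (N - 1))%nat by lia.
  assert (H : is_poly (N - 1) (Pj j)) by (apply (is_poly_exc den N j Hj); intros i _; apply den_lin).
  apply is_poly_mul; exact H.
Qed.

(** [Pn] is self-inversive: reflection in the circle reproduces it up to a unimodular factor and a
    power of [u]. Zeros outside the disc therefore correspond to zeros inside. *)
Lemma Pn_reflect (u : C) : u <> 0%C -> (Cmod u * Cmod u) * Cmod (Pn u) = (Cmod u ^ N * Cmod u ^ N) * Cmod (Pn (/ Cconj u)%C).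
Proof.
  intros Hu. assert (Hcu : Cconj u <> 0%C) by (apply mod_neq0; rewrite Cmod_conj; apply C_neq0_mod, Hu).
  set (v := (/ Cconj u)%C).
  set (A := Cprod al N).
  assert (HA1 : Cmod A = 1) by (apply Cmod_Cprod_unit; exact Hal).
  assert (HAA : (A * Cconj A)%C = 1%C) by apply conj_unit, HA1.
  (* Each linear factor changes sign under reflection; the resulting sign is the same for all [j]
     and disappears because [Pj] enters squared. *)
  assert (HP : forall j, (j < N)%nat -> (u ^ N * A * Cconj (al j) * Cconj (Pj j v))%C = ((- (1)) ^ (N + 1) * u * Pj j u)%C).
  { intros j Hj. unfold Pj. rewrite Cprod_conj.
    assert (Hc : forall i, (i < N)%nat -> (u * al i * Cconj (den i v))%C = ((- (1)) * den i u)%C).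
    { intros i Hi. unfold den, v. rewrite Cminus_conj, Cmult_conj, Cinv_conj, Cconj_conj by exact Hcu.
      replace (Cconj 1) with (RtoC 1) by (apply C_ext; simpl; ring).
      replace (u * al i * (1 - Cconj (al i) * / u))%C with (u * al i - al i * Cconj (al i))%C by (field; exact Hu).
      rewrite conj_unit by (apply Hal, Hi). ring. }
    set (X := Cprod (exc j (fun i => (u * al i)%C)) N).
    assert (HX : (u * al j * X)%C = (u ^ N * A)%C).
    { unfold X. rewrite (Cprod_exc (fun i => (u * al i)%C) N j Hj), (Cprod_mult (fun _ => u)), Cprod_pow. reflexivity. }
    set (Y := Cprod (exc j (fun _ => (- (1))%C)) N).
    assert (HY : ((- (1)) * Y)%C = ((- (1)) ^ N)%C).
    { unfold Y. rewrite (Cprod_exc (fun _ => (- (1))%C) N j Hj), Cprod_pow. reflexivity. }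
    assert (HXY : (X * Cprod (fun k => Cconj (exc j (fun i => den i v) k)) N)%C = (Y * Cprod (exc j (fun i => den i u)) N)%C).
    { unfold X, Y. rewrite <- !Cprod_mult. apply Cprod_ext. intros i Hi. unfold exc.
      destruct (Nat.eq_dec i j); [apply C_ext; simpl; ring | apply Hc, Hi]. }
    rewrite <- HX.
    replace (u * al j * X * Cconj (al j) * Cprod (fun k => Cconj (exc j (fun i => den i v) k)) N)%C
      with (u * (al j * Cconj (al j)) * (X * Cprod (fun k => Cconj (exc j (fun i => den i v) k)) N))%C by ring.
    rewrite HXY, conj_unit by (apply Hal, Hj).
    rewrite Nat.add_1_r. simpl. rewrite <- HY. ring. }
  assert (Hsq : ((- (1)) ^ (N + 1) * (- (1)) ^ (N + 1))%C = 1%C).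
  { rewrite <- Cpow_mult_l. replace (- (1) * - (1))%C with (RtoC 1) by ring. apply Cpow_1. }
  assert (Main : (u ^ N * u ^ N * (A * A) * Cconj (Pn v))%C = (u * u * Pn u)%C).
  { unfold Pn. rewrite Csum_conj, <- !Csum_scal. apply Csum_ext. intros j Hj.
    rewrite !Cmult_conj. replace (Cconj (lam j)) with (RtoC (lam j)) by (apply C_ext; simpl; ring).
    replace (Cconj 2) with (RtoC 2) by (apply C_ext; simpl; ring).
    replace (u ^ N * u ^ N * (A * A) * (2 * lam j * Cconj (al j) * (Cconj (Pj j v) * Cconj (Pj j v))))%C
      with (2 * lam j * (u ^ N * A * (al j * Cconj (al j)) * Cconj (Pj j v)) * (u ^ N * A * Cconj (al j) * Cconj (Pj j v)))%C
      by (rewrite conj_unit by (apply Hal, Hj); ring).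
    replace (u ^ N * A * (al j * Cconj (al j)) * Cconj (Pj j v))%C with (al j * (u ^ N * A * Cconj (al j) * Cconj (Pj j v)))%C by ring.
    rewrite (HP j Hj).
    replace (2 * lam j * (al j * ((- (1)) ^ (N + 1) * u * Pj j u)) * ((- (1)) ^ (N + 1) * u * Pj j u))%C
      with (((- (1)) ^ (N + 1) * (- (1)) ^ (N + 1)) * (u * u * (2 * lam j * al j * (Pj j u * Pj j u))))%C by ring.
    rewrite Hsq. ring. }
  apply (f_equal Cmod) in Main. rewrite !Cmod_mult, Cmod_conj, Cmod_pow, HA1 in Main. rewrite <- Main. ring.
Qed.

(** Zeros of [Pn] in the punctured disc are critical points of [f], those outside are excluded by
    reflection. On the circle, off the poles, [v / (1 - v)^2 = - 1 / |1 - v|^2] makes [u Pn / Dn^2]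
    strictly negative. So [Pn] is a monomial. *)
Lemma critical_moments : (forall z, inD z -> z <> 0%C -> forall l, cdiff f z l -> l <> 0%C) ->
  forall k, (1 <= k < N)%nat -> pm N lam al k = 0%C.
Proof.
  intros Hcrit.
  assert (Hin : forall u, inD u -> u <> 0%C -> Pn u <> 0%C).
  { intros u Hu Hu0 HP.
    assert (Hd : cdiff f u 0%C).
    { apply cdiff_ext_loc with (fun z => gam * Cexp (- hh z))%C.
      - destruct (Cnear_inD u Hu) as [d [Hd Hd']]. exists d. split; [exact Hd|]. intros w Hw. symmetry. apply Hf, Hd', Hw.
      - replace (RtoC 0) with (gam * (Cexp (- hh u) * (- (Pn u / (Dn u * Dn u)))))%C.
        + apply cdiff_scal. apply (cdiff_comp Cexp (fun z => - hh z)%C); [|apply cdiff_Cexp].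
          apply cdiff_opp, cdiff_hat, Hu.
        + rewrite HP. field. apply Dn_disc, Hu. }
    exact (Hcrit u Hu Hu0 _ Hd eq_refl). }
  assert (Hnz : forall u : C, u <> 0%C -> Pn u <> 0%C).
  { intros u Hu. assert (Hup := C_neq0_mod _ Hu).
    destruct (Rtotal_order (Cmod u) 1) as [H1|[H1|H1]].
    - apply Hin; assumption.
    - destruct (excluded_middle_informative (Dn u = 0%C)) as [HD|HD].
      + apply (at_pole (fun j u => 2 * lam j * al j * (Pj j u * Pj j u))%C); [| |exact HD].
        * intros j _ ->. ring.
        * intros j Hj HP. apply Cmult_neq_0; [apply lam_al_neq0, Hj | apply Cmult_neq_0; exact HP].
      + intros HP.
        assert (E : (u * Pn u / (Dn u * Dn u))%C = RtoC (- Rsum (fun j => 2 * lam j / (Cmod (den j u) * Cmod (den j u))) N)).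
        { unfold Pn. replace (u * Csum (fun j => 2 * lam j * al j * (Pj j u * Pj j u)) N / (Dn u * Dn u))%C
            with ((u / (Dn u * Dn u)) * Csum (fun j => 2 * lam j * al j * (Pj j u * Pj j u)) N)%C by (field; exact HD).
          rewrite RtoC_opp, RtoC_sum.
          replace (- Csum (fun k => RtoC (2 * lam k / (Cmod (den k u) * Cmod (den k u)))) N)%C
            with ((- (1)) * Csum (fun k => RtoC (2 * lam k / (Cmod (den k u) * Cmod (den k u)))) N)%C by ring.
          rewrite <- !Csum_scal. apply Csum_ext. intros j Hj.
          assert (Ej := Dn_Pj j u Hj).
          assert (Hd : den j u <> 0%C) by (intros Z; apply HD; rewrite Ej, Z; ring).
          assert (HPj : Pj j u <> 0%C) by (intros Z; apply HD; rewrite Ej, Z; ring).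
          assert (Hdp := C_neq0_mod _ Hd).
          rewrite RtoC_div by (apply Rgt_not_eq, Rmult_lt_0_compat; exact Hdp).
          rewrite <- Cmult_conj_mod, RtoC_mult.
          assert (Hv : Cmod (al j * u) = 1) by (rewrite Cmod_mult, (Hal j Hj), H1; ring).
          assert (Hvv := conj_unit _ Hv). assert (Hv0 := mod_unit_neq0 _ Hv).
          assert (Hcd : Cconj (den j u) = (- den j u / (al j * u))%C).
          { unfold den. rewrite Cminus_conj. replace (Cconj 1) with (RtoC 1) by (apply C_ext; simpl; ring).
            replace (Cconj (al j * u)) with ((al j * u) * Cconj (al j * u) / (al j * u))%C by (field; split; intros Z; apply Hv0; rewrite Z; ring).
            rewrite Hvv. field. split; intros Z; apply Hv0; rewrite Z; ring. }
          rewrite Hcd, Ej. field. repeat split; try assumption; intros Z; apply Hv0; rewrite Z; ring. }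
        rewrite HP in E. apply (f_equal Re) in E. rewrite Re_R in E.
        assert (Hpos : 0 < Rsum (fun j => 2 * lam j / (Cmod (den j u) * Cmod (den j u))) N).
        { assert (Hp : forall j, (j < N)%nat -> 0 < 2 * lam j / (Cmod (den j u) * Cmod (den j u))).
          { intros j Hj. assert (Hd : den j u <> 0%C) by (intros Z; apply HD; rewrite (Dn_Pj j u Hj), Z; ring).
            assert (Hdp := C_neq0_mod _ Hd). assert (Hl := Hlam j Hj).
            apply Rdiv_lt_0_compat; [lra | apply Rmult_lt_0_compat; assumption]. }
          assert (T := Rsum_term _ N 0 (fun k Hk => Rlt_le _ _ (Hp k Hk)) ltac:(lia)). assert (Hp0 := Hp 0%nat ltac:(lia)). lra. }
        replace (u * 0 / (Dn u * Dn u))%C with (RtoC 0) in E by (field; exact HD). rewrite Re_R in E. lra.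
    - intros HP. assert (R := Pn_reflect u Hu). rewrite HP, Cmod_0, Rmult_0_r in R.
      assert (Hcu : Cconj u <> 0%C) by (apply mod_neq0; rewrite Cmod_conj; exact Hup).
      assert (Hv : Pn (/ Cconj u)%C <> 0%C).
      { apply Hin.
        - unfold inD. rewrite Cmod_inv, Cmod_conj by exact Hcu. rewrite <- Rinv_1. apply Rinv_lt_contravar; lra.
        - apply mod_neq0. rewrite Cmod_inv, Cmod_conj by exact Hcu. apply Rinv_0_lt_compat. lra. }
      assert (Hvp := C_neq0_mod _ Hv). assert (HpN : 0 < Cmod u ^ N) by (apply pow_lt; lra).
      assert (0 < Cmod u ^ N * Cmod u ^ N * Cmod (Pn (/ Cconj u)%C)) by (repeat apply Rmult_lt_0_compat; assumption). lra. }
  destruct (poly_monomial _ Pn Pn_poly Hnz) as [l [c [Hl [Hc HE]]]].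
  assert (HlN : S l = N).
  (* Comparing moduli at [2] and [1 / 2] gives [2^(2 l + 2) = 2^(2 N)], so the degree is [N - 1] and
     the derivative of [hat] vanishes to order [N - 1]. *)
  { assert (R := Pn_reflect 2%C ltac:(apply RtoC_neq0; lra)).
    assert (Hcp := C_neq0_mod _ Hc).
    replace (/ Cconj 2)%C with (RtoC (/ 2)) in R.
    - rewrite !HE, !Cmod_mult, !Cmod_pow, !Cmod_R, !Rabs_pos_eq in R by lra.
      assert (H2l : 0 < 2 ^ l) by (apply pow_lt; lra).
      rewrite pow_inv in R.
      assert (R2 : (2 * 2 ^ l) * (2 * 2 ^ l) = 2 ^ N * 2 ^ N).
      { apply Rmult_eq_reg_l with (Cmod c * / 2 ^ l).
        - transitivity (2 * 2 * (Cmod c * 2 ^ l)); [field; lra|]. rewrite R. ring.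
        - apply Rgt_not_eq, Rmult_lt_0_compat; [exact Hcp | apply Rinv_0_lt_compat, H2l]. }
      change (2 * 2 ^ l) with (2 ^ S l) in R2. rewrite <- !pow_add in R2.
      assert (S l + S l = N + N)%nat; [|lia].
      destruct (Nat.lt_total (S l + S l) (N + N)) as [H|[H|H]]; [|exact H|];
        [assert (2 ^ (S l + S l) < 2 ^ (N + N)) by (apply Rlt_pow; [lra | exact H])
        |assert (2 ^ (N + N) < 2 ^ (S l + S l)) by (apply Rlt_pow; [lra | exact H])]; lra.
    - replace (Cconj 2) with (RtoC 2) by (apply C_ext; simpl; ring). rewrite RtoC_inv by lra. reflexivity. }
  intros k Hk. apply pm_of_coef; [lia|]. destruct k as [|k]; [lia|].
  assert (Hh := hh_holo).
  assert (Hz : coef (deriv_D hh) k = 0%C).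
  { rewrite (coef_ext_D _ (fun u => u ^ l * (c * / Dn u ^ 2))%C).
    - rewrite (coef_shift (fun u => c * / Dn u ^ 2)%C l k (holo_scal c _ (holo_invD 2))).
      destruct (le_lt_dec l k); [lia | reflexivity].
    - intros u Hu. rewrite (deriv_D_eq hh u _ Hh Hu (cdiff_hat u Hu)), HE. simpl. field. apply Dn_disc, Hu. }
  rewrite coef_deriv_D in Hz by exact Hh. apply C_integral in Hz. destruct Hz as [Hz|Hz]; [|exact Hz].
  exfalso. apply (RtoC_neq0 (INR (S k))); [apply not_0_INR; lia | exact Hz].
Qed.
End Conditions.

(** * One-atom functions are not extremal beyond the second coefficient *)

Lemma Csum_delta (F : nat -> C) (a : C) d j : (j < d)%nat ->
  Csum (fun i => (if Nat.eq_dec i j then a else RtoC 0) * F i)%C d = (a * F j)%C.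
Proof.
  intros Hj. rewrite (Csum_single _ d j Hj).
  - destruct (Nat.eq_dec j j); [reflexivity | lia].
  - intros k _ Hk. destruct (Nat.eq_dec k j); [lia | ring].
Qed.

Lemma Rsum_delta (a : R) d j : (j < d)%nat -> Rsum (fun i => if Nat.eq_dec i j then a else 0) d = a.
Proof.
  intros Hj. rewrite (Rsum_single _ d j Hj).
  - destruct (Nat.eq_dec j j); [reflexivity | lia].
  - intros k _ Hk. destruct (Nat.eq_dec k j); [lia | reflexivity].
Qed.

(* Test vectors [g = 1 + eta z^q] and [y = sigma z^m g] in [toeplitz_contraction]. *)
Lemma atom_window t m q (eta sg : R) : 0 <= t -> (1 <= q <= m)%nat -> eta * eta = 1 -> sg * sg = 1 ->
  sg * (2 * er t m + eta * (er t (m - q) + er t (m + q))) <= 2.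
Proof.
  intros Ht Hq Heta Hsg.
  set (g := fun l => ((if Nat.eq_dec l 0 then RtoC 1 else RtoC 0) + (if Nat.eq_dec l q then RtoC eta else RtoC 0))%C).
  set (y := fun i => ((if Nat.eq_dec i m then RtoC sg else RtoC 0) + (if Nat.eq_dec i (m + q) then RtoC (sg * eta) else RtoC 0))%C).
  assert (Habs : forall x, x * x = 1 -> Rabs x * Rabs x = 1) by (intros x Hx; rewrite <- Rabs_mult, Hx; apply Rabs_R1).
  assert (M := toeplitz_contraction (Atom t) g y (S (m + q)) (holo_Atom t) (fun z Hz => proj2 (Cmod_Atom t z Ht Hz))).
  assert (Hg : Rsum (fun i => Cmod (g i) * Cmod (g i)) (S (m + q)) = 2).
  { rewrite (Rsum_ext _ (fun i => (if Nat.eq_dec i 0 then 1 else 0) + (if Nat.eq_dec i q then 1 else 0))).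
    - rewrite Rsum_plus, !Rsum_delta by lia. ring.
    - intros i _. unfold g. destruct (Nat.eq_dec i 0), (Nat.eq_dec i q); try lia.
      + rewrite Cplus_0_r, Cmod_1. ring.
      + rewrite Cplus_0_l, Cmod_R, Habs by exact Heta. ring.
      + rewrite Cplus_0_r, Cmod_0. ring. }
  assert (Hy : Rsum (fun i => Cmod (y i) * Cmod (y i)) (S (m + q)) = 2).
  { rewrite (Rsum_ext _ (fun i => (if Nat.eq_dec i m then 1 else 0) + (if Nat.eq_dec i (m + q) then 1 else 0))).
    - rewrite Rsum_plus, !Rsum_delta by lia. ring.
    - intros i _. unfold y. destruct (Nat.eq_dec i m), (Nat.eq_dec i (m + q)); try lia.
      + rewrite Cplus_0_r, Cmod_R, Habs by exact Hsg. ring.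
      + rewrite Cplus_0_l, Cmod_R, Habs; [ring|]. replace (sg * eta * (sg * eta)) with ((sg * sg) * (eta * eta)) by ring.
        rewrite Hsg, Heta. ring.
      + rewrite Cplus_0_r, Cmod_0. ring. }
  rewrite Hg, Hy in M.
  set (T := fun i => Csum (fun l => g l * coef (Atom t) (i - l))%C (S i)).
  assert (HT : forall i, (q <= i)%nat -> T i = RtoC (er t i + eta * er t (i - q))).
  { intros i Hi. unfold T, g.
    rewrite (Csum_ext _ (fun l => (if Nat.eq_dec l 0 then RtoC 1 else RtoC 0) * (fun l => coef (Atom t) (i - l)) l
       + (if Nat.eq_dec l q then RtoC eta else RtoC 0) * (fun l => coef (Atom t) (i - l)) l)%C) by (intros; ring).
    rewrite Csum_plus, !Csum_delta by lia. rewrite Nat.sub_0_r, !Atom_er, RtoC_plus, RtoC_mult. ring. }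
  rewrite (Csum_ext _ (fun i => (if Nat.eq_dec i m then RtoC sg else RtoC 0) * T i
      + (if Nat.eq_dec i (m + q) then RtoC (sg * eta) else RtoC 0) * T i)%C) in M.
  - rewrite Csum_plus, !Csum_delta, !HT in M by lia. replace (m + q - q)%nat with m in M by lia.
    rewrite <- !RtoC_mult, <- RtoC_plus, Re_R in M.
    replace (sg * eta * (er t (m + q) + eta * er t m)) with (sg * (eta * er t (m + q) + (eta * eta) * er t m)) in M by ring.
    rewrite Heta in M. lra.
  - intros i _. fold (T i). unfold y. rewrite Cplus_conj.
    replace (Cconj (if Nat.eq_dec i m then RtoC sg else RtoC 0)) with (if Nat.eq_dec i m then RtoC sg else RtoC 0)
      by (destruct (Nat.eq_dec i m); apply C_ext; simpl; ring).
    replace (Cconj (if Nat.eq_dec i (m + q) then RtoC (sg * eta) else RtoC 0)) with (if Nat.eq_dec i (m + q) then RtoC (sg * eta) else RtoC 0)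
      by (destruct (Nat.eq_dec i (m + q)); apply C_ext; simpl; ring).
    ring.
Qed.

(** From [exp (- 1 / 16) >= 15 / 16] raised to the sixteenth power; it leaves [exp 1 - 2 <= 0.81]
    for the next lemma. *)
Lemma exp1_lt : exp 1 <= 281 / 100.
Proof.
  assert (H : exp (- / 16) >= 15 / 16) by (generalize (exp_ineq1_le (- / 16)); lra).
  assert (E : exp (- / 16) ^ 16 * exp 1 = 1).
  { assert (P : forall n x, exp x ^ n = exp (INR n * x)).
    { induction n as [|n IH]; intros x; [simpl; rewrite Rmult_0_l, exp_0; reflexivity|].
      rewrite S_INR, Rmult_plus_distr_r, Rmult_1_l, exp_plus, <- IH. simpl. ring. }
    rewrite P, <- exp_plus. replace (INR 16 * - / 16 + 1) with 0 by (simpl; field). apply exp_0. }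
  assert (L : (15 / 16) ^ 16 <= exp (- / 16) ^ 16) by (apply pow_incr; lra).
  assert (N : 100 / 281 <= (15 / 16) ^ 16) by lra.
  assert (Hp := exp_pos 1). nra.
Qed.

(** Here [s = M - t], [v] is the sum of the two nearest neighbours of [e_M] divided by [e_M], and
    [X] the same for distance two. The hypotheses give [|v| <= 0.81] and [X >= - 0.81], while [HX]
    expresses [X] through [v] and forces it below that for [M >= 3]. *)
Lemma window_contradiction (M s e : R) : 3 <= M -> e <= 281 / 100 ->
  2 + (s / (M - 1) + s / (M + 1)) <= e -> 2 - (s / (M - 1) + s / (M + 1)) <= e ->
  2 - ((2 * (s - 1) * (s / (M - 1)) - M) / (M - 2) + (2 * (s + 1) * (s / (M + 1)) - M) / (M + 2)) <= e -> False.
Proof.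
  intros HM He H1 H2 H3.
  set (v := s / (M - 1) + s / (M + 1)) in *.
  assert (Hs : s = v * ((M * M - 1) / (2 * M))) by (unfold v; field; split; [|split]; lra).
  assert (Hv : -81 / 100 <= v <= 81 / 100) by lra.
  assert (HX : ((2 * (s - 1) * (s / (M - 1)) - M) / (M - 2) + (2 * (s + 1) * (s / (M + 1)) - M) / (M + 2)) * (M * M - 4)
     = v * v * (M * M + 1 - 2 / (M * M)) - 6 * v - 2 * (M * M)).
  { rewrite Hs. field. repeat split; lra. }
  set (X := (2 * (s - 1) * (s / (M - 1)) - M) / (M - 2) + (2 * (s + 1) * (s / (M + 1)) - M) / (M + 2)) in *.
  assert (HX2 : -81 / 100 <= X) by lra.
  assert (HM2 : 9 <= M * M) by nra.
  assert (Hvv : v * v <= 6561 / 10000) by nra.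
  assert (Hvv0 : 0 <= v * v) by nra.
  assert (Hin : 0 < 2 / (M * M)) by (apply Rdiv_lt_0_compat; lra).
  assert (A1 : v * v * (M * M + 1 - 2 / (M * M)) <= 6561 / 10000 * (M * M + 1)).
  { apply Rle_trans with (v * v * (M * M + 1)); [apply Rmult_le_compat_l; lra | apply Rmult_le_compat_r; lra]. }
  assert (A2 : - (81 / 100) * (M * M - 4) <= X * (M * M - 4)) by (apply Rmult_le_compat_r; lra).
  lra.
Qed.

(** Stationarity equates the two outer terms of the recurrence at [m], so each equals [(m - t) e_m].
    The recurrences one step down and one step up then make [e_(m-2)] and [e_(m+2)] multiples of
    [e_m] too. *)
Lemma atom_not_critical t m : 0 <= t -> (3 <= m)%nat -> 2 / exp 1 <= Rabs (er t m) ->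
  INR (S m) * er t (S m) = INR (m - 1) * er t (m - 1) -> False.
Proof.
  intros Ht Hm Hbig Hcrit.
  assert (HM : 3 <= INR m) by (apply (le_INR 3) in Hm; simpl in Hm; lra).
  assert (Hep := exp_pos 1).
  assert (R1 := er_rec t (m - 1)). replace (S (m - 1)) with m in R1 by lia.
  assert (R2 := er_rec t (m - 2)). replace (S (S (m - 2))) with m in R2 by lia. replace (S (m - 2)) with (m - 1)%nat in R2 by lia.
  assert (R3 := er_rec t m).
  assert (Em1 : INR (m - 1) = INR m - 1) by (rewrite minus_INR by lia; simpl; ring).
  assert (Em2 : INR (m - 2) = INR m - 2) by (rewrite minus_INR by lia; simpl; ring).
  rewrite S_INR, Em1 in Hcrit. rewrite S_INR, Em1 in R1. rewrite Em1, Em2 in R2. rewrite !S_INR in R3.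
  set (M := INR m) in *. set (s := M - t).
  set (x := er t m) in *. set (a1 := er t (m - 1)) in *. set (b1 := er t (S m)) in *.
  set (a2 := er t (m - 2)) in *. set (b2 := er t (S (S m))) in *.
  assert (Ea1 : a1 = s / (M - 1) * x).
  { apply Rmult_eq_reg_l with (M - 1); [|lra].
    replace ((M - 1) * (s / (M - 1) * x)) with (s * x) by (field; lra).
    unfold s. lra. }
  assert (Eb1 : b1 = s / (M + 1) * x).
  { apply Rmult_eq_reg_l with (M + 1); [|lra].
    replace ((M + 1) * (s / (M + 1) * x)) with (s * x) by (field; lra).
    unfold s. lra. }
  assert (Ea2 : a2 = (2 * (s - 1) * (s / (M - 1)) - M) / (M - 2) * x).
  { apply Rmult_eq_reg_l with (M - 2); [|lra].
    replace ((M - 2) * ((2 * (s - 1) * (s / (M - 1)) - M) / (M - 2) * x)) with (2 * (s - 1) * (s / (M - 1) * x) - M * x) by (field; split; lra).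
    rewrite <- Ea1. unfold s. lra. }
  assert (Eb2 : b2 = (2 * (s + 1) * (s / (M + 1)) - M) / (M + 2) * x).
  { apply Rmult_eq_reg_l with (M + 2); [|lra].
    replace ((M + 2) * ((2 * (s + 1) * (s / (M + 1)) - M) / (M + 2) * x)) with (2 * (s + 1) * (s / (M + 1) * x) - M * x) by (field; split; lra).
    rewrite <- Eb1. unfold s. lra. }
  assert (Hsg : exists sg, sg * sg = 1 /\ sg * x = Rabs x).
  { destruct (Rle_dec 0 x); [exists 1; rewrite Rabs_pos_eq; lra | exists (-1); rewrite Rabs_left; lra]. }
  destruct Hsg as [sg [Hsg1 Hsg2]].
  (* Distance one with both signs bounds [v] on both sides; distance two with the negative sign
     bounds [X] from below. [sg] is the sign of [e_m], so that its modulus factors out. *)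
  assert (W1 := atom_window t m 1 1 sg Ht ltac:(lia) ltac:(lra) Hsg1).
  assert (W2 := atom_window t m 1 (-1) sg Ht ltac:(lia) ltac:(lra) Hsg1).
  assert (W3 := atom_window t m 2 (-1) sg Ht ltac:(lia) ltac:(lra) Hsg1).
  replace (m + 1)%nat with (S m) in * by lia. replace (m + 2)%nat with (S (S m)) in * by lia.
  fold x a1 b1 a2 b2 in W1, W2, W3.
  rewrite Ea1, Eb1 in W1, W2. rewrite Ea2, Eb2 in W3.
  set (p := s / (M - 1) + s / (M + 1)).
  set (X := (2 * (s - 1) * (s / (M - 1)) - M) / (M - 2) + (2 * (s + 1) * (s / (M + 1)) - M) / (M + 2)).
  replace (sg * (2 * x + 1 * (s / (M - 1) * x + s / (M + 1) * x))) with ((sg * x) * (2 + p)) in W1 by (unfold p; ring).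
  replace (sg * (2 * x + -1 * (s / (M - 1) * x + s / (M + 1) * x))) with ((sg * x) * (2 - p)) in W2 by (unfold p; ring).
  match type of W3 with ?L <= 2 => replace L with ((sg * x) * (2 - X)) in W3 by (unfold X; ring) end.
  rewrite Hsg2 in W1, W2, W3. set (Y := Rabs x) in *.
  assert (HY : 0 < 2 / exp 1) by (apply Rdiv_lt_0_compat; lra).
  assert (Hall : forall Z, Y * Z <= 2 -> Z <= exp 1).
  { intros Z HZ. destruct (Rle_dec Z 0) as [|Hz]; [lra|].
    assert (B : 2 / exp 1 * Z <= 2) by (apply Rle_trans with (Y * Z); [apply Rmult_le_compat_r; lra | exact HZ]).
    apply (Rmult_le_compat_r (exp 1)) in B; [|lra].
    replace (2 / exp 1 * Z * exp 1) with (2 * Z) in B by (field; lra). lra. }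
  apply (window_contradiction M s (exp 1) HM exp1_lt).
  - apply Hall, W1.
  - apply Hall, W2.
  - apply Hall, W3.
Qed.

(** * Powers of the variable *)

Lemma coef_dil (g : C -> C) (mu : C) m : Cmod mu = 1 -> holo_D g -> coef (fun z => g (mu * z)%C) m = (mu ^ m * coef g m)%C.
Proof.
  intros Hmu Hg. symmetry.
  apply (coef_unique (fun z => g (mu * z)%C) (fun m => mu ^ m * coef g m)%C m).
  - apply (holo_comp g (fun z => mu * z)%C); [intros z Hz; apply inD_unit_mult; assumption | exact Hg | apply holo_scal, holo_id].
  - intros z Hz. apply Cseries_ext with (fun k => coef g k * (mu * z) ^ k)%C.
    + intros k. rewrite Cpow_mult_l. ring.
    + apply coef_series; [exact Hg | apply inD_unit_mult; assumption].
Qed.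

Lemma inD_pow z N : (1 <= N)%nat -> inD z -> inD (z ^ N)%C.
Proof.
  intros HN Hz. replace (z ^ N)%C with (1 * z ^ N)%C by ring. apply inD_pow_unit; [exact HN | apply Cmod_1 | exact Hz].
Qed.

Lemma coef_powN (g : C -> C) N k : (1 <= N)%nat -> holo_D g ->
  coef (fun z => g (z ^ N)%C) k = Csum (fun i => if Nat.eq_dec (N * i) k then coef g i else RtoC 0) (S k).
Proof.
  intros HN Hg. destruct (taylor_remainder g (S k) Hg) as [r [Hr [E _]]].
  assert (HrN : holo_D (fun z => r (z ^ N)%C)).
  { apply (holo_comp r (fun z => z ^ N)%C); [intros; apply inD_pow; assumption | exact Hr | apply holo_pow, holo_id]. }
  assert (Hm : forall i, (i < S k)%nat -> holo_D (fun z => coef g i * z ^ (N * i))%C) by (intros; apply holo_scal, holo_pow, holo_id).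
  assert (Hs := holo_sum (fun i z => coef g i * z ^ (N * i))%C (S k) Hm).
  assert (Hz := holo_mult _ _ (holo_pow _ (N * S k) holo_id) HrN).
  rewrite (coef_ext_D _ (fun z => Csum (fun i => coef g i * z ^ (N * i)) (S k) + z ^ (N * S k) * r (z ^ N))%C).
  - rewrite (coef_plus _ _ k Hs Hz), (coef_shift _ (N * S k) k HrN).
    destruct (le_lt_dec (N * S k) k) as [H|H]; [nia|]. rewrite Cplus_0_r.
    rewrite (coef_sum (fun i z => coef g i * z ^ (N * i))%C (S k) k Hm).
    apply Csum_ext. intros i _. apply coef_monomial.
  - intros z Hzd. rewrite (E (z ^ N)%C (inD_pow z N HN Hzd)), <- Cpow_mul. f_equal.
    apply Csum_ext. intros i _. rewrite <- Cpow_mul. reflexivity.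
Qed.

Lemma coef_powN_mult (g : C -> C) N m : (1 <= N)%nat -> holo_D g -> coef (fun z => g (z ^ N)%C) (N * m) = coef g m.
Proof.
  intros HN Hg. rewrite coef_powN by assumption. rewrite (Csum_single _ _ m).
  - destruct (Nat.eq_dec (N * m) (N * m)); [reflexivity | lia].
  - nia.
  - intros i _ Hi. destruct (Nat.eq_dec (N * i) (N * m)) as [E|]; [|reflexivity].
    exfalso. apply Hi. apply Nat.mul_cancel_l in E; lia.
Qed.

Lemma coef_powN_gap (g : C -> C) N k : (1 <= N)%nat -> holo_D g -> (forall i, (N * i)%nat <> k) ->
  coef (fun z => g (z ^ N)%C) k = 0%C.
Proof.
  intros HN Hg Hk. rewrite coef_powN by assumption. apply Csum_0. intros i _.
  destruct (Nat.eq_dec (N * i) k) as [E|]; [exfalso; apply (Hk i), E | reflexivity].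
Qed.

(** * Extremal functions with one atom in a power of the variable *)

Definition model_bound (n : nat) (f : C -> C) : Prop :=
  Cmod (coef f n) <= 2 / exp 1 /\
  (Cmod (coef f n) = 2 / exp 1 -> exists gam c, Cmod gam = 1 /\ Cmod c = 1 /\
     forall z, inD z -> f z = (gam * Atom 1 (c * z ^ n))%C).

(** The coefficient of degree [m] in [(1 - u^2) E' = - 2 t E (1 + u) / (1 - u)]. As [- E * cay 1] is
    the derivative of [E] in [t], it turns stationarity in the mass into a relation between two
    neighbouring coefficients. *)
Lemma Atom_cay_critical t m : (1 <= m)%nat ->
  (INR (S m) * er t (S m) - INR (m - 1) * er t (m - 1))%C = (- (2 * t) * coef (fun u => Atom t u * cay 1 u) m)%C.
Proof.
  intros Hm. assert (HE := holo_Atom t). assert (HD := holo_deriv_D _ HE).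
  assert (HQ := holo_mult _ _ HE (holo_cay 1 Cmod_1)).
  set (D := deriv_D (Atom t)) in *.
  assert (H2 := holo_mult _ _ (holo_pow _ 2 holo_id) HD).
  assert (Hz : coef (fun u => D u - u ^ 2 * D u)%C m = (- (2 * t) * coef (fun u => Atom t u * cay 1 u) m)%C).
  { rewrite <- (coef_scal _ _ m HQ). apply coef_ext_D. intros u Hu. unfold D.
    rewrite (deriv_D_eq (Atom t) u _ HE Hu (cdiff_Atom t u Hu)). unfold cay.
    rewrite !Cmult_1_l. field. apply one_minus_neq0, Hu. }
  rewrite <- Hz, (coef_minus _ _ m HD H2), (coef_shift _ 2 m HD).
  unfold D. rewrite !coef_deriv_D by exact HE.
  destruct (le_lt_dec 2 m) as [H|H].
  - replace (S (m - 2)) with (m - 1)%nat by lia. rewrite !Atom_er. ring.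
  - assert (m = 1)%nat as -> by lia. rewrite !Atom_er. simpl. ring.
Qed.

(** Only multiples of [N] carry coefficients, so [n = N m]. For [m >= 3] the mass can be varied both
    ways inside the class, and the stationarity obtained contradicts [atom_not_critical]. *)
Lemma spaced_extremal n f gam t mu N : (1 <= n)%nat -> extremal n f -> Cmod gam = 1 -> Cmod mu = 1 -> 0 < t ->
  (1 <= N)%nat -> (forall z, inD z -> f z = (gam * Atom t (mu * z ^ N))%C) -> model_bound n f.
Proof.
  intros Hn Hext Hgam Hmu Ht HN Hf.
  assert (HB := ext_B0 n f Hext).
  destruct (extremal_real n f Hn Hext) as [A [HA2 HA]].
  assert (Hpos : 0 < 2 / exp 1) by (apply Rdiv_lt_0_compat; [lra | apply exp_pos]).
  assert (Hdil : forall g : C -> C, holo_D g -> holo_D (fun u => g (mu * u)%C)).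
  { intros g Hg. apply (holo_comp g (fun z => mu * z)%C); [intros z Hz; apply inD_unit_mult; assumption | exact Hg | apply holo_scal, holo_id]. }
  assert (HpN : forall g : C -> C, holo_D g -> holo_D (fun z => g (mu * z ^ N)%C)).
  { intros g Hg. apply (holo_comp g (fun z => mu * z ^ N)%C); [intros z Hz; apply inD_pow_unit; assumption | exact Hg | apply holo_scal, holo_pow, holo_id]. }
  assert (HE := holo_Atom t).
  assert (Hgap : forall k, (forall i, (N * i)%nat <> k) -> coef f k = 0%C).
  { intros k Hk. rewrite (coef_ext_D f _ k Hf), (coef_scal gam _ k (HpN _ HE)).
    rewrite (coef_powN_gap (fun u => Atom t (mu * u)%C) N k HN (Hdil _ HE) Hk). ring. }
  assert (Hmul : forall g : C -> C, holo_D g -> forall m, coef (fun z => g (mu * z ^ N)%C) (N * m) = (mu ^ m * coef g m)%C).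
  { intros g Hg m. rewrite (coef_powN_mult (fun u => g (mu * u)%C) N m HN (Hdil _ Hg)). apply coef_dil; assumption. }
  destruct (excluded_middle_informative (exists m, (N * m)%nat = n)) as [[m Hm]|Hno].
  2:{ exfalso. rewrite Hgap in HA; [apply (f_equal Re) in HA; rewrite !Re_R in HA; lra|].
      intros i Hi. apply Hno. exists i. exact Hi. }
  destruct (le_lt_dec 3 m) as [Hm3|Hm3].
  - exfalso.
    assert (Ecf : (gam * mu ^ m * er t m)%C = RtoC A).
    { rewrite <- HA, <- Hm, (coef_ext_D f _ (N * m) Hf), (coef_scal gam _ (N * m) (HpN _ HE)), (Hmul _ HE), Atom_er. ring. }
    assert (HAbs : Rabs (er t m) = A).
    { apply (f_equal Cmod) in Ecf. rewrite !Cmod_mult, Cmod_pow, Hgam, Hmu, pow1, !Cmod_R in Ecf.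
      rewrite (Rabs_pos_eq A) in Ecf by lra. lra. }
    apply (atom_not_critical t m); [lra | exact Hm3 | rewrite HAbs; exact HA2 |].
    set (Q := fun u => (Atom t u * cay 1 u)%C).
    assert (HQ : holo_D Q) by (apply holo_mult; [exact HE | apply holo_cay, Cmod_1]).
    set (p := fun z => (t * cay 1 (mu * z ^ N))%C).
    assert (Hp : holo_D p) by (apply holo_scal; apply (HpN (cay 1)), holo_cay, Cmod_1).
    assert (Hfp : coef (fun z => f z * p z)%C n = (gam * t * (mu ^ m * coef Q m))%C).
    { rewrite (coef_ext_D _ (fun z => gam * t * Q (mu * z ^ N))%C n).
      - rewrite (coef_scal _ _ n (HpN _ HQ)), <- Hm, (Hmul _ HQ). reflexivity.
      - intros z Hz. rewrite (Hf z Hz). unfold p, Q. ring. }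
    (* Multiplication by [Cexp (- (x * p z))] merely changes the mass to [t * (1 + x)], which stays
       positive. *)
    assert (Hvar : forall x, -1 < x < 1 -> B0 (fun z => f z * Cexp (- (x * p z)))%C).
    { intros x Hx. apply B0_ext with (fun z => gam * Atom (t * (1 + x)) (mu * z ^ N))%C.
      - intros z Hz. rewrite (Hf z Hz). unfold Atom. rewrite <- Cmult_assoc, <- Cexp_add. do 2 f_equal.
        unfold p, cay. rewrite !Cmult_1_l, RtoC_mult, RtoC_plus. ring.
      - apply B0_model; try assumption. apply Rmult_le_pos; lra. }
    assert (V1 : 0 <= Re (coef (fun z => f z * p z)%C n)).
    { apply (variation n f p Hext Hp). intros eps He. apply Hvar. lra. }
    assert (V2 : 0 <= Re (coef (fun z => f z * (- p z))%C n)).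
    { apply (variation n f (fun z => - p z)%C Hext (holo_opp _ Hp)). intros eps He.
      apply B0_ext with (fun z => f z * Cexp (- (RtoC (- eps) * p z)))%C.
      - intros z _. rewrite RtoC_opp. do 2 f_equal. ring.
      - apply Hvar. lra. }
    rewrite (coef_ext_D _ (fun z => - (f z * p z))%C) in V2 by (intros; ring).
    rewrite (coef_opp _ n (holo_mult _ _ (proj1 HB) Hp)), Re_opp in V2.
    assert (V : Re (coef (fun z => f z * p z)%C n) = 0) by lra. rewrite Hfp in V.
    assert (C1 := Atom_cay_critical t m ltac:(lia)). fold Q in C1.
    assert (Hx0 : er t m <> 0) by (intros Z; rewrite Z, Rabs_R0 in HAbs; lra).
    set (S0 := INR (S m) * er t (S m) - INR (m - 1) * er t (m - 1)).
    assert (C2 : (gam * t * (mu ^ m * coef Q m))%C = RtoC (- (A / er t m) * S0 / 2)).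
    { assert (Hn0 : RtoC (er t m) <> 0%C) by (apply RtoC_neq0, Hx0).
      replace (gam * t * (mu ^ m * coef Q m))%C with ((gam * mu ^ m * er t m) / er t m * (- (- (2 * t) * coef Q m)) / 2)%C by (field; exact Hn0).
      rewrite Ecf, <- C1. unfold S0, Rdiv. rewrite !RtoC_mult, RtoC_opp, RtoC_mult, !RtoC_inv, RtoC_minus, !RtoC_mult by (try exact Hx0; lra).
      unfold Cdiv. ring. }
    rewrite C2, Re_R in V.
    assert (HS : S0 = 0).
    { apply Rmult_eq_reg_l with (- (A / er t m) / 2); [unfold Rdiv in *; lra|].
      unfold Rdiv. apply Rmult_integral_contrapositive_currified; [|lra]. apply Ropp_neq_0_compat.
      apply Rmult_integral_contrapositive_currified; [lra | apply Rinv_neq_0_compat, Hx0]. }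
    unfold S0 in HS. lra.
  (* For [m <= 2] the gap up to [N - 1] suffices, since [n <= 2 N <= 3 (N - 1) + 2]. *)
  - apply (krzyz_gap f (N - 1) n HB); [nia|]. intros j Hj. apply Hgap. intros i Hi. destruct i; nia.
Qed.

(** * Existence of extremal functions *)

(** Extractions are recorded by [i <= th i] instead of monotonicity; this passes to compositions and
    preserves limits along [eventually]. *)
Lemma bw_R (w : nat -> R) : (forall i, -1 <= w i <= 1) ->
  exists (th : nat -> nat) (l : R), (forall i, (i <= th i)%nat) /\
  forall eps, 0 < eps -> exists N, forall i, (N <= i)%nat -> Rabs (w (th i) - l) < eps.
Proof.
  intros Hw. destruct (Bolzano_Weierstrass w (fun c => -1 <= c <= 1) (compact_P3 (-1) 1) Hw) as [l Hl].
  assert (H : forall i, exists p, (i <= p)%nat /\ Rabs (w p - l) < / INR (S i)).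
  { intros i. assert (Hp : 0 < / INR (S i)) by (apply Rinv_0_lt_compat, lt_0_INR; lia).
    destruct (Hl (disc l (mkposreal _ Hp)) i) as [p [Hp1 Hp2]].
    - exists (mkposreal _ Hp). intros x Hx. exact Hx.
    - exists p. split; [exact Hp1 | exact Hp2]. }
  set (th := fun i => proj1_sig (constructive_indefinite_description _ (H i))).
  assert (Hth : forall i, (i <= th i)%nat /\ Rabs (w (th i) - l) < / INR (S i))
    by (intros i; unfold th; destruct constructive_indefinite_description as [p Hp]; exact Hp).
  exists th, l. split; [apply Hth|]. intros eps He.
  destruct (INR_unbounded (/ eps)) as [N HN]. exists N. intros i Hi.
  eapply Rlt_trans; [apply Hth|]. rewrite <- (Rinv_inv eps).
  apply Rinv_lt_contravar.
  - apply Rmult_lt_0_compat; [apply Rinv_0_lt_compat, He | apply lt_0_INR; lia].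
  - eapply Rlt_trans; [exact HN|]. apply lt_INR. lia.
Qed.

Lemma bw_C (w : nat -> C) : (forall i, Cmod (w i) <= 1) ->
  exists (th : nat -> nat) (l : C), (forall i, (i <= th i)%nat) /\ Clim eventually (fun i => w (th i)) l.
Proof.
  intros Hw.
  destruct (bw_R (fun i => Re (w i))) as [t1 [x [H1 Hx]]].
  { intros i. apply Rabs_le_between. eapply Rle_trans; [apply re_le_Cmod | apply Hw]. }
  destruct (bw_R (fun i => Im (w (t1 i)))) as [t2 [y [H2 Hy]]].
  { intros i. apply Rabs_le_between. eapply Rle_trans; [apply Im_abs_le_mod | apply Hw]. }
  exists (fun i => t1 (t2 i)), (x, y). split.
  - intros i. eapply Nat.le_trans; [apply H2 | apply H1].
  - intros eps He. assert (He2 : 0 < eps / 2) by lra.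
    destruct (Hx _ He2) as [N1 HN1]. destruct (Hy _ He2) as [N2 HN2].
    exists (Nat.max N1 N2). intros i Hi. eapply Rle_lt_trans; [apply Cmod_le_abs|].
    rewrite Re_minus, Im_minus. change (Re (x, y)) with x. change (Im (x, y)) with y.
    assert (A1 := HN1 (t2 i) ltac:(specialize (H2 i); lia)). assert (A2 := HN2 i ltac:(lia)). lra.
Qed.

Lemma diagonal (u : nat -> nat -> C) : (forall i j, Cmod (u i j) <= 1) ->
  exists (phi : nat -> nat) (a : nat -> C), (forall i, (i <= phi i)%nat) /\
  forall j, Clim eventually (fun i => u (phi i) j) (a j).
Proof.
  intros Hu.
  set (P := fun s : nat * (nat -> nat) => forall i, (i <= snd s i)%nat).
  (* A state is the next coordinate to treat and the extraction reached so far; a step refines the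
     extraction until that coordinate converges. *)
  set (Q := fun s s' : nat * (nat -> nat) => fst s' = S (fst s) /\
    (exists th : nat -> nat, (forall i, (i <= th i)%nat) /\ forall i, snd s' i = snd s (th i)) /\
    exists l, Clim eventually (fun i => u (snd s' i) (fst s)) l).
  destruct (dependent_choice P Q (0%nat, fun i => i)) as [s [Hs0 Hs]].
  - intros i. simpl. lia.
  - intros [k Phi] HP. unfold P in HP. simpl in HP.
    destruct (bw_C (fun i => u (Phi i) k)) as [th [l [Hth Hl]]]; [intros; apply Hu|].
    exists (S k, fun i => Phi (th i)). split.
    + intros i. simpl. eapply Nat.le_trans; [apply Hth | apply HP].
    + split; [reflexivity|]. split; [exists th; split; [exact Hth | reflexivity] | exists l; exact Hl].
  - assert (Hk : forall k, fst (s k) = k).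
    { induction k as [|k IH]; [rewrite Hs0; reflexivity|]. destruct (Hs k) as [_ [E _]]. rewrite E, IH. reflexivity. }
    assert (Hth : forall k m, exists th : nat -> nat, (forall i, (i <= th i)%nat) /\ forall i, snd (s (k + m)%nat) i = snd (s k) (th i)).
    { intros k m. induction m as [|m [th [H1 H2]]].
      - exists (fun i => i). rewrite Nat.add_0_r. split; [lia | reflexivity].
      - destruct (Hs (k + m)%nat) as [_ [_ [[th' [H1' H2']] _]]].
        exists (fun i => th (th' i)). rewrite Nat.add_succ_r. split.
        + intros i. eapply Nat.le_trans; [apply H1' | apply H1].
        + intros i. rewrite H2', H2. reflexivity. }
    assert (Hconv : forall k, exists l, Clim eventually (fun i => u (snd (s i) i) k) l).
    { intros k. destruct (Hs k) as [_ [_ [_ [l Hl]]]]. rewrite Hk in Hl. exists l. intros eps He.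
      destruct (Hl eps He) as [N HN]. exists (Nat.max N (S k)). intros i Hi.
      destruct (Hth (S k) (i - S k)%nat) as [th [H1 H2]]. replace (S k + (i - S k))%nat with i in H2 by lia.
      rewrite H2. apply HN. specialize (H1 i). lia. }
    exists (fun i => snd (s i) i), (fun j => proj1_sig (constructive_indefinite_description _ (Hconv j))).
    split; [intros i; apply (proj1 (Hs i))|].
    intros j. destruct constructive_indefinite_description as [l Hl]. exact Hl.
Qed.

Lemma unimodular_const F : B0 F -> 1 <= Cmod (F 0%C) -> (forall z, inD z -> F z = F 0%C) /\ Cmod (F 0%C) = 1.
Proof.
  intros [HF Hb] H1.
  assert (Hone : Cmod (F 0%C) = 1) by (generalize (Hb _ inD_0); lra).
  split; [|exact Hone]. apply coef_const_fun; [exact HF|]. intros k. apply Cmod_eq_0.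
  assert (Bs := bessel F (S (S k)) HF (fun z Hz => proj2 (Hb z Hz))).
  assert (T := Rsum_term (fun i => Cmod (coef F i) * Cmod (coef F i)) (S k) 0
    (fun _ _ => Rmult_le_pos _ _ (Cmod_ge_0 _) (Cmod_ge_0 _)) ltac:(lia)).
  cbv beta in T. rewrite coef_0 in T by exact HF.
  change (Rsum (fun i => Cmod (coef F i) * Cmod (coef F i)) (S k) + Cmod (coef F (S k)) * Cmod (coef F (S k)) <= 1) in Bs.
  assert (H0 := Cmod_ge_0 (coef F (S k))). rewrite Hone in T. nra.
Qed.

(** By subordination with [|w z| <= |z|], and since the real part of the Cayley transform at modulus
    [v] lies between [(1 - v) / (1 + v)] and its inverse. Both bounds use the [t] read off at the
    origin, so smallness or largeness there spreads to every [z]. *)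
Lemma harnack F z : B0 F -> inD z -> exists t, 0 <= t /\ Cmod (F 0%C) = exp (- t) /\
  exp (- (t * ((1 + Cmod z) / (1 - Cmod z)))) <= Cmod (F z) <= exp (- (t * ((1 - Cmod z) / (1 + Cmod z)))).
Proof.
  intros HF Hz. assert (Hz1 := Hz). unfold inD in Hz1. assert (Hz0 := Cmod_ge_0 z).
  set (r := Cmod z) in *.
  assert (Hmono : forall x y, x <= y -> exp x <= exp y).
  { intros x y [H|H]; [left; apply exp_increasing, H | right; f_equal; exact H]. }
  destruct (Rlt_le_dec (Cmod (F 0%C)) 1) as [H1|H1].
  - destruct (subordination F HF H1) as [gam [t [w [Hg [Ht [Hw [Hwz Hfw]]]]]]].
    exists t. split; [lra|]. split.
    + rewrite (Hfw _ inD_0), Cmod_mult, Hg, Rmult_1_l.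
      assert (E : w 0%C = 0%C).
      { apply Cmod_eq_0. assert (H := Hwz _ inD_0). rewrite Cmod_0 in H. generalize (Cmod_ge_0 (w 0%C)). lra. }
      rewrite E, <- coef_0, Atom_0, Cmod_R, Rabs_pos_eq by (try apply holo_Atom; left; apply exp_pos). reflexivity.
    + rewrite (Hfw z Hz), Cmod_mult, Hg, Rmult_1_l. unfold Atom. rewrite Cmod_Cexp, Re_opp, Re_Rmult.
      assert (Hx := Hwz z Hz). fold r in Hx. set (x := w z) in *. assert (Hx0 := Cmod_ge_0 x).
      assert (Hn : (1 - x)%C <> 0%C) by (apply one_minus_neq0; unfold inD; lra).
      rewrite Re_cayley by exact Hn. set (y := Cmod (1 - x)). set (v := Cmod x) in *.
      assert (Hy1 : 1 - v <= y) by (unfold y, v; generalize (Cmod_triangle_rev 1 x); rewrite Cmod_1; lra).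
      assert (Hy2 : y <= 1 + v).
      { unfold y, v. generalize (Cmod_triangle 1 (- x)). rewrite Cmod_1, Cmod_opp. unfold Cminus. lra. }
      assert (Hyp : 0 < y * y) by (apply Rmult_lt_0_compat; lra).
      assert (Hy3 : (1 - v) * (1 - v) <= y * y) by (apply Rmult_le_compat; lra).
      assert (Hy4 : y * y <= (1 + v) * (1 + v)) by (apply Rmult_le_compat; lra).
      split; apply Hmono, Ropp_le_contravar, Rmult_le_compat_l; try lra.
      * apply Rmult_le_reg_r with (y * y); [exact Hyp|]. unfold Rdiv at 1. rewrite Rmult_assoc, Rinv_l, Rmult_1_r by lra.
        apply Rmult_le_reg_r with (1 - r); [lra|].
        replace ((1 + r) / (1 - r) * (y * y) * (1 - r)) with ((1 + r) * (y * y)) by (field; lra).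
        apply Rle_trans with ((1 + r) * ((1 - v) * (1 - v))); [|apply Rmult_le_compat_l; lra].
        replace ((1 - v * v) * (1 - r)) with ((1 - v) * ((1 + v) * (1 - r))) by ring.
        replace ((1 + r) * ((1 - v) * (1 - v))) with ((1 - v) * ((1 + r) * (1 - v))) by ring.
        apply Rmult_le_compat_l; nra.
      * apply Rmult_le_reg_r with (y * y); [exact Hyp|]. unfold Rdiv at 2. rewrite (Rmult_assoc (1 - v * v)), Rinv_l, Rmult_1_r by lra.
        apply Rmult_le_reg_r with (1 + r); [lra|].
        replace ((1 - r) / (1 + r) * (y * y) * (1 + r)) with ((1 - r) * (y * y)) by (field; lra).
        apply Rle_trans with ((1 - r) * ((1 + v) * (1 + v))); [apply Rmult_le_compat_l; lra|].
        replace ((1 - v * v) * (1 + r)) with ((1 + v) * ((1 - v) * (1 + r))) by ring.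
        replace ((1 - r) * ((1 + v) * (1 + v))) with ((1 + v) * ((1 - r) * (1 + v))) by ring.
        apply Rmult_le_compat_l; nra.
  - destruct (unimodular_const F HF H1) as [Hc Ho]. exists 0. split; [lra|].
    rewrite Ropp_0, exp_0, !Rmult_0_l, Ropp_0, exp_0, (Hc z Hz), Ho. split; [reflexivity | lra].
Qed.

(** All coefficients are at most one, so the tails of the series at [z] are small uniformly in [i],
    and finitely many coefficients decide the limit. *)
Lemma holo_limit (F : nat -> C -> C) (a : nat -> C) : (forall i, holo_D (F i)) ->
  (forall i z, inD z -> Cmod (F i z) <= 1) -> (forall j, Clim eventually (fun i => coef (F i) j) (a j)) ->
  radius1 a /\ forall z, inD z -> Clim eventually (fun i => F i z) (pser a z).
Proof.
  intros HF Hb Ha.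
  assert (Hc : forall i j, Cmod (coef (F i) j) <= 1) by (intros i j; apply coef_mod_le1; [apply HF | apply Hb]).
  assert (Ha1 : forall j, Cmod (a j) <= 1).
  { intros j. apply (Clim_mod_le _ _ _ (Ha j)). apply filter_forall. intros i. apply Hc. }
  assert (Hr : radius1 a).
  { intros rho Hrho. exists 1. intros k. assert (P := pow_le_1_compat rho k ltac:(lra)).
    assert (H0 := Cmod_ge_0 (a k)). specialize (Ha1 k). nra. }
  split; [exact Hr|]. intros z Hz. assert (Hz1 := Hz). unfold inD in Hz1. assert (Hz0 := Cmod_ge_0 z).
  assert (Htail : forall (c : nat -> C) l J, (forall k, Cmod (c k) <= 1) -> Cseries (fun k => c k * z ^ k)%C l ->
    Cmod (l - Csum (fun k => c k * z ^ k) J)%C <= 1 * Cmod z ^ J / (1 - Cmod z)).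
  { intros c l J Hcc Hl. apply Cseries_tail; [lra | | exact Hl]. intros k. rewrite Cmod_mult, Cmod_pow.
    apply Rmult_le_compat_r; [apply pow_le, Hz0 | apply Hcc]. }
  intros eps He.
  assert (HJ : exists J, 1 * Cmod z ^ J / (1 - Cmod z) < eps / 4).
  { destruct (pow_lt_1_zero (Cmod z)) with (y := eps / 4 * (1 - Cmod z)) as [J HJ].
    - rewrite Rabs_pos_eq; lra.
    - apply Rmult_lt_0_compat; lra.
    - exists J. specialize (HJ J (Nat.le_refl _)). rewrite Rabs_pos_eq in HJ by (apply pow_le, Hz0).
      apply Rmult_lt_reg_r with (1 - Cmod z); [lra|].
      replace (1 * Cmod z ^ J / (1 - Cmod z) * (1 - Cmod z)) with (Cmod z ^ J) by (field; lra). exact HJ. }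
  destruct HJ as [J HJ].
  assert (HS : Clim eventually (fun i => Csum (fun k => coef (F i) k * z ^ k)%C J) (Csum (fun k => a k * z ^ k)%C J)).
  { apply (Clim_sum (fun k i => coef (F i) k * z ^ k)%C). intros k _. apply Clim_mult; [apply Ha | apply Clim_const]. }
  assert (He2 : 0 < eps / 2) by lra. generalize (HS _ He2). apply filter_imp. intros i Hi.
  assert (T1 := Htail (coef (F i)) (F i z) J (Hc i) (coef_series (F i) z (HF i) Hz)).
  assert (T2 := Htail a (pser a z) J Ha1 (pser_spec a z Hr Hz)).
  set (S1 := Csum (fun k => coef (F i) k * z ^ k)%C J) in *. set (S2 := Csum (fun k => a k * z ^ k)%C J) in *.
  replace (F i z - pser a z)%C with ((F i z - S1) + ((S1 - S2) + - (pser a z - S2)))%C by ring.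
  eapply Rle_lt_trans; [apply Cmod_triangle|].
  assert (T3 := Cmod_triangle (S1 - S2) (- (pser a z - S2))). rewrite Cmod_opp in T3. lra.
Qed.

(* Normality plus Harnack: a limit of functions of [B0] is either zero-free or identically zero. *)
Lemma exists_extremal n : (1 <= n)%nat -> exists f, extremal n f.
Proof.
  intros Hn.
  set (V := fun x => exists F, B0 F /\ x = Re (coef F n)).
  destruct (f_extr_B0 n Hn) as [HfB Hfc].
  assert (Hpos : 0 < 2 / exp 1) by (apply Rdiv_lt_0_compat; [lra | apply exp_pos]).
  destruct (completeness V) as [M [HM1 HM2]].
  - exists 1. intros x [F [[HF Hb] ->]]. eapply Rle_trans; [apply Re_le_mod|].
    apply coef_mod_le1; [exact HF | intros z Hz; apply (Hb z Hz)].
  - exists (Re (coef (f_extr n) n)), (f_extr n). split; [exact HfB | reflexivity].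
  - assert (HMpos : 2 / exp 1 <= M) by (apply HM1; exists (f_extr n); rewrite Hfc; split; [exact HfB | reflexivity]).
    assert (HFi : forall i, exists F, B0 F /\ M - / INR (S i) < Re (coef F n)).
    { intros i. apply NNPP. intros Hno.
      assert (Hp : 0 < / INR (S i)) by (apply Rinv_0_lt_compat, lt_0_INR; lia).
      assert (M <= M - / INR (S i)); [|lra]. apply HM2. intros x [F [HF ->]].
      apply Rnot_lt_le. intros Hlt. apply Hno. exists F. auto. }
    set (G := fun i => proj1_sig (constructive_indefinite_description _ (HFi i))).
    assert (HG : forall i, B0 (G i) /\ M - / INR (S i) < Re (coef (G i) n))
      by (intros i; unfold G; destruct constructive_indefinite_description as [F HF]; exact HF).
    clearbody G. clear HFi.
    destruct (diagonal (fun i j => coef (G i) j)) as [phi [a [Hphi Ha]]].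
    { intros i j. destruct (HG i) as [[HF Hb] _]. apply coef_mod_le1; [exact HF | intros z Hz; apply (Hb z Hz)]. }
    set (F := fun i => G (phi i)).
    assert (HF : forall i, B0 (F i)) by (intros i; apply HG).
    destruct (holo_limit F a (fun i => proj1 (HF i)) (fun i z Hz => proj2 (proj2 (HF i) z Hz)) Ha) as [Hr Hlim].
    set (f := pser a) in *.
    assert (Hf : holo_D f) by (apply holo_pser, Hr).
    assert (Han : Re (coef f n) = M).
    { unfold f. rewrite coef_pser by exact Hr. apply Rle_antisym.
      - apply (Clim_Re_le _ _ _ (Ha n)). apply filter_forall. intros i. apply HM1. exists (F i). split; [apply HF | reflexivity].
      - apply le_epsilon. intros eps He.
        assert (M - eps <= Re (a n)); [|lra]. apply (Clim_Re_ge _ _ _ (Ha n)).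
        destruct (INR_unbounded (/ eps)) as [N HN]. exists N. intros i Hi.
        assert (B := proj2 (HG (phi i))). assert (Hle : / INR (S (phi i)) <= eps).
        { rewrite <- (Rinv_inv eps). apply Rinv_le_contravar; [apply Rinv_0_lt_compat, He|].
          left. eapply Rlt_trans; [exact HN|]. apply lt_INR. specialize (Hphi i). lia. }
        fold (F i) in B. change (coef (G (phi i)) n) with (coef (F i) n). lra. }
    assert (H0lim := Hlim _ inD_0).
    assert (Hf0 : f 0%C <> 0%C).
    (* If the limit vanished at the origin, Harnack's upper bound would make it vanish identically,
       against [M >= 2 / e]. *)
    { intros E.
      assert (Hzero : forall z, inD z -> f z = 0%C).
      { intros z Hz. apply Cmod_eq_0. apply Rle_antisym; [|apply Cmod_ge_0].
        assert (Hz1 := Hz). unfold inD in Hz1. assert (Hz0 := Cmod_ge_0 z).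
        set (c := (1 - Cmod z) / (1 + Cmod z)). assert (Hc : 0 < c) by (apply Rdiv_lt_0_compat; lra).
        apply le_epsilon. intros eps He. rewrite Rplus_0_l.
        apply (Clim_mod_le _ _ _ (Hlim z Hz)).
        (* A value at the origin below this forces [t * c > / eps], and then
           [exp (- (t * c)) <= eps] by [exp x >= x]. *)
        assert (Hd : 0 < exp (- (/ eps / c))) by apply exp_pos.
        generalize (H0lim _ Hd). apply filter_imp. intros i Hi. rewrite E in Hi.
        replace (F i 0%C - 0)%C with (F i 0%C) in Hi by ring.
        destruct (harnack (F i) z (HF i) Hz) as [t [Ht [Et [_ B]]]]. rewrite Et in Hi. fold c in B.
        apply exp_lt_inv in Hi. eapply Rle_trans; [exact B|].
        assert (Htc : / eps <= t * c).
        { apply Rle_trans with (/ eps / c * c); [right; field; lra|]. apply Rmult_le_compat_r; lra. }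
        rewrite exp_Ropp, <- (Rinv_inv eps). assert (Hie : 0 < / eps) by (apply Rinv_0_lt_compat, He).
        apply Rinv_le_contravar; [exact Hie|]. generalize (exp_ineq1_le (t * c)). lra. }
      assert (Hz : coef f n = 0%C).
      { rewrite (coef_ext_D f (fun _ => RtoC 0) n Hzero). apply coef_const. lia. }
      rewrite Hz, Re_R in Han. lra. }
    assert (Hd0 := C_neq0_mod _ Hf0).
    exists f. apply extremal_coef. split.
    + split; [exact Hf|]. intros z Hz. split.
      * assert (Hz1 := Hz). unfold inD in Hz1. assert (Hz0 := Cmod_ge_0 z).
        set (c := (1 + Cmod z) / (1 - Cmod z)). assert (Hc : 0 < c) by (apply Rdiv_lt_0_compat; lra).
        (* The number [(Cmod (f 0) / 2)^c] bounds the approximants from below at [z], because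
           eventually their value at the origin exceeds half of the limit. *)
        apply Rlt_le_trans with (exp (ln (Cmod (f 0%C) / 2) * c)); [apply exp_pos|].
        rewrite <- (Re_R (Cmod (f z))).
        apply (Clim_Re_ge _ _ _ (Clim_mod _ _ (Hlim z Hz))).
        assert (Hd2 : 0 < Cmod (f 0%C) / 2) by lra.
        generalize (H0lim _ Hd2). apply filter_imp. intros i Hi. rewrite Re_R.
        destruct (harnack (F i) z (HF i) Hz) as [t [Ht [Et [B _]]]]. fold c in B.
        eapply Rle_trans; [|exact B].
        assert (Hlow : Cmod (f 0%C) / 2 < exp (- t)).
        { rewrite <- Et. generalize (Cmod_triangle_rev (f 0%C) (F i 0%C)). rewrite Cmod_minus_sym in Hi. lra. }
        apply ln_increasing in Hlow; [|exact Hd2]. rewrite ln_exp in Hlow.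
        left. apply exp_increasing. rewrite <- Ropp_mult_distr_l_reverse. apply Rmult_lt_compat_r; assumption.
      * apply (Clim_mod_le _ _ _ (Hlim z Hz)). apply filter_forall. intros i. apply (HF i), Hz.
    + intros H HH. rewrite Han. apply HM1. exists H. split; [exact HH | reflexivity].
Qed.

(** * The equivalences *)

(** The first part matches the gap of condition (5) with the range [n <= 3 K + 2] of [krzyz_gap];
    the second keeps it inside the gap of the model function. *)
Lemma ceil_div_bounds n : (3 <= n)%nat -> (n <= 3 * ceil_div (n - 2) 3 + 2)%nat /\ (ceil_div (n - 2) 3 <= n - 1)%nat.
Proof.
  intros Hn. unfold ceil_div. replace (n - 2 + 3 - 1)%nat with n by lia.
  assert (H := Nat.mul_succ_div_gt n 3 ltac:(lia)). split; [lia|].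
  apply Nat.Div0.div_le_upper_bound. lia.
Qed.

Lemma cond_of_model k n f gam c : (1 <= k <= 5)%nat -> (3 <= n)%nat -> holo_D f -> Cmod gam = 1 -> Cmod c = 1 ->
  (forall z, inD z -> f z = (gam * Atom 1 (c * z ^ n))%C) -> cond k n f.
Proof.
  intros Hk Hn Hf Hgam Hc Hfz.
  destruct (coef_model f gam c n Hgam Hc ltac:(lia) Hfz) as [_ Hgap].
  assert (Hc0 := mod_unit_neq0 c Hc).
  assert (HnR : 0 < INR n) by (apply lt_0_INR; lia).
  assert (Hv : forall z, inD z -> inD (c * z ^ n)%C) by (intros; apply inD_pow_unit; [lia | exact Hc | assumption]).
  destruct k as [|[|[|[|[|[|k]]]]]]; try lia; simpl.
  - exists (2 * PI / INR n). assert (HPI := PI_RGT_0). split.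
    + split; [apply Rdiv_lt_0_compat; lra|]. apply Rmult_lt_compat_r; [apply Rinv_0_lt_compat, HnR | lra].
    + intros z Hz. change (cos (2 * PI / INR n), sin (2 * PI / INR n)) with (Cis (2 * PI / INR n)).
      rewrite (Hfz z Hz), Hfz by (apply inD_unit_mult; [apply Cmod_Cis | exact Hz]).
      rewrite Cpow_mult_l, Cis_pow. replace (INR n * (2 * PI / INR n)) with (2 * PI) by (field; lra).
      rewrite Cis_2PI. do 2 f_equal. ring.
  - destruct (Cexp_surj gam (mod_unit_neq0 gam Hgam)) as [w Hw].
    set (g := fun z => (w + - (1 * ((1 + c * z ^ n) / (1 - c * z ^ n))))%C).
    exists g. split; [|split].
    + apply (holo_plus (fun _ => w)); [apply holo_const|]. apply holo_opp, holo_scal. apply holo_div.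
      * intros z Hz. apply one_minus_neq0, Hv, Hz.
      * apply holo_plus; [apply holo_const | apply holo_scal, holo_pow, holo_id].
      * apply holo_minus; [apply holo_const | apply holo_scal, holo_pow, holo_id].
    + intros z Hz. unfold g. rewrite Cexp_add, Hw, (Hfz z Hz). reflexivity.
    + intros z Hz. split; [|intros ->; reflexivity]. unfold g. intros E.
      assert (Hn1 := one_minus_neq0 _ (Hv z Hz)). rewrite (Cpow_0 n) in E by lia.
      set (v := (c * z ^ n)%C) in *.
      assert (E2 : (w + - (1 * ((1 + c * 0) / (1 - c * 0))))%C = (w - 1)%C).
      { replace (c * 0)%C with (RtoC 0) by ring. field. }
      rewrite E2 in E.
      assert (Ev : v = 0%C).
      { replace v with (((w - 1) - (w + - (1 * ((1 + v) / (1 - v))))) * (1 - v) / 2)%C by (field; exact Hn1).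
        rewrite E. field. }
      apply NNPP. intros Hz0. revert Ev. unfold v. apply Cmult_neq_0; [exact Hc0 | apply Cpow_neq0, Hz0].
  - intros z Hz Hz0 l Hl. apply cdiff_is_derive in Hl.
    assert (Hn1 := one_minus_neq0 _ (Hv z Hz)).
    set (v := (c * z ^ n)%C) in *.
    assert (Dp : forall m, n = S m -> cdiff (fun u => u ^ n)%C z (INR (S m) * (1 * z ^ m))%C).
    { intros m ->. apply (cdiff_pow (fun u => u)), cdiff_id. }
    assert (D : cdiff f z (gam * ((Atom 1 v * (- (1 * (2 / ((1 - v) * (1 - v)))))) * (c * (INR (S (n - 1)) * (1 * z ^ (n - 1))))))%C).
    { apply cdiff_ext_loc with (fun z => gam * Atom 1 (c * z ^ n))%C.
      - destruct (Cnear_inD z Hz) as [d [Hd Hd']]. exists d. split; [exact Hd|]. intros u Hu. symmetry. apply Hfz, Hd', Hu.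
      - apply cdiff_scal. apply (cdiff_comp (Atom 1) (fun z => c * z ^ n)%C).
        + apply cdiff_scal. apply Dp. lia.
        + apply (cdiff_Atom 1 v), Hv, Hz. }
    rewrite (cdiff_unique _ _ _ _ Hl D).
    assert (HS : RtoC (INR (S (n - 1))) <> 0%C) by (apply RtoC_neq0, not_0_INR; lia).
    assert (H2 : RtoC 2 <> 0%C) by (apply RtoC_neq0; lra).
    assert (H1 : RtoC 1 <> 0%C) by (apply RtoC_neq0; lra).
    repeat apply Cmult_neq_0; try assumption.
    + apply mod_unit_neq0, Hgam.
    + apply Cexp_neq0.
    + intros E. apply H2. replace (RtoC 2) with ((- - (1 * (2 / ((1 - v) * (1 - v))))) * ((1 - v) * (1 - v)))%C by (field; exact Hn1).
      rewrite E. ring.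
    + apply Cpow_neq0, Hz0.
  - intros a Ha gamma N lambda alpha [_ [HN _]] j Hj. rewrite (taylor_unique f a j Hf Ha). apply Hgap. lia.
  - intros a Ha j Hj. rewrite (taylor_unique f a j Hf Ha). apply Hgap.
    destruct (ceil_div_bounds n Hn) as [_ B]. unfold ceil_div in *. simpl in B. lia.
Qed.

(** The conjecture speaks of [a_0 > 0] only. Rotating the variable and multiplying by a constant
    makes [a_0] positive while leaving [a_n] unchanged; undoing both produces [gam] and [c]. *)
Lemma krzyz_extremal_form n f : Krzyz_conjecture -> (1 <= n)%nat -> extremal n f ->
  exists gam c, Cmod gam = 1 /\ Cmod c = 1 /\ forall z, inD z -> f z = (gam * Atom 1 (c * z ^ n))%C.
Proof.
  intros HK Hn Hext. assert (HB := ext_B0 n f Hext). destruct (extremal_real n f Hn Hext) as [A [HA2 HA]].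
  assert (Hf := proj1 HB).
  assert (HnR : INR n <> 0) by (apply not_0_INR; lia).
  destruct (polar (coef f 0)) as [th Hth].
  (* An [n]-th root of the phase of [coef f 0]: its effect on [a_n] cancels the division by that
     phase. *)
  set (be := Cis (th / INR n)).
  assert (Hbe : Cmod be = 1) by apply Cmod_Cis.
  assert (Hben : (be ^ n)%C = Cis th) by (unfold be; rewrite Cis_pow; f_equal; field; exact HnR).
  set (F := fun z => (Cis (- th) * f (be * z))%C).
  assert (Hfb : holo_D (fun z => f (be * z)%C)).
  { apply (holo_comp f (fun z => be * z)%C); [intros z Hz; apply inD_unit_mult; assumption | exact Hf | apply holo_scal, holo_id]. }
  assert (HFB : B0 F).
  { apply B0_scal; [apply Cmod_Cis|]. split; [exact Hfb|]. intros z Hz. apply HB, inD_unit_mult; assumption. }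
  assert (Hcis : (Cis (- th) * Cis th)%C = 1%C) by (rewrite <- Cis_add; replace (- th + th) with 0 by ring; apply Cis_0).
  assert (HcF : forall k, coef F k = (Cis (- th) * (be ^ k * coef f k))%C).
  { intros k. unfold F. rewrite (coef_scal _ _ k Hfb), coef_dil by assumption. reflexivity. }
  assert (HF0 : coef F 0 = RtoC (Cmod (coef f 0))).
  { rewrite HcF, Hth at 1. simpl.
    replace (Cis (- th) * (1 * (Cmod (coef f 0) * Cis th)))%C with (Cmod (coef f 0) * (Cis (- th) * Cis th))%C by ring.
    rewrite Hcis. ring. }
  assert (HFn : coef F n = RtoC A).
  { rewrite HcF, Hben, HA, Cmult_assoc, Hcis. ring. }
  assert (Hpos0 : 0 < Cmod (coef f 0)) by (rewrite coef_0 by exact Hf; apply HB, inD_0).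
  destruct (HK n Hn F (coef F) HFB (taylor_coef F (proj1 HFB))) as [K1 K2].
  { rewrite HF0. reflexivity. } { rewrite HF0, Re_R. exact Hpos0. }
  rewrite HFn, Re_R in K1, K2. assert (EA : A = 2 / exp 1) by lra. specialize (K2 EA).
  exists (Cis th), (- Cis (- th))%C.
  split; [apply Cmod_Cis|]. split; [rewrite Cmod_opp; apply Cmod_Cis|].
  intros z Hz.
  assert (Hbc := conj_unit be Hbe).
  set (u := (Cconj be * z)%C).
  assert (Hu : inD u) by (apply inD_unit_mult; [rewrite Cmod_conj; exact Hbe | exact Hz]).
  assert (E := K2 u Hu). rewrite (f_extr_eq n u Hn Hu) in E. unfold F in E.
  assert (Ebu : (be * u)%C = z) by (unfold u; rewrite Cmult_assoc, Hbc; ring). rewrite Ebu in E.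
  assert (Eu : (u ^ n)%C = (Cis (- th) * z ^ n)%C).
  { unfold u. rewrite Cpow_mult_l, <- Cpow_conj, Hben, Cis_conj. reflexivity. }
  rewrite Eu in E. replace (- (1) * (Cis (- th) * z ^ n))%C with (- Cis (- th) * z ^ n)%C in E by ring.
  rewrite <- E, Cmult_assoc, (Cmult_comm (Cis th)), Hcis. ring.
Qed.

Lemma sin_half_pos x : 0 < x < 2 * PI -> cos x <> 1.
Proof.
  intros Hx E. replace x with (2 * (x / 2)) in E by field. rewrite cos_2a_sin in E.
  assert (H := sin_gt_0 (x / 2) ltac:(lra) ltac:(lra)). nra.
Qed.

Lemma cos_1_2PI x : 0 < x < 4 * PI -> cos x = 1 -> x = 2 * PI.
Proof.
  intros Hx E. destruct (Rtotal_order x (2 * PI)) as [H|[H|H]]; [|exact H|].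
  - exfalso. apply (sin_half_pos x); lra.
  - exfalso. apply (sin_half_pos (x - 2 * PI)); [lra|]. rewrite cos_minus, cos_2PI, sin_2PI. lra.
Qed.

(** A nonzero [a_j] forces [j theta] to be a multiple of [2 PI]. As [0 < n theta < 4 PI], this gives
    [n theta = 2 PI], and for [0 < j < n] the angle lies strictly between [0] and [2 PI]. *)
Lemma symmetry_gap n f theta : (1 <= n)%nat -> holo_D f -> coef f n <> 0%C -> 0 < theta < 4 * PI / INR n ->
  (forall z, inD z -> f (Cis theta * z)%C = f z) -> forall j, (1 <= j < n)%nat -> coef f j = 0%C.
Proof.
  intros Hn Hf Hfn Hth Hsym.
  assert (HnR : 0 < INR n) by (apply lt_0_INR; lia).
  assert (E : forall j, coef f j <> 0%C -> cos (INR j * theta) = 1).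
  { intros j Hj. assert (D := coef_dil f (Cis theta) j (Cmod_Cis _) Hf).
    rewrite (coef_ext_D _ f j Hsym), Cis_pow in D.
    assert (D2 : Cis (INR j * theta) = 1%C).
    { replace (Cis (INR j * theta)) with (Cis (INR j * theta) * coef f j / coef f j)%C by (field; exact Hj).
      rewrite <- D. field. exact Hj. }
    apply (f_equal Re) in D2. exact D2. }
  assert (Hnt : INR n * theta = 2 * PI).
  { apply cos_1_2PI; [|apply E, Hfn]. split; [apply Rmult_lt_0_compat; lra|].
    apply Rmult_lt_reg_r with (/ INR n); [apply Rinv_0_lt_compat, HnR|].
    replace (INR n * theta * / INR n) with theta by (field; lra). unfold Rdiv in Hth. lra. }
  intros j Hj. apply NNPP. intros Hne. assert (Hc := E j Hne).
  apply (sin_half_pos (INR j * theta)); [|exact Hc].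
  assert (Hj1 : 0 < INR j) by (apply lt_0_INR; lia). assert (Hj2 : INR j < INR n) by (apply lt_INR; lia).
  split; [apply Rmult_lt_0_compat; lra|]. rewrite <- Hnt. apply Rmult_lt_compat_r; lra.
Qed.

Lemma model_of_cond k n f : (1 <= k <= 5)%nat -> (3 <= n)%nat -> extremal n f -> cond k n f -> model_bound n f.
Proof.
  intros Hk Hn Hext Hcond. assert (HB := ext_B0 n f Hext). assert (Hf := proj1 HB).
  destruct (extremal_real n f ltac:(lia) Hext) as [A [HA2 HA]].
  assert (Hpos : 0 < 2 / exp 1) by (apply Rdiv_lt_0_compat; [lra | apply exp_pos]).
  destruct (Nat.eq_dec k 1) as [->|Hk1]; [|destruct (Nat.eq_dec k 5) as [->|Hk5]].
  - destruct Hcond as [theta [Hth Hsym]].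
    apply (krzyz_gap f (n - 1) n HB); [lia|]. intros j Hj.
    apply (symmetry_gap n f theta); try assumption; try lia.
    rewrite HA. apply RtoC_neq0. lra.
  - destruct (ceil_div_bounds n Hn) as [B _].
    apply (krzyz_gap f (ceil_div (n - 2) 3) n HB); [lia|]. intros j Hj.
    apply (Hcond (coef f) (taylor_coef f Hf)). exact Hj.
  - destruct (atomic_structure n f ltac:(lia) Hext) as [gam [N [lam [al Hrep]]]].
    assert (Hrep' := Hrep). destruct Hrep' as [Hgam [HN [Hlam [Hal [Hdist Hform]]]]].
    assert (HN1 : (1 <= N)%nat) by lia.
    assert (Hfh : forall z, inD z -> f z = (gam * Cexp (- hat N lam al z))%C).
    { intros z Hz. rewrite (Hform z Hz), sum_n_Csum by exact HN1. reflexivity. }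
    assert (Hpm : forall j, (1 <= j < N)%nat -> pm N lam al j = 0%C).
    { destruct k as [|[|[|[|[|k]]]]]; try lia.
      (* The given branch [g] and [- hat] differ by a constant, because the exponential of [g + hat]
         is the constant [gam]; so [hat] inherits the injectivity at the centre. *)
      - destruct Hcond as [g [Hg [Hge Hgi]]].
        apply (branch_moments N lam al HN1 Hlam Hal Hdist). intros z Hz Ehat. apply (Hgi z Hz).
        set (hh := hat N lam al) in *.
        assert (Hh : holo_D hh) by (apply holo_hat, Hal).
        assert (Hsum : holo_D (fun z => g z + hh z)%C) by (apply holo_plus; assumption).
        assert (Hexp : forall z, inD z -> Cexp (g z + hh z) = gam).
        { intros u Hu. rewrite Cexp_add, (Hge u Hu), (Hfh u Hu). fold hh. rewrite Cexp_opp. field. apply Cexp_neq0. }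
        assert (Hconst : (g z + hh z)%C = (g 0 + hh 0)%C).
        { apply (deriv_0_const (fun z => g z + hh z)%C Hsum); [|exact Hz]. intros u Hu.
          assert (D := cdiff_deriv_D _ u Hsum Hu). set (l := deriv_D (fun z => g z + hh z)%C u) in D.
          assert (D2 : cdiff (fun z => Cexp (g z + hh z)) u (Cexp (g u + hh u) * l)%C)
            by (apply (cdiff_comp Cexp (fun z => g z + hh z)%C); [exact D | apply cdiff_Cexp]).
          assert (D3 : cdiff (fun z => Cexp (g z + hh z)) u 0%C).
          { apply cdiff_ext_loc with (fun _ => gam); [|apply cdiff_const].
            destruct (Cnear_inD u Hu) as [d [Hd Hd']]. exists d. split; [exact Hd|]. intros w Hw. symmetry. apply Hexp, Hd', Hw. }
          assert (E := cdiff_unique _ _ _ _ D2 D3). apply C_integral in E.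
          destruct E as [E|E]; [exfalso; apply (Cexp_neq0 (g u + hh u)); exact E|]. rewrite <- E. exact D. }
        rewrite Ehat in Hconst. replace (g z) with (g z + hh 0%C - hh 0%C)%C by ring. rewrite Hconst. ring.
      - apply (critical_moments f gam N lam al HN1 Hlam Hal Hdist Hfh).
        intros z Hz Hz0 l Hl. apply (Hcond z Hz Hz0 l). apply cdiff_is_derive, Hl.
      - apply (gap_moments f gam N lam al HN1 Hgam Hal Hf Hfh). intros j Hj.
        apply (Hcond (coef f) (taylor_coef f Hf) gam N lam al Hrep). exact Hj. }
    destruct (spaced_form f gam N lam al HN1 Hlam Hal Hfh Hpm) as [mu [Hmu Hmodel]].
    apply (spaced_extremal n f gam (mass N lam) mu N); try assumption; [lia|].
    apply mass_pos; assumption.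
Qed.

Theorem theorem4 : forall k : nat, (1 <= k <= 5)%nat ->
  (Krzyz_conjecture <->
   forall n : nat, (3 <= n)%nat -> forall f : C -> C, extremal n f -> cond k n f).
Proof.
  intros k Hk. split.
  - intros HK n Hn f Hext.
    destruct (krzyz_extremal_form n f HK ltac:(lia) Hext) as [gam [c [Hgam [Hc Hfz]]]].
    apply (cond_of_model k n f gam c); try assumption. apply (ext_B0 n f Hext).
  - intros Hcond.
    assert (Hmodel : forall n, (1 <= n)%nat -> forall f, extremal n f -> model_bound n f).
    { intros n Hn f Hext. destruct (le_lt_dec 3 n) as [H3|H3].
      - apply (model_of_cond k n f Hk H3 Hext), Hcond; assumption.
      (* With an empty gap, [K = 0], the bound covers [n <= 2]. *)
      - apply (krzyz_gap f 0 n (ext_B0 n f Hext)); [lia|]. intros j Hj. lia. }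
    intros n Hn f a HB Ha Him0 Hre0. assert (Hf := proj1 HB).
    rewrite (taylor_unique f a n Hf Ha). rewrite (taylor_unique f a 0 Hf Ha) in Him0, Hre0.
    (* The hypothesis concerns extremal functions only; existence of one transfers its bound to the
       whole class, and shows that a function attaining [2 / e] is itself extremal. *)
    destruct (exists_extremal n Hn) as [E HE].
    destruct (Hmodel n Hn E HE) as [BE _].
    apply extremal_coef in HE. destruct HE as [_ HEmax].
    assert (HEle : Re (coef E n) <= 2 / exp 1) by (eapply Rle_trans; [apply Re_le_mod | exact BE]).
    split; [eapply Rle_trans; [apply HEmax, HB | exact HEle]|].
    intros Heq.
    assert (Hext : extremal n f).
    { apply extremal_coef. split; [exact HB|]. intros F HF. rewrite Heq. eapply Rle_trans; [apply HEmax, HF | exact HEle]. }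
    destruct (Hmodel n Hn f Hext) as [B1 B2].
    assert (Habs : Cmod (coef f n) = 2 / exp 1) by (apply Rle_antisym; [exact B1 | rewrite <- Heq; apply Re_le_mod]).
    destruct (B2 Habs) as [gam [c [Hgam [Hc Hfz]]]].
    assert (He := exp_pos 1).
    (* The central value is [gam / e], so the normalisation [a_0 > 0] fixes [gam]. *)
    assert (Hgam1 : gam = 1%C).
    { assert (E0 : coef f 0 = (RtoC (/ exp 1) * gam)%C).
      { rewrite coef_0, (Hfz _ inD_0) by exact Hf. rewrite Cpow_0 by exact Hn.
        replace (c * 0)%C with (RtoC 0) by ring. rewrite <- coef_0 by apply holo_Atom.
        rewrite Atom_0, exp_m1. ring. }
      rewrite E0, Im_Rmult in Him0. rewrite E0, Re_Rmult in Hre0.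
      assert (Hi := Rinv_0_lt_compat _ He).
      assert (Hg0 : Im gam = 0) by (apply Rmult_integral in Him0; destruct Him0; [lra | assumption]).
      assert (Hgp : 0 < Re gam) by (apply Rmult_lt_reg_l with (/ exp 1); lra).
      assert (S := Cmod_sqr gam). rewrite Hgam, Hg0 in S. apply C_ext; [rewrite Re_R; nra | rewrite Im_R; exact Hg0]. }
    (* With [gam = 1], [a_n = - (2 / e) c]; the value [2 / e] leaves only [c = - 1], which is
       [f_extr n]. *)
    assert (Hc1 : c = (- (1))%C).
    { destruct (coef_model f gam c n Hgam Hc Hn Hfz) as [Ec _]. rewrite Ec, Hgam1 in Heq.
      replace (1 * c * (- (2 / exp 1))%R)%C with ((- (2 / exp 1))%R * c)%C in Heq by ring.
      rewrite Re_Rmult in Heq.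
      assert (Hp : 0 < 2 / exp 1) by (apply Rdiv_lt_0_compat; lra).
      assert (Hr : Re c = -1) by (apply Rmult_eq_reg_l with (- (2 / exp 1)); lra).
      assert (S := Cmod_sqr c). rewrite Hc, Hr in S.
      apply C_ext; [rewrite Hr; unfold Re; simpl; ring | unfold Im in *; simpl; nra]. }
    intros z Hz. rewrite (Hfz z Hz), Hgam1, Hc1, (f_extr_eq n z Hn Hz). ring.
Qed.
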